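(* (a) For $n\ge 0$ the diagonal map $\Delta\colon S^{n,n}\to S^{n,n}\wedge S^{n,n}$ represents $\rho^n$ in $\pi_{-n,-n}(S)$. (b) For $p>q\ge 0$ the diagonal map $\Delta\colon S^{p,q}\to S^{p,q}\wedge S^{p,q}$ is null homotopic. (c) For $n\in\mathbb{Z}$, the $n$th power map $P_n\colon(\mathbb{A}^1-0)\to(\mathbb{A}^1-0)$, $z\mapsto z^n$, represents in $\pi_{0,0}(S)$ the element $$\begin{cases}\frac{n}{2}(1-\epsilon) & \text{if } n \text{ is even},\\ 1+\frac{n-1}{2}(1-\epsilon) & \text{if } n\text{ is odd.}\end{cases}$$
   Context: **Motivic setting.** $k$ is a fixed commutative base ring and $\mathrm{Sm}/k$ is the category of smooth schemes over $\mathrm{Spec}\,k$. A (pointed) motivic space is a (pointed) simplicial presheaf on $\mathrm{Sm}/k$, with the injective Morel--Voevodsky $\mathbb{A}^1$-local model structure. The motivic stable homotopy category is the homotopy category of motivic symmetric spectra, with smash product $\wedge$. A pointed space also denotes its suspension spectrum. Associativity isomorphisms are suppressed. **Spheres and canonical isomorphisms.** $S^{1,0}$ is the simplicial circle, and $S^{1,1}=(\mathbb{A}^1-0)$ based at $1$. Choose spectra $S^{-1,0}$, $S^{-1,-1}$ with isomorphisms $a_1\colon S^{-1,0}\wedge S^{1,0}\to S^{0,0}$ and $a_2\colon S^{-1,-1}\wedge S^{1,1}\to S^{0,0}$ ($a_1$ coming from classical spectra). Put $S^{p,q}=(S^{1,0})^{\wedge(p-q)}\wedge(S^{1,1})^{\wedge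 q}$, where negative powers use $S^{-1,0}$, $S^{-1,-1}$. For $p\ge q\ge 0$ this is (the suspension spectrum of) a pointed motivic space, so it has a diagonal map. Between any two smash products of spheres with the same total bidegree there is a unique distinguished ''canonical'' isomorphism, always called $\phi$. Identities, $a_1$, $a_2$, unit isomorphisms, and the twists interchanging a power of $S^{\pm1,0}$ with a power of $S^{\pm(1,1)}$ are canonical, and canonical isomorphisms are closed under composition, inverse and $\wedge$. Twists of two spheres of the same type are in general not canonical. **The ring.** $\pi_{p,q}(S)=[S^{p,q},S^{0,0}]$ and $\pi_{*,*}(S)=\bigoplus_{p,q}\pi_{p,q}(S)$. The product of $f\in\pi_{a,b}(S)$ and $g\in\pi_{c,d}(S)$ is $S^{a+c,b+d}\xrightarrow{\phi}S^{a,b}\wedge S^{c,d}\xrightarrow{f\wedge g}S^{0,0}\wedge S^{0,0}\cong S^{0,0}$. A stable map $f\colon S^{a,b}\to S^{p,q}$ represents $[f]\in\pi_{a-p,b-q}(S)$, the composite $S^{a-p,b-q}\xrightarrow{\phi}S^{-p,-q}\wedge S^{a,b}\xrightarrow{1\wedge f}S^{-p,-q}\wedge S^{p,q}\xrightarrow{\phi}S^{0,0}$. (In (a), $S^{n,n}\wedge S^{n,n}$ is identified with $S^{2n,2n}$ by $\phi$.) **Elements.** $\epsilon\in\pi_{0,0}(S)$ is represented by the twist map on $S^{1,1}\wedge S^{1,1}$. $\rho\in\pi_{-1,-1}(S)$ is represented by the map $S^{0,0}\to S^{1,1}=(\mathbb{A}^1-0)$ sending the basepoint to $1$ and the non-basepoint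 to $-1$. *)

(* Defs.v *)
From HB Require Import structures.
From Stdlib Require Import Relation_Operators.
From mathcomp Require Import all_boot all_algebra.
From mathcomp Require Import boolp.

Set Implicit Arguments.
Unset Strict Implicit.
Unset Printing Implicit Defensive.

Import GRing.Theory.
Local Open Scope ring_scope.

(** Schemes are treated through their functor of points on commutative
    [k]-algebras (Demazure-Gabriel).  [comPzRingType] is used, rather than
    [comNzRingType], because the zero algebra has to be allowed. *)

Record kalg (k : comPzRingType) := KAlg {
  kalg_ring :> comPzRingType;
  kalg_str : {rmorphism k -> kalg_ring} }.

Record khom (k : comPzRingType) (A B : kalg k) := KHom {
  khom_fun :> {rmorphism A -> B};
  khomE : forall c, khom_fun (kalg_str A c) = kalg_str B c }.

Definition kid (k : comPzRingType) (A : kalg k) : khom A A :=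
  @KHom k A A (idfun : {rmorphism A -> A}) (fun c => erefl).

Lemma kcomp_subproof (k : comPzRingType) (A B C : kalg k)
    (g : khom B C) (f : khom A B) (c : k) :
  ((g \o f) : {rmorphism A -> C}) (kalg_str A c) = kalg_str C c.
Proof. by rewrite /= !khomE. Qed.

Definition kcomp (k : comPzRingType) (A B C : kalg k)
    (g : khom B C) (f : khom A B) : khom A C :=
  @KHom k A C ((g \o f) : {rmorphism A -> C}) (kcomp_subproof g f).

Record kfunctor (k : comPzRingType) := KFunctor {
  kpt :> kalg k -> Type;
  kmap : forall A B : kalg k, khom A B -> kpt A -> kpt B;
  kmap_id : forall A (x : kpt A), kmap (kid A) x = x;
  kmap_comp : forall A B C (g : khom B C) (f : khom A B) (x : kpt A),
    kmap (kcomp g f) x = kmap g (kmap f x) }.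

Record knat (k : comPzRingType) (X Y : kfunctor k) := KNat {
  knat_fun :> forall A : kalg k, X A -> Y A;
  knatE : forall A B (f : khom A B) (x : X A),
    knat_fun (kmap f x) = kmap f (knat_fun x) }.

Definition is_kfield (R : comPzRingType) : Prop :=
  (1 : R) <> 0 /\ forall x : R, x <> 0 -> exists y : R, x * y = 1.

(** [l : A -> B] exhibits [B] as the localization of [A] at the powers of [a]. *)
Definition is_localization (k : comPzRingType) (A B : kalg k) (a : A)
    (l : khom A B) : Prop :=
  [/\ exists b : B, l a * b = 1,
      forall b : B, exists (c : A) (n : nat), b * l a ^+ n = l c
    & forall c : A, l c = 0 -> exists n : nat, c * a ^+ n = 0].

Definition zariski_sheaf (k : comPzRingType) (X : kfunctor k) : Prop :=
  forall (A : kalg k) (n : nat) (a c : 'I_n -> A),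
    \sum_i c i * a i = 1 ->
  forall (B : 'I_n -> kalg k) (l : forall i, khom A (B i)),
    (forall i, is_localization (a i) (l i)) ->
  forall (D : 'I_n -> 'I_n -> kalg k)
      (r : forall i j, khom (B i) (D i j)) (s : forall i j, khom (B j) (D i j)),
    (forall i j x, r i j (l i x) = s i j (l j x)) ->
    (forall i j, is_localization (a i * a j) (kcomp (r i j) (l i))) ->
  forall x : forall i, X (B i),
    (forall i j, kmap (r i j) (x i) = kmap (s i j) (x j)) ->
  exists! y : X A, forall i, kmap (l i) y = x i.

Definition subfunctor (k : comPzRingType) (X : kfunctor k)
    (U : forall A : kalg k, X A -> Prop) : Prop :=
  forall A B (f : khom A B) (x : X A), U A x -> U B (kmap f x).

(** [U] is an open subfunctor: its pullback along any [x : Spec A -> X] is the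
    complement of the closed subscheme [V(I)] for some subset [I] of [A]. *)
Definition open_subfunctor (k : comPzRingType) (X : kfunctor k)
    (U : forall A : kalg k, X A -> Prop) : Prop :=
  subfunctor U /\
  forall (A : kalg k) (x : X A), exists I : A -> Prop,
  forall (B : kalg k) (f : khom A B),
    U B (kmap f x) <->
    exists (n : nat) (a : 'I_n -> A) (b : 'I_n -> B),
      (forall i, I (a i)) /\ \sum_i b i * f (a i) = 1.

Inductive pterm (k : comPzRingType) (n : nat) : Type :=
| PVar of 'I_n
| PCst of k
| PAdd of pterm k n & pterm k n
| PMul of pterm k n & pterm k n.

Fixpoint peval (k : comPzRingType) (n : nat) (A : kalg k) (a : 'I_n -> A)
    (t : pterm k n) : A :=
  match t with
  | PVar i => a i
  | PCst c => kalg_str A c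
  | PAdd t u => peval a t + peval a u
  | PMul t u => peval a t * peval a u
  end.

(** [R = k[x_1..x_n]/(r_1..r_m)], by the universal property of the quotient. *)
Definition finitely_presented (k : comPzRingType) (R : kalg k) : Prop :=
  exists (n : nat) (a : 'I_n -> R) (m : nat) (r : 'I_m -> pterm k n),
    (forall j, peval a (r j) = 0) /\
    forall (B : kalg k) (b : 'I_n -> B), (forall j, peval b (r j) = 0) ->
      exists! f : khom R B, forall i, f (a i) = b i.

(** The subfunctor [U] of [X] is represented by [Spec R]. *)
Definition represented_by (k : comPzRingType) (X : kfunctor k)
    (U : forall A : kalg k, X A -> Prop) (R : kalg k) : Prop :=
  exists2 u : X R, U R u &
    forall (A : kalg k) (x : X A), U A x -> exists! f : khom R A, x = kmap f u.

(** Covering by open subschemes which are spectra of finitely presented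
    [k]-algebras; covering is tested on field-valued points. *)
Definition fp_affine_cover (k : comPzRingType) (X : kfunctor k) : Prop :=
  exists (J : Type) (U : J -> forall A : kalg k, X A -> Prop),
    [/\ forall j, open_subfunctor (U j),
        forall j, exists2 R, represented_by (U j) R & finitely_presented R
      & forall K : kalg k, is_kfield K -> forall x : X K, exists j, U j K x].

Definition square_zero_ext (k : comPzRingType) (A B : kalg k) (f : khom A B) :
    Prop :=
  (forall b : B, exists a : A, f a = b) /\
  (forall a a' : A, f a = 0 -> f a' = 0 -> a * a' = 0).

(** Smooth = locally of finite presentation and formally smooth. *)
Definition is_smooth_scheme (k : comPzRingType) (X : kfunctor k) : Prop :=
  [/\ zariski_sheaf X,
      fp_affine_cover X
    & forall (A B : kalg k) (f : khom A B), square_zero_ext f ->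
      forall x : X B, exists y : X A, kmap f y = x].

Record smooth_scheme (k : comPzRingType) := SmoothScheme {
  sm_functor :> kfunctor k;
  sm_smooth : is_smooth_scheme sm_functor }.

(** A morphism between smooth [k]-schemes is automatically locally of finite
    presentation, so that it is etale iff it is formally etale. *)
Definition etale (k : comPzRingType) (V X : smooth_scheme k) (p : knat V X) :
    Prop :=
  forall (A B : kalg k) (f : khom A B), square_zero_ext f ->
  forall (v : V B) (x : X A), p B v = kmap f x ->
  exists! w : V A, kmap f w = v /\ p A w = x.

Definition nisnevich_cover (k : comPzRingType) (X : smooth_scheme k)
    (J : Type) (V : J -> smooth_scheme k) (p : forall j, knat (V j) X) : Prop :=
  (forall j, etale (p j)) /\
  forall K : kalg k, is_kfield K -> forall x : X K,
    exists (j : J) (v : V j K), p j K v = x.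

Definition A1 (k : comPzRingType) : kfunctor k :=
  @KFunctor k (fun A => A) (fun A B f => f)
    (fun A x => erefl) (fun A B C g f x => erefl).

(** A point of [A^1 - 0] is a unit, given together with its inverse. *)
Definition Gm_pt (k : comPzRingType) (A : kalg k) : Type :=
  {x : A * A | x.1 * x.2 = 1}.

Lemma Gm_pt_eq (k : comPzRingType) (A : kalg k) (x y : Gm_pt A) :
  sval x = sval y -> x = y.
Proof. by case: x y => [x p] [y q] /= e; apply: eq_exist. Qed.

Lemma Gm_map_subproof (k : comPzRingType) (A B : kalg k) (f : khom A B)
    (x : Gm_pt A) : f (sval x).1 * f (sval x).2 = 1.
Proof. by rewrite -rmorphM (svalP x) rmorph1. Qed.

Definition Gm_map (k : comPzRingType) (A B : kalg k) (f : khom A B)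
    (x : Gm_pt A) : Gm_pt B :=
  exist (fun y : B * B => y.1 * y.2 = 1) (f (sval x).1, f (sval x).2)
    (Gm_map_subproof f x).

Lemma Gm_map_id (k : comPzRingType) (A : kalg k) (x : Gm_pt A) :
  Gm_map (kid A) x = x.
Proof. by apply: Gm_pt_eq; case: x => [[]]. Qed.

Lemma Gm_map_comp (k : comPzRingType) (A B C : kalg k) (g : khom B C)
    (f : khom A B) (x : Gm_pt A) :
  Gm_map (kcomp g f) x = Gm_map g (Gm_map f x).
Proof. exact: Gm_pt_eq. Qed.

Definition Gm (k : comPzRingType) : kfunctor k :=
  KFunctor (@Gm_map_id k) (@Gm_map_comp k).

Definition Gm_one (k : comPzRingType) (A : kalg k) : Gm k A :=
  exist (fun y : A * A => y.1 * y.2 = 1) (1, 1) (mulr1 1).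

Lemma Gm_m1_subproof (k : comPzRingType) (A : kalg k) :
  (-1 : A) * (-1) = 1.
Proof. by rewrite mulrNN mulr1. Qed.

Definition Gm_m1 (k : comPzRingType) (A : kalg k) : Gm k A :=
  exist (fun y : A * A => y.1 * y.2 = 1) (-1, -1) (Gm_m1_subproof A).

Lemma Gm_pow_subproof (k : comPzRingType) (A : kalg k) (n : int)
    (x : A * A) (p : x.1 * x.2 = 1) :
  let y := match n with
           | Posz m => (x.1 ^+ m, x.2 ^+ m)
           | Negz m => (x.2 ^+ m.+1, x.1 ^+ m.+1)
           end in y.1 * y.2 = 1.
Proof.
by case: n => m /=; rewrite -exprMn ?[x.2 * _]mulrC p expr1n.
Qed.

(** [z |-> z ^ n]; the inverse of [z = x.1] is [x.2]. *)
Definition Gm_pow (k : comPzRingType) (n : int) (A : kalg k) (x : Gm k A) :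
    Gm k A :=
  exist (fun y : A * A => y.1 * y.2 = 1) _ (Gm_pow_subproof n (svalP x)).

Lemma Gm_one_nat (k : comPzRingType) (A B : kalg k) (f : khom A B) :
  Gm_one B = kmap f (Gm_one A).
Proof. by apply: Gm_pt_eq; rewrite /= rmorph1. Qed.

Lemma Gm_m1_nat (k : comPzRingType) (A B : kalg k) (f : khom A B) :
  Gm_m1 B = kmap f (Gm_m1 A).
Proof. by apply: Gm_pt_eq; rewrite /= rmorphN rmorph1. Qed.

Lemma Gm_pow_nat (k : comPzRingType) (n : int) (A B : kalg k) (f : khom A B)
    (x : Gm k A) : Gm_pow n (kmap f x) = kmap f (Gm_pow n x).
Proof. by apply: Gm_pt_eq; case: n => m; rewrite /= !rmorphXn. Qed.

Lemma Gm_pow_one (k : comPzRingType) (n : int) (A : kalg k) :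
  Gm_pow n (Gm_one A) = Gm_one A.
Proof. by apply: Gm_pt_eq; case: n => m; rewrite /= !expr1n. Qed.

Record icat := ICat {
  iob :> Type;
  ihom : iob -> iob -> Type;
  iid : forall U, ihom U U;
  icomp : forall U V W, ihom V W -> ihom U V -> ihom U W;
  icomp1m : forall U V (f : ihom U V), icomp (iid V) f = f;
  icompm1 : forall U V (f : ihom U V), icomp f (iid U) = f;
  icompA : forall U V W Z (h : ihom W Z) (g : ihom V W) (f : ihom U V),
    icomp h (icomp g f) = icomp (icomp h g) f }.

Definition icat1 : icat :=
  @ICat unit (fun _ _ => unit) (fun _ => tt) (fun _ _ _ _ _ => tt)
    (fun _ _ f => match f with tt => erefl end)
    (fun _ _ f => match f with tt => erefl end) (fun _ _ _ _ _ _ _ => erefl).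

Lemma knat_eq (k : comPzRingType) (X Y : kfunctor k) (f g : knat X Y) :
  (forall A x, f A x = g A x) -> f = g.
Proof.
case: f g => [f p] [g q] /= fg.
have e : f = g by apply: functional_extensionality_dep => A; apply/funext.
by case: _ / e q => q; congr KNat; apply: Prop_irrelevance.
Qed.

Definition knat_id (k : comPzRingType) (X : kfunctor k) : knat X X :=
  @KNat k X X (fun _ x => x) (fun _ _ _ _ => erefl).

Lemma knat_comp_subproof (k : comPzRingType) (X Y Z : kfunctor k)
    (g : knat Y Z) (f : knat X Y) (A B : kalg k) (h : khom A B) (x : X A) :
  g B (f B (kmap h x)) = kmap h (g A (f A x)).
Proof. by rewrite !knatE. Qed.

Definition knat_comp (k : comPzRingType) (X Y Z : kfunctor k)
    (g : knat Y Z) (f : knat X Y) : knat X Z :=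
  @KNat k X Z (fun A x => g A (f A x)) (knat_comp_subproof g f).

Lemma knat_comp1m (k : comPzRingType) (X Y : kfunctor k) (f : knat X Y) :
  knat_comp (knat_id Y) f = f.
Proof. exact: knat_eq. Qed.

Lemma knat_compm1 (k : comPzRingType) (X Y : kfunctor k) (f : knat X Y) :
  knat_comp f (knat_id X) = f.
Proof. exact: knat_eq. Qed.

Lemma knat_compA (k : comPzRingType) (X Y Z W : kfunctor k) (h : knat Z W)
    (g : knat Y Z) (f : knat X Y) :
  knat_comp h (knat_comp g f) = knat_comp (knat_comp h g) f.
Proof. exact: knat_eq. Qed.

Definition Sm (k : comPzRingType) : icat :=
  @ICat (smooth_scheme k) (fun X Y => knat X Y) (fun X => knat_id X)
    (fun X Y Z g f => knat_comp g f)
    (fun X Y f => knat_comp1m f) (fun X Y f => knat_compm1 f)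
    (fun X Y Z W h g f => knat_compA h g f).

Record mono (m n : nat) := Mono {
  mono_fun :> 'I_m.+1 -> 'I_n.+1;
  monoP : {homo mono_fun : i j / (i <= j)%N} }.

Lemma mono_eq (m n : nat) (s t : mono m n) : s =1 t -> s = t.
Proof.
case: s t => [s p] [t q] /= st.
have e : s = t by apply/funext.
by case: _ / e q => q; congr Mono; apply: Prop_irrelevance.
Qed.

Definition mono_id (n : nat) : mono n n := @Mono n n id (fun _ _ h => h).

Definition mono_comp (m n p : nat) (t : mono n p) (s : mono m n) : mono m p :=
  @Mono m p (fun i => t (s i)) (fun _ _ h => monoP t (monoP s h)).

Lemma mono_compm1 (m n : nat) (t : mono m n) : mono_comp t (mono_id m) = t.
Proof. exact: mono_eq. Qed.

Lemma mono_compA (m n p q : nat) (t : mono p q) (s : mono n p) (u : mono m n) :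
  mono_comp t (mono_comp s u) = mono_comp (mono_comp t s) u.
Proof. exact: mono_eq. Qed.

Definition mono_const (m n : nat) (i : 'I_n.+1) : mono m n :=
  @Mono m n (fun _ => i) (fun _ _ _ => leqnn i).

Record spsh (C : icat) := SPsh {
  sp :> C -> nat -> Type;
  sres : forall (U V : C) (m n : nat), ihom V U -> mono n m -> sp U m -> sp V n;
  sres_id : forall U n (x : sp U n), sres (iid U) (mono_id n) x = x;
  sres_comp : forall (U V W : C) (m n p : nat) (f : ihom V U) (g : ihom W V)
      (s : mono n m) (t : mono p n) (x : sp U m),
    sres (icomp f g) (mono_comp s t) x = sres g t (sres f s x) }.

Notation sset := (spsh icat1).

Record smap (C : icat) (X Y : spsh C) := SMap {
  smap_fun :> forall (U : C) (n : nat), X U n -> Y U n;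
  smapE : forall (U V : C) (m n : nat) (f : ihom V U) (s : mono n m)
      (x : X U m),
    smap_fun (sres f s x) = sres f s (smap_fun x) }.

Definition smap_id (C : icat) (X : spsh C) : smap X X :=
  @SMap C X X (fun _ _ x => x) (fun _ _ _ _ _ _ _ => erefl).

Lemma smap_comp_subproof (C : icat) (X Y Z : spsh C) (g : smap Y Z)
    (f : smap X Y) (U V : C) (m n : nat) (h : ihom V U) (s : mono n m)
    (x : X U m) :
  g _ _ (f _ _ (sres h s x)) = sres h s (g _ _ (f _ _ x)).
Proof. by rewrite !smapE. Qed.

Definition smap_comp (C : icat) (X Y Z : spsh C) (g : smap Y Z)
    (f : smap X Y) : smap X Z :=
  @SMap C X Z (fun U n x => g U n (f U n x)) (smap_comp_subproof g f).

(** [f] and [g] are the two ends of a map [X * Delta^1 -> Z]; the [n]-simplices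
    of [Delta^1] are the elements of [mono n 1]. *)
Definition homotopy (C : icat) (X Z : spsh C) (f g : smap X Z) : Prop :=
  exists H : forall (U : C) (n : nat), X U n -> mono n 1 -> Z U n,
  [/\ forall (U V : C) (m n : nat) (h : ihom V U) (s : mono n m) (x : X U m)
        (t : mono m 1),
        H V n (sres h s x) (mono_comp t s) = sres h s (H U m x t),
      forall (U : C) (n : nat) (x : X U n), H U n x (mono_const n ord0) = f U n x
    & forall (U : C) (n : nat) (x : X U n), H U n x (mono_const n ord_max) = g U n x].

Definition homotopic (C : icat) (X Z : spsh C) (f g : smap X Z) : Prop :=
  clos_refl_sym_trans (smap X Z) (@homotopy C X Z) f g.

(** [f^* : [Y, Z] -> [X, Z]] is a bijection of sets of homotopy classes. *)
Definition bij_classes (C : icat) (X Y : spsh C) (f : smap X Y) (Z : spsh C) :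
    Prop :=
  (forall g h : smap Y Z, homotopic (smap_comp g f) (smap_comp h f) ->
     homotopic g h) /\
  (forall g : smap X Z, exists h : smap Y Z, homotopic (smap_comp h f) g).

Section SubSimplex.
Context (n : nat) (P : forall m, mono m n -> Prop).
Context (Pstable : forall m p (t : mono m n) (s : mono p m),
  P t -> P (mono_comp t s)).

Definition subsimplex_res (U V : icat1) (m p : nat) (_ : ihom V U)
    (s : mono p m) (t : {t : mono m n | P t}) : {t : mono p n | P t} :=
  exist (@P p) (mono_comp (sval t) s) (Pstable s (svalP t)).

Lemma subsimplex_res_id (U : icat1) (m : nat) (t : {t : mono m n | P t}) :
  subsimplex_res (iid U) (mono_id m) t = t.
Proof. by case: t => t p; apply: eq_exist; apply: mono_eq. Qed.

Lemma subsimplex_res_comp (U V W : icat1) (m p q : nat) (f : ihom V U)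
    (g : ihom W V) (s : mono p m) (u : mono q p) (t : {t : mono m n | P t}) :
  subsimplex_res (icomp f g) (mono_comp s u) t =
  subsimplex_res g u (subsimplex_res f s t).
Proof. by apply: eq_exist; apply: mono_eq. Qed.

Definition subsimplex : sset :=
  @SPsh icat1 (fun _ m => {t : mono m n | P t}) subsimplex_res
    subsimplex_res_id subsimplex_res_comp.

End SubSimplex.

Definition in_boundary (n m : nat) (t : mono m n) : Prop :=
  exists j : 'I_n.+1, forall l, t l <> j.

Lemma in_boundary_stable (n m p : nat) (t : mono m n) (s : mono p m) :
  in_boundary t -> in_boundary (mono_comp t s).
Proof. by case=> j tj; exists j => l; apply: tj. Qed.

Definition boundary (n : nat) : sset := subsimplex (@in_boundary_stable n).

Definition in_horn (n : nat) (i : 'I_n.+1) (m : nat) (t : mono m n) : Prop :=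
  exists j : 'I_n.+1, j <> i /\ forall l, t l <> j.

Lemma in_horn_stable (n : nat) (i : 'I_n.+1) (m p : nat) (t : mono m n)
    (s : mono p m) :
  in_horn i t -> in_horn i (mono_comp t s).
Proof. by case=> j [ji tj]; exists j; split=> // l; apply: tj. Qed.

Definition horn (n : nat) (i : 'I_n.+1) : sset :=
  subsimplex (@in_horn_stable n i).

Definition kan (Z : sset) : Prop :=
  forall (n : nat) (i : 'I_n.+2) (h : smap (horn i) Z),
  exists z : Z tt n.+1, forall (m : nat) (t : mono m n.+1) (p : in_horn i t),
    sres (tt : @ihom icat1 tt tt) t z = h tt m (exist _ t p).

Definition sset_we (X Y : sset) (f : smap X Y) : Prop :=
  forall Z : sset, kan Z -> bij_classes f Z.

Section Sections.
Context (C : icat) (X : spsh C) (U : C).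

Definition sections_res (u v : icat1) (m n : nat) (_ : ihom v u)
    (s : mono n m) (x : X U m) : X U n := sres (iid U) s x.

Lemma sections_res_id (u : icat1) (m : nat) (x : X U m) :
  sections_res (iid u) (mono_id m) x = x.
Proof. exact: sres_id. Qed.

Lemma sections_res_comp (u v w : icat1) (m p q : nat) (f : ihom v u)
    (g : ihom w v) (s : mono p m) (t : mono q p) (x : X U m) :
  sections_res (icomp f g) (mono_comp s t) x =
  sections_res g t (sections_res f s x).
Proof. by rewrite /sections_res -{1}(icomp1m (iid U)) sres_comp. Qed.

Definition sections : sset :=
  @SPsh icat1 (fun _ m => X U m) sections_res sections_res_id
    sections_res_comp.

End Sections.

Definition smap_sections (C : icat) (X Y : spsh C) (f : smap X Y) (U : C) :
    smap (sections X U) (sections Y U) :=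
  @SMap icat1 (sections X U) (sections Y U) (fun _ n x => f U n x)
    (fun _ _ m n _ s x => smapE f (iid U) s x).

Definition monic (C : icat) (X Y : spsh C) (f : smap X Y) : Prop :=
  forall (U : C) (n : nat), injective (f U n).

Definition sectionwise_we (C : icat) (X Y : spsh C) (f : smap X Y) : Prop :=
  forall U : C, sset_we (smap_sections f U).

Definition rlp (C : icat) (A B : spsh C) (i : smap A B) (X Y : spsh C)
    (p : smap X Y) : Prop :=
  forall (a : smap A X) (b : smap B Y), smap_comp p a = smap_comp b i ->
  exists h : smap B X, smap_comp h i = a /\ smap_comp p h = b.

Definition injective_fibrant (C : icat) (Z : spsh C) : Prop :=
  forall (A B : spsh C) (i : smap A B), monic i -> sectionwise_we i ->
  forall a : smap A Z, exists h : smap B Z, smap_comp h i = a.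

(** Local acyclic fibrations for the Nisnevich topology (generalized
    hypercovers): local right lifting property with respect to all the
    inclusions of the boundary of a simplex. *)
Definition local_acyclic_fibration (k : comPzRingType) (F G : spsh (Sm k))
    (f : smap F G) : Prop :=
  forall (X : Sm k) (n : nat) (b : smap (boundary n) (sections F X)) (y : G X n),
    (forall (m : nat) (t : mono m n) (p : in_boundary t),
       f X m (b tt m (exist _ t p)) = sres (iid X) t y) ->
  exists (J : Type) (V : J -> Sm k) (c : forall j, ihom (V j) X),
    nisnevich_cover c /\
    forall j, exists x : F (V j) n,
      f (V j) n x = sres (c j) (mono_id n) y /\
      forall (m : nat) (t : mono m n) (p : in_boundary t),
        sres (iid (V j)) t x = sres (c j) (mono_id m) (b tt m (exist _ t p)).

Lemma points_res_id (k : comPzRingType) (Y : kfunctor k) (U : Sm k) (n : nat)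
    (x : knat U Y) : knat_comp x (iid U) = x.
Proof. exact: knat_eq. Qed.

Lemma points_res_comp (k : comPzRingType) (Y : kfunctor k) (U V W : Sm k)
    (m n p : nat) (f : ihom V U) (g : ihom W V) (s : mono n m) (t : mono p n)
    (x : knat U Y) :
  knat_comp x (icomp f g) = knat_comp (knat_comp x f) g.
Proof. exact: knat_eq. Qed.

Definition points (k : comPzRingType) (Y : kfunctor k) : spsh (Sm k) :=
  @SPsh (Sm k) (fun U _ => knat U Y) (fun U V m n f s x => knat_comp x f)
    (@points_res_id k Y) (@points_res_comp k Y).

Section Product.
Context (C : icat) (X Y : spsh C).

Definition sprod_res (U V : C) (m n : nat) (f : ihom V U) (s : mono n m)
    (x : X U m * Y U m) : X V n * Y V n := (sres f s x.1, sres f s x.2).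

Lemma sprod_res_id (U : C) (n : nat) (x : X U n * Y U n) :
  sprod_res (iid U) (mono_id n) x = x.
Proof. by case: x => x y; rewrite /sprod_res !sres_id. Qed.

Lemma sprod_res_comp (U V W : C) (m n p : nat) (f : ihom V U) (g : ihom W V)
    (s : mono n m) (t : mono p n) (x : X U m * Y U m) :
  sprod_res (icomp f g) (mono_comp s t) x = sprod_res g t (sprod_res f s x).
Proof. by rewrite /sprod_res !sres_comp. Qed.

Definition sprod : spsh C :=
  @SPsh C (fun U n => (X U n * Y U n)%type) sprod_res sprod_res_id
    sprod_res_comp.

Definition sfst : smap sprod X :=
  @SMap C sprod X (fun U n x => x.1) (fun _ _ _ _ _ _ _ => erefl).

End Product.

(** The fibrant objects of the left Bousfield localization of the injective
    model structure at the generalized Nisnevich hypercovers and at the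
    projections [X * A^1 -> X]. These two classes of maps being closed under
    products with simplicial sets, bijections on homotopy classes amount to
    weak equivalences of mapping spaces. *)
Definition motivic_fibrant (k : comPzRingType) (Z : spsh (Sm k)) : Prop :=
  [/\ injective_fibrant Z,
      forall (F G : spsh (Sm k)) (f : smap F G), local_acyclic_fibration f ->
        bij_classes f Z
    & forall X : spsh (Sm k), bij_classes (sfst X (points (A1 k))) Z].

Definition motivic_we (k : comPzRingType) (X Y : spsh (Sm k)) (f : smap X Y) :
    Prop :=
  forall Z : spsh (Sm k), motivic_fibrant Z -> bij_classes f Z.

Record pspace (C : icat) := PSpace {
  psp :> spsh C;
  bpt : forall (U : C) (n : nat), psp U n;
  sres_bpt : forall (U V : C) (m n : nat) (f : ihom V U) (s : mono n m),
    sres f s (bpt U m) = bpt V n }.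
Arguments bpt {C} p U n.

Record pmap (C : icat) (X Y : pspace C) := PMap {
  pmap_map :> smap X Y;
  pmap_bpt : forall (U : C) (n : nat), pmap_map U n (bpt X U n) = bpt Y U n }.

Definition pmap_id (C : icat) (X : pspace C) : pmap X X :=
  @PMap C X X (smap_id X) (fun _ _ => erefl).

(** The quotient [X / A] for a subpresheaf [A] of [X] containing the base
    point: its elements are represented by the base point and by the elements
    of [X] which are not in [A]. *)
Section Collapse.
Context (C : icat) (X : pspace C) (A : forall (U : C) (n : nat), X U n -> Prop).
Context (A_bpt : forall U n, A (bpt X U n)).
Context (A_res : forall (U V : C) (m n : nat) (f : ihom V U) (s : mono n m)
  (x : X U m), A x -> A (sres f s x)).

Definition collapse_sort (U : C) (n : nat) : Type :=
  {x : X U n | A x -> x = bpt X U n}.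

Definition collapse_cl (U : C) (n : nat) (x : X U n) : collapse_sort U n :=
  match pselect (A x) with
  | left _ => exist (fun y => A y -> y = bpt X U n) (bpt X U n) (fun _ => erefl)
  | right nAx => exist (fun y => A y -> y = bpt X U n) x (fun Ax => False_ind _ (nAx Ax))
  end.

Lemma collapse_clT (U : C) (n : nat) (x : X U n) :
  A x -> sval (collapse_cl x) = bpt X U n.
Proof. by rewrite /collapse_cl; case: pselect. Qed.

Lemma collapse_clF (U : C) (n : nat) (x : X U n) :
  ~ A x -> sval (collapse_cl x) = x.
Proof. by rewrite /collapse_cl; case: pselect. Qed.

Lemma collapse_inj (U : C) (n : nat) (x y : collapse_sort U n) :
  sval x = sval y -> x = y.
Proof. by case: x y => [x p] [y q] /= e; apply: eq_exist. Qed.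

Lemma collapse_clK (U : C) (n : nat) (x : collapse_sort U n) :
  collapse_cl (sval x) = x.
Proof.
apply: collapse_inj; have [Ax|nAx] := pselect (A (sval x)).
  by rewrite collapse_clT // (svalP x Ax).
by rewrite collapse_clF.
Qed.

Lemma collapse_clA (U : C) (n : nat) (x y : X U n) :
  A x -> A y -> collapse_cl x = collapse_cl y.
Proof. by move=> Ax Ay; apply: collapse_inj; rewrite !collapse_clT. Qed.

Definition collapse_res (U V : C) (m n : nat) (f : ihom V U) (s : mono n m)
    (x : collapse_sort U m) : collapse_sort V n :=
  collapse_cl (sres f s (sval x)).

Lemma collapse_resE (U V : C) (m n : nat) (f : ihom V U) (s : mono n m)
    (x : X U m) :
  collapse_res f s (collapse_cl x) = collapse_cl (sres f s x).
Proof.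
rewrite /collapse_res; have [Ax|nAx] := pselect (A x).
  rewrite collapse_clT // sres_bpt.
  by apply: collapse_clA; [apply: A_bpt | apply: A_res].
by rewrite collapse_clF.
Qed.

Lemma collapse_res_id (U : C) (n : nat) (x : collapse_sort U n) :
  collapse_res (iid U) (mono_id n) x = x.
Proof. by rewrite /collapse_res sres_id collapse_clK. Qed.

Lemma collapse_res_comp (U V W : C) (m n p : nat) (f : ihom V U)
    (g : ihom W V) (s : mono n m) (t : mono p n) (x : collapse_sort U m) :
  collapse_res (icomp f g) (mono_comp s t) x =
  collapse_res g t (collapse_res f s x).
Proof. by rewrite [collapse_res f s x]/collapse_res collapse_resE /collapse_res sres_comp. Qed.

Definition collapse_spsh : spsh C :=
  @SPsh C collapse_sort collapse_res collapse_res_id collapse_res_comp.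

Definition collapse : pspace C :=
  @PSpace C collapse_spsh (fun U n => collapse_cl (bpt X U n))
    (fun U V m n f s =>
       etrans (collapse_resE f s _) (f_equal (@collapse_cl V n) (sres_bpt X f s))).

End Collapse.

Lemma collapse_cl_map (C : icat) (X : pspace C)
    (A : forall (U : C) (n : nat), X U n -> Prop) (Y : pspace C)
    (B : forall (U : C) (n : nat), Y U n -> Prop)
    (A_bpt : forall U n, A U n (bpt X U n)) (U V : C) (m n : nat)
    (phi : X U m -> Y V n) :
  (forall x, A U m x -> B V n (phi x)) ->
  forall x, collapse_cl B (phi (sval (collapse_cl A x))) = collapse_cl B (phi x).
Proof.
move=> AB x; have [Ax|nAx] := pselect (A U m x).
  by rewrite collapse_clT //; apply: collapse_clA; apply: AB.
by rewrite collapse_clF.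
Qed.

Definition pprod (C : icat) (X Y : pspace C) : pspace C :=
  @PSpace C (sprod X Y) (fun U n => (bpt X U n, bpt Y U n))
    (fun U V m n f s => f_equal2 pair (sres_bpt X f s) (sres_bpt Y f s)).

Definition in_wedge (C : icat) (X Y : pspace C) (U : C) (n : nat)
    (x : pprod X Y U n) : Prop := x.1 = bpt X U n \/ x.2 = bpt Y U n.

Lemma in_wedge_bpt (C : icat) (X Y : pspace C) (U : C) (n : nat) :
  in_wedge (bpt (pprod X Y) U n).
Proof. by left. Qed.

Lemma in_wedge_res (C : icat) (X Y : pspace C) (U V : C) (m n : nat)
    (f : ihom V U) (s : mono n m) (x : pprod X Y U m) :
  in_wedge x -> in_wedge (sres f s x).
Proof. by case=> e; [left|right]; rewrite /= e sres_bpt. Qed.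

Definition smash (C : icat) (X Y : pspace C) : pspace C :=
  collapse (@in_wedge_bpt C X Y) (@in_wedge_res C X Y).

Definition smash_pair (C : icat) (X Y : pspace C) (U : C) (n : nat)
    (x : X U n) (y : Y U n) : smash X Y U n := collapse_cl (@in_wedge C X Y) (x, y).

Lemma smash_pairE (C : icat) (X Y : pspace C) (U V : C) (m n : nat)
    (f : ihom V U) (s : mono n m) (x : X U m) (y : Y U m) :
  sres f s (smash_pair x y) = smash_pair (sres f s x) (sres f s y).
Proof. exact: (collapse_resE (@in_wedge_bpt C X Y) (@in_wedge_res C X Y)). Qed.

Lemma smash_pair_bpt (C : icat) (X Y : pspace C) (U : C) (n : nat)
    (x : X U n) (y : Y U n) : x = bpt X U n \/ y = bpt Y U n ->
  smash_pair x y = bpt (smash X Y) U n.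
Proof. by move=> xy; apply: collapse_clA => //; left. Qed.

Definition diagonal (C : icat) (X : pspace C) : pmap X (smash X X) :=
  @PMap C X (smash X X)
    (@SMap C X (smash X X) (fun U n x => smash_pair x x)
       (fun U V m n f s x => esym (smash_pairE f s x x)))
    (fun U n => smash_pair_bpt (or_introl erefl)).

Definition simplex1_sp (C : icat) : spsh C :=
  @SPsh C (fun _ n => mono n 1) (fun U V m n f s t => mono_comp t s)
    (fun U n t => mono_compm1 t)
    (fun U V W m n p f g s u t => mono_compA t s u).

Definition simplex1 (C : icat) : pspace C :=
  @PSpace C (simplex1_sp C) (fun _ n => mono_const n ord0)
    (fun U V m n f s => mono_eq (fun i => erefl)).

Definition in_ends (C : icat) (U : C) (n : nat) (t : simplex1 C U n) : Prop :=
  exists i : 'I_2, forall l, t l = i.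

Lemma in_ends_bpt (C : icat) (U : C) (n : nat) : in_ends (bpt (simplex1 C) U n).
Proof. by exists ord0. Qed.

Lemma in_ends_res (C : icat) (U V : C) (m n : nat) (f : ihom V U) (s : mono n m)
    (t : simplex1 C U m) : in_ends t -> in_ends (sres f s t).
Proof. by case=> i ti; exists i => l; apply: ti. Qed.

Definition S1 (C : icat) : pspace C := collapse (@in_ends_bpt C) (@in_ends_res C).

Definition S0_sp (C : icat) : spsh C :=
  @SPsh C (fun _ _ => bool) (fun U V m n f s b => b)
    (fun U n b => erefl) (fun U V W m n p f g s t b => erefl).

Definition S0 (C : icat) : pspace C :=
  @PSpace C (S0_sp C) (fun _ _ => false) (fun U V m n f s => erefl).

Definition Gm_const1 (k : comPzRingType) (U : kfunctor k) : knat U (Gm k) :=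
  @KNat k U (Gm k) (fun A _ => Gm_one A) (fun A B f _ => Gm_one_nat f).

Definition Gm_constm1 (k : comPzRingType) (U : kfunctor k) : knat U (Gm k) :=
  @KNat k U (Gm k) (fun A _ => Gm_m1 A) (fun A B f _ => Gm_m1_nat f).

Definition Gm_power (k : comPzRingType) (n : int) : knat (Gm k) (Gm k) :=
  @KNat k (Gm k) (Gm k) (fun A x => Gm_pow n x) (@Gm_pow_nat k n).

Lemma Gm_const1_res (k : comPzRingType) (U V : Sm k) (m n : nat) (f : ihom V U)
    (s : mono n m) :
  @sres (Sm k) (points (Gm k)) U V m n f s (Gm_const1 U) = Gm_const1 V.
Proof. exact: knat_eq. Qed.

(** [S^{1,1}]: the scheme [A^1 - 0] based at [1]. *)
Definition S11 (k : comPzRingType) : pspace (Sm k) :=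
  @PSpace (Sm k) (points (Gm k)) (fun U n => Gm_const1 U) (@Gm_const1_res k).

Lemma power_res (k : comPzRingType) (i : int) (U V : Sm k) (m n : nat)
    (f : ihom V U) (s : mono n m) (x : S11 k U m) :
  knat_comp (Gm_power k i) (sres f s x) =
  @sres (Sm k) (S11 k) U V m n f s (knat_comp (Gm_power k i) x).
Proof. exact: knat_eq. Qed.

Lemma power_bpt (k : comPzRingType) (i : int) (U : Sm k) (n : nat) :
  knat_comp (Gm_power k i) (bpt (S11 k) U n) = bpt (S11 k) U n.
Proof. by apply: knat_eq => A x; apply: Gm_pow_one. Qed.

Definition power_map (k : comPzRingType) (i : int) : pmap (S11 k) (S11 k) :=
  @PMap (Sm k) (S11 k) (S11 k)
    (@SMap (Sm k) (S11 k) (S11 k) (fun U n x => knat_comp (Gm_power k i) x)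
       (@power_res k i))
    (@power_bpt k i).

Lemma rho_res (k : comPzRingType) (U V : Sm k) (m n : nat)
    (f : ihom V U) (s : mono n m) (b : S0 (Sm k) U m) :
  (if sres f s b then Gm_constm1 V else Gm_const1 V) =
  @sres (Sm k) (S11 k) U V m n f s (if b then Gm_constm1 U else Gm_const1 U).
Proof. by case: b; apply: knat_eq. Qed.

Definition rho_map (k : comPzRingType) : pmap (S0 (Sm k)) (S11 k) :=
  @PMap (Sm k) (S0 (Sm k)) (S11 k)
    (@SMap (Sm k) (S0 (Sm k)) (S11 k)
       (fun U n b => if b then Gm_constm1 U else Gm_const1 U) (@rho_res k))
    (fun U n => erefl).

Record inj (m n : nat) := Inj {
  inj_fun :> 'I_m -> 'I_n;
  injP : injective inj_fun }.

Definition inj_id (n : nat) : inj n n := @Inj n n id (fun _ _ e => e).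

Definition inj_comp (m n p : nat) (b : inj n p) (a : inj m n) : inj m p :=
  @Inj m p (fun i => b (a i)) (fun _ _ e => injP (injP e)).

(** The family on ['I_n] which extends [t] along [a], and is [s] outside of the
    image of [a]. *)
Definition extend (V : Type) (m n : nat) (a : inj m n) (t : 'I_m -> V)
    (s : 'I_n -> V) (j : 'I_n) : V :=
  if [pick i | a i == j] is Some i then t i else s j.

(** A symmetric spectrum for the suspension coordinate [T], in coordinate-free
    form. For each injection [a : {0..m-1} -> {0..n-1}] there is a structure map
    [act a] from the smash product of [X_m] with one copy of [T] for each
    element of the complement of the image of [a] to [X_n]. It is given here as
    a function of a family [t] of points of [T] indexed by [{0..n-1}], the
    components on the image of [a] being irrelevant. The bijections [a] give the
    actions of the symmetric groups, and the inclusions [n -> n + 1] the usual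
    structure maps. *)
Record spectrum (C : icat) (T : pspace C) := Spectrum {
  lev :> nat -> pspace C;
  act : forall (m n : nat) (a : inj m n) (U : C) (q : nat),
    ('I_n -> T U q) -> lev m U q -> lev n U q;
  act_res : forall m n (a : inj m n) (U V : C) (q r : nat) (f : ihom V U)
      (s : mono r q) (t : 'I_n -> T U q) (x : lev m U q),
    act a (fun j => sres f s (t j)) (sres f s x) = sres f s (act a t x);
  act_irr : forall m n (a : inj m n) (U : C) (q : nat) (t t' : 'I_n -> T U q)
      (x : lev m U q),
    (forall j, (forall i, a i <> j) -> t j = t' j) -> act a t x = act a t' x;
  act_bpt : forall m n (a : inj m n) (U : C) (q : nat) (t : 'I_n -> T U q),
    act a t (bpt (lev m) U q) = bpt (lev n) U q;
  act_bptT : forall m n (a : inj m n) (U : C) (q : nat) (t : 'I_n -> T U q)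
      (x : lev m U q) (j : 'I_n),
    (forall i, a i <> j) -> t j = bpt T U q -> act a t x = bpt (lev n) U q;
  act_id : forall m (U : C) (q : nat) (t : 'I_m -> T U q) (x : lev m U q),
    act (inj_id m) t x = x;
  act_comp : forall m n p (a : inj m n) (b : inj n p) (U : C) (q : nat)
      (t : 'I_n -> T U q) (s : 'I_p -> T U q) (x : lev m U q),
    act b s (act a t x) = act (inj_comp b a) (extend b t s) x }.

Record spmap (C : icat) (T : pspace C) (X Y : spectrum T) := SpMap {
  spmap_lev :> forall n : nat, pmap (X n) (Y n);
  spmapE : forall m n (a : inj m n) (U : C) (q : nat) (t : 'I_n -> T U q)
      (x : X m U q),
    spmap_lev n U q (act a t x) = act a t (spmap_lev m U q x) }.

Definition spmap_id (C : icat) (T : pspace C) (X : spectrum T) : spmap X X :=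
  @SpMap C T X X (fun n => pmap_id (X n)) (fun _ _ _ _ _ _ _ => erefl).

Definition pmap_comp (C : icat) (X Y Z : pspace C) (g : pmap Y Z)
    (f : pmap X Y) : pmap X Z :=
  @PMap C X Z (smap_comp g f)
    (fun U n => etrans (f_equal (g U n) (pmap_bpt f U n)) (pmap_bpt g U n)).

Definition spmap_comp (C : icat) (T : pspace C) (X Y Z : spectrum T)
    (g : spmap Y Z) (f : spmap X Y) : spmap X Z :=
  @SpMap C T X Z (fun n => pmap_comp (g n) (f n))
    (fun m n a U q t x =>
       etrans (f_equal (g n U q) (spmapE f a t x)) (spmapE g a t _)).

Definition pmap_const (C : icat) (X Y : pspace C) : pmap X Y :=
  @PMap C X Y
    (@SMap C X Y (fun U n _ => bpt Y U n)
       (fun U V m n f s _ => esym (sres_bpt Y f s)))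
    (fun _ _ => erefl).

Definition spmap_const (C : icat) (T : pspace C) (X Y : spectrum T) :
    spmap X Y :=
  @SpMap C T X Y (fun n => pmap_const (X n) (Y n))
    (fun m n a U q t _ => esym (act_bpt Y a t)).

Lemma extend_im (V : Type) (m n : nat) (a : inj m n) (t : 'I_m -> V)
    (s : 'I_n -> V) (i : 'I_m) : extend a t s (a i) = t i.
Proof.
rewrite /extend; case: pickP => [l /eqP e|/(_ i)]; last by rewrite eqxx.
by rewrite (injP e).
Qed.

Lemma extend_out (V : Type) (m n : nat) (a : inj m n) (t : 'I_m -> V)
    (s : 'I_n -> V) (j : 'I_n) : (forall i, a i <> j) -> extend a t s j = s j.
Proof.
by move=> aj; rewrite /extend; case: pickP => [i /eqP e|//]; case: (aj i).
Qed.

Lemma inj_cases (m n : nat) (a : inj m n) (j : 'I_n) :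
  (exists i, a i = j) \/ (forall i, a i <> j).
Proof.
by have [[i e]|ne] := pselect (exists i, a i = j); [left; exists i|right=> i e; apply: ne; exists i].
Qed.

Section Suspension.
Context (C : icat) (T X : pspace C).

Section Level.
Context (n : nat).

Definition tpow_sort (U : C) (q : nat) : Type := (('I_n -> T U q) * X U q)%type.

Definition tpow_res (U V : C) (q r : nat) (f : ihom V U) (s : mono r q)
    (x : tpow_sort U q) : tpow_sort V r :=
  (fun i => sres f s (x.1 i), sres f s x.2).

Lemma tpow_res_id (U : C) (q : nat) (x : tpow_sort U q) :
  tpow_res (iid U) (mono_id q) x = x.
Proof.
case: x => t x; rewrite /tpow_res sres_id; congr pair.
by apply/funext => i; rewrite sres_id.
Qed.

Lemma tpow_res_comp (U V W : C) (q r p : nat) (f : ihom V U) (g : ihom W V)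
    (s : mono r q) (u : mono p r) (x : tpow_sort U q) :
  tpow_res (icomp f g) (mono_comp s u) x = tpow_res g u (tpow_res f s x).
Proof.
rewrite /tpow_res sres_comp; congr pair.
by apply/funext => i; rewrite sres_comp.
Qed.

Definition tpow_spsh : spsh C :=
  @SPsh C tpow_sort tpow_res tpow_res_id tpow_res_comp.

Lemma tpow_bpt_res (U V : C) (q r : nat) (f : ihom V U) (s : mono r q) :
  sres f s ((fun _ => bpt T U q, bpt X U q) : tpow_spsh U q) =
  (fun _ => bpt T V r, bpt X V r).
Proof.
apply: (f_equal2 pair); last exact: sres_bpt.
by apply/funext => i; apply: sres_bpt.
Qed.

Definition tpow : pspace C :=
  @PSpace C tpow_spsh (fun U q => (fun _ => bpt T U q, bpt X U q)) tpow_bpt_res.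

Definition in_fat_wedge (U : C) (q : nat) (x : tpow U q) : Prop :=
  (exists i, x.1 i = bpt T U q) \/ x.2 = bpt X U q.

Lemma in_fat_wedge_bpt (U : C) (q : nat) : in_fat_wedge (bpt tpow U q).
Proof. by right. Qed.

Lemma in_fat_wedge_res (U V : C) (q r : nat) (f : ihom V U) (s : mono r q)
    (x : tpow U q) : in_fat_wedge x -> in_fat_wedge (sres f s x).
Proof.
by case=> [[i e]|e]; [left; exists i|right]; rewrite /= e sres_bpt.
Qed.

Definition susp_lev : pspace C := collapse in_fat_wedge_bpt in_fat_wedge_res.

Definition susp_cl (U : C) (q : nat) (t : 'I_n -> T U q) (x : X U q) :
    susp_lev U q := collapse_cl in_fat_wedge ((t, x) : tpow U q).

End Level.

Definition susp_act (m n : nat) (a : inj m n) (U : C) (q : nat)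
    (t : 'I_n -> T U q) (x : susp_lev m U q) : susp_lev n U q :=
  susp_cl (extend a (sval x).1 t) (sval x).2.

Lemma susp_actE (m n : nat) (a : inj m n) (U : C) (q : nat)
    (t : 'I_n -> T U q) (f : 'I_m -> T U q) (x : X U q) :
  susp_act a t (susp_cl f x) = susp_cl (extend a f t) x.
Proof.
pose phi (y : tpow m U q) : tpow n U q := (extend a y.1 t, y.2).
apply: (collapse_cl_map (@in_fat_wedge_bpt m) (phi := phi)) => y.
case=> [[i e]|e]; [left; exists (a i)|by right].
by rewrite /= extend_im.
Qed.

Lemma susp_clK (n : nat) (U : C) (q : nat) (x : susp_lev n U q) :
  susp_cl (sval x).1 (sval x).2 = x.
Proof.
have := collapse_clK x; rewrite /susp_cl.
by case: (sval x).
Qed.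

Lemma susp_cl_res (n : nat) (U V : C) (q r : nat) (f : ihom V U) (s : mono r q)
    (t : 'I_n -> T U q) (x : X U q) :
  sres f s (susp_cl t x) = susp_cl (fun i => sres f s (t i)) (sres f s x).
Proof. exact: (collapse_resE (@in_fat_wedge_bpt n) (@in_fat_wedge_res n)). Qed.

Lemma susp_cl_bpt (n : nat) (U : C) (q : nat) (t : 'I_n -> T U q) (x : X U q) :
  (exists i, t i = bpt T U q) \/ x = bpt X U q ->
  susp_cl t x = bpt (susp_lev n) U q.
Proof. by move=> tx; apply: collapse_clA => //; right. Qed.

Lemma susp_act_res (m n : nat) (a : inj m n) (U V : C) (q r : nat)
    (f : ihom V U) (s : mono r q) (t : 'I_n -> T U q) (x : susp_lev m U q) :
  susp_act a (fun j => sres f s (t j)) (sres f s x) = sres f s (susp_act a t x).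
Proof.
rewrite -[x]susp_clK susp_cl_res !susp_actE susp_cl_res; congr susp_cl.
apply/funext => j; have [[i <-]|aj] := inj_cases a j; first by rewrite !extend_im.
by rewrite !extend_out.
Qed.

Lemma susp_act_irr (m n : nat) (a : inj m n) (U : C) (q : nat)
    (t t' : 'I_n -> T U q) (x : susp_lev m U q) :
  (forall j, (forall i, a i <> j) -> t j = t' j) ->
  susp_act a t x = susp_act a t' x.
Proof.
move=> tt'; congr susp_cl; apply/funext => j.
have [[i <-]|aj] := inj_cases a j; first by rewrite !extend_im.
by rewrite !extend_out // tt'.
Qed.

Lemma susp_act_bpt (m n : nat) (a : inj m n) (U : C) (q : nat)
    (t : 'I_n -> T U q) :
  susp_act a t (bpt (susp_lev m) U q) = bpt (susp_lev n) U q.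
Proof.
have -> : bpt (susp_lev m) U q = susp_cl (fun=> bpt T U q) (bpt X U q) by [].
by rewrite susp_actE susp_cl_bpt //; right.
Qed.

Lemma susp_act_bptT (m n : nat) (a : inj m n) (U : C) (q : nat)
    (t : 'I_n -> T U q) (x : susp_lev m U q) (j : 'I_n) :
  (forall i, a i <> j) -> t j = bpt T U q ->
  susp_act a t x = bpt (susp_lev n) U q.
Proof.
by move=> aj tj; apply: susp_cl_bpt; left; exists j; rewrite extend_out.
Qed.

Lemma susp_act_id (m : nat) (U : C) (q : nat) (t : 'I_m -> T U q)
    (x : susp_lev m U q) : susp_act (inj_id m) t x = x.
Proof.
rewrite -{2}[x]susp_clK; congr susp_cl; apply/funext => j.
exact: (extend_im (inj_id m)).
Qed.

Lemma susp_act_comp (m n p : nat) (a : inj m n) (b : inj n p) (U : C) (q : nat)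
    (t : 'I_n -> T U q) (s : 'I_p -> T U q) (x : susp_lev m U q) :
  susp_act b s (susp_act a t x) = susp_act (inj_comp b a) (extend b t s) x.
Proof.
rewrite [susp_act a t x]/susp_act susp_actE; congr susp_cl; apply/funext => j.
have [[i <-]|bj] := inj_cases b j.
  rewrite extend_im; have [[l <-]|ai] := inj_cases a i.
    by rewrite extend_im (extend_im (inj_comp b a)).
  rewrite extend_out // [RHS]extend_out ?extend_im // => l /= /injP; exact: ai.
by rewrite !extend_out // => l; apply: bj.
Qed.

Definition susp : spectrum T :=
  @Spectrum C T susp_lev susp_act susp_act_res susp_act_irr susp_act_bpt
    susp_act_bptT susp_act_id susp_act_comp.

End Suspension.
Arguments susp {C} T X.

Section SuspensionMap.
Context (C : icat) (T X Y : pspace C) (f : pmap X Y).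

Definition susp_map_fun (n : nat) (U : C) (q : nat) (x : susp_lev T X n U q) :
    susp_lev T Y n U q := susp_cl (sval x).1 (f U q (sval x).2).

Lemma susp_map_cl (n : nat) (U : C) (q : nat) (t : 'I_n -> T U q) (x : X U q) :
  susp_map_fun (susp_cl t x) = susp_cl t (f U q x).
Proof.
pose phi (y : tpow T X n U q) : tpow T Y n U q := (y.1, f U q y.2).
apply: (collapse_cl_map (@in_fat_wedge_bpt C T X n) (phi := phi)) => y.
by case=> [[i e]|e]; [left; exists i|right; rewrite /= e pmap_bpt].
Qed.

Lemma susp_map_res (n : nat) (U V : C) (q r : nat) (h : ihom V U)
    (s : mono r q) (x : susp_lev T X n U q) :
  susp_map_fun (sres h s x) = sres h s (susp_map_fun x).
Proof.
by rewrite -[x]susp_clK susp_cl_res !susp_map_cl susp_cl_res smapE.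
Qed.

Lemma susp_map_bpt (n : nat) (U : C) (q : nat) :
  susp_map_fun (bpt (susp_lev T X n) U q) = bpt (susp_lev T Y n) U q.
Proof.
have -> : bpt (susp_lev T X n) U q = susp_cl (fun=> bpt T U q) (bpt X U q) by [].
by rewrite susp_map_cl susp_cl_bpt //; right; apply: pmap_bpt.
Qed.

Lemma susp_map_act (m n : nat) (a : inj m n) (U : C) (q : nat)
    (t : 'I_n -> T U q) (x : susp T X m U q) :
  susp_map_fun (act a t x) = @act C T (susp T Y) m n a U q t (susp_map_fun x).
Proof.
by rewrite /= -[x]susp_clK susp_actE !susp_map_cl susp_actE.
Qed.

Definition susp_map : spmap (susp T X) (susp T Y) :=
  @SpMap C T (susp T X) (susp T Y)
    (fun n => @PMap C (susp_lev T X n) (susp_lev T Y n)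
       (@SMap C (susp_lev T X n) (susp_lev T Y n) (@susp_map_fun n)
          (@susp_map_res n))
       (@susp_map_bpt n))
    susp_map_act.

End SuspensionMap.
Arguments susp_map {C} T {X Y} f.

Lemma inj_sum_subproof (m n m' n' : nat) (a : inj m n) (b : inj m' n') :
  injective (fun i : 'I_(m + m') => match split i with
    | inl j => lshift n' (a j) | inr j => rshift n (b j) end).
Proof.
move=> i i' e; apply: (can_inj (@splitK m m')); move: e.
case: (split i) => j; case: (split i') => j'.
- by move/lshift_inj/injP ->.
- by move/eqP; rewrite eq_lrshift.
- by move/eqP; rewrite eq_rlshift.
- by move/rshift_inj/injP ->.
Qed.

Definition inj_sum (m n m' n' : nat) (a : inj m n) (b : inj m' n') :
    inj (m + m') (n + n') := Inj (@inj_sum_subproof m n m' n' a b).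

Definition family_cat (V : Type) (m n : nat) (t : 'I_m -> V) (s : 'I_n -> V)
    (i : 'I_(m + n)) : V :=
  match split i with inl j => t j | inr j => s j end.

Lemma inj_swap_subproof (m n : nat) :
  injective (fun i : 'I_(m + n) => match split i with
    | inl j => rshift n j | inr j => lshift m j end).
Proof.
move=> i i' e; apply: (can_inj (@splitK m n)); move: e.
case: (split i) => j; case: (split i') => j'.
- by move/rshift_inj ->.
- by move/eqP; rewrite eq_rlshift.
- by move/eqP; rewrite eq_lrshift.
- by move/lshift_inj ->.
Qed.

Definition inj_swap (m n : nat) : inj (m + n) (n + m) :=
  Inj (@inj_swap_subproof m n).

Definition inj_cast (m n : nat) (e : m = n) : inj m n := Inj (@cast_ord_inj m n e).

(** The action of a bijection (the family of points of [T] is irrelevant). *)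
Definition relabel (C : icat) (T : pspace C) (X : spectrum T) (m n : nat)
    (a : inj m n) (U : C) (q : nat) (x : X m U q) : X n U q :=
  act a (fun _ => bpt T U q) x.

(** A bimorphism [(X, Y) -> Z] consists of maps [X_m /\ Y_n -> Z_(m+n)] which
    are compatible with the structure maps of [X], [Y] and [Z]. The smash
    product of [X] and [Y] is the target of the universal one. *)
Record bimor (C : icat) (T : pspace C) (X Y Z : spectrum T) := Bimor {
  bim_fun :> forall (m n : nat) (U : C) (q : nat),
    X m U q -> Y n U q -> Z (m + n)%N U q;
  bim_res : forall m n (U V : C) (q r : nat) (f : ihom V U) (s : mono r q)
      (x : X m U q) (y : Y n U q),
    bim_fun (sres f s x) (sres f s y) =
    sres f s (bim_fun x y);
  bim_bptl : forall m n (U : C) (q : nat) (y : Y n U q),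
    bim_fun (bpt (X m) U q) y = bpt (Z (m + n)%N) U q;
  bim_bptr : forall m n (U : C) (q : nat) (x : X m U q),
    bim_fun x (bpt (Y n) U q) = bpt (Z (m + n)%N) U q;
  bim_act : forall m n m' n' (a : inj m n) (b : inj m' n') (U : C) (q : nat)
      (t : 'I_n -> T U q) (s : 'I_n' -> T U q) (x : X m U q) (y : Y m' U q),
    bim_fun (act a t x) (act b s y) =
    act (inj_sum a b) (family_cat t s) (bim_fun x y) }.

Definition universal_bimor (C : icat) (T : pspace C) (X Y Z : spectrum T)
    (b : bimor X Y Z) : Prop :=
  forall (W : spectrum T) (c : bimor X Y W),
  exists! h : spmap Z W, forall (m n : nat) (U : C) (q : nat) (x : X m U q)
    (y : Y n U q), h (m + n)%N U q (b m n U q x y) = c m n U q x y.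

(** The bimorphism exhibiting [Sigma^oo (X /\ Y)] as the smash product of
    [Sigma^oo X] and [Sigma^oo Y]. *)
Section SuspensionBimor.
Context (C : icat) (T X Y : pspace C).

Definition susp_bimor_fun (m n : nat) (U : C) (q : nat) (x : susp_lev T X m U q)
    (y : susp_lev T Y n U q) : susp_lev T (smash X Y) (m + n)%N U q :=
  susp_cl (X := smash X Y) (family_cat (sval x).1 (sval y).1)
    (smash_pair (sval x).2 (sval y).2).

Lemma family_cat_bptl (m n : nat) (U : C) (q : nat) (t : 'I_m -> T U q)
    (s : 'I_n -> T U q) : (exists i, t i = bpt T U q) ->
  exists i, family_cat t s i = bpt T U q.
Proof.
case=> i e; exists (lshift n i).
by rewrite /family_cat (unsplitK (inl _ i)).
Qed.

Lemma family_cat_bptr (m n : nat) (U : C) (q : nat) (t : 'I_m -> T U q)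
    (s : 'I_n -> T U q) : (exists i, s i = bpt T U q) ->
  exists i, family_cat t s i = bpt T U q.
Proof.
case=> i e; exists (rshift m i).
by rewrite /family_cat (unsplitK (inr _ i)).
Qed.

Lemma susp_bimor_cl (m n : nat) (U : C) (q : nat) (t : 'I_m -> T U q)
    (x : X U q) (s : 'I_n -> T U q) (y : Y U q) :
  susp_bimor_fun (susp_cl t x) (susp_cl s y) =
  susp_cl (X := smash X Y) (family_cat t s) (smash_pair x y).
Proof.
pose phi (v : tpow T Y n U q) (u : tpow T X m U q) :
  tpow T (smash X Y) (m + n) U q := (family_cat u.1 v.1, smash_pair u.2 v.2).
pose psi (u : tpow T X m U q) (v : tpow T Y n U q) := phi v u.
have Hphi v u : in_fat_wedge u -> in_fat_wedge (phi v u).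
  case=> [e|e]; [left; exact: family_cat_bptl|right].
  by apply: smash_pair_bpt; left.
have Hpsi u v : in_fat_wedge v -> in_fat_wedge (psi u v).
  case=> [e|e]; [left; exact: family_cat_bptr|right].
  by apply: smash_pair_bpt; right.
transitivity (susp_cl (X := smash X Y) (family_cat t (sval (susp_cl s y)).1)
    (smash_pair x (sval (susp_cl s y)).2)).
  exact: (collapse_cl_map (@in_fat_wedge_bpt C T X m)
    (Hphi (sval (susp_cl s y))) (t, x)).
exact: (collapse_cl_map (@in_fat_wedge_bpt C T Y n) (Hpsi (t, x)) (s, y)).
Qed.

Lemma susp_bimor_res (m n : nat) (U V : C) (q r : nat) (f : ihom V U)
    (s : mono r q) (x : susp_lev T X m U q) (y : susp_lev T Y n U q) :
  susp_bimor_fun (sres f s x) (sres f s y) = sres f s (susp_bimor_fun x y).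
Proof.
rewrite -[x]susp_clK -[y]susp_clK 2!susp_cl_res 2!susp_bimor_cl susp_cl_res.
rewrite smash_pairE; congr susp_cl; apply/funext => i.
by rewrite /family_cat; case: split.
Qed.

Lemma susp_bimor_bptl (m n : nat) (U : C) (q : nat) (y : susp_lev T Y n U q) :
  susp_bimor_fun (bpt (susp_lev T X m) U q) y = bpt (susp_lev T (smash X Y) (m + n)%N) U q.
Proof.
have -> : bpt (susp_lev T X m) U q = susp_cl (fun=> bpt T U q) (bpt X U q) by [].
rewrite -[y]susp_clK susp_bimor_cl; apply: susp_cl_bpt; right.
by apply: smash_pair_bpt; left.
Qed.

Lemma susp_bimor_bptr (m n : nat) (U : C) (q : nat) (x : susp_lev T X m U q) :
  susp_bimor_fun x (bpt (susp_lev T Y n) U q) = bpt (susp_lev T (smash X Y) (m + n)%N) U q.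
Proof.
have -> : bpt (susp_lev T Y n) U q = susp_cl (fun=> bpt T U q) (bpt Y U q) by [].
rewrite -[x]susp_clK susp_bimor_cl; apply: susp_cl_bpt; right.
by apply: smash_pair_bpt; right.
Qed.

Lemma extend_family_cat (V : Type) (m n m' n' : nat) (a : inj m n)
    (b : inj m' n') (f : 'I_m -> V) (g : 'I_m' -> V) (t : 'I_n -> V)
    (s : 'I_n' -> V) :
  family_cat (extend a f t) (extend b g s) =
  extend (inj_sum a b) (family_cat f g) (family_cat t s).
Proof.
apply/funext => j; rewrite -[j]splitK.
have E (u : 'I_m + 'I_m') : inj_sum a b (unsplit u) =
    match u with inl l => lshift n' (a l) | inr l => rshift n (b l) end.
  by rewrite /= unsplitK.
case: (split j) => i; rewrite {1}/family_cat unsplitK.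
  have [[l <-]|ai] := inj_cases a i.
    have -> : unsplit (inl _ (a l)) = inj_sum a b (unsplit (inl _ l)) by rewrite E.
    by rewrite !extend_im /family_cat unsplitK.
  rewrite !extend_out // ?/family_cat ?unsplitK // => l.
  rewrite -[l]splitK E; case: (split l) => l' /eqP.
    by rewrite eq_lshift => /eqP; apply: ai.
  by rewrite eq_rlshift.
have [[l <-]|ai] := inj_cases b i.
  have -> : unsplit (inr _ (b l)) = inj_sum a b (unsplit (inr _ l)) by rewrite E.
  by rewrite !extend_im /family_cat unsplitK.
rewrite !extend_out // ?/family_cat ?unsplitK // => l.
rewrite -[l]splitK E; case: (split l) => l' /eqP.
  by rewrite eq_lrshift.
by rewrite eq_rshift => /eqP; apply: ai.
Qed.

Lemma susp_bimor_act (m n m' n' : nat) (a : inj m n) (b : inj m' n') (U : C)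
    (q : nat) (t : 'I_n -> T U q) (s : 'I_n' -> T U q) (x : susp_lev T X m U q)
    (y : susp_lev T Y m' U q) :
  susp_bimor_fun (susp_act a t x) (susp_act b s y) =
  susp_act (inj_sum a b) (family_cat t s) (susp_bimor_fun x y).
Proof.
rewrite -[x]susp_clK -[y]susp_clK 2!susp_actE 2!susp_bimor_cl susp_actE.
by rewrite extend_family_cat.
Qed.

Definition susp_bimor : bimor (susp T X) (susp T Y) (susp T (smash X Y)) :=
  @Bimor C T (susp T X) (susp T Y) (susp T (smash X Y)) susp_bimor_fun
    susp_bimor_res susp_bimor_bptl susp_bimor_bptr susp_bimor_act.

End SuspensionBimor.
Arguments susp_bimor {C} T X Y.

(** The loop object [Omega_T E], i.e. the internal hom of pointed presheaves
    from [T] to [E]. *)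
Section Loops.
Context (C : icat) (T E : pspace C).

Record loop (U : C) (n : nat) := Loop {
  loop_fun :> forall (V : C) (m : nat), ihom V U -> mono m n -> T V m -> E V m;
  loop_nat : forall (V W : C) (m p : nat) (g : ihom V U) (s : mono m n)
      (f : ihom W V) (t : mono p m) (x : T V m),
    loop_fun (icomp g f) (mono_comp s t) (sres f t x) =
    sres f t (loop_fun g s x);
  loop_bpt : forall (V : C) (m : nat) (g : ihom V U) (s : mono m n),
    loop_fun g s (bpt T V m) = bpt E V m }.

Lemma loop_eq (U : C) (n : nat) (a b : loop U n) :
  (forall V m g s x, a V m g s x = b V m g s x) -> a = b.
Proof.
case: a b => [a p q] [b p' q'] /= ab.
have e : a = b.
  apply: functional_extensionality_dep => V.
  apply: functional_extensionality_dep => m.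
  apply/funext => g; apply/funext => s; apply/funext => x; exact: ab.
case: _ / e p' q' => p' q'.
by congr Loop; apply: Prop_irrelevance.
Qed.

Lemma loop_res_nat (U V : C) (m n : nat) (f : ihom V U) (s : mono n m)
    (a : loop U m) (W Z : C) (p r : nat) (g : ihom W V) (t : mono p n)
    (h : ihom Z W) (u : mono r p) (x : T W p) :
  a Z r (icomp f (icomp g h)) (mono_comp s (mono_comp t u)) (sres h u x) =
  sres h u (a W p (icomp f g) (mono_comp s t) x).
Proof. by rewrite icompA mono_compA loop_nat. Qed.

Definition loop_res (U V : C) (m n : nat) (f : ihom V U) (s : mono n m)
    (a : loop U m) : loop V n :=
  @Loop V n (fun W p g t x => a W p (icomp f g) (mono_comp s t) x)
    (loop_res_nat f s a)
    (fun W p g t => loop_bpt a (icomp f g) (mono_comp s t)).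

Lemma loop_res_id (U : C) (n : nat) (a : loop U n) :
  loop_res (iid U) (mono_id n) a = a.
Proof.
apply: loop_eq => V m g s x /=; rewrite icomp1m.
by have -> : mono_comp (mono_id n) s = s by exact: mono_eq.
Qed.

Lemma loop_res_comp (U V W : C) (m n p : nat) (f : ihom V U) (g : ihom W V)
    (s : mono n m) (t : mono p n) (a : loop U m) :
  loop_res (icomp f g) (mono_comp s t) a = loop_res g t (loop_res f s a).
Proof. by apply: loop_eq => Z q h u x /=; rewrite icompA mono_compA. Qed.

Definition loops : spsh C := @SPsh C loop loop_res loop_res_id loop_res_comp.

End Loops.

Section AdjointStructureMap.
Context (C : icat) (T : pspace C) (E : spectrum T) (n : nat).

Definition inj_succ : inj n n.+1 := Inj (@lift_inj n.+1 ord0).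

Lemma bond_nat (U : C) (q : nat) (x : E n U q) (V W : C) (m p : nat)
    (g : ihom V U) (s : mono m q) (f : ihom W V) (u : mono p m) (t : T V m) :
  act inj_succ (fun _ => sres f u t) (sres (icomp g f) (mono_comp s u) x) =
  sres f u (act inj_succ (fun _ => t) (sres g s x)).
Proof. by rewrite sres_comp act_res. Qed.

Lemma bond_bpt (U : C) (q : nat) (x : E n U q) (V : C) (m : nat)
    (g : ihom V U) (s : mono m q) :
  act inj_succ (fun _ => bpt T V m) (sres g s x) = bpt (E n.+1) V m.
Proof.
apply: (@act_bptT _ _ E _ _ inj_succ _ _ _ _ ord0); last by [].
by move=> i /= /eqP; rewrite eq_sym (negbTE (neq_lift _ _)).
Qed.

Definition bond (U : C) (q : nat) (x : E n U q) : loop T (E n.+1) U q :=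
  @Loop C T (E n.+1) U q
    (fun V m g s t => act inj_succ (fun _ => t) (sres g s x))
    (bond_nat x) (bond_bpt x).

Lemma bond_res (U V : C) (q r : nat) (f : ihom V U) (s : mono r q)
    (x : E n U q) : bond (sres f s x) = loop_res f s (bond x).
Proof. by apply: loop_eq => W m g t y /=; rewrite sres_comp. Qed.

(** The adjoint [E_n -> Omega_T E_(n+1)] of the structure map. *)
Definition adjoint_bond : smap (E n) (loops T (E n.+1)) :=
  @SMap C (E n) (loops T (E n.+1)) bond bond_res.

End AdjointStructureMap.

(** The suspension coordinate is [S^{2,1} = S^{1,0} /\ S^{1,1}]. *)
Definition Tsph (k : comPzRingType) : pspace (Sm k) :=
  smash (S1 (Sm k)) (S11 k).

Notation mspec k := (spectrum (Tsph k)).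

Definition injective_spectrum (k : comPzRingType) (E : mspec k) : Prop :=
  forall (A B : mspec k) (i : spmap A B),
    (forall n, monic (i n)) -> (forall n, motivic_we (i n)) ->
  forall a : spmap A E, exists h : spmap B E, spmap_comp h i = a.

Definition omega_spectrum (k : comPzRingType) (E : mspec k) : Prop :=
  forall n, motivic_fibrant (E n) /\ motivic_we (adjoint_bond E n).

Definition sp_homotopy (C : icat) (T : pspace C) (X E : spectrum T)
    (f g : spmap X E) : Prop :=
  exists H : forall (n : nat) (U : C) (q : nat), X n U q -> mono q 1 -> E n U q,
  [/\ forall n (U V : C) (q r : nat) (h : ihom V U) (s : mono r q)
        (x : X n U q) (u : mono q 1),
        H n V r (sres h s x) (mono_comp u s) = sres h s (H n U q x u),
      forall n (U : C) (q : nat) (u : mono q 1),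
        H n U q (bpt (X n) U q) u = bpt (E n) U q,
      forall m n (a : inj m n) (U : C) (q : nat) (t : 'I_n -> T U q)
        (x : X m U q) (u : mono q 1),
        H n U q (act a t x) u = act a t (H m U q x u)
    & forall n (U : C) (q : nat) (x : X n U q),
        H n U q x (mono_const q ord0) = f n U q x /\
        H n U q x (mono_const q ord_max) = g n U q x].

Definition sp_homotopic (C : icat) (T : pspace C) (X E : spectrum T)
    (f g : spmap X E) : Prop :=
  clos_refl_sym_trans (spmap X E) (@sp_homotopy C T X E) f g.

(** Hovey-Shipley-Smith: [f] is a stable equivalence iff [[f, E]] is a bijection
    for each injective Omega-spectrum [E]. *)
Definition stable_equivalence (k : comPzRingType) (X Y : mspec k)
    (f : spmap X Y) : Prop :=
  forall E : mspec k, injective_spectrum E -> omega_spectrum E ->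
    (forall g h : spmap Y E,
       sp_homotopic (spmap_comp g f) (spmap_comp h f) -> sp_homotopic g h) /\
    (forall g : spmap X E, exists h : spmap Y E, sp_homotopic (spmap_comp h f) g).

(** The motivic stable homotopy category is the localization of the category
    of motivic symmetric spectra at the stable equivalences;
    morphisms are classes of zigzags. *)

Inductive zigzag (k : comPzRingType) : mspec k -> mspec k -> Type :=
| ZMap X Y (f : spmap X Y) : zigzag X Y
| ZInv X Y (f : spmap X Y) (w : stable_equivalence f) : zigzag Y X
| ZComp X Y Z (g : zigzag Y Z) (f : zigzag X Y) : zigzag X Z.

Inductive zigzag_eq (k : comPzRingType) :
    forall X Y : mspec k, zigzag X Y -> zigzag X Y -> Prop :=
| ZRefl X Y (z : zigzag X Y) : zigzag_eq z z
| ZSym X Y (z z' : zigzag X Y) : zigzag_eq z z' -> zigzag_eq z' z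
| ZTrans X Y (z z' z'' : zigzag X Y) :
    zigzag_eq z z' -> zigzag_eq z' z'' -> zigzag_eq z z''
| ZCongr X Y Z (g g' : zigzag Y Z) (f f' : zigzag X Y) :
    zigzag_eq g g' -> zigzag_eq f f' -> zigzag_eq (ZComp g f) (ZComp g' f')
| ZAssoc X Y Z W (h : zigzag Z W) (g : zigzag Y Z) (f : zigzag X Y) :
    zigzag_eq (ZComp h (ZComp g f)) (ZComp (ZComp h g) f)
| ZIdl X Y (f : zigzag X Y) : zigzag_eq (ZComp (ZMap (spmap_id Y)) f) f
| ZIdr X Y (f : zigzag X Y) : zigzag_eq (ZComp f (ZMap (spmap_id X))) f
| ZMapComp X Y Z (g : spmap Y Z) (f : spmap X Y) :
    zigzag_eq (ZMap (spmap_comp g f)) (ZComp (ZMap g) (ZMap f))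
| ZInvl X Y (f : spmap X Y) (w : stable_equivalence f) :
    zigzag_eq (ZComp (ZInv w) (ZMap f)) (ZMap (spmap_id X))
| ZInvr X Y (f : spmap X Y) (w : stable_equivalence f) :
    zigzag_eq (ZComp (ZMap f) (ZInv w)) (ZMap (spmap_id Y)).

Definition SH (k : comPzRingType) (X Y : mspec k) : Type :=
  {P : zigzag X Y -> Prop | exists z, P = zigzag_eq z}.

Definition zclass (k : comPzRingType) (X Y : mspec k) (z : zigzag X Y) : SH X Y :=
  exist (fun P => exists z, P = zigzag_eq z) (zigzag_eq z)
    (ex_intro _ z erefl).

Definition zrepr (k : comPzRingType) (X Y : mspec k) (f : SH X Y) : zigzag X Y :=
  sval (cid (svalP f)).

Definition sh_map (k : comPzRingType) (X Y : mspec k) (f : spmap X Y) : SH X Y :=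
  zclass (ZMap f).

Definition sh_id (k : comPzRingType) (X : mspec k) : SH X X :=
  sh_map (spmap_id X).

Definition sh_comp (k : comPzRingType) (X Y Z : mspec k) (g : SH Y Z)
    (f : SH X Y) : SH X Z := zclass (ZComp (zrepr g) (zrepr f)).

Definition sh_inverse (k : comPzRingType) (X Y : mspec k) (f : SH X Y)
    (g : SH Y X) : Prop := sh_comp g f = sh_id X /\ sh_comp f g = sh_id Y.

Definition sh_iso (k : comPzRingType) (X Y : mspec k) (f : SH X Y) : Prop :=
  exists g, sh_inverse f g.

Definition sh_null (k : comPzRingType) (X Y : mspec k) : SH X Y :=
  sh_map (spmap_const X Y).

Definition sh_inv (k : comPzRingType) (X Y : mspec k) (f : SH X Y) : SH Y X :=
  match pselect (sh_iso f) with
  | left e => sval (cid e)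
  | right _ => sh_null Y X
  end.

Definition cofibrant_spectrum (k : comPzRingType) (X : mspec k) : Prop :=
  forall (E B : mspec k) (p : spmap E B),
    (forall (n : nat) (F G : spsh (Sm k)) (i : smap F G), monic i ->
       rlp i (p n)) ->
  forall b : spmap X B, exists h : spmap X E, spmap_comp p h = b.

Definition sphere_spectrum (k : comPzRingType) : mspec k :=
  susp (Tsph k) (S0 (Sm k)).

Definition sphere_unit (k : comPzRingType) (U : Sm k) (q : nat) :
    sphere_spectrum k 0%N U q :=
  susp_cl (X := S0 (Sm k)) (fun _ : 'I_0 => bpt (Tsph k) U q) true.

(** The symmetric monoidal structure on the motivic stable homotopy category
    given by the (left derived) smash product. A bimorphism [(X, Y) -> Z], i.e.
    a map of spectra out of the point-set smash product of [X] and [Y], induces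
    a map [sm_bim] out of the derived smash product, which is an isomorphism if
    the bimorphism is universal and [X] and [Y] are cofibrant. The structure
    isomorphisms come from those of the point-set smash product. *)
Record smash_structure (k : comPzRingType) := SmashStructure {
  sm : mspec k -> mspec k -> mspec k;
  smf : forall X X' Y Y', SH X X' -> SH Y Y' -> SH (sm X Y) (sm X' Y');
  sm_assoc : forall X Y Z, SH (sm (sm X Y) Z) (sm X (sm Y Z));
  sm_unitl : forall X, SH (sm (sphere_spectrum k) X) X;
  sm_unitr : forall X, SH (sm X (sphere_spectrum k)) X;
  sm_twist : forall X Y, SH (sm X Y) (sm Y X);
  smf_id : forall X Y, smf (sh_id X) (sh_id Y) = sh_id (sm X Y);
  smf_comp : forall X X' X'' Y Y' Y'' (f' : SH X' X'') (f : SH X X')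
      (g' : SH Y' Y'') (g : SH Y Y'),
    smf (sh_comp f' f) (sh_comp g' g) = sh_comp (smf f' g') (smf f g);
  sm_assoc_iso : forall X Y Z, sh_iso (sm_assoc X Y Z);
  sm_unitl_iso : forall X, sh_iso (sm_unitl X);
  sm_unitr_iso : forall X, sh_iso (sm_unitr X);
  sm_assoc_nat : forall X X' Y Y' Z Z' (f : SH X X') (g : SH Y Y') (h : SH Z Z'),
    sh_comp (sm_assoc X' Y' Z') (smf (smf f g) h) =
    sh_comp (smf f (smf g h)) (sm_assoc X Y Z);
  sm_unitl_nat : forall X X' (f : SH X X'),
    sh_comp (sm_unitl X') (smf (sh_id _) f) = sh_comp f (sm_unitl X);
  sm_unitr_nat : forall X X' (f : SH X X'),
    sh_comp (sm_unitr X') (smf f (sh_id _)) = sh_comp f (sm_unitr X);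
  sm_twist_nat : forall X X' Y Y' (f : SH X X') (g : SH Y Y'),
    sh_comp (sm_twist X' Y') (smf f g) = sh_comp (smf g f) (sm_twist X Y);
  sm_pentagon : forall X Y Z W,
    sh_comp (sm_assoc X Y (sm Z W)) (sm_assoc (sm X Y) Z W) =
    sh_comp (smf (sh_id X) (sm_assoc Y Z W))
      (sh_comp (sm_assoc X (sm Y Z) W) (smf (sm_assoc X Y Z) (sh_id W)));
  sm_triangle : forall X Y,
    sh_comp (smf (sh_id X) (sm_unitl Y)) (sm_assoc X (sphere_spectrum k) Y) =
    smf (sm_unitr X) (sh_id Y);
  sm_hexagon : forall X Y Z,
    sh_comp (sm_assoc Y Z X) (sh_comp (sm_twist X (sm Y Z)) (sm_assoc X Y Z)) =
    sh_comp (smf (sh_id Y) (sm_twist X Z))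
      (sh_comp (sm_assoc Y X Z) (smf (sm_twist X Y) (sh_id Z)));
  sm_twistK : forall X Y, sh_comp (sm_twist Y X) (sm_twist X Y) = sh_id (sm X Y);
  sm_bim : forall X Y Z : mspec k, bimor X Y Z -> SH (sm X Y) Z;
  sm_bim_nat : forall (X X' Y Y' Z Z' : mspec k) (b : bimor X Y Z)
      (b' : bimor X' Y' Z') (f : spmap X X') (g : spmap Y Y') (h : spmap Z Z'),
    (forall m n U q x y,
       h (m + n)%N U q (b m n U q x y) = b' m n U q (f m U q x) (g n U q y)) ->
    sh_comp (sh_map h) (sm_bim b) =
    sh_comp (sm_bim b') (smf (sh_map f) (sh_map g));
  sm_bim_iso : forall (X Y Z : mspec k) (b : bimor X Y Z),
    cofibrant_spectrum X -> cofibrant_spectrum Y -> universal_bimor b ->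
    sh_iso (sm_bim b);
  sm_bim_assoc : forall (X Y Z A B W : mspec k) (b : bimor X Y A)
      (c : bimor A Z W) (b' : bimor Y Z B) (c' : bimor X B W),
    (forall m n p U q x y z,
       relabel (inj_cast (esym (addnA m n p)))
         (c (m + n)%N p U q (b m n U q x y) z) =
       c' m (n + p)%N U q x (b' n p U q y z)) ->
    sh_comp (sm_bim c) (smf (sm_bim b) (sh_id Z)) =
    sh_comp (sh_comp (sm_bim c') (smf (sh_id X) (sm_bim b'))) (sm_assoc X Y Z);
  sm_bim_unitl : forall (X : mspec k) (b : bimor (sphere_spectrum k) X X),
    (forall n U q x, b 0%N n U q (sphere_unit U q) x = x) ->
    sm_bim b = sm_unitl X;
  sm_bim_unitr : forall (X : mspec k) (b : bimor X (sphere_spectrum k) X),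
    (forall n U q x, b n 0%N U q x (sphere_unit U q) =
       relabel (inj_cast (esym (addn0 n))) x) ->
    sm_bim b = sm_unitr X;
  sm_bim_twist : forall (X Y Z : mspec k) (b : bimor X Y Z) (b' : bimor Y X Z),
    (forall m n U q x y,
       relabel (inj_swap m n) (b m n U q x y) = b' n m U q y x) ->
    sm_bim b = sh_comp (sm_bim b') (sm_twist X Y) }.

(** The motivic stable homotopy category is additive; as it has finite
    biproducts, the structure below is unique. *)
Record additive_structure (k : comPzRingType) := AdditiveStructure {
  sh_add : forall X Y : mspec k, SH X Y -> SH X Y -> SH X Y;
  sh_zero : forall X Y : mspec k, SH X Y;
  sh_opp : forall X Y : mspec k, SH X Y -> SH X Y;
  sh_addA : forall X Y (f g h : SH X Y),
    sh_add f (sh_add g h) = sh_add (sh_add f g) h;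
  sh_addC : forall X Y (f g : SH X Y), sh_add f g = sh_add g f;
  sh_add0 : forall X Y (f : SH X Y), sh_add (sh_zero X Y) f = f;
  sh_addN : forall X Y (f : SH X Y), sh_add (sh_opp f) f = sh_zero X Y;
  sh_addl : forall X Y Z (g : SH Y Z) (f f' : SH X Y),
    sh_comp g (sh_add f f') = sh_add (sh_comp g f) (sh_comp g f');
  sh_addr : forall X Y Z (g g' : SH Y Z) (f : SH X Y),
    sh_comp (sh_add g g') f = sh_add (sh_comp g f) (sh_comp g' f) }.

Fixpoint sh_muln (k : comPzRingType) (A : additive_structure k)
    (X Y : mspec k) (n : nat) (f : SH X Y) : SH X Y :=
  if n is m.+1 then sh_add A f (sh_muln A m f) else sh_zero A X Y.

Definition sh_mulz (k : comPzRingType) (A : additive_structure k)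
    (X Y : mspec k) (n : int) (f : SH X Y) : SH X Y :=
  match n with
  | Posz m => sh_muln A m f
  | Negz m => sh_opp A (sh_muln A m.+1 f)
  end.

Definition sh_sub (k : comPzRingType) (A : additive_structure k)
    (X Y : mspec k) (f g : SH X Y) : SH X Y := sh_add A f (sh_opp A g).

(** [Sn10 = S^{-1,0}], [Sn11 = S^{-1,-1}], [inv10 = a_1], [inv11 = a_2]. *)
Record negative_spheres (k : comPzRingType) (M : smash_structure k) :=
  NegativeSpheres {
  Sn10 : mspec k;
  Sn11 : mspec k;
  inv10 : SH (sm M Sn10 (susp (Tsph k) (S1 (Sm k)))) (sphere_spectrum k);
  inv10_iso : sh_iso inv10;
  inv11 : SH (sm M Sn11 (susp (Tsph k) (S11 k))) (sphere_spectrum k);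
  inv11_iso : sh_iso inv11 }.

(** Formal smash products of the spheres [S^{0,0}], [S^{1,0}], [S^{1,1}],
    [S^{-1,0}] and [S^{-1,-1}]. *)
Inductive sword :=
| W00 | W10 | W11 | Wn10 | Wn11
| Wsm of sword & sword.

Fixpoint bideg (w : sword) : int * int :=
  match w with
  | W00 => (0, 0)
  | W10 => (1, 0)
  | W11 => (1, 1)
  | Wn10 => (-1, 0)
  | Wn11 => (-1, -1)
  | Wsm v w => ((bideg v).1 + (bideg w).1, (bideg v).2 + (bideg w).2)
  end.

(** The smash power with exponent [n], for inverse spheres [g] and [g']. *)
Definition wpow (g g' : sword) (n : int) : sword :=
  match n with
  | Posz m => iter m (Wsm g) W00
  | Negz m => iter m.+1 (Wsm g') W00
  end.

Definition wsphere (p q : int) : sword :=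
  Wsm (wpow W10 Wn10 (p - q)) (wpow W11 Wn11 q).

Section Spheres.
Context (k : comPzRingType) (M : smash_structure k) (N : negative_spheres M).

Fixpoint wspec (w : sword) : mspec k :=
  match w with
  | W00 => sphere_spectrum k
  | W10 => susp (Tsph k) (S1 (Sm k))
  | W11 => susp (Tsph k) (S11 k)
  | Wn10 => Sn10 N
  | Wn11 => Sn11 N
  | Wsm v w => sm M (wspec v) (wspec w)
  end.

(** The distinguished isomorphisms between smash products of spheres of the same
    bidegree. They are determined by the listed properties; [phi v w] is
    irrelevant if the bidegrees of [v] and [w] differ. *)
Record canonical_isos := CanonicalIsos {
  phi :> forall v w : sword, SH (wspec v) (wspec w);
  phi_id : forall w, phi w w = sh_id (wspec w);
  phi_comp : forall u v w, bideg u = bideg v -> bideg v = bideg w ->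
    sh_comp (phi v w) (phi u v) = phi u w;
  phi_sm : forall v v' w w', bideg v = bideg v' -> bideg w = bideg w' ->
    phi (Wsm v w) (Wsm v' w') = smf M (phi v v') (phi w w');
  phi_assoc : forall u v w,
    phi (Wsm (Wsm u v) w) (Wsm u (Wsm v w)) =
    sm_assoc M (wspec u) (wspec v) (wspec w);
  phi_unitl : forall w, phi (Wsm W00 w) w = sm_unitl M (wspec w);
  phi_unitr : forall w, phi (Wsm w W00) w = sm_unitr M (wspec w);
  phi_inv10 : phi (Wsm Wn10 W10) W00 = inv10 N;
  phi_inv11 : phi (Wsm Wn11 W11) W00 = inv11 N;
  phi_twist : forall m n : int,
    phi (Wsm (wpow W10 Wn10 m) (wpow W11 Wn11 n))
      (Wsm (wpow W11 Wn11 n) (wpow W10 Wn10 m)) =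
    sm_twist M (wspec (wpow W10 Wn10 m)) (wspec (wpow W11 Wn11 n)) }.

(** The pointed motivic space corresponding to a smash product of nonnegative
    spheres (the value on negative spheres is irrelevant). *)
Fixpoint wspace (w : sword) : pspace (Sm k) :=
  match w with
  | W00 => S0 (Sm k)
  | W10 => S1 (Sm k)
  | W11 => S11 k
  | Wn10 => S0 (Sm k)
  | Wn11 => S0 (Sm k)
  | Wsm v w => smash (wspace v) (wspace w)
  end.

(** The isomorphism [Sigma^oo X /\ Sigma^oo Y -> Sigma^oo (X /\ Y)]. *)
Definition susp_smash (X Y : pspace (Sm k)) :
    SH (sm M (susp (Tsph k) X) (susp (Tsph k) Y)) (susp (Tsph k) (smash X Y)) :=
  sm_bim M (susp_bimor (Tsph k) X Y).

(** The identification of a smash product of nonnegative spheres with the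
    suspension spectrum of the corresponding space. *)
Fixpoint wcomp (w : sword) : SH (wspec w) (susp (Tsph k) (wspace w)) :=
  match w return SH (wspec w) (susp (Tsph k) (wspace w)) with
  | W00 => sh_id _
  | W10 => sh_id _
  | W11 => sh_id _
  | Wn10 => sh_null _ _
  | Wn11 => sh_null _ _
  | Wsm v w => sh_comp (susp_smash (wspace v) (wspace w))
                 (smf M (wcomp v) (wcomp w))
  end.

Definition wdiag (w : sword) : SH (wspec w) (wspec (Wsm w w)) :=
  sh_comp (sh_inv (wcomp (Wsm w w)))
    (sh_comp (sh_map (susp_map (Tsph k) (diagonal (wspace w)))) (wcomp w)).

Context (F : canonical_isos).

Definition pi_ (p q : int) : Type := SH (wspec (wsphere p q)) (wspec W00).

(** The product, for [p = a + c] and [q = b + d]. *)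
Definition pi_mul (a b c d p q : int) (f : pi_ a b) (g : pi_ c d) : pi_ p q :=
  sh_comp (sm_unitl M (wspec W00))
    (sh_comp (smf M f g) (F (wsphere p q) (Wsm (wsphere a b) (wsphere c d)))).

(** The unit, for [p = q = 0]. *)
Definition pi_one (p q : int) : pi_ p q := F (wsphere p q) W00.

(** The element represented by a stable map [f : v -> w] between smash products
    of spheres, for [(p, q) = bideg v - bideg w]. *)
Definition represents (v w : sword) (p q : int) (f : SH (wspec v) (wspec w)) :
    pi_ p q :=
  let w' := wsphere (- (bideg w).1) (- (bideg w).2) in
  sh_comp (F (Wsm w' w) W00)
    (sh_comp (smf M (sh_id (wspec w')) f) (F (wsphere p q) (Wsm w' v))).

Definition pi_epsilon : pi_ 0 0 :=
  @represents (Wsm W11 W11) (Wsm W11 W11) 0 0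
    (sm_twist M (wspec W11) (wspec W11)).

Definition pi_rho : pi_ (-1) (-1) :=
  @represents W00 W11 (-1) (-1) (sh_map (susp_map (Tsph k) (rho_map k))).

Fixpoint pi_rho_pow (n : nat) : pi_ (- n%:Z) (- n%:Z) :=
  match n return pi_ (- n%:Z) (- n%:Z) with
  | 0 => pi_one _ _
  | m.+1 => pi_mul _ _ pi_rho (pi_rho_pow m)
  end.

Definition pi_power (n : int) : pi_ 0 0 :=
  @represents W11 W11 0 0 (sh_map (susp_map (Tsph k) (power_map k n))).

End Spheres.

(* Main.v *)
(** Write [X] for [A^1 - 0], [T] for [A^1/(A^1 - 0)] and [-1 : T -> T] for [x |-> -x]. The
    map [(u, t) |-> 1 - t + t u] identifies the suspension of [X] with [T], and [T /\ T] is
    locally equivalent to [A^2/(A^2 - 0)]. A map to the latter is a pair of functions [(x, y)],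
    and any algebraic deformation of [(x, y)] which keeps it unimodular where it has to be
    trivial is a homotopy. Three kinds of deformations suffice. Paths in [SL_2] show that the
    twist of [T /\ T] is [(-1) /\ 1] and that [(w x, y)] and [(x, w y)] are homotopic for a
    unit [w]. Over [X], the pair [(f, g) = (u, 1 - t + t u)] can be deformed to
    [(-1, 1 - t + t u)] with [f] invertible modulo [g]: this gives [Delta = rho /\ 1] on [X],
    and the loop [u^m (1 - t + t u)] in [T] is [(-1)^m]. Finally the triangle with vertices
    [1], [u^m], [u^(m+1)] gives [P_(m+1) = P_m + (-1)^m]. The twist of the simplicial circle is
    minus the identity because its diagonal splits [S^1 /\ S^1] into two triangles; comparing
    the twists of [T] and of [S^1 /\ X] one gets [(-1) = - epsilon], hence (c).

    The diagonal of a smash product is the smash product of the diagonals up to interchange,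
    and that of the simplicial circle is null through [(x, max(x, t))], which proves (b). For
    (a), the canonical isomorphisms allow to compute as in a strict monoidal category, where
    [rho] commutes with [S^{1,1}] since [Delta] is both [rho /\ 1] and [1 /\ rho]; hence it
    commutes with [S^{-1,-1}] as well. *)

From HB Require Import structures.
From Stdlib Require Import Relation_Operators.
From mathcomp Require Import all_boot all_algebra ring.
From mathcomp Require Import boolp.
Require Import Defs.

Set Implicit Arguments.
Unset Strict Implicit.
Unset Printing Implicit Defensive.

Import GRing.Theory.
Local Open Scope ring_scope.

(** * The stable homotopy category *)

(** A morphism of [SH] is a bare class of zigzags, so equalities come only from functoriality, from
    homotopies and from cancelling maps shown to be invertible. Whether a map of suspension spectra
    is invertible is tested on pointed homotopy classes into motivic fibrant spaces, for which the
    definition of fibrancy gives unpointed bijections; the relative versions come from homotopy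
    extension. Invertibility of the spheres is used twice. Two maps agree once they agree after
    smashing with a sphere, which is how maps become pairs of functions. And every endomorphism of a
    sphere is a scalar coming from the unit, so that twists, power maps and [x |-> -x], which live
    on different spheres, can be compared in one ring. The addition is abstract. It meets geometry
    through wedges, where the two idempotents add up to the identity. Presheaves are not sheafified,
    so local triviality on a covering has to be turned into homotopies, and the empty scheme, over
    which 0 = 1, must be watched. The polynomial deformations need a parameter in [A^1] while the
    sign of the twist comes from the simplicial circle, hence two circles. *)

Notation mspec k := (spectrum (Tsph k)).

Section StableCategory.
Context (k : comPzRingType).
Implicit Types X Y Z W : mspec k.

Lemma smap_eq (C : icat) (X Y : spsh C) (f g : smap X Y) :
  (forall U n x, f U n x = g U n x) -> f = g.
Proof.
case: f g => [f p] [g q] /= fg.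
have e : f = g.
  by apply: functional_extensionality_dep => U;
     apply: functional_extensionality_dep => n; apply/funext => x; apply: fg.
by case: _ / e q => q; congr SMap; apply: Prop_irrelevance.
Qed.

Lemma pmap_eq (C : icat) (X Y : pspace C) (f g : pmap X Y) :
  (forall U n x, f U n x = g U n x) -> f = g.
Proof.
move=> fg; have e := smap_eq fg.
case: f g e {fg} => [f p] [g q] /= e.
by case: _ / e q => q; congr PMap; apply: Prop_irrelevance.
Qed.

Lemma spmap_eq (C : icat) (T : pspace C) (X Y : spectrum T) (f g : spmap X Y) :
  (forall n U q x, f n U q x = g n U q x) -> f = g.
Proof.
case: f g => [f p] [g q] /= fg.
have e : f = g.
  by apply: functional_extensionality_dep => n; apply: pmap_eq => U r x; apply: fg.
by case: _ / e q => q; congr SpMap; apply: Prop_irrelevance.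
Qed.

Lemma zclassP X Y (z z' : zigzag X Y) : zclass z = zclass z' <-> zigzag_eq z z'.
Proof.
split=> [[e]|e]; first by rewrite e; apply: ZRefl.
apply: eq_exist; apply/funext => w; apply/propext.
by split; apply: ZTrans; [apply: ZSym|].
Qed.

Lemma zreprK X Y (f : SH X Y) : zclass (zrepr f) = f.
Proof. by case: f => P h; apply: eq_exist; rewrite /zrepr; case: cid. Qed.

Lemma zrepr_class X Y (z : zigzag X Y) : zigzag_eq (zrepr (zclass z)) z.
Proof. by apply/zclassP; rewrite zreprK. Qed.

Lemma sh_compE X Y Z (g : zigzag Y Z) (f : zigzag X Y) :
  sh_comp (zclass g) (zclass f) = zclass (ZComp g f).
Proof. by apply/zclassP; apply: ZCongr; apply: zrepr_class. Qed.

Lemma sh_compA X Y Z W (h : SH Z W) (g : SH Y Z) (f : SH X Y) :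
  sh_comp h (sh_comp g f) = sh_comp (sh_comp h g) f.
Proof.
rewrite -[h]zreprK -[g]zreprK -[f]zreprK !sh_compE.
by apply/zclassP; apply: ZAssoc.
Qed.

Lemma sh_comp1m X Y (f : SH X Y) : sh_comp (sh_id Y) f = f.
Proof. by rewrite -[f]zreprK sh_compE; apply/zclassP; apply: ZIdl. Qed.

Lemma sh_compm1 X Y (f : SH X Y) : sh_comp f (sh_id X) = f.
Proof. by rewrite -[f]zreprK sh_compE; apply/zclassP; apply: ZIdr. Qed.

Lemma sh_map_comp X Y Z (g : spmap Y Z) (f : spmap X Y) :
  sh_comp (sh_map g) (sh_map f) = sh_map (spmap_comp g f).
Proof. by rewrite sh_compE; apply/zclassP; apply/ZSym/ZMapComp. Qed.

Lemma sh_map_iso X Y (f : spmap X Y) : stable_equivalence f -> sh_iso (sh_map f).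
Proof.
by move=> w; exists (zclass (ZInv w)); split; rewrite sh_compE;
   apply/zclassP; [apply: ZInvl|apply: ZInvr].
Qed.

Lemma sh_iso_id X : sh_iso (sh_id X).
Proof. by exists (sh_id X); split; apply: sh_comp1m. Qed.

Lemma sh_inverse_sym X Y (f : SH X Y) g : sh_inverse f g -> sh_inverse g f.
Proof. by case. Qed.

Lemma sh_iso_comp X Y Z (g : SH Y Z) (f : SH X Y) :
  sh_iso g -> sh_iso f -> sh_iso (sh_comp g f).
Proof.
move=> [g' [gg' g'g]] [f' [ff' f'f]]; exists (sh_comp f' g'); split.
  by rewrite -sh_compA (sh_compA g') gg' sh_comp1m.
by rewrite -sh_compA (sh_compA f) f'f sh_comp1m.
Qed.

Lemma sh_invP X Y (f : SH X Y) : sh_iso f -> sh_inverse f (sh_inv f).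
Proof. by move=> i; rewrite /sh_inv; case: pselect => // e; case: cid. Qed.

Lemma sh_mulVm X Y (f : SH X Y) : sh_iso f -> sh_comp (sh_inv f) f = sh_id X.
Proof. by move/sh_invP => []. Qed.

Lemma sh_mulmV X Y (f : SH X Y) : sh_iso f -> sh_comp f (sh_inv f) = sh_id Y.
Proof. by move/sh_invP => []. Qed.

Lemma sh_iso_inv X Y (f : SH X Y) : sh_iso f -> sh_iso (sh_inv f).
Proof. by move=> i; exists f; apply/sh_inverse_sym/sh_invP. Qed.

Lemma sh_mono X Y Z (g : SH Y Z) (f f' : SH X Y) :
  sh_iso g -> sh_comp g f = sh_comp g f' -> f = f'.
Proof.
move=> [h [hg _]] e; move: (congr1 (sh_comp h) e).
by rewrite !sh_compA hg !sh_comp1m.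
Qed.

Lemma sh_epi X Y Z (g g' : SH Y Z) (f : SH X Y) :
  sh_iso f -> sh_comp g f = sh_comp g' f -> g = g'.
Proof.
move=> [h [_ fh]] e; move: (congr1 (fun x => sh_comp x h) e).
by rewrite -!sh_compA fh !sh_compm1.
Qed.

Lemma sh_inv_uniq X Y (f : SH X Y) g : sh_inverse f g -> sh_inv f = g.
Proof.
move=> [gf fg]; have i : sh_iso f by exists g.
by apply: (sh_mono i); rewrite sh_mulmV.
Qed.

Lemma sh_inv_id X : sh_inv (sh_id X) = sh_id X.
Proof. by apply: sh_inv_uniq; split; apply: sh_comp1m. Qed.

(** Induction on zigzags. For a formal inverse, the null map is first factored through the inverted
    map, which then cancels. *)
Lemma sh_nullL X Y Z (f : SH X Y) : sh_comp (sh_null Y Z) f = sh_null X Z.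
Proof.
rewrite -[f]zreprK; elim: (zrepr f) Z => {f X Y} [X Y f|X Y f w|X Y Z g IHg f IHf] W.
- rewrite -/(sh_map f) sh_map_comp; congr sh_map; exact: spmap_eq.
- have -> : sh_null X W = sh_comp (sh_null Y W) (sh_map f).
    by rewrite sh_map_comp; congr sh_map; apply: spmap_eq.
  rewrite -sh_compA /sh_map sh_compE.
  by rewrite (_ : zclass _ = sh_id Y) ?sh_compm1 //; apply/zclassP/ZInvr.
- by rewrite -sh_compE sh_compA IHg IHf.
Qed.

Lemma sh_nullR X Y Z (f : SH Y Z) : sh_comp f (sh_null X Y) = sh_null X Z.
Proof.
rewrite -[f]zreprK; elim: (zrepr f) X => {f Z Y} [Y Z f|Y Z f w|Y Z W g IHg f IHf] X.
- rewrite -/(sh_map f) sh_map_comp; congr sh_map; apply: spmap_eq => n U q x /=.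
  exact: pmap_bpt.
- have -> : sh_null X Z = sh_comp (sh_map f) (sh_null X Y).
    by rewrite sh_map_comp; congr sh_map; apply: spmap_eq => n U q x /=; rewrite pmap_bpt.
  rewrite sh_compA /sh_map sh_compE.
  by rewrite (_ : zclass _ = sh_id Y) ?sh_comp1m //; apply/zclassP/ZInvl.
- by rewrite -sh_compE -sh_compA IHf IHg.
Qed.

Section Additive.
Context (A : additive_structure k).

Lemma sh_addI X Y (f g h : SH X Y) : sh_add A f g = sh_add A f h -> g = h.
Proof.
move=> e; rewrite -[g](sh_add0 A) -[h](sh_add0 A) -(sh_addN A f).
by rewrite -!sh_addA e.
Qed.

Lemma sh_addr0 X Y (f : SH X Y) : sh_add A f (sh_zero A X Y) = f.
Proof. by rewrite sh_addC sh_add0. Qed.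

Lemma sh_zeroL X Y Z (f : SH X Y) : sh_comp (sh_zero A Y Z) f = sh_zero A X Z.
Proof.
by apply: (@sh_addI _ _ (sh_comp (sh_zero A Y Z) f)); rewrite -sh_addr sh_add0 sh_addr0.
Qed.

Lemma sh_zeroR X Y Z (f : SH Y Z) : sh_comp f (sh_zero A X Y) = sh_zero A X Z.
Proof.
by apply: (@sh_addI _ _ (sh_comp f (sh_zero A X Y))); rewrite -sh_addl sh_add0 sh_addr0.
Qed.

(** Both are absorbing: the null map after [sh_zero A X X] is null by one rule and zero by the
    other. *)
Lemma sh_null_zero X Y : sh_null X Y = sh_zero A X Y.
Proof. by rewrite -(sh_nullL Y (sh_zero A X X)) sh_zeroR. Qed.

End Additive.

Definition sg (X Y : pspace (Sm k)) (f : pmap X Y) : SH (susp (Tsph k) X) (susp (Tsph k) Y) :=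
  sh_map (susp_map (Tsph k) f).

Lemma susp_ind (C : icat) (T X : pspace C) n U q (P : susp_lev T X n U q -> Prop) :
  (forall t x, P (susp_cl t x)) -> forall z, P z.
Proof. by move=> h z; rewrite -(susp_clK z). Qed.

Lemma sg_id (X : pspace (Sm k)) : sg (pmap_id X) = sh_id _.
Proof.
congr sh_map; apply: spmap_eq => n U q; apply: susp_ind => t x.
by rewrite /= susp_map_cl.
Qed.

Lemma sg_comp (X Y Z : pspace (Sm k)) (g : pmap Y Z) (f : pmap X Y) :
  sg (pmap_comp g f) = sh_comp (sg g) (sg f).
Proof.
rewrite sh_map_comp; congr sh_map; apply: spmap_eq => n U q; apply: susp_ind => t x.
by rewrite /= !susp_map_cl.
Qed.

Lemma sg_const (X Y : pspace (Sm k)) : sg (pmap_const X Y) = sh_null _ _.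
Proof.
congr sh_map; apply: spmap_eq => n U q; apply: susp_ind => t x.
by rewrite /= !susp_map_cl susp_cl_bpt //; right.
Qed.

End StableCategory.

(** * Extension of partial maps into fibrant presheaves *)

Section Homotopic.
Context (C : icat).
Implicit Types X Y Z : spsh C.

Lemma homotopic_compl X Y Z (h : smap Y Z) (f g : smap X Y) :
  homotopic f g -> homotopic (smap_comp h f) (smap_comp h g).
Proof.
elim=> {f g} [f g [H [Hn H0 H1]]|f|f g _ IH|f g i _ IH1 _ IH2].
- apply: rst_step; exists (fun U n x t => h U n (H U n x t)); split=> *.
  + by rewrite Hn smapE.
  + by rewrite H0.
  + by rewrite H1.
- exact: rst_refl.
- exact: rst_sym.
- exact: rst_trans IH1 IH2.
Qed.

Lemma homotopic_compr X Y Z (h : smap X Y) (f g : smap Y Z) :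
  homotopic f g -> homotopic (smap_comp f h) (smap_comp g h).
Proof.
elim=> {f g} [f g [H [Hn H0 H1]]|f|f g _ IH|f g i _ IH1 _ IH2].
- apply: rst_step; exists (fun U n x t => H U n (h U n x) t); split=> *.
  + by rewrite smapE Hn.
  + by rewrite H0.
  + by rewrite H1.
- exact: rst_refl.
- exact: rst_sym.
- exact: rst_trans IH1 IH2.
Qed.

Lemma heq_bij X Y (f : smap X Y) (r : smap Y X) Z :
  homotopic (smap_comp r f) (smap_id X) -> homotopic (smap_comp f r) (smap_id Y) ->
  bij_classes f Z.
Proof.
move=> rf fr; split=> [g h gh|g].
  have e (i : smap Y Z) : homotopic (smap_comp (smap_comp i f) r) i.
    have -> : smap_comp (smap_comp i f) r = smap_comp i (smap_comp f r) by exact: smap_eq.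
    have {2}-> : i = smap_comp i (smap_id Y) by exact: smap_eq.
    exact: homotopic_compl.
  apply: rst_trans (e h); apply: rst_trans (rst_sym _ _ _ _ (e g)) _.
  exact: homotopic_compr.
exists (smap_comp g r).
have -> : smap_comp (smap_comp g r) f = smap_comp g (smap_comp r f) by exact: smap_eq.
have {2}-> : g = smap_comp g (smap_id X) by exact: smap_eq.
exact: homotopic_compl.
Qed.

End Homotopic.

Section Extension.
Context (C : icat).
Implicit Types X Y Z Q : spsh C.

Definition spred X : Type := forall (U : C) (n : nat), X U n -> Prop.

Definition stable X (P : spred X) : Prop :=
  forall (U V : C) (m n : nat) (f : ihom V U) (s : mono n m) (x : X U m),
    P U m x -> P V n (sres f s x).

(** Partial maps are total functions which are natural where they matter. *)
Definition natural_on X Z (P : spred X) (phi : forall U n, X U n -> Z U n) : Prop :=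
  forall (U V : C) (m n : nat) (f : ihom V U) (s : mono n m) (x : X U m),
    P U m x -> phi V n (sres f s x) = sres f s (phi U m x).

Definition extends Z Q (P : spred Q) : Prop :=
  forall phi, natural_on (Z := Z) P phi ->
  exists h : smap Q Z, forall U n q, P U n q -> h U n q = phi U n q.

Section Sub.
Context (X : spsh C) (P : spred X) (st : stable P).

Definition subp_res (U V : C) (m n : nat) (f : ihom V U) (s : mono n m)
    (x : {x : X U m | P x}) : {x : X V n | P x} :=
  exist (P (n:=n)) (sres f s (sval x)) (st f s (svalP x)).

Lemma subp_res_id (U : C) n (x : {x : X U n | P x}) :
  subp_res (iid U) (mono_id n) x = x.
Proof. by case: x => x p; apply: eq_exist; apply: sres_id. Qed.

Lemma subp_res_comp (U V W : C) (m n p : nat) (f : ihom V U) (g : ihom W V)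
    (s : mono n m) (t : mono p n) (x : {x : X U m | P x}) :
  subp_res (icomp f g) (mono_comp s t) x = subp_res g t (subp_res f s x).
Proof. by apply: eq_exist; apply: sres_comp. Qed.

Definition subp : spsh C := @SPsh C (fun U n => {x : X U n | P x}) subp_res
  subp_res_id subp_res_comp.

Lemma subp_eq (U : C) n (x y : subp U n) : sval x = sval y -> x = y.
Proof. by case: x y => [x p] [y q] /= e; apply: eq_exist. Qed.

Definition subp_incl : smap subp X :=
  @SMap C subp X (fun U n x => sval x) (fun U V m n f s x => erefl).

Definition subp_map Z (phi : forall U n, X U n -> Z U n) (nat : natural_on P phi) :
    smap subp Z :=
  @SMap C subp Z (fun U n x => phi U n (sval x))
    (fun U V m n f s x => nat U V m n f s (sval x) (svalP x)).

End Sub.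

Definition simp_sp (n : nat) : spsh C :=
  @SPsh C (fun _ m => mono m n) (fun U V m p f s t => mono_comp t s)
    (fun U m t => mono_compm1 t) (fun U V W m p q f g s u t => mono_compA t s u).

(** The contraction of [Delta^n] to its vertex 0: where [s] is 0 the simplex [t] is moved to 0,
    where [s] is 1 it stays. *)
Definition push n m (t : mono m n) (s : mono m 1) (i : 'I_m.+1) : 'I_n.+1 :=
  if s i == ord0 then ord0 else t i.

Lemma push_mono n m (t : mono m n) (s : mono m 1) :
  {homo push t s : i j / (i <= j)%N}.
Proof.
move=> i j ij; rewrite /push; case: eqP => [_|si]; first by [].
case: eqP => [sj|_]; last exact: monoP.
case: si; apply/val_inj/eqP; rewrite /= -leqn0.
by have := monoP s ij; rewrite sj.
Qed.

Definition mpush n m (t : mono m n) (s : mono m 1) : mono m n := Mono (@push_mono n m t s).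

Lemma mpush0 n m (t : mono m n) : mpush t (mono_const m ord0) = mono_const m ord0.
Proof. exact: mono_eq. Qed.

Lemma mpush1 n m (t : mono m n) : mpush t (mono_const m ord_max) = t.
Proof. exact: mono_eq. Qed.

Lemma mpush_comp n m p (t : mono m n) (s : mono m 1) (u : mono p m) :
  mpush (mono_comp t u) (mono_comp s u) = mono_comp (mpush t s) u.
Proof. exact: mono_eq. Qed.

Lemma homotopic_sections X Y (f g : smap X Y) (U : C) :
  homotopy f g -> homotopic (smap_sections f U) (smap_sections g U).
Proof.
move=> [H [Hn H0 H1]]; apply: rst_step.
exists (fun _ n x t => H U n x t); split=> [u v m n h s x t|u n x|u n x] /=.
- exact: (Hn U U m n (iid U) s x t).
- exact: H0.
- exact: H1.
Qed.

(** [P] being star-shaped towards the vertex [0], its inclusion is a homotopy equivalence. *)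
Lemma star_extends Z X n (P : spred (sprod X (simp_sp n))) :
  injective_fibrant Z -> stable P ->
  (forall U m x, P U m (x, mono_const m ord0)) ->
  (forall U m x t s, P U m (x, t) -> P U m (x, mpush t s)) ->
  extends Z P.
Proof.
move=> Zf st P0 Pp phi nat.
pose incl := subp_incl st.
have we : sectionwise_we incl.
  move=> U Z' _.
  pose rf U m (x : sprod X (simp_sp n) U m) : subp st U m :=
    exist (P U m) (x.1, mono_const m ord0) (P0 U m x.1).
  have rn V W m p (f : ihom W V) (s : mono p m) x : rf W p (sres f s x) = sres f s (rf V m x).
    apply: subp_eq; rewrite /= /sprod_res /=; congr pair; exact: mono_eq.
  pose r : smap (sprod X (simp_sp n)) (subp st) := SMap rn.
  apply: (heq_bij (r := smap_sections r U)).
    have -> : smap_comp (smap_sections r U) (smap_sections incl U)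
            = smap_sections (smap_comp r incl) U by exact: smap_eq.
    have -> : smap_id (sections (subp st) U) = smap_sections (smap_id _) U by exact: smap_eq.
    apply: homotopic_sections.
    exists (fun U m (x : subp st U m) t => exist (P U m) ((sval x).1, mpush (sval x).2 t)
      (Pp U m (sval x).1 (sval x).2 t (eq_rect _ (P U m) (svalP x) _ (surjective_pairing _)))).
    split=> [U' V m p h s x t|U' m x|U' m x]; apply: subp_eq => /=.
    - by rewrite /sprod_res /= mpush_comp.
    - by rewrite mpush0.
    - by rewrite mpush1 -surjective_pairing.
  have -> : smap_comp (smap_sections incl U) (smap_sections r U)
          = smap_sections (smap_comp incl r) U by exact: smap_eq.
  have -> : smap_id (sections (sprod X (simp_sp n)) U) = smap_sections (smap_id _) U
    by exact: smap_eq.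
  apply: homotopic_sections.
  exists (fun U m (x : sprod X (simp_sp n) U m) t => (x.1, mpush x.2 t)).
  split=> [U' V m p h s x t|U' m x|U' m x] /=.
  - by rewrite /sprod_res /= mpush_comp.
  - by rewrite mpush0.
  - by rewrite mpush1 -surjective_pairing.
have mon : monic incl by move=> U m x y; apply: subp_eq.
have [h he] := Zf _ _ incl mon we (subp_map st nat).
exists h => U m q Pq.
by have := congr1 (fun g : smap (subp st) Z => g U m (exist _ q Pq)) he.
Qed.

Notation v0 n := (mono_const n (ord0 : 'I_2)).
Notation v1 n := (mono_const n (ord_max : 'I_2)).
Notation cyl X := (sprod X (simp_sp 1)).

Lemma v0_comp m n (s : mono n m) : mono_comp (v0 m) s = v0 n.
Proof. exact: mono_eq. Qed.

Lemma v1_comp m n (s : mono n m) : mono_comp (v1 m) s = v1 n.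
Proof. exact: mono_eq. Qed.

Lemma v0_neq_v1 n : v0 n <> v1 n.
Proof. by move/(congr1 (fun t : mono n 1 => val (t ord0))). Qed.

(** Homotopy extension: the union of [X * 0] and [P * Delta^1] is star-shaped towards the vertex
    0. *)
Lemma hep Z X (P : spred X) (h : smap X Z)
    (phi : forall U n, cyl X U n -> Z U n) :
  injective_fibrant Z -> stable P ->
  natural_on (fun U n (y : cyl X U n) => P U n y.1) phi ->
  (forall U n x, P U n x -> phi U n (x, v0 n) = h U n x) ->
  exists K : smap (cyl X) Z, (forall U n x, K U n (x, v0 n) = h U n x) /\
    (forall U n x t, P U n x -> K U n (x, t) = phi U n (x, t)).
Proof.
move=> Zf st nat e0.
pose Q : spred (cyl X) := fun U n y => y.2 = v0 n \/ P U n y.1.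
pose psi U n (y : cyl X U n) : Z U n := if pselect (P U n y.1) then phi U n y else h U n y.1.
have [||||K HK] := @star_extends Z X 1 Q Zf _ _ _ psi.
- by move=> U V m n f s y [e|p]; [left; rewrite /= e v0_comp|right; apply: st].
- by move=> U m x; left.
- move=> U m x t s [/= ->|p]; last by right.
  by left=> /=; apply: mono_eq => i /=; rewrite /push; case: ifP.
- move=> U V m n f s [x t] /=; rewrite /psi /=.
  case: (pselect (P U m x)) => [p|np] Qx /=.
    by case: pselect => [p'|np'] /=; [exact: nat|case: np'; exact: st].
  case: Qx => [/= ->|p]; last by case: (np p).
  case: pselect => [p|np'] /=; last exact: smapE.
  by rewrite -smapE -(e0 _ _ _ p) /sprod_res /= v0_comp.
exists K; split=> [U n x|U n x t p].
  rewrite HK; last by left.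
  by rewrite /psi /=; case: pselect => // p; apply: e0.
rewrite HK; last by right.
by rewrite /psi; case: pselect.
Qed.

(** The degeneracy of [Delta^2] which identifies the vertices 1 and 2; [mj2] is the edge between
    these two. *)
Definition d2 : 'I_3 -> 'I_2 := fun i => if i == ord0 then ord0 else ord_max.
Lemma d2_mono : {homo d2 : i j / (i <= j)%N}.
Proof.
move=> i j; rewrite /d2; case: eqP => // ni; case: eqP => // ->.
by rewrite leqn0 => /eqP e; case: ni; apply/val_inj.
Qed.
Definition md2 : mono 2 1 := Mono d2_mono.

Lemma j2_mono : {homo (lift ord0 : 'I_2 -> 'I_3) : i j / (i <= j)%N}.
Proof. by move=> i j ij; rewrite /= /bump /= !add1n ltnS. Qed.
Definition mj2 : mono 1 2 := Mono j2_mono.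

(** The homotopies are put on the edges 01 and 02 of [Delta^2], and over [P] the whole triangle is
    filled through [md2]. This horn is star-shaped towards 0; the edge 12 of an extension is the
    homotopy wanted. *)
Lemma fill Z X (P : spred X) (k1 k2 : smap (cyl X) Z) :
  injective_fibrant Z -> stable P ->
  (forall U n x, k1 U n (x, v0 n) = k2 U n (x, v0 n)) ->
  (forall U n x t, P U n x -> k1 U n (x, t) = k2 U n (x, t)) ->
  exists H : smap (cyl X) Z,
    [/\ forall U n x, H U n (x, v0 n) = k1 U n (x, v1 n),
        forall U n x, H U n (x, v1 n) = k2 U n (x, v1 n)
      & forall U n x t, P U n x -> H U n (x, t) = k1 U n (x, v1 n)].
Proof.
move=> Zf st e0 eP.
pose no2 m (t : mono m 2) := forall i, t i <> ord_max.
pose no1 m (t : mono m 2) := forall i, t i <> lift ord0 ord0.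
pose Q : spred (sprod X (simp_sp 2)) := fun U m y => [\/ P U m y.1, no2 m y.2 | no1 m y.2].
pose psi U m (y : sprod X (simp_sp 2) U m) : Z U m :=
  if pselect (no2 m y.2) then k1 U m (y.1, mono_comp md2 y.2)
  else k2 U m (y.1, mono_comp md2 y.2).
have [||||K HK] := @star_extends Z X 2 Q Zf _ _ _ psi.
- move=> U V m n f s y [p|p|p]; [apply: Or31; exact: st|apply: Or32|apply: Or33];
  by move=> i; apply: p.
- by move=> U m x; apply: Or32.
- move=> U m x t s [p|p|p]; [exact: Or31|apply: Or32|apply: Or33];
    by move=> i /=; rewrite /push; case: ifP => // _; apply: p.
- move=> U V m n f s [x t]; rewrite /psi /=.
  case: (pselect (no2 m t)) => [n2|n2] /= Qx.
    case: pselect => [n2'|[]] /=; last by move=> i; apply: n2.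
    by rewrite -smapE /= /sprod_res /= mono_compA.
  case: pselect => [n2'|n2'] /=; last by rewrite -smapE /= /sprod_res /= mono_compA.
  rewrite -smapE /= /sprod_res /= mono_compA; case: Qx => //= [p|n1].
    by apply: eP; apply: st.
  suff -> : mono_comp (mono_comp md2 t) s = v0 n by apply: e0.
  apply: mono_eq => i /=; rewrite /d2; case: eqP => // nt.
  have := n1 (s i); have := n2' i; rewrite /=.
  by case: (t (s i)) nt => [[|[|[|]]] ?] // nt a b;
    [case: nt|case: b|case: a]; apply: val_inj.
exists (@SMap C (cyl X) Z (fun U m y => K U m (y.1, mono_comp mj2 y.2))
  (fun U V m n f s y => etrans (congr1 (fun t => K V n (sres f s y.1, t)) (mono_compA _ _ _))
     (smapE K f s (y.1, mono_comp mj2 y.2)))).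
have d2j m (t : mono m 1) : mono_comp md2 (mono_comp mj2 t) = v1 m by exact: mono_eq.
split=> U m x /=.
- have n2 : no2 m (mono_comp mj2 (v0 m)) by move=> i /(congr1 val).
  rewrite HK; last exact: Or32.
  by rewrite /psi /=; case: pselect => //= _; rewrite d2j.
- have n1 : no1 m (mono_comp mj2 (v1 m)) by move=> i /(congr1 val).
  rewrite HK; last exact: Or33.
  rewrite /psi /=; case: pselect => [/(_ ord0)[]|n2] /=; first exact: val_inj.
  by rewrite d2j.
move=> t p; rewrite HK; last exact: Or31.
by rewrite /psi /=; case: pselect => //= _; rewrite d2j ?eP.
Qed.

(** A single homotopy relative to [P]. For an injective fibrant target and a stable [P] this is
    already an equivalence relation, whereas [homotopic] is a generated one. *)
Definition hrel Z X (P : spred X) (f g : smap X Z) : Prop :=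
  exists H : smap (cyl X) Z,
    [/\ forall U n x, H U n (x, v0 n) = f U n x,
        forall U n x, H U n (x, v1 n) = g U n x
      & forall U n x t, P U n x -> H U n (x, t) = f U n x].

Section HomotopyRel.
Context (Z : spsh C) (Zf : injective_fibrant Z) (X : spsh C) (P : spred X) (st : stable P).

Lemma hrel_refl (f : smap X Z) : hrel P f f.
Proof.
by exists (smap_comp f (@sfst C X (simp_sp 1))); split.
Qed.

Lemma hrel_fill (f g h : smap X Z) : hrel P h f -> hrel P h g -> hrel P f g.
Proof.
move=> [H [H0 H1 HP]] [K [K0 K1 KP]].
have [||L [L0 L1 LP]] := @fill Z X P H K Zf st.
- by move=> U n x; rewrite H0 K0.
- by move=> U n x t p; rewrite HP ?KP.
exists L; split=> [U n x|U n x|U n x t p]; first by rewrite L0 H1.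
  by rewrite L1 K1.
by rewrite LP // H1.
Qed.

Lemma hrel_sym (f g : smap X Z) : hrel P f g -> hrel P g f.
Proof. by move=> fg; apply: hrel_fill fg (hrel_refl f). Qed.

Lemma hrel_trans (f g h : smap X Z) : hrel P f g -> hrel P g h -> hrel P f h.
Proof. by move=> /hrel_sym fg gh; apply: hrel_fill fg gh. Qed.

End HomotopyRel.

Definition no_pred X : spred X := fun _ _ _ => False.

Lemma no_pred_stable X : stable (@no_pred X).
Proof. by []. Qed.

Lemma homotopic_hrel Z X (f g : smap X Z) :
  injective_fibrant Z -> homotopic f g -> hrel (@no_pred X) f g.
Proof.
move=> Zf; have st := @no_pred_stable X.
elim=> {f g} [f g [H [Hn H0 H1]]|f|f g _ IH|f g h _ IH1 _ IH2].
- exists (@SMap C (cyl X) Z (fun U n y => H U n y.1 y.2)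
    (fun U V m n f s y => Hn U V m n f s y.1 y.2)).
  by split=> [U n x|U n x|U n x t] //=.
- exact: hrel_refl.
- exact: hrel_sym.
- exact: hrel_trans IH1 IH2.
Qed.

Lemma hrel_compr Z X Y (P : spred X) (P' : spred Y) (f g : smap X Z) (h : smap Y X) :
  (forall U n y, P' U n y -> P U n (h U n y)) ->
  hrel P f g -> hrel P' (smap_comp f h) (smap_comp g h).
Proof.
move=> hP [H [H0 H1 HP]].
exists (@SMap C (cyl Y) Z (fun U n y => H U n (h U n y.1, y.2))
  (fun U V m n f s y => etrans (congr1 (fun z => H V n (z, _)) (smapE h f s y.1))
     (smapE H f s (h U m y.1, y.2)))).
by split=> [U n x|U n x|U n x t p] /=; [exact: H0|exact: H1|apply: HP; apply: hP].
Qed.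

End Extension.
Notation v0 n := (mono_const n (ord0 : 'I_2)).
Notation v1 n := (mono_const n (ord_max : 'I_2)).
Notation cyl X := (sprod X (simp_sp _ 1)).

(** * Intervals *)

Section FunctionRing.
Context (k : comPzRingType) (U : kfunctor k).
Notation O := (knat U (A1 k)).

Definition ofun0 : O := @KNat k U (A1 k) (fun A _ => 0) (fun A B f x => esym (rmorph0 f)).
Definition ofun1 : O := @KNat k U (A1 k) (fun A _ => 1) (fun A B f x => esym (rmorph1 f)).

Lemma ofun_add_subproof (x y : O) (A B : kalg k) (f : khom A B) (p : U A) :
  x B (kmap f p) + y B (kmap f p) = f (x A p + y A p).
Proof. by rewrite !knatE /= rmorphD. Qed.
Definition ofun_add (x y : O) : O :=
  @KNat k U (A1 k) (fun A p => x A p + y A p) (ofun_add_subproof x y).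

Lemma ofun_mul_subproof (x y : O) (A B : kalg k) (f : khom A B) (p : U A) :
  x B (kmap f p) * y B (kmap f p) = f (x A p * y A p).
Proof. by rewrite !knatE /= rmorphM. Qed.
Definition ofun_mul (x y : O) : O :=
  @KNat k U (A1 k) (fun A p => x A p * y A p) (ofun_mul_subproof x y).

Lemma ofun_opp_subproof (x : O) (A B : kalg k) (f : khom A B) (p : U A) :
  - x B (kmap f p) = f (- x A p).
Proof. by rewrite knatE /= rmorphN. Qed.
Definition ofun_opp (x : O) : O :=
  @KNat k U (A1 k) (fun A p => - x A p) (ofun_opp_subproof x).

End FunctionRing.

(** [knat U (A1 k)] is too large for a [comPzRingType]: its ring operations are plain
    functions, and identities between them are proved pointwise. *)
Declare Scope fn_scope.
Delimit Scope fn_scope with fn.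
Notation "0" := (ofun0 _) : fn_scope.
Notation "1" := (ofun1 _) : fn_scope.
Notation "x + y" := (ofun_add x y) : fn_scope.
Notation "- x" := (ofun_opp x) : fn_scope.
Notation "x - y" := (ofun_add x (ofun_opp y)) : fn_scope.
Notation "x * y" := (ofun_mul x y) : fn_scope.
Notation fn U := (knat (sm_functor U) (A1 _)).
Ltac fn_ring := by move=> *; apply: knat_eq => ? ? /=; ring.

Section Intervals.
Context (k : comPzRingType).

(** A common interface for [Delta^1], [A^1] and products of intervals. Only the values of [ijoin]
    and [imeet] at the ends are prescribed, since on [A^1] they are [s + t - s t] and [s t], which
    do not form a lattice. The field [iext] is homotopy extension. *)
Record interval := Interval {
  isp :> spsh (Sm k);
  i0 : forall U n, isp U n;
  i1 : forall U n, isp U n;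
  ijoin : forall U n, isp U n -> isp U n -> isp U n;
  imeet : forall U n, isp U n -> isp U n -> isp U n;
  i0_res : forall (U V : Sm k) m n (f : ihom V U) (s : mono n m), sres f s (i0 U m) = i0 V n;
  i1_res : forall (U V : Sm k) m n (f : ihom V U) (s : mono n m), sres f s (i1 U m) = i1 V n;
  ijoin_res : forall (U V : Sm k) m n (f : ihom V U) (s : mono n m) x y,
    ijoin (sres f s x) (sres f s y) = sres f s (ijoin x y);
  imeet_res : forall (U V : Sm k) m n (f : ihom V U) (s : mono n m) x y,
    imeet (sres f s x) (sres f s y) = sres f s (imeet x y);
  ijoinx0 : forall U n (x : isp U n), ijoin x (i0 U n) = x;
  ijoinx1 : forall U n (x : isp U n), ijoin x (i1 U n) = i1 U n;
  ijoin0x : forall U n (x : isp U n), ijoin (i0 U n) x = x;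
  ijoin1x : forall U n (x : isp U n), ijoin (i1 U n) x = i1 U n;
  imeetx0 : forall U n (x : isp U n), imeet x (i0 U n) = i0 U n;
  imeetx1 : forall U n (x : isp U n), imeet x (i1 U n) = x;
  imeet0x : forall U n (x : isp U n), imeet (i0 U n) x = i0 U n;
  imeet1x : forall U n (x : isp U n), imeet (i1 U n) x = x;
  iext : forall Z, motivic_fibrant Z -> forall (X : spsh (Sm k)) (P : spred X), stable P ->
    extends Z (Q := sprod X isp) (fun U n y => y.2 = i0 U n \/ P U n y.1) }.

(** Extend over [X * Delta^1 * I], prescribing [H] at the vertex 1 and the constant [f] at the
    vertex 0, over [P] and along [i0]. The restriction to [i1] is a simplicial homotopy. *)
Lemma interval_hrel (I : interval) Z X (P : spred X) (H : smap (sprod X I) Z)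
    (f g : smap X Z) :
  motivic_fibrant Z -> stable P ->
  (forall U n x, H U n (x, i0 I U n) = f U n x) ->
  (forall U n x, H U n (x, i1 I U n) = g U n x) ->
  (forall U n x t, P U n x -> H U n (x, t) = f U n x) -> hrel P f g.
Proof.
move=> Zm st H0 H1 HP.
pose Q : spred (cyl X) := fun U n y => [\/ P U n y.1, y.2 = v0 n | y.2 = v1 n].
have Qst : stable Q.
  move=> U V m n h s [x t] [p|/= ->|/= ->]; [apply: Or31; exact: st|apply: Or32|apply: Or33];
  exact: mono_eq.
pose phi U n (z : sprod (cyl X) I U n) : Z U n :=
  if pselect (z.1.2 = v1 n) then H U n (z.1.1, z.2) else f U n z.1.1.
have [|K HK] := iext Zm Qst (phi := phi).
  move=> U V m n h s [[x t] a]; rewrite /phi /=.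
  case: (pselect (t = v1 m)) => [e|nt] /= Qx.
    by case: pselect => [e'|[]] /=; [exact: (smapE H h s (x, a))|rewrite e; exact: mono_eq].
  case: pselect => [e|ne] /=; last exact: smapE.
  case: Qx => [->|[p|e'|//]].
  - by rewrite i0_res H0 smapE.
  - by rewrite HP ?smapE //; apply: st.
  - by move: e; rewrite /= in e' *; rewrite e' v0_comp => /v0_neq_v1.
exists (@SMap (Sm k) (cyl X) Z (fun U n y => K U n (y, i1 I U n))
  (fun U V m n h s y => etrans (congr1 (fun a => K V n (_, a)) (esym (i1_res I h s)))
     (smapE K h s (y, i1 I U m)))).
split=> [U n x|U n x|U n x t p] /=.
- rewrite HK; last by right; apply: Or32.
  by rewrite /phi /=; case: pselect => [e|ne] //=; case: (v0_neq_v1 e).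
- rewrite HK; last by right; apply: Or33.
  by rewrite /phi /=; case: pselect => [e|[]] //=; apply: H1.
- rewrite HK; last by right; apply: Or31.
  by rewrite /phi /=; case: pselect => //= _; apply: HP.
Qed.

Definition mmax n (s t : mono n 1) (i : 'I_n.+1) : 'I_2 := if s i == ord0 then t i else ord_max.
Lemma mmax_mono n (s t : mono n 1) : {homo mmax s t : i j / (i <= j)%N}.
Proof.
move=> i j ij; rewrite /mmax; have := monoP s ij; have := monoP t ij.
by case: (s i) (s j) (t i) (t j) => [[|[|?]] ?] // [[|[|?]] ?] // [[|[|?]] ?] // [[|[|?]] ?].
Qed.
Definition smax n (s t : mono n 1) : mono n 1 := Mono (@mmax_mono n s t).
Definition smin n (s t : mono n 1) : mono n 1 := mpush t s.

Lemma ord2_cases (i : 'I_2) : i = ord0 \/ i = ord_max.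
Proof. by case: i => [[|[|?]] ?] //; [left|right]; apply: val_inj. Qed.

Lemma d1_extends Z : motivic_fibrant Z -> forall (X : spsh (Sm k)) (P : spred X), stable P ->
  extends Z (Q := cyl X) (fun U n y => y.2 = v0 n \/ P U n y.1).
Proof.
move=> [Zf _ _] X P st phi nat.
have n0 U V m n (f : ihom V U) (s : mono n m) (x : X U m) :
    phi V n (sres f s x, v0 n) = sres f s (phi U m (x, v0 m)).
  rewrite -nat; last by left.
  by rewrite /= /sprod_res /= v0_comp.
have [||K [K0 KP]] := @hep _ Z X P (SMap n0) phi Zf st.
- by move=> U V m n f s y p; apply: nat; right.
- by [].
by exists K => U n [x t] [/= ->|p]; [exact: K0|exact: KP].
Qed.

Definition d1_interval : interval.
Proof.
refine (@Interval (simp_sp (Sm k) 1) (fun _ n => v0 n) (fun _ n => v1 n)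
  (fun _ n s t => smax s t) (fun _ n s t => smin s t) _ _ _ _ _ _ _ _ _ _ _ _ d1_extends).
- by move=> *; apply: mono_eq.
- by move=> *; apply: mono_eq.
- by move=> *; apply: mono_eq.
- by move=> *; apply: mono_eq.
- move=> U n x; apply: mono_eq => i /=; rewrite /mmax /=.
  by case: (ord2_cases (x i)) => ->.
- move=> U n x; apply: mono_eq => i /=; rewrite /mmax /=.
  by case: (ord2_cases (x i)) => ->.
- by move=> *; apply: mono_eq.
- by move=> *; apply: mono_eq.
- move=> U n x; apply: mono_eq => i /=; rewrite /push /=.
  by case: (ord2_cases (x i)) => ->.
- move=> U n x; apply: mono_eq => i /=; rewrite /push /=.
  by case: (ord2_cases (x i)) => ->.
- by move=> *; apply: mono_eq.
- by move=> *; apply: mono_eq.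
Defined.

Notation A1p := (points (A1 k)).

Definition cst0 (U : Sm k) : fn U := ofun0 U.

Lemma cst0_res (U V : Sm k) m n (f : ihom V U) (s : mono n m) :
  @sres (Sm k) A1p U V m n f s (cst0 U) = cst0 V.
Proof. exact: knat_eq. Qed.

(** A homotopy [u0 p -> u] is made constant on [X * 0] by filling a horn whose other
    side is its own restriction to [X * 0]; no further correction is needed. *)
Lemma a1_contract Z (X : spsh (Sm k)) (u : smap (sprod X A1p) Z) :
  motivic_fibrant Z ->
  exists H : smap (cyl (sprod X A1p)) Z,
  [/\ forall U n x a, H U n ((x, a), v0 n) = u U n (x, cst0 U),
      forall U n x a, H U n ((x, a), v1 n) = u U n (x, a)
    & forall U n x t, H U n ((x, cst0 U), t) = u U n (x, cst0 U)].
Proof.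
move=> [Zf _ Za]; have [_ /(_ u) [h hu]] := Za X.
pose z : smap (sprod X A1p) (sprod X A1p) := @SMap (Sm k) (sprod X A1p) (sprod X A1p)
  (fun U n y => (y.1, cst0 U))
  (fun U V m n f s y => f_equal (pair (sres f s y.1)) (esym (cst0_res f s))).
have st := @no_pred_stable (Sm k) (sprod X A1p).
have : hrel (@no_pred (Sm k) (sprod X A1p)) (smap_comp u z) u.
  apply: (hrel_trans Zf st _ (homotopic_hrel Zf hu)).
  apply: (hrel_sym Zf st); apply: (homotopic_hrel Zf).
  have -> : smap_comp h (sfst X A1p) = smap_comp (smap_comp h (sfst X A1p)) z by exact: smap_eq.
  exact: homotopic_compr.
move=> [K [K0 K1 _]].
pose K' : smap (cyl (sprod X A1p)) Z := @SMap (Sm k) (cyl (sprod X A1p)) Z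
  (fun U n y => K U n (z U n y.1, y.2))
  (fun U V m n f s y => etrans (f_equal (fun w => K V n (w, _)) (smapE z f s y.1))
    (smapE K f s (z U m y.1, y.2))).
have [|||H [H0 H1 HP]] := @fill _ Z _ (fun U n (y : sprod X A1p U n) => y.2 = cst0 U) K' K Zf.
- by move=> U V m n f s [x a] /= ->; exact: (@cst0_res U V m n f s).
- by move=> U n y; rewrite /= !K0.
- by move=> U n [x a] t /= ->.
exists H; split=> [U n x a|U n x a|U n x t].
- by rewrite H0 /= K1.
- by rewrite H1 K1.
- by rewrite HP //= K1.
Qed.

(** Start from the map with values [phi (x, 0)], constant along [A^1]. The homotopy of [a1_contract]
    deforms it to [phi] over [P * A^1] and does not move over [X * 0]; it is extended by [hep], and
    its end extends [phi]. *)
Lemma a1_extends Z : motivic_fibrant Z -> forall (X : spsh (Sm k)) (P : spred X), stable P ->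
  extends Z (Q := sprod X A1p) (fun U n y => y.2 = cst0 U \/ P U n y.1).
Proof.
move=> Zm X P st phi nat; have Zf : injective_fibrant Z by case: Zm.
have xn U V m n (f : ihom V U) (s : mono n m) (y : sprod X A1p U m) :
    phi V n ((sres f s y).1, cst0 V) = sres f s (phi U m (y.1, cst0 U)).
  rewrite -nat; last by left.
  by rewrite /= /sprod_res /= -(cst0_res f s).
have un U V m n (f : ihom V U) (s : mono n m) (y : sprod (subp st) A1p U m) :
    phi V n (sval (sres f s y).1, (sres f s y).2) = sres f s (phi U m (sval y.1, y.2)).
  by rewrite -nat //; right; apply: (svalP y.1).
have [H [H0 H1 HP]] := @a1_contract Z (subp st) (SMap un) Zm.
pose Q : spred (sprod X A1p) := fun U n y => y.2 = cst0 U \/ P U n y.1.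
pose psi U n (y : cyl (sprod X A1p) U n) : Z U n :=
  match pselect (P U n y.1.1) with
  | left p => H U n ((exist _ y.1.1 p, y.1.2), y.2)
  | right _ => phi U n (y.1.1, cst0 U)
  end.
have [|||K [K0 KP]] := @hep _ Z _ Q (SMap xn) psi Zf.
- move=> U V m n f s [x a] [/= ->|p]; [left; exact: (@cst0_res U V m n f s)|right; apply: (st U V m n f s x p)].
- move=> U V m n f s [[x a] t] /=; rewrite /psi /=.
  case: (pselect (P U m x)) => [p|np] Qx.
    case: pselect => [p'|[]]; last exact: (st U V m n f s x p).
    rewrite -(smapE H) /=; congr (H V n ((_, _), _)); exact: subp_eq.
  case: Qx => [/= ->|//].
  case: pselect => [p|np']; last exact: (xn U V m n f s (x, a)).
  have -> : knat_comp (cst0 U) f = cst0 V by exact: knat_eq.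
  by rewrite HP /=; apply: (xn U V m n f s (x, a)).
- move=> U n [x a] Qx; rewrite /psi /=; case: pselect => [p|np] //.
exists (@SMap (Sm k) (sprod X A1p) Z (fun U n y => K U n (y, v1 n))
  (fun U V m n f s y => etrans (f_equal (fun t => K V n (_, t)) (esym (v1_comp s)))
    (smapE K f s (y, v1 m)))).
move=> U n [x a] Qx; rewrite /= KP // /psi /=; case: pselect => [p|np]; first by rewrite H1.
by case: Qx => [/= ->|//].
Qed.

Definition a1_interval : interval.
Proof.
refine (@Interval A1p (fun U n => cst0 U) (fun U n => ofun1 U)
  (fun U n s t => (s + t - s * t)%fn) (fun U n s t => (s * t)%fn)
  _ _ _ _ _ _ _ _ _ _ _ _ a1_extends);
  by [move=> *; apply: knat_eq | fn_ring].
Defined.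

(** Two extensions in a row: along [I] with the second coordinate at [i0], then along [J]. *)
Lemma prod_extends (I J : interval) Z :
  motivic_fibrant Z -> forall (X : spsh (Sm k)) (P : spred X), stable P ->
  extends Z (Q := sprod X (sprod I J)) (fun U n y => y.2 = (i0 I U n, i0 J U n) \/ P U n y.1).
Proof.
move=> Zm X P st phi nat.
pose phi1 U n (y : sprod X I U n) : Z U n := phi U n (y.1, (y.2, i0 J U n)).
have [|h hE] := iext (i := I) Zm st (phi := phi1).
  move=> U V m n f s [x a] Qx; rewrite /phi1 /= -nat /=; last first.
    by case: Qx => /= [->|p]; [left|right].
  by rewrite /sprod_res /= /sprod_res /= i0_res.
pose P' : spred (sprod X I) := fun U n y => P U n y.1.
have st' : stable P' by move=> U V m n f s y; apply: st.
pose phi2 U n (y : sprod (sprod X I) J U n) : Z U n :=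
  if pselect (P U n y.1.1) then phi U n (y.1.1, (y.1.2, y.2)) else h U n y.1.
have [|K KE] := iext (i := J) Zm st' (phi := phi2).
  move=> U V m n f s [[x a] b]; rewrite /phi2 /=.
  case: (pselect (P U m x)) => [p|np] Qx /=.
    case: pselect => [p'|[]] /=; last exact: st.
    by rewrite -nat //; right.
  case: Qx => [/= ->|//].
  case: pselect => [p|_] /=; last exact: (smapE h).
  rewrite -(smapE h) hE /phi1 /=; last by right.
  by rewrite /sprod_res /= i0_res.
exists (@SMap (Sm k) (sprod X (sprod I J)) Z (fun U n y => K U n ((y.1, y.2.1), y.2.2))
  (fun U V m n f s y => smapE K f s ((y.1, y.2.1), y.2.2))).
move=> U n [x [a b]] Qx /=.
have Qx' : b = i0 J U n \/ P U n x by case: Qx => [[_ ->]|]; [left|right].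
rewrite KE // /phi2 /=; case: pselect => //= np.
case: Qx => //= [[-> ->]]; rewrite hE //; by left.
Qed.

Definition prod_interval (I J : interval) : interval.
Proof.
refine (@Interval (sprod I J) (fun U n => (i0 I U n, i0 J U n)) (fun U n => (i1 I U n, i1 J U n))
  (fun U n s t => (ijoin s.1 t.1, ijoin s.2 t.2)) (fun U n s t => (imeet s.1 t.1, imeet s.2 t.2))
  _ _ _ _ _ _ _ _ _ _ _ _ (@prod_extends I J)).
- by move=> *; rewrite /= /sprod_res /= !i0_res.
- by move=> *; rewrite /= /sprod_res /= !i1_res.
- by move=> *; rewrite /= /sprod_res /= !ijoin_res.
- by move=> *; rewrite /= /sprod_res /= !imeet_res.
- by move=> U n [x y]; rewrite /= !ijoinx0.
- by move=> U n [x y]; rewrite /= !ijoinx1.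
- by move=> U n [x y]; rewrite /= !ijoin0x.
- by move=> U n [x y]; rewrite /= !ijoin1x.
- by move=> U n [x y]; rewrite /= !imeetx0.
- by move=> U n [x y]; rewrite /= !imeetx1.
- by move=> U n [x y]; rewrite /= !imeet0x.
- by move=> U n [x y]; rewrite /= !imeet1x.
Defined.

(** A locally surjective inclusion of presheaves is a local acyclic fibration. *)
Definition locally_in (Q : spsh (Sm k)) (P : spred Q) : spred Q := fun U n y =>
  exists (J : Type) (V : J -> Sm k) (c : forall j, ihom (V j) U),
    nisnevich_cover c /\ forall j, P (V j) n (sres (c j) (mono_id n) y).

(** Fibrancy only gives a map which agrees with [phi] on [P] up to homotopy; [hep] makes the
    agreement strict. The boundary conditions on local lifts hold because an inclusion is
    injective. *)
Lemma dense_extends Z (Q : spsh (Sm k)) (P : spred Q) :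
  motivic_fibrant Z -> stable P -> (forall U n y, locally_in P (U:=U) (n:=n) y) ->
  extends Z P.
Proof.
move=> [Zf Zl _] st dense phi nat.
pose incl := subp_incl st.
have lf : local_acyclic_fibration incl.
  move=> X n b y by_; have [J [V [c [cov cP]]]] := dense X n y.
  exists J, V, c; split=> // j; exists (exist (P (V j) n) _ (cP j)); split=> // m t p.
  apply: subp_eq => /=; have := by_ m t p => /= ->.
  rewrite -!sres_comp icomp1m icompm1 mono_compm1.
  by congr sres; apply: mono_eq.
have [_ /(_ (subp_map st nat)) [h hphi]] := Zl _ _ _ lf.
have [K [K0 K1 _]] := homotopic_hrel Zf hphi.
pose psi U n (y : cyl Q U n) : Z U n :=
  match pselect (P U n y.1) with
  | left p => K U n (exist _ y.1 p, y.2)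
  | right _ => h U n y.1
  end.
have [||L [_ LP]] := @hep _ Z Q P h psi Zf st.
- move=> U V m n f s [y t] /= p; rewrite /psi /=.
  case: pselect => [p'|[]]; last exact: (st U V m n f s y p).
  case: pselect => [q|[]] //; rewrite -(smapE K) /=; congr (K V n (_, _)); exact: subp_eq.
- by move=> U n y p; rewrite /psi /=; case: pselect => // q; rewrite K0.
exists (@SMap (Sm k) Q Z (fun U n y => L U n (y, v1 n))
  (fun U V m n f s y => etrans (f_equal (fun t => L V n (_, t)) (esym (v1_comp s)))
    (smapE L f s (y, v1 m)))).
by move=> U n y p; rewrite /= LP // /psi /=; case: pselect => // q; rewrite K1.
Qed.

End Intervals.
Notation A1p k := (points (A1 k)).

(** * Quotients and stable equivalences *)

Section Quotients.
Context (C : icat).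

(** The map [p] presents [Y] as [R / ker], where [R] need not be pointed. Iterated collapses and
    smash products are thereby described by plain tuples, on which maps and homotopies are given by
    formulas. *)
Record quot (R : spsh C) (Y : pspace C) (p : smap R Y) (ker : spred R) : Prop := Quot {
  quot_surj : forall U n y, exists r, p U n r = y;
  quot_ker : forall U n r, @ker U n r <-> p U n r = bpt Y U n;
  quot_inj : forall U n r r', p U n r = p U n r' -> r = r' \/ @ker U n r }.

Definition is_bpt (Y : pspace C) : spred Y := fun U n y => y = bpt Y U n.

Lemma is_bpt_stable (Y : pspace C) : stable (@is_bpt Y).
Proof. by move=> U V m n f s y ->; apply: sres_bpt. Qed.

Lemma quot_id (Y : pspace C) : quot (smap_id Y) (@is_bpt Y).
Proof. by split=> // [U n y|U n r r' e]; [exists y|left]. Qed.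

Section Lift.
Context (R : spsh C) (Y : pspace C) (p : smap R Y) (ker : spred R) (q : quot p ker).

Lemma quot_peq (Z : pspace C) (f g : pmap Y Z) :
  (forall U n r, f U n (p U n r) = g U n (p U n r)) -> f = g.
Proof. by move=> fg; apply: pmap_eq => U n y; have [r <-] := quot_surj q y. Qed.

Lemma quot_ker_stable : stable ker.
Proof.
by move=> U V m n f s r /(quot_ker q) e; apply/(quot_ker q); rewrite smapE e sres_bpt.
Qed.

(** The factor [W] is the parameter space of a homotopy, so that homotopies descend to quotients as
    maps do. *)
Lemma quot_lift2 (W : spsh C) (Z : pspace C) (phi : smap (sprod R W) Z) :
  (forall U n r w, @ker U n r -> phi U n (r, w) = bpt Z U n) ->
  exists f : smap (sprod Y W) Z,
    (forall U n r w, f U n (p U n r, w) = phi U n (r, w)) /\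
    (forall U n w, f U n (bpt Y U n, w) = bpt Z U n).
Proof.
move=> phi0.
pose rep U n (y : Y U n) : R U n := sval (cid (quot_surj q y)).
have repK U n (y : Y U n) : p U n (rep U n y) = y by rewrite /rep; case: cid.
have phi_eq U n r r' w : p U n r = p U n r' -> phi U n (r, w) = phi U n (r', w).
  move=> e; case: (quot_inj q e) => [->//|kr].
  rewrite (phi0 _ _ _ _ kr) phi0 //; apply/(quot_ker q); rewrite -e.
  exact/(quot_ker q).
pose ff U n (y : sprod Y W U n) : Z U n := phi U n (rep U n y.1, y.2).
have fn U V m n (f : ihom V U) (s : mono n m) y : ff V n (sres f s y) = sres f s (ff U m y).
  rewrite /ff /= -smapE /= /sprod_res /=; apply: phi_eq.
  by rewrite repK smapE repK.
exists (SMap fn); split=> [U n r w|U n w]; first by apply: phi_eq; rewrite repK.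
by apply: phi0; apply/(quot_ker q); rewrite repK.
Qed.

Lemma quot_lift (Z : pspace C) (phi : smap R Z) :
  (forall U n r, @ker U n r -> phi U n r = bpt Z U n) ->
  exists f : pmap Y Z, forall U n r, f U n (p U n r) = phi U n r.
Proof.
move=> phi0.
have [|f [fE f0]] := @quot_lift2 R Z (SMap (fun U V m n h s (x : sprod R R U m) => smapE phi h s x.1)).
  by move=> U n r w kr; apply: phi0.
pose rep U n (y : Y U n) : R U n := sval (cid (quot_surj q y)).
have repK U n (y : Y U n) : p U n (rep U n y) = y by rewrite /rep; case: cid.
pose g U n (y : Y U n) : Z U n := phi U n (rep U n y).
have gE U n y w : g U n y = f U n (y, w) by rewrite -[in RHS](repK _ _ y) fE.
have gn U V m n (h : ihom V U) (s : mono n m) y : g V n (sres h s y) = sres h s (g U m y).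
  by rewrite (gE _ _ _ (sres h s (rep U m y))) (gE U m y (rep U m y)) -smapE.
have g0 U n : SMap gn U n (bpt Y U n) = bpt Z U n.
  by rewrite /= (gE _ _ _ (rep U n (bpt Y U n))).
by exists (PMap g0) => U n r; rewrite /= (gE _ _ _ r) fE.
Qed.

End Lift.

Definition qmap R Y p ker (q : @quot R Y p ker) (Z : pspace C) (phi : smap R Z)
    (phi0 : forall U n r, ker U n r -> phi U n r = bpt Z U n) : pmap Y Z :=
  sval (cid (quot_lift q phi0)).

Lemma qmapE R Y p ker (q : @quot R Y p ker) (Z : pspace C) (phi : smap R Z)
    (phi0 : forall U n r, ker U n r -> phi U n r = bpt Z U n) U n r :
  qmap q phi0 U n (p U n r) = phi U n r.
Proof. by rewrite /qmap; case: cid. Qed.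

Section CollapseQuot.
Context (X : pspace C) (A : spred X) (A_bpt : forall U n, @A U n (bpt X U n))
  (A_res : forall (U V : C) (m n : nat) (f : ihom V U) (s : mono n m) x,
    @A U m x -> @A V n (sres f s x)).

Definition collapse_map : smap X (collapse A_bpt A_res) :=
  @SMap C X (collapse A_bpt A_res) (fun U n x => collapse_cl A x)
    (fun U V m n f s x => esym (collapse_resE A_bpt A_res f s x)).

Lemma collapse_quot : quot collapse_map A.
Proof.
split=> [U n y|U n r|U n r r' /= e].
- by exists (sval y); apply: collapse_clK.
- split=> [Ar|/= e]; first exact: collapse_clA.
  have {}e : collapse_cl A r = collapse_cl A (bpt X U n) by [].
  have [//|nA] := pselect (@A U n r).
  by move: (congr1 sval e); rewrite collapse_clF // collapse_clT // => ->.
have [Ar|nAr] := pselect (@A U n r); [by right|left].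
have [Ar'|nAr'] := pselect (@A U n r'); last by move: (congr1 sval e); rewrite !collapse_clF.
by case: (nAr); move: (congr1 sval e); rewrite collapse_clF // collapse_clT // => ->.
Qed.

End CollapseQuot.

Section SmashQuot.
Context (R1 R2 : spsh C) (Y1 Y2 : pspace C) (p1 : smap R1 Y1) (p2 : smap R2 Y2).

Definition smash_map0 : smap (sprod R1 R2) (smash Y1 Y2) :=
  @SMap C (sprod R1 R2) (smash Y1 Y2)
    (fun U n x => smash_pair (p1 U n x.1) (p2 U n x.2))
    (fun U V m n f s x => etrans (congr2 (fun a b => smash_pair a b) (smapE p1 f s x.1) (smapE p2 f s x.2))
      (esym (smash_pairE f s _ _))).

Context (k1 : spred R1) (k2 : spred R2) (q1 : quot p1 k1) (q2 : quot p2 k2).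

Lemma smash_quot : quot smash_map0 (fun U n x => k1 x.1 \/ k2 x.2).
Proof.
have Q := collapse_quot (@in_wedge_bpt C Y1 Y2) (@in_wedge_res C Y1 Y2).
split=> [U n y|U n [r1 r2]|U n [r1 r2] [r1' r2'] e].
- have [[y1 y2] <-] := quot_surj Q y.
  by have [[r1 <-] [r2 <-]] := (quot_surj q1 y1, quot_surj q2 y2); exists (r1, r2).
- split=> [k12|/= e].
    apply: smash_pair_bpt => /=.
    by case: k12 => k; [left; apply/(quot_ker q1)|right; apply/(quot_ker q2)].
  have [] : in_wedge (X := Y1) (Y := Y2) (p1 U n r1, p2 U n r2).
    by apply/(quot_ker Q).
  + by move/(quot_ker q1); left.
  + by move/(quot_ker q2); right.
- case: (quot_inj Q e) => [[e1 e2]|[|]].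
  + case: (quot_inj q1 e1) => [->|]; last by right; left.
    by case: (quot_inj q2 e2) => [->|]; [left|right; right].
  + by move/(quot_ker q1); right; left.
  + by move/(quot_ker q2); right; right.
Qed.

End SmashQuot.
End Quotients.

(** * The adjunction between suspension spectra and level zero *)

Section Adjunction.
Context (C : icat) (T X : pspace C).

Definition inj0 n : inj 0 n := @Inj 0 n (fun i => widen_ord (leq0n n) i)
  (fun i j _ => match i with Ordinal m p => False_ind _ (notF p) end).

Lemma inj0_uniq n (a b : inj 0 n) : a = b.
Proof.
case: a b => [a p] [b q]; have e : a = b by apply/funext => -[].
by case: _ / e q => q; congr Inj; apply: Prop_irrelevance.
Qed.

Lemma inj0_out n (j : 'I_n) i : inj0 n i <> j.
Proof. by case: i. Qed.

Lemma susp_unit_res (U V : C) (m n : nat) (f : ihom V U) (s : mono n m) (x : X U m) :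
  susp_cl (fun _ : 'I_0 => bpt T V n) (sres f s x) =
  sres f s (susp_cl (fun _ : 'I_0 => bpt T U m) x).
Proof. by rewrite susp_cl_res; congr susp_cl; apply/funext => -[]. Qed.

Lemma susp_unit_bpt (U : C) q :
  susp_cl (fun _ : 'I_0 => bpt T U q) (bpt X U q) = bpt (susp_lev T X 0) U q.
Proof. by apply: susp_cl_bpt; right. Qed.

Definition susp_unit : pmap X (susp_lev T X 0) :=
  @PMap C X (susp_lev T X 0) (SMap susp_unit_res) susp_unit_bpt.

Context (E : spectrum T).

Definition adj (g : spmap (susp T X) E) : pmap X (E 0%N) := pmap_comp (g 0%N) susp_unit.

Lemma spmap_susp_cl (g : spmap (susp T X) E) n U q (t : 'I_n -> T U q) x :
  g n U q (susp_cl t x) = act (inj0 n) t (adj g U q x).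
Proof.
rewrite -[RHS](spmapE g (inj0 n) t) [act _ _ _]susp_actE; congr (g n U q (susp_cl _ x)).
by apply/funext => j; rewrite extend_out // => i; apply: inj0_out.
Qed.

Section Extend.
Context (W : forall U : C, nat -> Type) (K : forall U q, X U q -> W U q -> E 0%N U q).
Context (K0 : forall U q w, K (bpt X U q) w = bpt (E 0%N) U q).

(** The argument [w] is a parameter, so that one formula extends both maps ([w] trivial) and
    homotopies ([w] a simplex of [Delta^1]). As the image of [inj0 n] is empty, all [n] coordinates
    of [T] enter. *)
Definition ext_fun n U q (z : susp T X n U q) (w : W U q) : E n U q :=
  act (inj0 n) (sval z).1 (K (sval z).2 w).

Lemma ext_cl n U q (t : 'I_n -> T U q) (x : X U q) w :
  ext_fun (susp_cl t x) w = act (inj0 n) t (K x w).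
Proof.
rewrite /ext_fun; have [A|nA] := pselect (in_fat_wedge ((t, x) : tpow T X n U q)); last first.
  by rewrite [sval _]collapse_clF.
rewrite [sval _]collapse_clT //= K0 act_bpt.
case: A => [[i e]|/= ->]; last by rewrite K0 act_bpt.
by symmetry; apply: (@act_bptT _ _ E _ _ _ _ _ _ _ i) => // l; apply: inj0_out.
Qed.

Lemma ext_act m n (a : inj m n) U q (t : 'I_n -> T U q) (z : susp T X m U q) w :
  ext_fun (act a t z) w = act a t (ext_fun z w).
Proof.
elim/susp_ind: z => s x; rewrite /= susp_actE !ext_cl act_comp.
by rewrite (inj0_uniq (inj_comp a (inj0 m)) (inj0 n)).
Qed.

Lemma ext_bpt n U q w : ext_fun (bpt (susp T X n) U q) w = bpt (E n) U q.
Proof.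
have -> : bpt (susp T X n) U q = susp_cl (fun=> bpt T U q) (bpt X U q) by [].
by rewrite ext_cl K0 act_bpt.
Qed.

Lemma ext_res n U V q r (f : ihom V U) (s : mono r q) (z : susp T X n U q) w w' :
  (forall x, K (sres f s x) w' = sres f s (K x w)) ->
  ext_fun (sres f s z) w' = sres f s (ext_fun z w).
Proof.
move=> h; elim/susp_ind: z => t x.
by rewrite [sres f s (susp_cl _ _)]susp_cl_res !ext_cl h act_res.
Qed.

End Extend.

Section ExtMap.
Context (a : pmap X (E 0%N)).
Let K U q (x : X U q) (_ : unit) := a U q x.
Let K0 U q w : K (bpt X U q) w = bpt (E 0%N) U q := pmap_bpt a U q.

Lemma ext_map_res n (U V : C) (q r : nat) (f : ihom V U) (s : mono r q) (z : susp T X n U q) :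
  ext_fun (W := fun _ _ => unit) K (sres f s z) tt = sres f s (ext_fun (W := fun _ _ => unit) K z tt).
Proof. by apply: (ext_res K0) => x; apply: smapE. Qed.

Definition ext : spmap (susp T X) E :=
  @SpMap C T (susp T X) E (fun n => @PMap C (susp T X n) (E n) (SMap (@ext_map_res n))
    (fun U q => @ext_bpt (fun _ _ => unit) K K0 n U q tt))
    (fun m n b U q t z => @ext_act (fun _ _ => unit) K K0 m n b U q t z tt).
End ExtMap.

Lemma extE (a : pmap X (E 0%N)) n U q (t : 'I_n -> T U q) x :
  ext a n U q (susp_cl t x) = act (inj0 n) t (a U q x).
Proof. by apply: (ext_cl (W := fun _ _ => unit)) => *; apply: pmap_bpt. Qed.

Lemma adj_ext (a : pmap X (E 0%N)) : adj (ext a) = a.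
Proof.
apply: pmap_eq => U q x; rewrite /= -[X in X = _]/(ext a 0%N U q (susp_cl _ x)) extE.
by rewrite (inj0_uniq (inj0 0) (inj_id 0)) act_id.
Qed.

Lemma sp_homotopic_hrel (g h : spmap (susp T X) E) : injective_fibrant (E 0%N) ->
  sp_homotopic g h -> hrel (@is_bpt C X) (adj g) (adj h).
Proof.
move=> Ef; have st := @is_bpt_stable C X.
elim=> {g h} [g h [H [Hn Hb _ H01]]|g|g h _ IH|f g h _ IH1 _ IH2].
- exists (@SMap C (cyl X) (E 0%N) (fun U q y => H 0%N U q (susp_unit U q y.1) y.2)
    (fun U V m n f s y => etrans (congr1 (fun z => H 0%N V n z _) (smapE susp_unit f s y.1))
       (Hn 0%N U V m n f s (susp_unit U m y.1) y.2))).
  split=> [U n x|U n x|U n x t e] /=; first by case: (H01 0%N U n (susp_unit U n x)).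
    by case: (H01 0%N U n (susp_unit U n x)).
  have -> : susp_cl (fun=> bpt T U n) x = bpt (susp_lev T X 0) U n.
    by rewrite e; exact: (pmap_bpt susp_unit).
  by rewrite Hb pmap_bpt.
- exact: hrel_refl.
- exact: hrel_sym.
- exact: hrel_trans IH1 IH2.
Qed.

Lemma hrel_sp_homotopic (g h : spmap (susp T X) E) :
  hrel (@is_bpt C X) (adj g) (adj h) -> sp_homotopic g h.
Proof.
move=> [H [H0 H1 HP]]; apply: rst_step.
pose K U q (x : X U q) (u : mono q 1) := H U q (x, u).
have K0 U q u : K U q (bpt X U q) u = bpt (E 0%N) U q.
  by rewrite /K HP // pmap_bpt.
exists (fun n U q z u => ext_fun (W := fun _ q => mono q 1) K z u); split.
- move=> n U V q r f s x u; apply: (ext_res K0) => y; exact: (smapE H f s (y, u)).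
- by move=> n U q u; apply: (ext_bpt K0).
- by move=> m n a U q t x u; apply: (ext_act K0).
- move=> n U q; apply: susp_ind => t x; rewrite !(ext_cl K0) !spmap_susp_cl.
  by rewrite /K H0 H1.
Qed.

End Adjunction.

Lemma adj_comp (C : icat) (T X Y : pspace C) (E : spectrum T) (f : pmap X Y)
    (g : spmap (susp T Y) E) :
  smap_comp (adj g) f = adj (spmap_comp g (susp_map T f)) :> smap X (E 0%N).
Proof. by apply: smap_eq => U n x; rewrite /= susp_map_cl. Qed.

(** * Stable equivalences of suspension spectra and homotopy invariance *)

Section StableCriterion.
Context (k : comPzRingType).
Notation T := (Tsph k).

(** By adjunction a suspension spectrum sees only level 0 of [E], which is motivic fibrant if [E] is
    an Omega-spectrum. *)
Lemma stable_crit (X Y : pspace (Sm k)) (f : pmap X Y) :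
  (forall Z : pspace (Sm k), motivic_fibrant Z ->
    (forall g h : pmap Y Z, hrel (@is_bpt _ X) (smap_comp g f) (smap_comp h f) ->
       hrel (@is_bpt _ Y) g h) /\
    (forall g : pmap X Z, exists h : pmap Y Z, hrel (@is_bpt _ X) (smap_comp h f) g)) ->
  stable_equivalence (susp_map T f).
Proof.
move=> crit E Einj Eom; have [Em _] := Eom 0%N.
have Ef : injective_fibrant (E 0%N) by case: Em.
have [inj surj] := crit _ Em; split=> [g h gh|g].
  apply: hrel_sp_homotopic; apply: inj; rewrite !adj_comp.
  exact: sp_homotopic_hrel.
have [h hg] := surj (adj g); exists (ext h).
by apply: hrel_sp_homotopic; rewrite -adj_comp adj_ext.
Qed.

Lemma quot_hrel (I : interval k) (R : spsh (Sm k)) (Y : pspace (Sm k)) (p : smap R Y)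
    (ker : spred R) (Z : pspace (Sm k)) (H : smap (sprod R I) Z) (f g : pmap Y Z) :
  quot p ker -> motivic_fibrant Z ->
  (forall U n r t, ker U n r -> H U n (r, t) = bpt Z U n) ->
  (forall U n r, H U n (r, i0 I U n) = f U n (p U n r)) ->
  (forall U n r, H U n (r, i1 I U n) = g U n (p U n r)) ->
  hrel (@is_bpt _ Y) f g.
Proof.
move=> q Zm Hk H0 H1; have [K [KE K0]] := quot_lift2 q Hk.
apply: (interval_hrel Zm (@is_bpt_stable _ Y) (H := K)) => [U n y|U n y|U n y t ->].
- by have [r <-] := quot_surj q y; rewrite KE.
- by have [r <-] := quot_surj q y; rewrite KE.
- by rewrite K0 pmap_bpt.
Qed.

Section Cylinder.
Context (I : interval k) (X : pspace (Sm k)).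

Definition hcyl0 : pspace (Sm k) :=
  @PSpace (Sm k) (sprod X I) (fun U n => (bpt X U n, i0 I U n))
    (fun U V m n f s => f_equal2 pair (sres_bpt X f s) (i0_res I f s)).
Definition hcyl_base : spred hcyl0 := fun U n y => y.1 = bpt X U n.
Lemma hcyl_bpt U n : hcyl_base (bpt hcyl0 U n).
Proof. by []. Qed.
Lemma hcyl_res (U V : Sm k) m n (f : ihom V U) (s : mono n m) (x : hcyl0 U m) :
  hcyl_base x -> hcyl_base (sres f s x).
Proof. by rewrite /hcyl_base /= => ->; apply: sres_bpt. Qed.
Definition hcyl := collapse hcyl_bpt hcyl_res.

Let q : quot (collapse_map hcyl_bpt hcyl_res) hcyl_base := collapse_quot hcyl_bpt hcyl_res.

Definition hcyl_proj : pmap hcyl X :=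
  qmap q (Z := X) (phi := sfst X I) (fun U n r h => h).

Lemma hcyl_projE U n x t : hcyl_proj U n (collapse_cl hcyl_base ((x, t) : hcyl0 U n)) = x.
Proof. exact: (qmapE q (phi := sfst X I) _ (x, t)). Qed.

Lemma hcyl_end_subproof (e : forall U n, I U n) :
  (forall (U V : Sm k) m n (f : ihom V U) (s : mono n m), sres f s (e U m) = e V n) ->
  exists g : pmap X hcyl, forall U n x, g U n x = collapse_cl hcyl_base ((x, e U n) : hcyl0 U n).
Proof.
move=> er.
have gn (U V : Sm k) m n (f : ihom V U) (s : mono n m) (x : X U m) :
    collapse_cl hcyl_base ((sres f s x, e V n) : hcyl0 V n) =
    sres f s (collapse_cl hcyl_base ((x, e U m) : hcyl0 U m) : hcyl U m).
  by rewrite -(er U V m n f s); exact: (smapE (collapse_map hcyl_bpt hcyl_res) f s (x, e U m)).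
have g0 U n : @SMap (Sm k) X hcyl _ gn U n (bpt X U n) = bpt hcyl U n.
  exact: (proj1 (quot_ker q _)).
by exists (@PMap (Sm k) X hcyl _ g0).
Qed.

(** The end [e0] is a section of the projection, and [imeet] contracts the cylinder onto it. *)
Lemma hcyl_proj_stable : stable_equivalence (susp_map T hcyl_proj).
Proof.
have [e0 e0E] := hcyl_end_subproof (i0_res I).
have pe0 : smap_comp hcyl_proj e0 = smap_id X.
  apply: smap_eq => U n x; rewrite /= e0E.
  exact: hcyl_projE.
apply: stable_crit => Z Zm; split=> [g h gh|g].
  have e (i : pmap X Z) : i = smap_comp (smap_comp i hcyl_proj) e0 :> smap X Z.
    have -> : smap_comp (smap_comp i hcyl_proj) e0 = smap_comp i (smap_comp hcyl_proj e0) by exact: smap_eq.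
    by rewrite pe0; apply: smap_eq.
  rewrite (e g) (e h); apply: hrel_compr gh => U n y ->; exact: pmap_bpt.
exists (pmap_comp g e0).
pose H : smap (sprod hcyl0 I) Z := @SMap (Sm k) (sprod hcyl0 I) Z
  (fun U n y => g U n (collapse_cl hcyl_base ((y.1.1, imeet y.1.2 y.2) : hcyl0 U n)))
  (fun U V m n f s y => etrans (congr1 (fun z => g V n (collapse_cl hcyl_base ((sres f s y.1.1, z) : hcyl0 V n))) (imeet_res f s _ _))
    (etrans (congr1 (g V n) (smapE (collapse_map hcyl_bpt hcyl_res) f s (y.1.1, imeet y.1.2 y.2))) (smapE g f s _))).
apply: (@quot_hrel I hcyl0 hcyl _ hcyl_base Z H (pmap_comp (pmap_comp g e0) hcyl_proj) g q Zm).
- move=> U n [x a] t e; rewrite /= (_ : collapse_cl _ _ = bpt hcyl U n) ?pmap_bpt //.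
  exact/(quot_ker q).
- move=> U n [x a]; rewrite /= imeetx0 -e0E; congr (g U n (e0 U n _)).
  by rewrite hcyl_projE.
- by move=> U n [x a]; rewrite /= imeetx1.
Qed.

End Cylinder.

(** Both maps are restrictions of one map to the ends of the reduced cylinder. The two ends are
    sections of [hcyl_proj], which is invertible in [SH], so they coincide there. *)
Lemma sg_homotopy (I : interval k) (R : spsh (Sm k)) (X : pspace (Sm k)) (p : smap R X)
    (ker : spred R) (Y : pspace (Sm k)) (H : smap (sprod R I) Y) (f g : pmap X Y) :
  quot p ker ->
  (forall U n r t, ker U n r -> H U n (r, t) = bpt Y U n) ->
  (forall U n r, H U n (r, i0 I U n) = f U n (p U n r)) ->
  (forall U n r, H U n (r, i1 I U n) = g U n (p U n r)) ->
  sg f = sg g.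
Proof.
move=> q Hk H0 H1; have [K [KE K0]] := quot_lift2 q Hk.
have qc := collapse_quot (@hcyl_bpt I X) (@hcyl_res I X).
have [|L LE] := quot_lift qc (phi := K : smap (hcyl0 I X) Y).
  by move=> U n [x t] e; rewrite (e : x = _) K0.
have [e0 e0E] := hcyl_end_subproof X (i0_res I).
have [e1 e1E] := hcyl_end_subproof X (i1_res I).
have -> : f = pmap_comp L e0.
  apply: pmap_eq => U n x; rewrite /= e0E (LE U n (x, _)).
  by have [r <-] := quot_surj q x; rewrite KE.
have -> : g = pmap_comp L e1.
  apply: pmap_eq => U n x; rewrite /= e1E (LE U n (x, _)).
  by have [r <-] := quot_surj q x; rewrite KE.
rewrite !sg_comp; congr sh_comp.
apply: (sh_mono (sh_map_iso (@hcyl_proj_stable I X))).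
rewrite -[sh_map _]/(sg (hcyl_proj I X)) -!sg_comp.
congr sg; apply: pmap_eq => U n x; rewrite /= e0E e1E.
by rewrite !hcyl_projE.
Qed.

End StableCriterion.

(** * Contractible cofibres and contractible kernels *)

Section Cofibres.
Context (k : comPzRingType).
Notation T := (Tsph k).
Implicit Types Y Z : pspace (Sm k).

Section Circle.
Context (I : interval k).

Definition circle0 : pspace (Sm k) :=
  @PSpace (Sm k) I (fun U n => i0 I U n) (fun U V m n f s => i0_res I f s).
Definition circle_ends : spred circle0 := fun U n t => t = i0 I U n \/ t = i1 I U n.
Lemma circle_bpt U n : circle_ends (bpt circle0 U n).
Proof. by left. Qed.
Lemma circle_res (U V : Sm k) m n (f : ihom V U) (s : mono n m) (t : circle0 U m) :
  circle_ends t -> circle_ends (sres f s t).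
Proof. by case=> ->; [left; apply: i0_res|right; apply: i1_res]. Qed.
Definition circle := collapse circle_bpt circle_res.
Definition circle_cl : smap I circle := collapse_map circle_bpt circle_res.
Lemma circle_quot : quot circle_cl circle_ends.
Proof. exact: (collapse_quot circle_bpt circle_res). Qed.

End Circle.

Lemma hrel_bpt_trans Y Z (f g h : smap Y Z) : motivic_fibrant Z ->
  hrel (@is_bpt _ Y) f g -> hrel (@is_bpt _ Y) g h -> hrel (@is_bpt _ Y) f h.
Proof. by case=> Zf _ _; exact: (hrel_trans Zf (@is_bpt_stable _ Y)). Qed.

Lemma hrel_bpt_sym Y Z (f g : smap Y Z) : motivic_fibrant Z ->
  hrel (@is_bpt _ Y) f g -> hrel (@is_bpt _ Y) g f.
Proof. by case=> Zf _ _; exact: (hrel_sym Zf (@is_bpt_stable _ Y)). Qed.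

(** A contraction of [B] turns the points of [A] into loops of [B/A], and this identifies
    the suspension of [A] with [B/A]. *)
Section ContractibleCofibre.
Context (I : interval k) (A B Q : pspace (Sm k)) (j : pmap A B) (q : smap B Q)
  (c : smap (sprod B I) B).
Hypothesis j_inj : forall U n, injective (j U n).
Hypothesis qq : quot q (fun U n b => exists a, j U n a = b).
Hypothesis c0 : forall U n b, c U n (b, i0 I U n) = bpt B U n.
Hypothesis c1 : forall U n b, c U n (b, i1 I U n) = b.
Hypothesis cb : forall U n t, c U n (bpt B U n, t) = bpt B U n.
Context (th : pmap (smash A (circle I)) Q).
Hypothesis thE : forall U n a t,
  th U n (smash_pair a (circle_cl I U n t)) = q U n (c U n (j U n a, t)).

Let sq := smash_quot (quot_id A) (circle_quot I).

Let q0 U n : q U n (bpt B U n) = bpt Q U n.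
Proof. by apply/(quot_ker qq); exists (bpt A U n); rewrite pmap_bpt. Qed.

Let pair_bpt U n (a : A U n) t : a = bpt A U n \/ t = i0 I U n \/ t = i1 I U n ->
  smash_pair a (circle_cl I U n t) = bpt (smash A (circle I)) U n.
Proof. by move=> h; apply: (proj1 (quot_ker sq (a, t))). Qed.

(** Extend [g], seen on [A * I], to a map [G] on [B * I] which is trivial at [i0], and let [h] be
    induced by [G (b, 1)]. Then [h th] is [G (c (a, t), 1)] and [g] is [G (c (a, 1), t)]; both are
    deformations of [G (c (a, t), t)], in which [ijoin] raises one of the two parameters to 1. *)
Lemma contractible_cofibre_surj Z (g : pmap (smash A (circle I)) Z) : motivic_fibrant Z ->
  exists h : pmap Q Z, hrel (@is_bpt _ (smash A (circle I))) (smap_comp h th) g.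
Proof.
move=> Zm; pose PA : spred B := fun U n b => exists a, j U n a = b.
have stA : stable PA.
  by move=> U V m n f s _ [a <-]; exists (sres f s a); rewrite smapE.
pose g' : smap (sprod A I) Z := smap_comp g (smash_map0 (smap_id A) (circle_cl I)).
have g'0 U n a t : a = bpt A U n \/ t = i0 I U n \/ t = i1 I U n ->
    g' U n (a, t) = bpt Z U n.
  by move=> h; rewrite /g' /= pair_bpt // pmap_bpt.
pose phi U n (y : sprod B I U n) : Z U n := match pselect (PA U n y.1) with
  | left e => g' U n (sval (cid e), y.2) | right _ => bpt Z U n end.
have phiA U n a t : phi U n (j U n a, t) = g' U n (a, t).
  rewrite /phi /=; case: pselect => [e|[]]; last by exists a.
  by congr (g' U n (_, _)); apply: j_inj; case: cid.
have phi0 U n b : phi U n (b, i0 I U n) = bpt Z U n.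
  rewrite /phi /=; case: pselect => // e; apply: g'0; right; exact: or_introl.
have [|G GE] := iext Zm stA (phi := phi).
  move=> U V m n f s [b t] [/= ->|[a /= <-]].
    by rewrite /sprod_res /= i0_res !phi0 sres_bpt.
  by rewrite /sprod_res /= -smapE !phiA -(smapE g').
have G0 U n b : G U n (b, i0 I U n) = bpt Z U n by rewrite GE; [exact: phi0|left].
have GA U n a t : G U n (j U n a, t) = g' U n (a, t).
  by rewrite GE; [exact: phiA|right; exists a].
have Gb U n t : G U n (bpt B U n, t) = bpt Z U n.
  by rewrite -(pmap_bpt j) GA g'0 //; left.
pose h0 : smap B Z := @SMap (Sm k) B Z (fun U n b => G U n (b, i1 I U n))
  (fun U V m n f s b => etrans (congr1 (fun t => G V n (_, t)) (esym (i1_res I f s)))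
    (smapE G f s (b, i1 I U m))).
have [|h hE] := quot_lift qq (phi := h0).
  by move=> U n _ [a <-]; rewrite /= GA g'0 //; right; right.
exists h.
pose m0 : smap (sprod A I) Z := @SMap (Sm k) (sprod A I) Z
  (fun U n y => G U n (c U n (j U n y.1, y.2), y.2))
  (fun U V m n f s y => etrans (congr1 (fun b => G V n (b, _)) (etrans
     (congr1 (fun b => c V n (b, _)) (smapE j f s y.1)) (smapE c f s (j U m y.1, y.2))))
     (smapE G f s (c U m (j U m y.1, y.2), y.2))).
have [|m mE] := quot_lift sq (phi := m0).
  move=> U n [a t] /= [->|[->|->]].
  - by rewrite pmap_bpt cb Gb.
  - exact: G0.
  - by rewrite c1 GA g'0 //; right; right.
apply: (@hrel_bpt_trans _ _ _ m) => //.
- apply: hrel_bpt_sym => //.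
  pose H : smap (sprod (sprod A I) I) Z := @SMap (Sm k) (sprod (sprod A I) I) Z
    (fun U n y => G U n (c U n (j U n y.1.1, y.1.2), ijoin y.1.2 y.2))
    (fun U V m n f s y => etrans (congr2 (fun b t => G V n (b, t)) (etrans
       (congr1 (fun b => c V n (b, _)) (smapE j f s y.1.1)) (smapE c f s (j U m y.1.1, y.1.2)))
       (ijoin_res f s _ _))
       (smapE G f s (c U m (j U m y.1.1, y.1.2), ijoin y.1.2 y.2))).
  apply: (quot_hrel (H := H) (g := pmap_comp h th) sq Zm) => U n [a t].
  + move=> s [/= ->|[/= ->|/= ->]] /=.
    * by rewrite pmap_bpt cb Gb.
    * by rewrite c0 Gb.
    * by rewrite c1 ijoin1x GA g'0 //; right; right.
  + by rewrite mE /= ijoinx0.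
  + by rewrite /= ijoinx1 thE hE.
- pose H : smap (sprod (sprod A I) I) Z := @SMap (Sm k) (sprod (sprod A I) I) Z
    (fun U n y => G U n (c U n (j U n y.1.1, ijoin y.1.2 y.2), y.1.2))
    (fun U V m n f s y => etrans (congr1 (fun b => G V n (b, _)) (etrans
       (congr2 (fun b t => c V n (b, t)) (smapE j f s y.1.1) (ijoin_res f s _ _))
          (smapE c f s (j U m y.1.1, ijoin y.1.2 y.2))))
       (smapE G f s (c U m (j U m y.1.1, ijoin y.1.2 y.2), y.1.2))).
  apply: (quot_hrel (H := H) (g := g) sq Zm) => U n [a t].
  + move=> s [/= ->|[/= ->|/= ->]] /=.
    * by rewrite pmap_bpt cb Gb.
    * exact: G0.
    * by rewrite ijoin1x c1 GA g'0 //; right; right.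
  + by rewrite mE /= ijoinx0.
  + by rewrite /= ijoinx1 c1 GA.
Qed.

(** The homotopy lives on [A * Delta^1 * I]. It is extended to [B * Delta^1 * I], with [g q c] and
    [h q c] over the ends of [Delta^1] and the base point at [i0]. At [i1] the extension is trivial
    on [A] and descends to [Q]. *)
Lemma contractible_cofibre_inj Z (g h : pmap Q Z) : motivic_fibrant Z ->
  hrel (@is_bpt _ (smash A (circle I))) (smap_comp g th) (smap_comp h th) ->
  hrel (@is_bpt _ Q) g h.
Proof.
move=> Zm [K [K0 K1 KP]].
have Kb U n a t s : a = bpt A U n \/ t = i0 I U n \/ t = i1 I U n ->
    K U n (smash_pair a (circle_cl I U n t), s) = bpt Z U n.
  by move=> e; rewrite (pair_bpt e) KP //= !pmap_bpt.
pose P : spred (cyl B) := fun U n y => [\/ exists a, j U n a = y.1, y.2 = v0 n | y.2 = v1 n].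
have stP : stable P.
  move=> U V m n f s [b t] [[a /= <-]|/= ->|/= ->]; [apply: Or31|apply: Or32|apply: Or33].
  + by exists (sres f s a); rewrite smapE.
  + exact: mono_eq.
  + exact: mono_eq.
pose gq : smap (sprod B I) Z := smap_comp (smap_comp g q) c.
pose hq : smap (sprod B I) Z := smap_comp (smap_comp h q) c.
pose phi U n (y : sprod (cyl B) I U n) : Z U n :=
  match pselect (exists a, j U n a = y.1.1) with
  | left e => K U n (smash_pair (sval (cid e)) (circle_cl I U n y.2), y.1.2)
  | right _ => if pselect (y.1.2 = v0 n) then gq U n (y.1.1, y.2) else
               if pselect (y.1.2 = v1 n) then hq U n (y.1.1, y.2) else bpt Z U n end.
have phiA U n a s t : phi U n ((j U n a, s), t) = K U n (smash_pair a (circle_cl I U n t), s).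
  rewrite /phi /=; case: pselect => [e|[]]; last by exists a.
  congr (K U n (smash_pair _ _, _)); apply: j_inj; by case: cid.
have phi0 U n b t : phi U n ((b, v0 n), t) = gq U n (b, t).
  have [[a <-]|na] := pselect (exists a, j U n a = b).
    by rewrite phiA K0 /= thE.
  by rewrite /phi /=; case: pselect => // _; case: pselect.
have phi1 U n b t : phi U n ((b, v1 n), t) = hq U n (b, t).
  have [[a <-]|na] := pselect (exists a, j U n a = b).
    by rewrite phiA K1 /= thE.
  rewrite /phi /=; case: pselect => // _; case: pselect => [e|ne] /=.
    by case: (v0_neq_v1 (esym e)).
  by case: pselect.
have phii U n y : phi U n (y, i0 I U n) = bpt Z U n.
  rewrite /phi; case: pselect => [e|na].
    by case: y e => b s e /=; apply: Kb; right; left.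
  case: pselect => [e|ne] /=; first by rewrite c0 q0 pmap_bpt.
  by case: pselect => [e|ne'] //=; rewrite c0 q0 pmap_bpt.
have [|L LE] := iext Zm stP (phi := phi).
  move=> U V m n f s [[b u] t] [/= ->|[[a /= <-]|/= ->|/= ->]].
  - by rewrite /sprod_res /= i0_res !phii sres_bpt.
  - rewrite /sprod_res /= /sprod_res /= -smapE !phiA -(smapE K) /= /sprod_res /=.
    congr (K V n (_, _)); exact: (smapE (smash_map0 (smap_id A) (circle_cl I)) f s (a, t)).
  - by rewrite /sprod_res /= /sprod_res /= v0_comp !phi0 -(smapE gq).
  - by rewrite /sprod_res /= /sprod_res /= v1_comp !phi1 -(smapE hq).
pose L1 : smap (cyl B) Z := @SMap (Sm k) (cyl B) Z (fun U n y => L U n (y, i1 I U n))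
  (fun U V m n f s y => etrans (congr1 (fun t => L V n (_, t)) (esym (i1_res I f s)))
    (smapE L f s (y, i1 I U m))).
have [|M [ME M0]] := quot_lift2 qq (phi := L1).
  move=> U n _ s [a <-]; rewrite /= LE; last by right; apply: Or31; exists a.
  by rewrite phiA; apply: Kb; right; right.
exists M; split=> [U n y|U n y|U n y t ->].
- have [b <-] := quot_surj qq y.
  rewrite ME /= LE; last by right; apply: Or32.
  by rewrite phi0 /= c1.
- have [b <-] := quot_surj qq y.
  rewrite ME /= LE; last by right; apply: Or33.
  by rewrite phi1 /= c1.
- by rewrite M0 pmap_bpt.
Qed.

Lemma contractible_cofibre : stable_equivalence (susp_map T th).
Proof.
apply: stable_crit => Z Zm; split=> [g h|g].
  exact: contractible_cofibre_inj.
exact: contractible_cofibre_surj.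
Qed.

End ContractibleCofibre.

Definition spt : spsh (Sm k) := @SPsh (Sm k) (fun _ _ => unit) (fun _ _ _ _ _ _ _ => tt)
  (fun _ _ x => match x with tt => erefl end) (fun _ _ _ _ _ _ _ _ _ _ _ => erefl).

Section Kill.
Context (B Y : pspace (Sm k)) (f : pmap B Y) (ker : spred B) (q : quot f ker).

(** Every family of maps to [Z] which are trivial at the base point becomes trivial on
    [ker], by a homotopy which is constant where the family already is. *)
Definition ker_contracts : Prop :=
  forall (Z : pspace (Sm k)), motivic_fibrant Z ->
  forall (X : spsh (Sm k)) (X0 : spred X) (g : smap (sprod X B) Z), stable X0 ->
  (forall U n x, g U n (x, bpt B U n) = bpt Z U n) ->
  (forall U n x b, X0 U n x -> @ker U n b -> g U n (x, b) = bpt Z U n) ->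
  exists K : forall U n, cyl (sprod X B) U n -> Z U n,
  [/\ natural_on (fun U n (y : cyl (sprod X B) U n) => ker y.1.2) K,
      forall U n x b, @ker U n b -> K U n ((x, b), v0 n) = g U n (x, b),
      forall U n x b, @ker U n b -> K U n ((x, b), v1 n) = bpt Z U n,
      forall U n x t, K U n ((x, bpt B U n), t) = bpt Z U n
    & forall U n x b t, X0 U n x -> @ker U n b -> K U n ((x, b), t) = bpt Z U n].

Let ker_st : stable ker := quot_ker_stable q.
Let ker_bpt U n : @ker U n (bpt B U n).
Proof. by apply/(quot_ker q); apply: pmap_bpt. Qed.

(** Surjectivity uses the hypothesis for a family with one member; injectivity uses it for a
    homotopy, seen as a family over [Delta^1] with [X0] its two ends. In both cases [hep] extends
    the deformation from [ker] to [B], and its end descends to the quotient. *)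
Lemma quot_stable : ker_contracts -> stable_equivalence (susp_map T f).
Proof.
move=> kc; apply: stable_crit => Z Zm; have Zf : injective_fibrant Z by case: Zm.
split=> [g h [M [M0 M1 MP]]|g].
- pose X := simp_sp (Sm k) 1.
  pose X0 : spred X := fun U n t => t = v0 n \/ t = v1 n.
  have st0 : stable X0.
    move=> U V m n e s t [->|->]; [left|right]; exact: mono_eq.
  pose M' : smap (sprod X B) Z := @SMap (Sm k) (sprod X B) Z (fun U n y => M U n (y.2, y.1))
    (fun U V m n e s y => smapE M e s (y.2, y.1)).
  have Mb U n t : M U n (bpt B U n, t) = bpt Z U n by rewrite MP //= !pmap_bpt.
  have M'0 U n x b : X0 U n x -> @ker U n b -> M' U n (x, b) = bpt Z U n.
    move=> [->|->] /(quot_ker q) e; first by rewrite /= M0 /= e pmap_bpt.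
    by rewrite /= M1 /= e pmap_bpt.
  have [|K [Kn K0 K1 Kb KX]] := kc Z Zm X X0 M' st0 _ M'0.
    by move=> U n x; apply: Mb.
  pose P : spred (sprod X B) := fun U n y => ker y.2 \/ X0 U n y.1.
  have stP : stable P.
    by move=> U V m n e s [x b] [p|p]; [left; apply: ker_st|right; apply: st0].
  pose phi U n (y : cyl (sprod X B) U n) : Z U n :=
    if pselect (ker y.1.2) then K U n y else M' U n y.1.
  have phiK U n x b t : @ker U n b -> phi U n ((x, b), t) = K U n ((x, b), t).
    by rewrite /phi /=; case: pselect.
  have phiX U n x b t : X0 U n x -> phi U n ((x, b), t) = M' U n (x, b).
    move=> Xx; rewrite /phi; case: pselect => // kb.
    by transitivity (bpt Z U n); [exact: KX|exact/esym/M'0].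
  have [||L [L0 LP]] := @hep _ Z _ P M' phi Zf stP.
  + move=> U V m n e s [[x b] t] [/= kb|/= Xx].
      rewrite /sprod_res /= /sprod_res /= !phiK //; last exact: ker_st.
      exact: (Kn U V m n e s ((x, b), t)).
    rewrite /sprod_res /= /sprod_res /= !phiX //; last exact: st0.
    exact: (smapE M' e s (x, b)).
  + move=> U n [x b] [/= kb|/= Xx]; last exact: phiX.
    by rewrite phiK // K0.
  pose L1 : smap (cyl B) Z := @SMap (Sm k) (cyl B) Z (fun U n y => L U n ((y.2, y.1), v1 n))
    (fun U V m n e s y => etrans (congr1 (fun t => L V n (_, t)) (esym (v1_comp s)))
      (smapE L e s ((y.2, y.1), v1 m))).
  have [|N [NE N0]] := quot_lift2 q (phi := L1).
    by move=> U n b t kb; rewrite /= LP; [rewrite phiK // K1|left].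
  exists N; split=> [U n y|U n y|U n y t ->].
  + have [b <-] := quot_surj q y.
    by rewrite NE /= LP ?phiX /= ?M0 //; [left|right; left].
  + have [b <-] := quot_surj q y.
    by rewrite NE /= LP ?phiX /= ?M1 //; [right|right; right].
  + by rewrite N0 pmap_bpt.
- pose g' : smap (sprod spt B) Z := @SMap (Sm k) (sprod spt B) Z (fun U n y => g U n y.2)
    (fun U V m n e s y => smapE g e s y.2).
  have [||K [Kn K0 K1 Kb _]] := kc Z Zm spt (@no_pred _ spt) g' (@no_pred_stable _ spt).
    by move=> U n x; apply: pmap_bpt.
    by [].
  pose P : spred (sprod spt B) := fun U n y => ker y.2.
  have stP : stable P by move=> U V m n e s [x b]; apply: ker_st.
  have [||L [L0 LP]] := @hep _ Z _ P g' K Zf stP.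
  + by move=> U V m n e s y; apply: Kn.
  + by move=> U n [x b] kb; rewrite K0.
  pose g1 : smap B Z := @SMap (Sm k) B Z (fun U n b => L U n ((tt, b), v1 n))
    (fun U V m n e s b => etrans (congr1 (fun t => L V n (_, t)) (esym (v1_comp s)))
      (smapE L e s ((tt, b), v1 m))).
  have [|h hE] := quot_lift q (phi := g1).
    by move=> U n b kb; rewrite /= LP // K1.
  exists h; apply: hrel_bpt_sym => //.
  exists (@SMap (Sm k) (cyl B) Z (fun U n y => L U n ((tt, y.1), y.2))
    (fun U V m n e s y => smapE L e s ((tt, y.1), y.2))).
  split=> [U n b|U n b|U n b t ->] /=.
  + by rewrite L0.
  + by rewrite hE.
  + by rewrite LP ?Kb ?pmap_bpt //; apply: ker_bpt.
Qed.

(** At the base point the contraction has to be constant. Since every element of [ker] is locally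
    the base point, the part of [X * ker * Delta^1] on which the contraction is prescribed is
    locally everything, and [dense_extends] produces the rest. *)
Lemma dense_contracts :
  (forall U n b, @ker U n b -> locally_in (@is_bpt _ B) b) -> ker_contracts.
Proof.
move=> dense Z Zm X X0 g st0 gb gX.
pose Q : spsh (Sm k) := cyl (sprod X (subp ker_st)).
pose P : spred Q := fun U n y =>
  [\/ y.2 = v0 n, y.2 = v1 n, X0 U n y.1.1 | sval y.1.2 = bpt B U n].
have stP : stable P.
  move=> U V m n e s [[x b] t] [/= ->|/= ->|p|/= p];
    [apply: Or41|apply: Or42|apply: Or43|apply: Or44]; try exact: mono_eq.
  - exact: st0.
  - by rewrite /= p sres_bpt.
pose phi U n (y : Q U n) : Z U n :=
  if pselect (y.2 = v0 n) then g U n (y.1.1, sval y.1.2) else bpt Z U n.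
have phi0 U n x b : phi U n ((x, b), v0 n) = g U n (x, sval b).
  by rewrite /phi /=; case: pselect.
have phi1 U n x b : phi U n ((x, b), v1 n) = bpt Z U n.
  by rewrite /phi /=; case: pselect => //= e; case: (v0_neq_v1 (esym e)).
have phiX U n x b t : X0 U n x -> phi U n ((x, b), t) = bpt Z U n.
  by move=> Xx; rewrite /phi /=; case: pselect => //= _; apply: gX => //; apply: (svalP b).
have phib U n x (b : subp ker_st U n) t : sval b = bpt B U n -> phi U n ((x, b), t) = bpt Z U n.
  by move=> e; rewrite /phi /=; case: pselect => //= _; rewrite e gb.
have Dn U n y : locally_in P (U := U) (n := n) y.
  case: y => [[x b] t]; have [J [V [c [cov cP]]]] := dense U n _ (svalP b).
  by exists J, V, c; split=> // j; apply: Or44; apply: cP.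
have [|K KE] := dense_extends Zm stP Dn (phi := phi).
- move=> U V m n e s [[x b] t] [/= ->|/= ->|/= p|/= p]; rewrite /sprod_res /= /sprod_res /=.
  + rewrite v0_comp !phi0; exact: (smapE g e s (x, sval b)).
  + by rewrite v1_comp !phi1 sres_bpt.
  + by rewrite !phiX ?sres_bpt //; apply: st0.
  + by rewrite !phib ?sres_bpt //= p sres_bpt.
exists (fun U n y => match pselect (ker y.1.2) with
  | left kb => K U n ((y.1.1, exist _ y.1.2 kb), y.2) | right _ => bpt Z U n end).
split.
- move=> U V m n e s [[x b] t] /= kb.
  case: pselect => [kb'|[]]; last exact: ker_st.
  case: pselect => [kb''|[]] //; rewrite -(smapE K); congr (K V n ((_, _), _)); exact: subp_eq.
- by move=> U n x b kb /=; case: pselect => // kb'; rewrite KE ?phi0 //; apply: Or41.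
- by move=> U n x b kb /=; case: pselect => // kb'; rewrite KE ?phi1 //; apply: Or42.
- by move=> U n x t /=; case: pselect => // kb'; rewrite KE ?phib //; apply: Or44.
- by move=> U n x b t Xx kb /=; case: pselect => // kb'; rewrite KE ?phiX //; apply: Or43.
Qed.

Lemma homotopy_contracts (d : forall U n, cyl B U n -> B U n) :
  natural_on (fun U n (y : cyl B U n) => ker y.1) d ->
  (forall U n b, @ker U n b -> d U n (b, v0 n) = b) ->
  (forall U n b, @ker U n b -> d U n (b, v1 n) = bpt B U n) ->
  (forall U n t, d U n (bpt B U n, t) = bpt B U n) ->
  (forall U n b t, @ker U n b -> ker (d U n (b, t))) -> ker_contracts.
Proof.
move=> dn d0 d1 db dk Z Zm X X0 g st0 gb gX.
exists (fun U n y => g U n (y.1.1, d U n (y.1.2, y.2))); split=> [U V m n e s [[x b] t] kb|U n x b kb|U n x b kb|U n x t|U n x b t Xx kb] /=.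
- by rewrite -(smapE g) /= /sprod_res /= -dn.
- by rewrite d0.
- by rewrite d1 // gb.
- by rewrite db gb.
- by apply: gX => //; apply: dk.
Qed.

End Kill.
End Cofibres.

(** * Wedges *)

Section WedgeSpectra.
Context (C : icat) (T : pspace C).
Implicit Types X Y Z E : spectrum T.

Section Wedge.
Context (X Y : spectrum T).

Definition in_axes n : spred (sprod (X n) (Y n)) :=
  fun U q z => z.1 = bpt (X n) U q \/ z.2 = bpt (Y n) U q.
Lemma in_axes_stable n : stable (@in_axes n).
Proof. by move=> U V m r f s z [e|e]; [left|right]; rewrite /= e sres_bpt. Qed.

Definition wedge_bpt n U q : subp (@in_axes_stable n) U q :=
  exist (@in_axes n U q) (bpt (X n) U q, bpt (Y n) U q) (or_introl erefl).
Lemma wedge_bpt_res n (U V : C) q r (f : ihom V U) (s : mono r q) :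
  sres f s (wedge_bpt n U q) = wedge_bpt n V r.
Proof. by apply: subp_eq; rewrite /= /sprod_res /= !sres_bpt. Qed.

Definition wedge_lev n : pspace C := @PSpace C _ (@wedge_bpt n) (@wedge_bpt_res n).

Definition wedge_act m n (a : inj m n) (U : C) q (t : 'I_n -> T U q)
    (z : wedge_lev m U q) : wedge_lev n U q.
Proof.
exists (act a t (sval z).1, act a t (sval z).2).
by case: z => z [/= ->|/= ->]; [left|right]; apply: act_bpt.
Defined.

Definition wedge : spectrum T.
Proof.
refine (@Spectrum C T wedge_lev wedge_act _ _ _ _ _ _) => [m n a U V q r f s t z|m n a U q t t' z tt'
  |m n a U q t|m n a U q t z j aj tj|m U q t z|m n p a b U q t s z]; apply: subp_eq => /=.
- by rewrite /sprod_res /= !act_res.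
- by congr pair; apply: act_irr.
- by rewrite !act_bpt.
- by rewrite !(@act_bptT _ _ _ _ _ _ _ _ _ _ j).
- by rewrite !act_id; case: (sval z).
- by rewrite !act_comp.
Defined.

Definition wl n U q (x : X n U q) : wedge n U q :=
  exist (@in_axes n U q) (x, bpt (Y n) U q) (or_intror erefl).
Definition wr n U q (y : Y n U q) : wedge n U q :=
  exist (@in_axes n U q) (bpt (X n) U q, y) (or_introl erefl).

Lemma wedge_ind n U q (P : wedge n U q -> Prop) :
  (forall x, P (wl x)) -> (forall y, P (wr y)) -> forall z, P z.
Proof.
move=> Pl Pr [[x y] h]; have [e|e] : x = bpt (X n) U q \/ y = bpt (Y n) U q := h.
  by rewrite (_ : exist _ _ _ = wr y) //; apply: subp_eq; rewrite /= e.
by rewrite (_ : exist _ _ _ = wl x) //; apply: subp_eq; rewrite /= e.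
Qed.

Lemma wl_res n U V q r (f : ihom V U) (s : mono r q) (x : X n U q) :
  sres f s (wl x) = wl (sres f s x).
Proof. by apply: subp_eq; rewrite /= /sprod_res /= sres_bpt. Qed.
Lemma wr_res n U V q r (f : ihom V U) (s : mono r q) (y : Y n U q) :
  sres f s (wr y) = wr (sres f s y).
Proof. by apply: subp_eq; rewrite /= /sprod_res /= sres_bpt. Qed.
Lemma wl_act m n (a : inj m n) U q t (x : X m U q) : @act C T wedge _ _ a _ _ t (wl x) = wl (act a t x).
Proof. by apply: subp_eq; rewrite /= act_bpt. Qed.
Lemma wr_act m n (a : inj m n) U q t (y : Y m U q) : @act C T wedge _ _ a _ _ t (wr y) = wr (act a t y).
Proof. by apply: subp_eq; rewrite /= act_bpt. Qed.
Lemma wl_bpt n U q : wl (bpt (X n) U q) = bpt (wedge n) U q.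
Proof. exact: subp_eq. Qed.
Lemma wr_bpt n U q : wr (bpt (Y n) U q) = bpt (wedge n) U q.
Proof. exact: subp_eq. Qed.

Definition winl : spmap X wedge :=
  @SpMap C T X wedge (fun n => @PMap C (X n) (wedge n)
    (@SMap C (X n) (wedge n) (fun U q x => wl x)
       (fun U V m r f s x => esym (wl_res f s x))) (@wl_bpt n))
    (fun m n a U q t x => esym (wl_act a t x)).
Definition winr : spmap Y wedge :=
  @SpMap C T Y wedge (fun n => @PMap C (Y n) (wedge n)
    (@SMap C (Y n) (wedge n) (fun U q x => wr x)
       (fun U V m r f s x => esym (wr_res f s x))) (@wr_bpt n))
    (fun m n a U q t x => esym (wr_act a t x)).

Definition wcase n U q (D : Type) (f : X n U q -> D) (g : Y n U q -> D) (z : wedge n U q) : D :=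
  if pselect ((sval z).2 = bpt (Y n) U q) then f (sval z).1 else g (sval z).2.

Lemma wcase_l n U q D (f : X n U q -> D) g x : wcase f g (wl x) = f x.
Proof. by rewrite /wcase /=; case: pselect. Qed.

Lemma wcase_r n U q D (f : X n U q -> D) g y :
  f (bpt (X n) U q) = g (bpt (Y n) U q) -> wcase f g (wr y) = g y.
Proof. by move=> e; rewrite /wcase /=; case: pselect => //= ->. Qed.

Section Copair.
Context (E : spectrum T).

Section CopairDef.
Context (f : spmap X E) (g : spmap Y E).

Lemma copair_agree n U q : f n U q (bpt (X n) U q) = g n U q (bpt (Y n) U q).
Proof. by rewrite !pmap_bpt. Qed.

Definition copair_fun n U q (z : wedge n U q) : E n U q := wcase (f n U q) (g n U q) z.

Lemma copair_res n (U V : C) (q r : nat) (h : ihom V U) (s : mono r q) (z : wedge n U q) :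
  copair_fun (sres h s z) = sres h s (copair_fun z).
Proof.
elim/wedge_ind: z => x; rewrite ?wl_res ?wr_res /copair_fun; first by rewrite !wcase_l smapE.
by rewrite !wcase_r ?copair_agree // smapE.
Qed.

Lemma copair_bpt n U q : copair_fun (bpt (wedge n) U q) = bpt (E n) U q.
Proof. by rewrite -wl_bpt /copair_fun wcase_l pmap_bpt. Qed.

Lemma copair_act m n (a : inj m n) U q (t : 'I_n -> T U q) (z : wedge m U q) :
  copair_fun (act a t z) = act a t (copair_fun z).
Proof.
elim/wedge_ind: z => x; rewrite ?wl_act ?wr_act /copair_fun; first by rewrite !wcase_l spmapE.
by rewrite !wcase_r ?copair_agree // spmapE.
Qed.

Definition copair : spmap wedge E :=
  @SpMap C T wedge E (fun n => @PMap C (wedge n) (E n) (SMap (@copair_res n)) (@copair_bpt n))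
    copair_act.

End CopairDef.

Lemma copair_l f g n U q x : copair f g n U q (wl x) = f n U q x.
Proof. exact: wcase_l. Qed.
Lemma copair_r f g n U q y : copair f g n U q (wr y) = g n U q y.
Proof. by apply: wcase_r; rewrite !pmap_bpt. Qed.

Lemma copair_eta (u : spmap wedge E) : u = copair (spmap_comp u winl) (spmap_comp u winr).
Proof.
by apply: spmap_eq => n U q; elim/wedge_ind => x; rewrite ?copair_l ?copair_r.
Qed.

Lemma sp_homotopy_refl (X' : spectrum T) (f : spmap X' E) : sp_homotopy f f.
Proof.
exists (fun n U q x _ => f n U q x); split=> //.
- by move=> *; rewrite smapE.
- by move=> *; rewrite pmap_bpt.
- by move=> *; rewrite spmapE.
Qed.

Lemma copair_homotopy f f' g g' : sp_homotopy f f' -> sp_homotopy g g' ->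
  sp_homotopy (copair f g) (copair f' g').
Proof.
move=> [H [Hn Hb Ha H01]] [K [Kn Kb Ka K01]].
have e n U q t : H n U q (bpt (X n) U q) t = K n U q (bpt (Y n) U q) t by rewrite Hb Kb.
exists (fun n U q z t => wcase (fun x => H n U q x t) (fun y => K n U q y t) z); split.
- move=> n U V q r h s z t; elim/wedge_ind: z => x; rewrite ?wl_res ?wr_res.
    by rewrite !wcase_l Hn.
  by rewrite !wcase_r ?e // Kn.
- by move=> n U q t; rewrite -wl_bpt wcase_l Hb.
- move=> m n a U q t z u; elim/wedge_ind: z => x; rewrite ?wl_act ?wr_act.
    by rewrite !wcase_l Ha.
  by rewrite !wcase_r ?e // Ka.
- move=> n U q; elim/wedge_ind => x.
    by rewrite !wcase_l !copair_l.
  by rewrite !wcase_r ?e // !copair_r.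
Qed.

Lemma copair_homotopic f f' g g' : sp_homotopic f f' -> sp_homotopic g g' ->
  sp_homotopic (copair f g) (copair f' g').
Proof.
move=> ff gg; apply: (rst_trans _ _ _ (copair f' g)).
  elim: ff => {f f'} [f f' h|f|f f' _ h|f f' f'' _ h1 _ h2].
  - by apply: rst_step; apply: copair_homotopy h (sp_homotopy_refl g).
  - exact: rst_refl.
  - exact: rst_sym.
  - exact: rst_trans h1 h2.
elim: gg => {g g'} [g g' h|g|g g' _ h|g g' g'' _ h1 _ h2].
- by apply: rst_step; apply: copair_homotopy (sp_homotopy_refl f') h.
- exact: rst_refl.
- exact: rst_sym.
- exact: rst_trans h1 h2.
Qed.

End Copair.
End Wedge.

Lemma sp_homotopic_compr X Y E (h : spmap X Y) (f g : spmap Y E) :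
  sp_homotopic f g -> sp_homotopic (spmap_comp f h) (spmap_comp g h).
Proof.
elim=> {f g} [f g [H [Hn Hb Ha H01]]|f|f g _ IH|f g i _ IH1 _ IH2].
- apply: rst_step; exists (fun n U q x t => H n U q (h n U q x) t); split.
  + by move=> *; rewrite smapE Hn.
  + by move=> *; rewrite pmap_bpt Hb.
  + by move=> *; rewrite spmapE Ha.
  + by move=> n U q x; apply: H01.
- exact: rst_refl.
- exact: rst_sym.
- exact: rst_trans IH1 IH2.
Qed.

Definition wmap X X' Y Y' (f : spmap X X') (g : spmap Y Y') : spmap (wedge X Y) (wedge X' Y') :=
  copair (spmap_comp (winl X' Y') f) (spmap_comp (winr X' Y') g).

Lemma wmap_l X X' Y Y' (f : spmap X X') (g : spmap Y Y') n U q x :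
  wmap f g n U q (wl Y x) = wl Y' (f n U q x).
Proof. exact: copair_l. Qed.
Lemma wmap_r X X' Y Y' (f : spmap X X') (g : spmap Y Y') n U q y :
  wmap f g n U q (wr X y) = wr X' (g n U q y).
Proof. exact: copair_r. Qed.

End WedgeSpectra.

Section WedgeSH.
Context (k : comPzRingType).
Implicit Types X Y Z W : mspec k.

Lemma wmap_stable X X' Y Y' (f : spmap X X') (g : spmap Y Y') :
  stable_equivalence f -> stable_equivalence g -> stable_equivalence (wmap f g).
Proof.
move=> sf sg E Ei Eo; have [fi fs] := sf E Ei Eo; have [gi gs] := sg E Ei Eo.
split=> [u v uv|u].
  rewrite (copair_eta u) (copair_eta v); apply: copair_homotopic.
    apply: fi; move: (sp_homotopic_compr (winl X Y) uv).
    have e w : spmap_comp (spmap_comp w (wmap f g)) (winl X Y) =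
        spmap_comp (spmap_comp w (winl X' Y')) f :> spmap X E.
      by apply: spmap_eq => n U q x; rewrite -[LHS]/(w n U q (wmap f g n U q (wl Y x))) wmap_l.
    by rewrite !e.
  apply: gi; move: (sp_homotopic_compr (winr X Y) uv).
  have e w : spmap_comp (spmap_comp w (wmap f g)) (winr X Y) =
      spmap_comp (spmap_comp w (winr X' Y')) g :> spmap Y E.
    by apply: spmap_eq => n U q x; rewrite -[LHS]/(w n U q (wmap f g n U q (wr X x))) wmap_r.
  by rewrite !e.
have [h1 h1E] := fs (spmap_comp u (winl X Y)).
have [h2 h2E] := gs (spmap_comp u (winr X Y)).
exists (copair h1 h2); rewrite (copair_eta u).
have -> : spmap_comp (copair h1 h2) (wmap f g) = copair (spmap_comp h1 f) (spmap_comp h2 g).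
  apply: spmap_eq => n U q; elim/wedge_ind => x.
    rewrite copair_l -[LHS]/(copair h1 h2 n U q (wmap f g n U q _)) wmap_l.
    exact: copair_l.
  rewrite copair_r -[LHS]/(copair h1 h2 n U q (wmap f g n U q _)) wmap_r.
  exact: copair_r.
exact: copair_homotopic.
Qed.

Lemma id_stable X : stable_equivalence (spmap_id X).
Proof.
move=> E _ _; have e (u : spmap X E) : spmap_comp u (spmap_id X) = u by exact: spmap_eq.
by split=> [u v|u]; [rewrite !e|exists u; rewrite e; apply: rst_refl].
Qed.

Fixpoint zwl Z X Y (z : zigzag X Y) : zigzag (wedge X Z) (wedge Y Z) :=
  match z with
  | ZMap X Y f => ZMap (wmap f (spmap_id Z))
  | ZInv X Y f w => ZInv (wmap_stable w (@id_stable Z))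
  | ZComp X Y W g f => ZComp (zwl Z g) (zwl Z f)
  end.

Lemma wmap_comp X X' X'' Y Y' Y'' (f' : spmap X' X'') (f : spmap X X')
    (g' : spmap Y' Y'') (g : spmap Y Y') :
  wmap (spmap_comp f' f) (spmap_comp g' g) = spmap_comp (wmap f' g') (wmap f g).
Proof.
apply: spmap_eq => n U q; elim/wedge_ind => x.
  by rewrite wmap_l -[RHS]/(wmap f' g' n U q (wmap f g n U q _)) !wmap_l.
by rewrite wmap_r -[RHS]/(wmap f' g' n U q (wmap f g n U q _)) !wmap_r.
Qed.

Lemma wmap_id X Y : wmap (spmap_id X) (spmap_id Y) = spmap_id (wedge X Y).
Proof.
by apply: spmap_eq => n U q; elim/wedge_ind => x; rewrite ?wmap_l ?wmap_r.
Qed.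

Lemma spmap_comp1m X Y (f : spmap X Y) : spmap_comp (spmap_id Y) f = f.
Proof. exact: spmap_eq. Qed.

Lemma zwl_eq Z X Y (z z' : zigzag X Y) : zigzag_eq z z' -> zigzag_eq (zwl Z z) (zwl Z z').
Proof.
elim=> {X Y z z'} /=.
- by move=> *; apply: ZRefl.
- by move=> *; apply: ZSym.
- by move=> X Y z z' z'' _ h1 _ h2; apply: ZTrans h1 h2.
- by move=> *; apply: ZCongr.
- by move=> *; apply: ZAssoc.
- by move=> X Y f; rewrite wmap_id; apply: ZIdl.
- by move=> X Y f; rewrite wmap_id; apply: ZIdr.
- move=> X Y W g f; rewrite -[spmap_id Z]spmap_comp1m wmap_comp !spmap_comp1m.
  exact: ZMapComp.
- by move=> X Y f w; rewrite wmap_id; apply: ZInvl.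
- by move=> X Y f w; rewrite wmap_id; apply: ZInvr.
Qed.

Definition shl Z X Y (f : SH X Y) : SH (wedge X Z) (wedge Y Z) := zclass (zwl Z (zrepr f)).

Lemma shl_class Z X Y (z : zigzag X Y) : shl Z (zclass z) = zclass (zwl Z z).
Proof. by apply/zclassP/zwl_eq/zrepr_class. Qed.

Lemma shl_map Z X Y (f : spmap X Y) : shl Z (sh_map f) = sh_map (wmap f (spmap_id Z)).
Proof. exact: shl_class. Qed.

Lemma shl_comp Z X Y W (g : SH Y W) (f : SH X Y) :
  shl Z (sh_comp g f) = sh_comp (shl Z g) (shl Z f).
Proof. by rewrite -[g]zreprK -[f]zreprK sh_compE !shl_class sh_compE. Qed.

Lemma shl_id Z X : shl Z (sh_id X) = sh_id (wedge X Z).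
Proof. by rewrite shl_map wmap_id. Qed.

Lemma sh_ind (P : forall X Y, SH X Y -> Prop) :
  (forall X Y (f : spmap X Y), P X Y (sh_map f)) ->
  (forall X Y (f : SH X Y) (g : SH Y X), sh_inverse f g -> P X Y f -> P Y X g) ->
  (forall X Y Z (g : SH Y Z) (f : SH X Y), P Y Z g -> P X Y f -> P X Z (sh_comp g f)) ->
  forall X Y (f : SH X Y), P X Y f.
Proof.
move=> Pm Pi Pc X Y f; rewrite -[f]zreprK.
elim: (zrepr f) => {X Y f} [X Y f|X Y f w|X Y Z g Pg f Pf]; first exact: Pm.
  apply: (Pi _ _ (sh_map f)); last exact: Pm.
  by split; rewrite sh_compE; apply/zclassP; [apply: ZInvl|apply: ZInvr].
by rewrite -sh_compE; apply: Pc.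
Qed.

Definition wswap X Y : spmap (wedge X Y) (wedge Y X) := copair (winr Y X) (winl Y X).

Definition shr Z X Y (f : SH X Y) : SH (wedge Z X) (wedge Z Y) :=
  locked (sh_comp (sh_map (wswap Y Z)) (sh_comp (shl Z f) (sh_map (wswap Z X)))).

Lemma wswapK X Y : sh_comp (sh_map (wswap Y X)) (sh_map (wswap X Y)) = sh_id (wedge X Y).
Proof.
rewrite sh_map_comp; congr sh_map; apply: spmap_eq => n U q; elim/wedge_ind => x.
  rewrite -[LHS]/(wswap Y X n U q (wswap X Y n U q _)) [wswap X Y n U q _]copair_l.
  exact: copair_r.
rewrite -[LHS]/(wswap Y X n U q (wswap X Y n U q _)) [wswap X Y n U q _]copair_r.
exact: copair_l.
Qed.

Lemma shr_comp Z X Y W (g : SH Y W) (f : SH X Y) :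
  shr Z (sh_comp g f) = sh_comp (shr Z g) (shr Z f).
Proof.
rewrite /shr -!lock shl_comp -!sh_compA; do 2!congr sh_comp.
by rewrite !sh_compA wswapK sh_comp1m.
Qed.

Lemma shr_map Z X Y (f : spmap X Y) : shr Z (sh_map f) = sh_map (wmap (spmap_id Z) f).
Proof.
rewrite /shr -lock shl_map !sh_map_comp; congr sh_map.
apply: spmap_eq => n U q; elim/wedge_ind => x.
  rewrite wmap_l -[LHS]/(wswap Y Z n U q (wmap f _ n U q (wswap Z X n U q _))).
  by rewrite [wswap Z X n U q _]copair_l wmap_r; apply: copair_r.
rewrite wmap_r -[LHS]/(wswap Y Z n U q (wmap f _ n U q (wswap Z X n U q _))).
by rewrite [wswap Z X n U q _]copair_r wmap_l; apply: copair_l.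
Qed.

Lemma shr_id Z X : shr Z (sh_id X) = sh_id (wedge Z X).
Proof. by rewrite shr_map wmap_id. Qed.

(** Bifunctoriality is clear for maps of spectra; a double induction carries it to formal inverses,
    one variable at a time, by cancelling the inverted map. *)
Lemma shlr_comm X Y X' Y' (v : SH X Y) (u : SH X' Y') :
  sh_comp (shl Y' v) (shr X u) = sh_comp (shr Y u) (shl X' v).
Proof.
move: X' Y' u; elim/sh_ind: v => {X Y} [X Y v|X Y v v' [v'v vv'] IH|X Y Z w v IHw IHv] X' Y' u.
- elim/sh_ind: u => {X' Y'} [X' Y' u|X' Y' u u' [u'u uu'] IH|X' Y' Z u' u IHu' IHu].
  + rewrite !shl_map !shr_map !sh_map_comp -!wmap_comp !spmap_comp1m.
    by congr (sh_map (wmap _ _)); apply: spmap_eq.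
  + have ru W : sh_inverse (shr W u) (shr W u').
      by split; rewrite -shr_comp ?u'u ?uu' shr_id.
    apply: (sh_mono (g := shr Y u)); first by exists (shr Y u'); apply: ru.
    rewrite !sh_compA (proj2 (ru Y)) sh_comp1m -IH -sh_compA (proj2 (ru X)).
    by rewrite sh_compm1.
  + by rewrite !shr_comp sh_compA IHu' -sh_compA IHu sh_compA.
- have lv W : sh_inverse (shl W v) (shl W v').
    by split; rewrite -shl_comp ?v'v ?vv' shl_id.
  apply: (sh_epi (f := shl X' v)); first by exists (shl X' v'); apply: lv.
  rewrite -!sh_compA (proj1 (lv X')) sh_compm1 -IH.
  by rewrite sh_compA (proj1 (lv Y')) sh_comp1m.
- by rewrite !shl_comp -sh_compA IHv sh_compA IHw sh_compA.
Qed.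

Definition wfold X : spmap (wedge X X) X := copair (spmap_id X) (spmap_id X).

Lemma wfold_nat X Y (u : SH X Y) :
  sh_comp u (sh_map (wfold X)) = sh_comp (sh_map (wfold Y)) (sh_comp (shl Y u) (shr X u)).
Proof.
elim/sh_ind: u => {X Y} [X Y u|X Y u u' [u'u uu'] IH|X Y Z u' u IHu' IHu].
- rewrite shl_map shr_map !sh_map_comp; congr sh_map.
  apply: spmap_eq => n U q; elim/wedge_ind => x.
    rewrite -[RHS]/(wfold Y n U q (wmap u _ n U q (wmap _ u n U q _))) !wmap_l.
    by rewrite -[LHS]/(u n U q (wfold X n U q _)) !copair_l.
  rewrite -[RHS]/(wfold Y n U q (wmap u _ n U q (wmap _ u n U q _))) !wmap_r.
  by rewrite -[LHS]/(u n U q (wfold X n U q _)) !copair_r.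
- have iu : sh_iso u by exists u'.
  apply: (sh_mono iu); rewrite !sh_compA uu' sh_comp1m IH -!sh_compA (sh_compA (shr X u)).
  by rewrite -shlr_comm -!sh_compA -shr_comp uu' shr_id sh_compm1 -shl_comp uu' shl_id sh_compm1.
- rewrite -sh_compA IHu sh_compA IHu' !shl_comp !shr_comp -!sh_compA.
  congr sh_comp; congr sh_comp; rewrite !sh_compA; congr sh_comp.
  by rewrite shlr_comm.
Qed.

Lemma wfold_incl X Y :
  spmap_comp (wfold (wedge X Y)) (wmap (winl X Y) (winr X Y)) = spmap_id (wedge X Y).
Proof.
apply: spmap_eq => n U q; elim/wedge_ind => x.
  rewrite -[LHS]/(wfold _ n U q (wmap (winl X Y) (winr X Y) n U q (wl Y x))).
  by rewrite wmap_l /wfold copair_l.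
rewrite -[LHS]/(wfold _ n U q (wmap (winl X Y) (winr X Y) n U q (wr X x))).
by rewrite wmap_r /wfold copair_r.
Qed.

(** The identity of a wedge is the fold map after the wedge of the two inclusions. By naturality of
    folding in [SH], every [w] is the fold of its two restrictions. *)
Lemma wedge_epi X Y W (u v : SH (wedge X Y) W) :
  sh_comp u (sh_map (winl X Y)) = sh_comp v (sh_map (winl X Y)) ->
  sh_comp u (sh_map (winr X Y)) = sh_comp v (sh_map (winr X Y)) -> u = v.
Proof.
move=> el er.
suff E w : w = sh_comp (sh_map (wfold W)) (sh_comp (shl W (sh_comp w (sh_map (winl X Y))))
     (shr X (sh_comp w (sh_map (winr X Y))))) by rewrite (E u) (E v) el er.
rewrite -[LHS]sh_compm1 /sh_id -wfold_incl -sh_map_comp sh_compA wfold_nat.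
have -> : sh_map (wmap (winl X Y) (winr X Y)) =
    sh_comp (shl (wedge X Y) (sh_map (winl X Y))) (shr X (sh_map (winr X Y))).
  rewrite shl_map shr_map sh_map_comp -wmap_comp spmap_comp1m.
  by congr (sh_map (wmap _ _)); apply: spmap_eq.
rewrite shl_comp shr_comp -!sh_compA; congr sh_comp; congr sh_comp.
by rewrite !sh_compA; congr sh_comp; rewrite shlr_comm.
Qed.

End WedgeSH.

Section WedgeSpace.
Context (C : icat) (T : pspace C).
Context (W Y1 Y2 : pspace C) (i1 : pmap Y1 W) (i2 : pmap Y2 W) (p1 : pmap W Y1) (p2 : pmap W Y2).

(** Formulated with retractions, the property is checked on elements and is inherited by smash
    products. *)
Record is_wedge : Prop := IsWedge {
  wedge_p1i1 : forall U n y, p1 U n (i1 U n y) = y;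
  wedge_p2i2 : forall U n y, p2 U n (i2 U n y) = y;
  wedge_p1i2 : forall U n y, p1 U n (i2 U n y) = bpt Y1 U n;
  wedge_p2i1 : forall U n y, p2 U n (i1 U n y) = bpt Y2 U n;
  wedge_cover : forall U n w, i1 U n (p1 U n w) = w \/ i2 U n (p2 U n w) = w }.

Context (iw : is_wedge).

Lemma wedge_split_axes n U q (z : susp T W n U q) :
  in_axes (X := susp T Y1) (Y := susp T Y2) (susp_map T p1 n U q z, susp_map T p2 n U q z).
Proof.
elim/susp_ind: z => t w; rewrite /= !susp_map_cl.
case: (wedge_cover iw w) => ew; [right|left]; apply: susp_cl_bpt; right; rewrite -ew.
  exact: wedge_p2i1.
exact: wedge_p1i2.
Qed.

Definition wedge_split_fun n U q (z : susp T W n U q) : wedge (susp T Y1) (susp T Y2) n U q :=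
  exist (@in_axes _ _ (susp T Y1) (susp T Y2) n U q)
     (susp_map T p1 n U q z, susp_map T p2 n U q z) (wedge_split_axes z).

Lemma wedge_split_res n (U V : C) (q r : nat) (h : ihom V U) (s : mono r q) (z : susp T W n U q) :
  wedge_split_fun (sres h s z) = sres h s (wedge_split_fun z).
Proof.
apply: subp_eq.
exact: (f_equal2 pair (smapE (susp_map T p1 n) h s z) (smapE (susp_map T p2 n) h s z)).
Qed.

Lemma wedge_split_bpt n U q :
  wedge_split_fun (bpt (susp T W n) U q) = bpt (wedge (susp T Y1) (susp T Y2) n) U q.
Proof.
apply: subp_eq.
exact: (f_equal2 pair (pmap_bpt (susp_map T p1 n) U q) (pmap_bpt (susp_map T p2 n) U q)).
Qed.

Lemma wedge_split_act m n (a : inj m n) U q (t : 'I_n -> T U q) (z : susp T W m U q) :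
  wedge_split_fun (act a t z) = act a t (wedge_split_fun z).
Proof.
apply: subp_eq.
exact: (f_equal2 pair (spmapE (susp_map T p1) a t z) (spmapE (susp_map T p2) a t z)).
Qed.

Definition wedge_split : spmap (susp T W) (wedge (susp T Y1) (susp T Y2)) :=
  @SpMap C T (susp T W) (wedge (susp T Y1) (susp T Y2))
    (fun n => @PMap _ (susp T W n) (wedge (susp T Y1) (susp T Y2) n)
       (SMap (@wedge_split_res n)) (@wedge_split_bpt n)) wedge_split_act.

Definition wedge_join : spmap (wedge (susp T Y1) (susp T Y2)) (susp T W) :=
  copair (susp_map T i1) (susp_map T i2).

Lemma wedge_splitK : spmap_comp wedge_join wedge_split = spmap_id (susp T W).
Proof.
apply: spmap_eq => n U q; apply: susp_ind => t w.
rewrite -[LHS]/(wedge_join n U q (wedge_split_fun (susp_cl t w))).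
case: (wedge_cover iw w) => ew.
  have -> : wedge_split_fun (susp_cl t w) = wl (X := susp T Y1) (susp T Y2) (susp_cl (X := Y1) t (p1 U q w)).
    apply: subp_eq; rewrite /= !susp_map_cl; congr pair; apply: susp_cl_bpt; right.
    by rewrite -ew; apply: wedge_p2i1.
  by rewrite /wedge_join copair_l /= susp_map_cl ew.
have -> : wedge_split_fun (susp_cl t w) = wr (Y := susp T Y2) (susp T Y1) (susp_cl (X := Y2) t (p2 U q w)).
  apply: subp_eq; rewrite /= !susp_map_cl; congr pair; apply: susp_cl_bpt; right.
  by rewrite -ew; apply: wedge_p1i2.
by rewrite /wedge_join copair_r /= susp_map_cl ew.
Qed.

Lemma wedge_join_l : spmap_comp wedge_join (winl _ _) = susp_map T i1.
Proof. by apply: spmap_eq => n U q x; apply: copair_l. Qed.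

Lemma wedge_join_r : spmap_comp wedge_join (winr _ _) = susp_map T i2.
Proof. by apply: spmap_eq => n U q x; apply: copair_r. Qed.

End WedgeSpace.

Section WedgeSpaceSH.
Context (k : comPzRingType) (W Y1 Y2 : pspace (Sm k)).
Context (i1 : pmap Y1 W) (i2 : pmap Y2 W) (p1 : pmap W Y1) (p2 : pmap W Y2).
Context (iw : is_wedge i1 i2 p1 p2).
Notation T := (Tsph k).

Lemma wedge_space_epi (Z : mspec k) (u v : SH (susp T W) Z) :
  sh_comp u (sg i1) = sh_comp v (sg i1) -> sh_comp u (sg i2) = sh_comp v (sg i2) -> u = v.
Proof.
move=> e1 e2; pose j := wedge_join T i1 i2.
suff e : sh_comp u (sh_map j) = sh_comp v (sh_map j).
  by rewrite -[u]sh_compm1 -[v]sh_compm1 /sh_id -(wedge_splitK T iw) -sh_map_comp !sh_compA e.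
by apply: wedge_epi; rewrite -!sh_compA !sh_map_comp ?wedge_join_l ?wedge_join_r.
Qed.

(** This ties the abstract addition to geometry: on each summand one of the two composites restricts
    to the inclusion and the other one is null. *)
Lemma wedge_biproduct (A : additive_structure k) :
  sh_add A (sh_comp (sg i1) (sg p1)) (sh_comp (sg i2) (sg p2)) = sh_id _.
Proof.
have e11 : pmap_comp p1 i1 = pmap_id Y1 by apply: pmap_eq => U n y; apply: (wedge_p1i1 iw).
have e22 : pmap_comp p2 i2 = pmap_id Y2 by apply: pmap_eq => U n y; apply: (wedge_p2i2 iw).
have e12 : pmap_comp p1 i2 = pmap_const Y2 Y1 by apply: pmap_eq => U n y; apply: (wedge_p1i2 iw).
have e21 : pmap_comp p2 i1 = pmap_const Y1 Y2 by apply: pmap_eq => U n y; apply: (wedge_p2i1 iw).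
apply: wedge_space_epi; rewrite sh_addr -!sh_compA.
  rewrite -(sg_comp p1 i1) -(sg_comp p2 i1) e11 e21.
  by rewrite sg_id sg_const sh_compm1 sh_comp1m sh_nullR (sh_null_zero A) sh_addr0.
rewrite -(sg_comp p1 i2) -(sg_comp p2 i2) e12 e22.
by rewrite sg_id sg_const sh_compm1 sh_comp1m sh_nullR (sh_null_zero A) sh_add0.
Qed.

End WedgeSpaceSH.

(** * Smash products and scalars *)

Section SmashMaps.
Context (C : icat).

Lemma smash_ind (X Y : pspace C) U n (P : smash X Y U n -> Prop) :
  (forall x y, P (smash_pair x y)) -> forall z, P z.
Proof.
move=> h z; have [[x y] <-] := quot_surj (smash_quot (quot_id X) (quot_id Y)) z.
exact: h.
Qed.

Section SmashMap.
Context (X X' Y Y' : pspace C) (f : pmap X X') (g : pmap Y Y').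

Lemma smash_pmap_subproof U n (r : sprod X Y U n) :
  is_bpt r.1 \/ is_bpt r.2 -> smash_map0 f g U n r = bpt (smash X' Y') U n.
Proof. by case=> /= ->; apply: smash_pair_bpt; rewrite pmap_bpt; [left|right]. Qed.

Definition smash_pmap : pmap (smash X Y) (smash X' Y') :=
  qmap (smash_quot (quot_id X) (quot_id Y)) smash_pmap_subproof.

Lemma smash_pmapE U n (x : X U n) (y : Y U n) :
  smash_pmap U n (smash_pair x y) = smash_pair (f U n x) (g U n y).
Proof. exact: (qmapE (smash_quot (quot_id X) (quot_id Y)) smash_pmap_subproof (x, y)). Qed.

End SmashMap.

Lemma smash_pmap_comp (X X' X'' Y Y' Y'' : pspace C) (f' : pmap X' X'') (f : pmap X X')
    (g' : pmap Y' Y'') (g : pmap Y Y') :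
  smash_pmap (pmap_comp f' f) (pmap_comp g' g) =
  pmap_comp (smash_pmap f' g') (smash_pmap f g).
Proof.
by apply: pmap_eq => U n; apply: smash_ind => x y; rewrite /= !smash_pmapE.
Qed.

Section SmashTwist.
Context (X Y : pspace C).

Definition smash_swap0 : smap (sprod X Y) (smash Y X) :=
  @SMap C (sprod X Y) (smash Y X) (fun U n r => smash_pair r.2 r.1)
    (fun U V m n f s r => esym (smash_pairE f s r.2 r.1)).

Lemma smash_tw_subproof U n (r : sprod X Y U n) :
  is_bpt r.1 \/ is_bpt r.2 -> smash_swap0 U n r = bpt (smash Y X) U n.
Proof. by case=> e; apply: smash_pair_bpt; [right|left]. Qed.

Definition smash_tw : pmap (smash X Y) (smash Y X) :=
  qmap (smash_quot (quot_id X) (quot_id Y)) smash_tw_subproof.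

Lemma smash_twE U n (x : X U n) (y : Y U n) :
  smash_tw U n (smash_pair x y) = smash_pair y x.
Proof. exact: (qmapE (smash_quot (quot_id X) (quot_id Y)) smash_tw_subproof (x, y)). Qed.

End SmashTwist.

Section SmashInterchange.
Context (X Y Z W : pspace C).

Let q4 := smash_quot (smash_quot (quot_id X) (quot_id Y)) (smash_quot (quot_id Z) (quot_id W)).

Definition smash_mid0 : smap (sprod (sprod X Y) (sprod Z W)) (smash (smash X Z) (smash Y W)) :=
  @SMap C (sprod (sprod X Y) (sprod Z W)) (smash (smash X Z) (smash Y W))
    (fun U n r => smash_pair (smash_pair r.1.1 r.2.1) (smash_pair r.1.2 r.2.2))
    (fun U V m n f s r => etrans (congr2 (fun a b => smash_pair a b)
       (esym (smash_pairE f s r.1.1 r.2.1)) (esym (smash_pairE f s r.1.2 r.2.2)))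
       (esym (smash_pairE f s (smash_pair r.1.1 r.2.1) (smash_pair r.1.2 r.2.2)))).

Lemma smash_mid_subproof U n (r : sprod (sprod X Y) (sprod Z W) U n) :
  (is_bpt r.1.1 \/ is_bpt r.1.2) \/ (is_bpt r.2.1 \/ is_bpt r.2.2) ->
  smash_mid0 U n r = bpt (smash (smash X Z) (smash Y W)) U n.
Proof.
case=> [[|]|[|]] e; apply: smash_pair_bpt.
- by left; apply: smash_pair_bpt; left.
- by right; apply: smash_pair_bpt; left.
- by left; apply: smash_pair_bpt; right.
- by right; apply: smash_pair_bpt; right.
Qed.

Definition smash_mid : pmap (smash (smash X Y) (smash Z W)) (smash (smash X Z) (smash Y W)) :=
  qmap q4 smash_mid_subproof.

Lemma smash_midE U n (x : X U n) (y : Y U n) (z : Z U n) (w : W U n) :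
  smash_mid U n (smash_pair (smash_pair x y) (smash_pair z w)) =
  smash_pair (smash_pair x z) (smash_pair y w).
Proof. exact: (qmapE q4 smash_mid_subproof ((x, y), (z, w))). Qed.

End SmashInterchange.

Lemma smash_midK (X Y Z W : pspace C) :
  pmap_comp (smash_mid X Z Y W) (smash_mid X Y Z W) = pmap_id _.
Proof.
apply: pmap_eq => U n; apply: smash_ind => xy zw.
elim/smash_ind: xy => x y; elim/smash_ind: zw => z w.
by rewrite /= !smash_midE.
Qed.

Section SmashUnit.
Context (Y : pspace C).

Definition unitor0 : smap (sprod Y (S0 C)) Y :=
  @SMap C (sprod Y (S0 C)) Y (fun U n r => if r.2 then r.1 else bpt Y U n)
    (fun U V m n f s r => match r.2 as b return
       (if b then sres f s r.1 else bpt Y V n) = sres f s (if b then r.1 else bpt Y U m)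
       with true => erefl | false => esym (sres_bpt Y f s) end).

Lemma unitor_subproof U n (r : sprod Y (S0 C) U n) :
  is_bpt r.1 \/ is_bpt r.2 -> unitor0 U n r = bpt Y U n.
Proof. by case: r => y b /= [->|->] //; case: b. Qed.

Definition runit : pmap (smash Y (S0 C)) Y :=
  qmap (smash_quot (quot_id Y) (quot_id (S0 C))) unitor_subproof.

Lemma runitE U n (y : Y U n) (b : bool) :
  runit U n (@smash_pair C Y (S0 C) U n y b) = if b then y else bpt Y U n.
Proof. exact: (qmapE (smash_quot (quot_id Y) (quot_id (S0 C))) unitor_subproof (y, b)). Qed.

Definition lunit : pmap (smash (S0 C) Y) Y := pmap_comp runit (smash_tw (S0 C) Y).

Lemma lunitE U n (y : Y U n) (b : bool) :
  lunit U n (@smash_pair C (S0 C) Y U n b y) = if b then y else bpt Y U n.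
Proof. by rewrite /= smash_twE runitE. Qed.

Definition rpair : pmap Y (smash Y (S0 C)) :=
  @PMap C Y (smash Y (S0 C)) (@SMap C Y (smash Y (S0 C))
    (fun U n y => @smash_pair C Y (S0 C) U n y true)
    (fun U V m n f s y => esym (@smash_pairE C Y (S0 C) U V m n f s y true)))
    (fun U n => smash_pair_bpt (or_introl erefl)).

Lemma rpairK : pmap_comp rpair runit = pmap_id _.
Proof.
apply: pmap_eq => U n; apply: smash_ind => y b; rewrite /= runitE.
by case: b => //=; rewrite !smash_pair_bpt //; [right|left].
Qed.

Definition lpair : pmap Y (smash (S0 C) Y) := pmap_comp (smash_tw Y (S0 C)) rpair.

Lemma lpairE U n y : lpair U n y = @smash_pair C (S0 C) Y U n true y.
Proof. by rewrite /= smash_twE. Qed.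

Lemma lunitK : pmap_comp lunit lpair = pmap_id Y.
Proof. by apply: pmap_eq => U n y; rewrite /= !smash_twE runitE. Qed.

Lemma lpairK : pmap_comp lpair lunit = pmap_id _.
Proof.
apply: pmap_eq => U n; apply: smash_ind => b y.
rewrite -[LHS]/(lpair U n (lunit U n _)) lpairE lunitE.
by case: b => //=; rewrite !smash_pair_bpt //; [left|right].
Qed.

End SmashUnit.

Lemma susp_cl_unit (T X : pspace C) n U q (t : 'I_n -> T U q) (x : X U q) :
  susp_cl t x = @act C T (susp T X) 0 n (inj0 n) U q t (susp_unit T X U q x).
Proof.
rewrite [RHS]susp_actE; congr susp_cl; apply/funext => j.
by rewrite extend_out // => i; apply: inj0_out.
Qed.

Section Universal.
Context (T X Y : pspace C).

Lemma susp_bimor_unit U q (x : X U q) (y : Y U q) :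
  susp_bimor T X Y 0 0 U q (susp_unit T X U q x) (susp_unit T Y U q y) =
  susp_unit T (smash X Y) U q (smash_pair x y).
Proof. by rewrite /= susp_bimor_cl; congr susp_cl; apply/funext => -[]. Qed.

(** The structure maps generate a suspension spectrum from level 0, so a bimorphism is determined by
    its component at levels [(0, 0)], which is a pointed map out of [X /\ Y]. *)
Lemma susp_bimor_universal : universal_bimor (susp_bimor T X Y).
Proof.
move=> W c.
pose phi : smap (sprod X Y) (W 0%N) := @SMap C (sprod X Y) (W 0%N)
  (fun U q r => c 0%N 0%N U q (susp_unit T X U q r.1) (susp_unit T Y U q r.2))
  (fun U V m n f s r => etrans (congr2 (fun a b => c 0%N 0%N V n a b)
     (smapE (susp_unit T X) f s r.1) (smapE (susp_unit T Y) f s r.2))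
     (bim_res c f s (susp_unit T X U m r.1) (susp_unit T Y U m r.2))).
have qs := smash_quot (quot_id X) (quot_id Y).
have [|a aE] := quot_lift qs (phi := phi).
  move=> U q [x y] /= [->|->].
    have -> : susp_cl (fun=> bpt T U q) (bpt X U q) = bpt (susp T X 0) U q.
      exact: (pmap_bpt (susp_unit T X)).
    exact: (@bim_bptl _ _ _ _ _ c 0%N 0%N U q (susp_unit T Y U q y)).
  have -> : susp_cl (fun=> bpt T U q) (bpt Y U q) = bpt (susp T Y 0) U q.
    exact: (pmap_bpt (susp_unit T Y)).
  exact: (@bim_bptr _ _ _ _ _ c 0%N 0%N U q (susp_unit T X U q x)).
exists (ext a); split.
  move=> m n U q; apply: susp_ind => t x; apply: susp_ind => s y.
  rewrite (susp_cl_unit t x) (susp_cl_unit s y) !bim_act spmapE; congr (act _ _ _).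
  rewrite (susp_bimor_unit x y).
  have -> : ext a (0 + 0)%N U q (susp_unit T (smash X Y) U q (smash_pair x y)) =
            adj (ext a) U q (smash_pair x y) by [].
  by rewrite adj_ext (aE _ _ (x, y)).
move=> h hE; apply: spmap_eq => n U q; apply: susp_ind => t z.
elim/smash_ind: z => x y; rewrite extE spmap_susp_cl; congr act.
by rewrite (aE _ _ (x, y)) /= -hE susp_bimor_unit.
Qed.

End Universal.
End SmashMaps.

Notation "g \c f" := (sh_comp g f) (at level 50, left associativity).

Lemma susp_mapE (C : icat) (T X Y : pspace C) (f : pmap X Y) n U q (t : 'I_n -> T U q) x :
  susp_map T f n U q (susp_cl t x) = susp_cl t (f U q x).
Proof. exact: susp_map_cl. Qed.

Lemma susp_bimorE (C : icat) (T X Y : pspace C) m n U q (t : 'I_m -> T U q) (x : X U q)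
    (s : 'I_n -> T U q) (y : Y U q) :
  susp_bimor T X Y m n U q (susp_cl t x) (susp_cl s y) =
  susp_cl (X := smash X Y) (family_cat t s) (smash_pair x y).
Proof. exact: susp_bimor_cl. Qed.

Lemma relabel_susp (C : icat) (T X : pspace C) m n (a : inj m n) U q (t : 'I_m -> T U q) x :
  relabel (X := susp T X) a (susp_cl t x) = susp_cl (extend a t (fun _ => bpt T U q)) x.
Proof. exact: susp_actE. Qed.

Section SmashSH.
Context (k : comPzRingType) (M : smash_structure k).
Notation T := (Tsph k).
Notation "[ 'S' X ]" := (susp T X) (format "[ 'S'  X ]").
Notation "f \s g" := (smf M f g) (at level 40, left associativity).
Notation I := (sphere_spectrum k).
Notation idm X := (sh_id X).
Implicit Types A B D X Y : mspec k.

(** The lift is found at level 0, relative to the inclusion of the base point, which makes it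
    pointed; adjunction extends it to all levels. *)
Lemma cofibrant_susp (X : pspace (Sm k)) : cofibrant_spectrum [S X].
Proof.
move=> E B p plift b.
pose i : smap (spt k) X := @SMap (Sm k) (spt k) X (fun U n _ => bpt X U n)
  (fun U V m n f s _ => esym (sres_bpt X f s)).
pose a : smap (spt k) (E 0%N) := @SMap (Sm k) (spt k) (E 0%N) (fun U n _ => bpt (E 0%N) U n)
  (fun U V m n f s _ => esym (sres_bpt (E 0%N) f s)).
have mi : monic i by move=> U n [] [].
have [|h [ha hb]] := plift 0%N _ _ i mi a (adj b).
  apply: smap_eq => U n x; rewrite -[LHS]/(p 0%N U n (bpt _ U n)).
  by rewrite -[RHS]/(adj b U n (bpt X U n)) !pmap_bpt.
have h0 U n : h U n (bpt X U n) = bpt (E 0%N) U n.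
  by have := congr1 (fun f : smap (spt k) (E 0%N) => f U n tt) ha.
exists (ext (PMap h0)); apply: spmap_eq => n U q; apply: susp_ind => t x.
rewrite -[LHS]/(p n U q (ext _ n U q _)) extE spmapE spmap_susp_cl; congr act.
by have := congr1 (fun f : smap X (B 0%N) => f U q x) hb.
Qed.

Lemma susp_smash_iso (X Y : pspace (Sm k)) : sh_iso (susp_smash M X Y).
Proof.
rewrite /susp_smash; apply: sm_bim_iso; [exact: cofibrant_susp|exact: cofibrant_susp|].
exact: susp_bimor_universal.
Qed.

Lemma smf_comp1 A B D X (g : SH B D) (f : SH A B) :
  (g \c f) \s idm X = (g \s idm X) \c (f \s idm X).
Proof. by rewrite -smf_comp sh_comp1m. Qed.

Lemma smf_1comp A B D X (g : SH B D) (f : SH A B) :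
  idm X \s (g \c f) = (idm X \s g) \c (idm X \s f).
Proof. by rewrite -smf_comp sh_comp1m. Qed.

Lemma smf_split A B X Y (f : SH A B) (g : SH X Y) : f \s g = (f \s idm Y) \c (idm A \s g).
Proof. by rewrite -smf_comp sh_comp1m sh_compm1. Qed.

Lemma smf_split' A B X Y (f : SH A B) (g : SH X Y) : f \s g = (idm B \s g) \c (f \s idm X).
Proof. by rewrite -smf_comp sh_comp1m sh_compm1. Qed.

Lemma smf_iso A B X Y (f : SH A B) (g : SH X Y) : sh_iso f -> sh_iso g -> sh_iso (f \s g).
Proof.
move=> [f' [f'f ff']] [g' [g'g gg']]; exists (f' \s g').
by split; rewrite -smf_comp ?f'f ?g'g ?ff' ?gg' smf_id.
Qed.

Lemma twist_iso A B : sh_iso (sm_twist M A B).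
Proof. by exists (sm_twist M B A); split; apply: sm_twistK. Qed.

Lemma susp_smash_nat (X X' Y Y' : pspace (Sm k)) (f : pmap X X') (g : pmap Y Y') :
  sg (smash_pmap f g) \c susp_smash M X Y = susp_smash M X' Y' \c (sg f \s sg g).
Proof.
apply: sm_bim_nat => m n U q; apply: susp_ind => t x; apply: susp_ind => s y.
by rewrite (susp_bimorE t x s y) !susp_mapE susp_bimorE smash_pmapE.
Qed.

Lemma sg_smashE (X X' Y Y' : pspace (Sm k)) (f : pmap X X') (g : pmap Y Y') :
  sg (smash_pmap f g) = susp_smash M X' Y' \c (sg f \s sg g) \c sh_inv (susp_smash M X Y).
Proof.
by rewrite -susp_smash_nat -sh_compA sh_mulmV ?sh_compm1 //; apply: susp_smash_iso.
Qed.

Lemma sg_smash_congr (X X' Y Y' : pspace (Sm k)) (f f' : pmap X X') (g g' : pmap Y Y') :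
  sg f = sg f' -> sg g = sg g' -> sg (smash_pmap f g) = sg (smash_pmap f' g').
Proof. by rewrite !sg_smashE => -> ->. Qed.

Lemma sg_smash_iso (X X' Y Y' : pspace (Sm k)) (f : pmap X X') (g : pmap Y Y') :
  sh_iso (sg f) -> sh_iso (sg g) -> sh_iso (sg (smash_pmap f g)).
Proof.
move=> fi gi; rewrite sg_smashE; apply: sh_iso_comp; last exact/sh_iso_inv/susp_smash_iso.
by apply: sh_iso_comp; [apply: susp_smash_iso|apply: smf_iso].
Qed.

Section Post.
Context (X Y Z Z' : mspec k) (h : spmap Z Z') (b : bimor X Y Z).

(** Moving a map of the target into the bimorphism reduces the symmetry and the units of suspension
    spectra to the corresponding fields of the smash structure. *)
Definition bim_post : bimor X Y Z' :=
  @Bimor _ _ X Y Z' (fun m n U q x y => h (m + n)%N U q (b m n U q x y))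
    (fun m n U V q r f s x y => etrans (congr1 (h (m + n)%N V r) (bim_res b f s x y))
       (smapE (h (m + n)%N) f s _))
    (fun m n U q y => etrans (congr1 (h (m + n)%N U q) (bim_bptl b m y)) (pmap_bpt (h (m + n)%N) U q))
    (fun m n U q x => etrans (congr1 (h (m + n)%N U q) (bim_bptr b n x)) (pmap_bpt (h (m + n)%N) U q))
    (fun m n m' n' a a' U q t s x y => etrans (congr1 (h _ U q) (bim_act b a a' t s x y))
       (spmapE h (inj_sum a a') (family_cat t s) (b m m' U q x y))).

Lemma sm_bim_post : sm_bim M bim_post = sh_map h \c sm_bim M b.
Proof.
have := @sm_bim_nat k M X X Y Y Z Z' b bim_post (spmap_id X) (spmap_id Y) h.
by rewrite -!/(sh_id _) smf_id sh_compm1 => -> // m n U q x y.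
Qed.

End Post.

Lemma split_swap m n (j : 'I_(n + m)) : inj_swap m n (inj_swap n m j) = j.
Proof.
rewrite -[in RHS](splitK j) /=.
by case: (split j) => i /=; rewrite ?(unsplitK (inr _ i)) ?(unsplitK (inl _ i)).
Qed.

Lemma susp_smash_twist (X Y : pspace (Sm k)) :
  susp_smash M X Y = sg (smash_tw Y X) \c susp_smash M Y X \c sm_twist M [S X] [S Y].
Proof.
rewrite /sg -sm_bim_post; apply: sm_bim_twist => m n U q.
apply: susp_ind => t x; apply: susp_ind => s y.
rewrite -[RHS]/(susp_map T _ _ _ _ (susp_bimor T _ _ _ _ _ _ _ _)).
rewrite !susp_bimorE relabel_susp susp_mapE smash_twE; congr susp_cl.
apply/funext => j; rewrite -{1}(split_swap j) extend_im /family_cat /=.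
by case: (split j) => i; rewrite ?(unsplitK (inr _ i)) ?(unsplitK (inl _ i)).
Qed.

Lemma twist_sg (X : pspace (Sm k)) :
  sm_twist M [S X] [S X] = sh_inv (susp_smash M X X) \c sg (smash_tw X X) \c susp_smash M X X.
Proof.
apply: (sh_mono (susp_smash_iso X X)); rewrite !sh_compA (sh_mulmV (susp_smash_iso X X)) sh_comp1m.
rewrite {2}susp_smash_twist !sh_compA -sg_comp.
suff -> : pmap_comp (smash_tw X X) (smash_tw X X) = pmap_id _ by rewrite sg_id sh_comp1m.
by apply: pmap_eq => U n; apply: smash_ind => x y; rewrite /= !smash_twE.
Qed.

Lemma susp_smash_runit (X : pspace (Sm k)) :
  sg (runit X) \c susp_smash M X (S0 (Sm k)) = sm_unitr M [S X].
Proof.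
rewrite /sg -sm_bim_post; apply: sm_bim_unitr => n U q; apply: susp_ind => t x.
rewrite -[LHS]/(susp_map T _ _ _ _ (susp_bimor T _ _ _ _ _ _ _ _)).
rewrite relabel_susp susp_bimorE susp_mapE runitE; congr susp_cl.
apply/funext => j; have -> : j = inj_cast (esym (addn0 n)) (cast_ord (addn0 n) j).
  exact: val_inj.
rewrite extend_im /family_cat; case: splitP => [i e|[]//].
by congr t; apply: val_inj; rewrite /= -e.
Qed.

Lemma susp_smash_lunit (X : pspace (Sm k)) :
  sg (lunit X) \c susp_smash M (S0 (Sm k)) X = sm_unitl M [S X].
Proof.
rewrite /sg -sm_bim_post; apply: sm_bim_unitl => n U q; apply: susp_ind => t x.
rewrite -[LHS]/(susp_map T _ _ _ _ (susp_bimor T _ _ _ _ _ _ _ _)).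
rewrite susp_bimorE susp_mapE lunitE; congr susp_cl.
apply/funext => j; rewrite /family_cat; case: splitP => [[]//|i e].
by congr t; apply: val_inj; rewrite /= e.
Qed.

Lemma sg_rpair (X : pspace (Sm k)) :
  sg (rpair X) = susp_smash M X (S0 (Sm k)) \c sh_inv (sm_unitr M [S X]).
Proof.
apply: (sh_epi (sm_unitr_iso M [S X])); rewrite -[RHS]sh_compA (sh_mulVm (sm_unitr_iso M [S X])).
by rewrite sh_compm1 -susp_smash_runit sh_compA -sg_comp rpairK sg_id sh_comp1m.
Qed.

Lemma sg_lpair (X : pspace (Sm k)) :
  sg (lpair X) = susp_smash M (S0 (Sm k)) X \c sh_inv (sm_unitl M [S X]).
Proof.
apply: (sh_epi (sm_unitl_iso M [S X])); rewrite -[RHS]sh_compA (sh_mulVm (sm_unitl_iso M [S X])).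
by rewrite sh_compm1 -susp_smash_lunit sh_compA -sg_comp lpairK sg_id sh_comp1m.
Qed.

(** * Scalars and invertible objects *)

Section Unitors.
Notation l := (sm_unitl M).
Notation r := (sm_unitr M).
Notation a := (sm_assoc M).

Lemma unitl_faithful A B (f g : SH A B) : idm I \s f = idm I \s g -> f = g.
Proof.
move=> e; apply: (sh_epi (sm_unitl_iso M A)).
by rewrite -!sm_unitl_nat e.
Qed.

(* Kelly's argument: the identity is checked after smashing with the unit. *)
Lemma unitl_assoc A B : l (sm M A B) \c a I A B = l A \s idm B.
Proof.
apply: unitl_faithful; rewrite smf_1comp.
have i1 : sh_iso (a I (sm M I A) B) by apply: sm_assoc_iso.
have i2 : sh_iso (a I I A \s idm B) by apply: smf_iso; [apply: sm_assoc_iso|apply: sh_iso_id].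
apply: (sh_epi i1); apply: (sh_epi i2).
have := sm_pentagon M I I A B; rewrite !sh_compA => P.
have := sm_triangle M I (sm M A B) => Tr1.
rewrite -[_ \c (idm I \s a I A B) \c _]sh_compA -[_ \c _ \c (a I I A \s idm B)]sh_compA -P.
rewrite sh_compA Tr1 -sm_assoc_nat -[RHS]sh_compA -smf_comp1 sm_triangle sm_assoc_nat.
by rewrite smf_id.
Qed.

(** Endomorphisms of the unit act on every object, naturally and compatibly with smash products: on
    [A /\ B] it does not matter which factor carries the scalar. *)
Definition scal (s : SH I I) A : SH A A := locked (l A \c (s \s idm A) \c sh_inv (l A)).

Lemma scalE s A : scal s A \c l A = l A \c (s \s idm A).
Proof. by rewrite /scal -lock -sh_compA sh_mulVm ?sh_compm1 //; apply: sm_unitl_iso. Qed.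

Lemma scal_nat s A B (f : SH A B) : f \c scal s A = scal s B \c f.
Proof.
apply: (sh_epi (sm_unitl_iso M A)); rewrite -!sh_compA scalE -sm_unitl_nat !sh_compA scalE.
rewrite -sm_unitl_nat -!sh_compA; congr sh_comp.
by rewrite -!smf_comp !sh_comp1m !sh_compm1.
Qed.

Lemma scal_comp s t A : scal s A \c scal t A = scal (s \c t) A.
Proof.
apply: (sh_epi (sm_unitl_iso M A)); rewrite scalE smf_comp1 -sh_compA scalE.
by rewrite sh_compA scalE !sh_compA.
Qed.

Lemma scal_id A : scal (idm I) A = idm A.
Proof. by apply: (sh_epi (sm_unitl_iso M A)); rewrite scalE smf_id sh_compm1 sh_comp1m. Qed.

Lemma scal_smL s A B : scal s A \s idm B = scal s (sm M A B).
Proof.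
have i : sh_iso (l A \s idm B) by apply: smf_iso; [apply: sm_unitl_iso|apply: sh_iso_id].
apply: (sh_epi i); rewrite -smf_comp1 scalE smf_comp1 -unitl_assoc sh_compA scalE.
by rewrite -!sh_compA sm_assoc_nat smf_id.
Qed.

Lemma scal_smR s A B : idm A \s scal s B = scal s (sm M A B).
Proof.
apply: (sh_mono (twist_iso A B)).
by rewrite sm_twist_nat scal_smL scal_nat.
Qed.

Definition sh_isomorphic A B : Prop := exists f : SH A B, sh_iso f.

Lemma isomorphic_sym A B : sh_isomorphic A B -> sh_isomorphic B A.
Proof. by case=> f i; exists (sh_inv f); apply: sh_iso_inv. Qed.

Lemma isomorphic_trans A B D : sh_isomorphic A B -> sh_isomorphic B D -> sh_isomorphic A D.
Proof. by move=> [f fi] [g gi]; exists (g \c f); apply: sh_iso_comp. Qed.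

Lemma isomorphic_refl A : sh_isomorphic A A.
Proof. by exists (idm A); apply: sh_iso_id. Qed.

Lemma isomorphic_sm A B X Y : sh_isomorphic A B -> sh_isomorphic X Y ->
  sh_isomorphic (sm M A X) (sm M B Y).
Proof. by move=> [f fi] [g gi]; exists (f \s g); apply: smf_iso. Qed.

Lemma isomorphic_assoc A B D : sh_isomorphic (sm M (sm M A B) D) (sm M A (sm M B D)).
Proof. by exists (a A B D); apply: sm_assoc_iso. Qed.

Lemma isomorphic_twist A B : sh_isomorphic (sm M A B) (sm M B A).
Proof. by exists (sm_twist M A B); apply: twist_iso. Qed.

Definition invertible A : Prop := exists B, sh_isomorphic (sm M A B) I.

Lemma invertible_iso A B : sh_isomorphic A B -> invertible A -> invertible B.
Proof.
move=> AB [D AD]; exists D; apply: isomorphic_trans AD.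
by apply: isomorphic_sm; [apply: isomorphic_sym|apply: isomorphic_refl].
Qed.

Lemma invertible_sm A B : invertible A -> invertible B -> invertible (sm M A B).
Proof.
move=> [A' AA'] [B' BB']; exists (sm M B' A').
apply: isomorphic_trans (isomorphic_assoc _ _ _) _; apply: isomorphic_trans AA'.
apply: isomorphic_sm; first exact: isomorphic_refl.
apply: isomorphic_trans (isomorphic_sym (isomorphic_assoc _ _ _)) _.
apply: isomorphic_trans (isomorphic_sm BB' (isomorphic_refl _)) _.
by exists (l A'); apply: sm_unitl_iso.
Qed.

Lemma invertible_factor A B : invertible (sm M A B) -> invertible B.
Proof.
move=> [D e]; exists (sm M A D); apply: isomorphic_trans e.
apply: isomorphic_trans (isomorphic_sym (isomorphic_assoc _ _ _)) _.
by apply: isomorphic_sm; [apply: isomorphic_twist|apply: isomorphic_refl].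
Qed.

Lemma invertible_inverse A B : sh_isomorphic (sm M A B) I -> invertible B.
Proof. by move=> e; exists A; apply: isomorphic_trans (isomorphic_twist _ _) e. Qed.

Lemma sm_cancel A X Y (f g : SH X Y) : invertible A -> f \s idm A = g \s idm A -> f = g.
Proof.
move=> [B [e ei]] fg.
have {}fg : f \s idm (sm M A B) = g \s idm (sm M A B).
  apply: (sh_epi (sm_assoc_iso M X A B)).
  by rewrite -smf_id -!sm_assoc_nat fg.
have {}fg : f \s idm I = g \s idm I.
  apply: (sh_epi (f := idm X \s e)); first exact: smf_iso (sh_iso_id X) ei.
  by rewrite -(smf_split f e) -(smf_split g e) (smf_split' f e) (smf_split' g e) fg.
by apply: (sh_epi (sm_unitr_iso M X)); rewrite -!sm_unitr_nat fg.
Qed.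

Lemma scal_inj A s t : invertible A -> scal s A = scal t A -> s = t.
Proof.
move=> iA e; apply: (sm_cancel iA); apply: (sh_mono (sm_unitl_iso M A)).
by rewrite -!scalE e.
Qed.

Hypothesis unit_eq : l I = r I.

Lemma scal_unit s : scal s I = s.
Proof.
by apply: (sh_epi (sm_unitl_iso M I)); rewrite scalE unit_eq sm_unitr_nat.
Qed.

(** An isomorphism from [A /\ B] to the unit turns [f /\ 1] into an endomorphism [s] of the unit.
    Then [f] and the action of [s] agree after smashing with [B], which can be cancelled. *)
Lemma scal_surj A (f : SH A A) : invertible A -> exists s, f = scal s A.
Proof.
move=> [B [e ei]]; exists (e \c (f \s idm B) \c sh_inv e).
have iB : invertible B by apply: (@invertible_inverse A); exists e.
apply: (sm_cancel iB); rewrite scal_smL; apply: (sh_mono ei).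
by rewrite scal_nat scal_unit -[RHS]sh_compA sh_mulVm // sh_compm1.
Qed.

End Unitors.

Section HonestMaps.
Context (X Y Z : pspace (Sm k)).

Lemma smash_isomorphic : sh_isomorphic (sm M [S X] [S Y]) [S smash X Y].
Proof. by exists (susp_smash M X Y); apply: susp_smash_iso. Qed.

Lemma sg_smash_scalL (f : pmap X X) s : sg f = scal s [S X] ->
  sg (smash_pmap f (pmap_id Y)) = scal s [S smash X Y].
Proof.
move=> e; rewrite sg_smashE e sg_id scal_smL scal_nat -sh_compA.
by rewrite (sh_mulmV (susp_smash_iso X Y)) sh_compm1.
Qed.

Lemma sg_smash_scalR (f : pmap Y Y) s : sg f = scal s [S Y] ->
  sg (smash_pmap (pmap_id X) f) = scal s [S smash X Y].
Proof.
move=> e; rewrite sg_smashE e sg_id scal_smR scal_nat -sh_compA.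
by rewrite (sh_mulmV (susp_smash_iso X Y)) sh_compm1.
Qed.

Lemma sg_cancel (f g : pmap X Y) : invertible [S Z] ->
  sg (smash_pmap f (pmap_id Z)) = sg (smash_pmap g (pmap_id Z)) -> sg f = sg g.
Proof.
move=> iZ; rewrite !sg_smashE => /(sh_epi (sh_iso_inv (susp_smash_iso X Z))).
by move/(sh_mono (susp_smash_iso Y Z)); rewrite !sg_id; apply: sm_cancel.
Qed.

Lemma invertible_smash : invertible [S X] -> invertible [S Y] -> invertible [S smash X Y].
Proof.
by move=> iX iY; apply: invertible_iso smash_isomorphic _; apply: invertible_sm.
Qed.

Lemma invertible_smash_factor : invertible [S smash X Y] -> invertible [S Y].
Proof.
move=> i; apply: (@invertible_factor [S X]).
by apply: invertible_iso i; apply: isomorphic_sym smash_isomorphic.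
Qed.

End HonestMaps.

Definition V2_sp : spsh (Sm k) := @SPsh (Sm k) (fun _ _ => option bool)
  (fun U V m n f s b => b) (fun U n b => erefl) (fun U V W m n p f g s t b => erefl).
(** The wedge of two copies of [S^{0,0}]. *)
Definition V2 : pspace (Sm k) := @PSpace (Sm k) V2_sp (fun _ _ => None) (fun U V m n f s => erefl).
Definition V2_in (c : bool) : pmap (S0 (Sm k)) V2 :=
  @PMap (Sm k) (S0 (Sm k)) V2 (@SMap (Sm k) (S0 (Sm k)) V2
    (fun U n b => if b then Some c else None) (fun U V m n f s b => erefl)) (fun U n => erefl).
Definition V2_out (c : bool) : pmap V2 (S0 (Sm k)) :=
  @PMap (Sm k) V2 (S0 (Sm k)) (@SMap (Sm k) V2 (S0 (Sm k))
    (fun U n b => b == Some c) (fun U V m n f s b => erefl)) (fun U n => erefl).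
Definition V2_fold : pmap V2 (S0 (Sm k)) :=
  @PMap (Sm k) V2 (S0 (Sm k)) (@SMap (Sm k) V2 (S0 (Sm k))
    (fun U n b => b != None) (fun U V m n f s b => erefl)) (fun U n => erefl).

Lemma V2_wedge : is_wedge (V2_in true) (V2_in false) (V2_out true) (V2_out false).
Proof. by split=> U n; [case|case|case|case|case=> [[]|]; [left|right|left]]. Qed.

Lemma wedge_smashL (W Y1 Y2 Y : pspace (Sm k)) i1 i2 p1 p2 :
  @is_wedge _ W Y1 Y2 i1 i2 p1 p2 ->
  is_wedge (smash_pmap i1 (pmap_id Y)) (smash_pmap i2 (pmap_id Y))
    (smash_pmap p1 (pmap_id Y)) (smash_pmap p2 (pmap_id Y)).
Proof.
move=> iw; split=> U n; apply: smash_ind => x y; rewrite !smash_pmapE /=.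
- by rewrite (wedge_p1i1 iw).
- by rewrite (wedge_p2i2 iw).
- by rewrite (wedge_p1i2 iw); apply: smash_pair_bpt; left.
- by rewrite (wedge_p2i1 iw); apply: smash_pair_bpt; left.
- by case: (wedge_cover iw x) => e; [left|right]; rewrite e.
Qed.

Lemma wedge_smashR (W Y1 Y2 Y : pspace (Sm k)) i1 i2 p1 p2 :
  @is_wedge _ W Y1 Y2 i1 i2 p1 p2 ->
  is_wedge (smash_pmap (pmap_id Y) i1) (smash_pmap (pmap_id Y) i2)
    (smash_pmap (pmap_id Y) p1) (smash_pmap (pmap_id Y) p2).
Proof.
move=> iw; split=> U n; apply: smash_ind => y x; rewrite !smash_pmapE /=.
- by rewrite (wedge_p1i1 iw).
- by rewrite (wedge_p2i2 iw).
- by rewrite (wedge_p1i2 iw); apply: smash_pair_bpt; right.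
- by rewrite (wedge_p2i1 iw); apply: smash_pair_bpt; right.
- by case: (wedge_cover iw x) => e; [left|right]; rewrite e.
Qed.

Section ScalarAdd.
Context (A : additive_structure k).

(** The sum [s + t] is the fold of [d = in1 s + in2 t]. Since [V2 /\ Y] is again a wedge, [d /\ 1]
    is the sum of its two components, and folding them gives the additivity of the action. *)
Lemma scal_add (s t : SH I I) (Y : pspace (Sm k)) :
  scal (sh_add A s t) [S Y] = sh_add A (scal s [S Y]) (scal t [S Y]).
Proof.
pose in1 := sg (V2_in true); pose in2 := sg (V2_in false).
pose out1 := sg (V2_out true); pose out2 := sg (V2_out false).
pose d : SH I [S V2] := sh_add A (in1 \c s) (in2 \c t).
have f1 : sg V2_fold \c in1 = idm I.
  by rewrite -sg_comp -sg_id; congr sg; apply: pmap_eq => U n [].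
have f2 : sg V2_fold \c in2 = idm I.
  by rewrite -sg_comp -sg_id; congr sg; apply: pmap_eq => U n [].
have o (c c' : bool) : sg (V2_out c) \c sg (V2_in c') = if c == c' then idm I else sh_null I I.
  rewrite -sg_comp; case: eqP => [->|ne].
    by rewrite -sg_id; congr sg; apply: pmap_eq => U n [] //=; rewrite eqxx.
  by rewrite -sg_const; congr sg; apply: pmap_eq => U n []; case: c c' ne => -[].
have o1 : out1 \c d = s.
  by rewrite sh_addl !sh_compA !o /= sh_comp1m sh_nullL (sh_null_zero A) sh_addr0.
have o2 : out2 \c d = t.
  by rewrite sh_addl !sh_compA !o /= sh_comp1m sh_nullL (sh_null_zero A) sh_add0.
have cd : sg V2_fold \c d = sh_add A s t by rewrite sh_addl !sh_compA f1 f2 !sh_comp1m.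
pose w := susp_smash M V2 Y.
have iw : sh_iso w by apply: susp_smash_iso.
have bip : sh_add A ((in1 \s idm [S Y]) \c (out1 \s idm [S Y]))
    ((in2 \s idm [S Y]) \c (out2 \s idm [S Y])) = idm (sm M [S V2] [S Y]).
  apply: (sh_mono iw); rewrite sh_addl sh_compm1 !sh_compA.
  have nt (f : pmap (S0 (Sm k)) V2) : w \c (sg f \s idm [S Y]) =
      sg (smash_pmap f (pmap_id Y)) \c susp_smash M (S0 (Sm k)) Y.
    by rewrite susp_smash_nat sg_id.
  rewrite !nt -!sh_compA.
  have nt' (f : pmap V2 (S0 (Sm k))) : susp_smash M (S0 (Sm k)) Y \c (sg f \s idm [S Y]) =
      sg (smash_pmap f (pmap_id Y)) \c w by rewrite susp_smash_nat sg_id.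
  rewrite !nt' !sh_compA -sh_addr (wedge_biproduct (wedge_smashL Y V2_wedge) A).
  by rewrite sh_comp1m.
have dE : d \s idm [S Y] = sh_add A ((in1 \s idm [S Y]) \c (s \s idm [S Y]))
    ((in2 \s idm [S Y]) \c (t \s idm [S Y])).
  by rewrite -[LHS]sh_comp1m -bip sh_addr -!sh_compA -!smf_comp1 o1 o2.
have st : sh_add A s t \s idm [S Y] = sh_add A (s \s idm [S Y]) (t \s idm [S Y]).
  by rewrite -cd smf_comp1 dE sh_addl !sh_compA -!smf_comp1 f1 f2 !sh_comp1m.
by rewrite /scal -!lock st sh_addl sh_addr.
Qed.

Lemma scal_zero (Y : pspace (Sm k)) : scal (sh_zero A I I) [S Y] = sh_zero A _ _.
Proof.
apply: (@sh_addI _ A _ _ (scal (sh_zero A I I) [S Y])).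
by rewrite -scal_add sh_add0 sh_addr0.
Qed.

Lemma scal_opp s (Y : pspace (Sm k)) :
  scal (sh_opp A s) [S Y] = sh_opp A (scal s [S Y]).
Proof.
apply: (@sh_addI _ A _ _ (scal s [S Y])); rewrite -scal_add.
by rewrite !(sh_addC A _ (sh_opp A _)) !sh_addN scal_zero.
Qed.

End ScalarAdd.
End SmashSH.

(** * Principal open subschemes *)

(** [k[x_1..x_n]/(r_1..r_m)]: two terms are identified if they have the same value at all
    the solutions of the equations, which makes the ring axioms hold by evaluation. *)
Section PresentedAlgebra.
Context (k : comPzRingType) (n m : nat) (r : 'I_m -> pterm k n).

Definition solution (B : kalg k) (b : 'I_n -> B) : Prop := forall j, peval b (r j) = 0.

Definition pres_eq (t u : pterm k n) : Prop :=
  forall (B : kalg k) (b : 'I_n -> B), solution b -> peval b t = peval b u.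

Definition pres : Type := {P : pterm k n -> Prop | exists t, P = pres_eq t}.

HB.instance Definition _ := gen_eqMixin pres.
HB.instance Definition _ := gen_choiceMixin pres.

Definition pcl (t : pterm k n) : pres :=
  exist (fun P => exists t, P = pres_eq t) (pres_eq t) (ex_intro _ t erefl).
Definition prep (p : pres) : pterm k n := sval (cid (svalP p)).

Lemma prepK p : pcl (prep p) = p.
Proof. by case: p => P h; apply: eq_exist; rewrite /prep; case: cid. Qed.

Lemma pclP t u : pcl t = pcl u <-> pres_eq t u.
Proof.
split=> [[e]|e]; first by have : pres_eq u u by []; rewrite -e.
apply: eq_exist; apply/funext => v; apply/propext.
by split=> h B b s; rewrite -?h ?e // -h // -e.
Qed.

Lemma pres_ind (P : pres -> Prop) : (forall t, P (pcl t)) -> forall p, P p.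
Proof. by move=> h p; rewrite -(prepK p). Qed.

Definition padd p q := pcl (PAdd (prep p) (prep q)).
Definition pmul p q := pcl (PMul (prep p) (prep q)).
Definition popp p := pcl (PMul (PCst n (-1)) (prep p)).

Lemma prep_eq t : pres_eq (prep (pcl t)) t.
Proof. by apply/pclP; rewrite prepK. Qed.
Lemma paddE t u : padd (pcl t) (pcl u) = pcl (PAdd t u).
Proof. by apply/pclP => B b s /=; rewrite !(prep_eq _ s). Qed.
Lemma pmulE t u : pmul (pcl t) (pcl u) = pcl (PMul t u).
Proof. by apply/pclP => B b s /=; rewrite !(prep_eq _ s). Qed.
Lemma poppE t : popp (pcl t) = pcl (PMul (PCst n (-1)) t).
Proof. by apply/pclP => B b s /=; rewrite !(prep_eq _ s). Qed.

Lemma paddA : associative padd.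
Proof.
elim/pres_ind=> t; elim/pres_ind=> u; elim/pres_ind=> v.
by rewrite !paddE; apply/pclP => B b s; apply: addrA.
Qed.
Lemma paddC : commutative padd.
Proof.
by elim/pres_ind=> t; elim/pres_ind=> u; rewrite !paddE; apply/pclP => B b s; apply: addrC.
Qed.
Lemma padd0 : left_id (pcl (PCst n 0)) padd.
Proof.
by elim/pres_ind=> t; rewrite paddE; apply/pclP => B b s; rewrite /= rmorph0 add0r.
Qed.
Lemma paddN : left_inverse (pcl (PCst n 0)) popp padd.
Proof.
elim/pres_ind=> t; rewrite poppE paddE; apply/pclP => B b s.
by rewrite /= rmorphN rmorph1 mulN1r addNr rmorph0.
Qed.
Lemma pmulA : associative pmul.
Proof.
elim/pres_ind=> t; elim/pres_ind=> u; elim/pres_ind=> v.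
by rewrite !pmulE; apply/pclP => B b s; apply: mulrA.
Qed.
Lemma pmulC : commutative pmul.
Proof.
by elim/pres_ind=> t; elim/pres_ind=> u; rewrite !pmulE; apply/pclP => B b s; apply: mulrC.
Qed.
Lemma pmul1 : left_id (pcl (PCst n 1)) pmul.
Proof.
by elim/pres_ind=> t; rewrite pmulE; apply/pclP => B b s; rewrite /= rmorph1 mul1r.
Qed.
Lemma pmulD : left_distributive pmul padd.
Proof.
elim/pres_ind=> t; elim/pres_ind=> u; elim/pres_ind=> v.
by rewrite !(paddE, pmulE); apply/pclP => B b s; apply: mulrDl.
Qed.

HB.instance Definition _ := GRing.isZmodule.Build pres paddA paddC padd0 paddN.
HB.instance Definition _ := GRing.Zmodule_isComPzRing.Build pres pmulA pmulC pmul1 pmulD.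

Definition pcst (c : k) : pres := pcl (PCst n c).
Lemma pcst_sub : zmod_morphism pcst.
Proof.
move=> c d; rewrite /pcst -[RHS]/(padd _ (popp _)) poppE paddE; apply/pclP => B b s.
by rewrite /= rmorphB rmorphN rmorph1 mulN1r.
Qed.
Lemma pcst_mul : monoid_morphism pcst.
Proof.
split=> [//|c d]; rewrite /pcst -[RHS]/(pmul _ _) pmulE; apply/pclP => B b s.
by rewrite /= rmorphM.
Qed.
HB.instance Definition _ := GRing.isZmodMorphism.Build k pres pcst pcst_sub.
HB.instance Definition _ := GRing.isMonoidMorphism.Build k pres pcst pcst_mul.

Definition pres_alg : kalg k := @KAlg k pres (pcst : {rmorphism k -> pres}).

Definition pgen (i : 'I_n) : pres_alg := pcl (PVar k i).

Lemma peval_gen t : peval pgen t = pcl t.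
Proof.
elim: t => [i|c|t IHt u IHu|t IHt u IHu] //=; rewrite IHt IHu.
  exact: paddE.
exact: pmulE.
Qed.

Lemma pgen_solution : solution pgen.
Proof. by move=> j; rewrite peval_gen; apply/pclP => B b s; rewrite /= s rmorph0. Qed.

Section Eval.
Context (B : kalg k) (b : 'I_n -> B) (s : solution b).
Definition pev (p : pres) : B := peval b (prep p).
Lemma pevE t : pev (pcl t) = peval b t.
Proof. exact: prep_eq. Qed.
Lemma pev_sub : zmod_morphism pev.
Proof.
elim/pres_ind=> t; elim/pres_ind=> u.
rewrite -[pcl t - _]/(padd _ (popp _)) poppE paddE !pevE /=.
by rewrite rmorphN rmorph1 mulN1r.
Qed.
Lemma pev_mul : monoid_morphism pev.
Proof.
split; first by rewrite -[1]/(pcl _) pevE /= rmorph1.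
by elim/pres_ind=> t; elim/pres_ind=> u; rewrite -[pcl t * _]/(pmul _ _) pmulE !pevE.
Qed.
HB.instance Definition _ := GRing.isZmodMorphism.Build pres B pev pev_sub.
HB.instance Definition _ := GRing.isMonoidMorphism.Build pres B pev pev_mul.
Definition pres_hom : khom pres_alg B :=
  @KHom k pres_alg B (pev : {rmorphism pres -> B}) (fun c => pevE (PCst n c)).
Lemma pres_homE t : pres_hom (pcl t) = peval b t.
Proof. exact: pevE. Qed.
End Eval.

End PresentedAlgebra.

Section FiniteAlgebras.
Context (k : comPzRingType).

Lemma khom_eq (A B : kalg k) (f g : khom A B) : (forall x, f x = g x) -> f = g.
Proof.
have rm (u v : {rmorphism A -> B}) : (forall x, u x = v x) -> u = v.
  case: u v => [u [[p1] [p2]]] [v [[q1] [q2]]] uv.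
  have e : u = v by apply/funext.
  case: _ / e q1 q2 {uv} => q1 q2.
  by rewrite (Prop_irrelevance p1 q1) (Prop_irrelevance p2 q2).
case: f g => [f p] [g q] /rm /= e.
by case: _ / e q => q; congr KHom; apply: Prop_irrelevance.
Qed.

Lemma khom_peval (A B : kalg k) (f : khom A B) n (a : 'I_n -> A) t :
  f (peval a t) = peval (fun i => f (a i)) t.
Proof.
elim: t => [i|c|t IHt u IHu|t IHt u IHu] //=; first exact: khomE.
  by rewrite rmorphD IHt IHu.
by rewrite rmorphM IHt IHu.
Qed.

Lemma peval_ext (A : kalg k) n (a b : 'I_n -> A) t : a =1 b -> peval a t = peval b t.
Proof. by move=> ab; have -> : a = b by apply/funext. Qed.

(** The composite of [R] to the algebra of terms and back fixes the generators, hence is the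
    identity by uniqueness. *)
Lemma presentation_generates (R : kalg k) n (a : 'I_n -> R) m (r : 'I_m -> pterm k n) :
  solution r a ->
  (forall (B : kalg k) (b : 'I_n -> B), solution r b ->
     exists! f : khom R B, forall i, f (a i) = b i) ->
  forall x, exists t, x = peval a t.
Proof.
move=> sa uni x; have [f [fE _]] := uni _ _ (pgen_solution r).
pose g := kcomp (pres_hom sa) f.
have [h [_ hu]] := uni _ _ sa.
have gid : g = kid R.
  rewrite -(hu g) ?(hu (kid R)) // => i; rewrite -[LHS]/(pres_hom sa (f (a i))) fE.
  exact: (pres_homE sa (PVar k i)).
have gx : g x = x by rewrite gid.
exists (prep (f x)); rewrite -[LHS]gx.
exact: etrans (congr1 (pres_hom sa) (esym (prepK (f x)))) (pres_homE sa _).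
Qed.

Fixpoint plift n (t : pterm k n) : pterm k n.+1 :=
  match t with
  | PVar i => PVar k (lift ord0 i)
  | PCst c => PCst n.+1 c
  | PAdd t u => PAdd (plift t) (plift u)
  | PMul t u => PMul (plift t) (plift u)
  end.

Lemma peval_lift (A : kalg k) n (a : 'I_n.+1 -> A) t :
  peval a (plift t) = peval (fun i => a (lift ord0 i)) t.
Proof. by elim: t => //= t -> u ->. Qed.

(** The Rabinowitsch presentation of a localization: a new variable [x_0] and a new relation
    [e x_0 - 1], both numbered 0. *)
Definition loc_rel n m (r : 'I_m -> pterm k n) (e : pterm k n) (j : 'I_m.+1) : pterm k n.+1 :=
  match unlift ord0 j with
  | Some j' => plift (r j')
  | None => PAdd (PMul (plift e) (PVar k ord0)) (PCst n.+1 (-1))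
  end.

Lemma loc_solution (A : kalg k) n m (r : 'I_m -> pterm k n) e (a : 'I_n.+1 -> A) :
  solution (loc_rel r e) a <->
  solution r (fun i => a (lift ord0 i)) /\ peval (fun i => a (lift ord0 i)) e * a ord0 = 1.
Proof.
split=> [s|[s ea] j]; last first.
  rewrite /loc_rel; case: unliftP => [j' _|_]; first by rewrite peval_lift.
  by rewrite /= peval_lift ea rmorphN rmorph1 subrr.
split=> [j|].
  by have := s (lift ord0 j); rewrite /loc_rel liftK peval_lift.
have := s ord0; rewrite /loc_rel unlift_none /= peval_lift rmorphN rmorph1.
by move/eqP; rewrite subr_eq0 => /eqP.
Qed.

End FiniteAlgebras.

Section PrincipalOpen.
Context (k : comPzRingType) (X : kfunctor k) (f : knat X (A1 k)).

Definition is_unit (A : kalg k) (y : A) : Prop := exists z, y * z = 1.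

Lemma is_unit_khom (A B : kalg k) (h : khom A B) (y : A) : is_unit y -> is_unit (h y).
Proof. by case=> z yz; exists (h z); rewrite -rmorphM yz rmorph1. Qed.

Definition popen_pt (A : kalg k) : Type := {p : X A | is_unit (f A p : A)}.

Lemma popen_map_subproof (A B : kalg k) (h : khom A B) (p : popen_pt A) :
  is_unit (f B (kmap h (sval p)) : B).
Proof. by rewrite knatE; apply: is_unit_khom; apply: (svalP p). Qed.

Definition popen_map (A B : kalg k) (h : khom A B) (p : popen_pt A) : popen_pt B :=
  exist (fun p : X B => is_unit (f B p : B)) (kmap h (sval p)) (popen_map_subproof h p).

Lemma popen_eq (A : kalg k) (p q : popen_pt A) : sval p = sval q -> p = q.
Proof. by case: p q => [p u] [q v] /= e; apply: eq_exist. Qed.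

Lemma popen_map_id (A : kalg k) (p : popen_pt A) : popen_map (kid A) p = p.
Proof. by apply: popen_eq; apply: kmap_id. Qed.

Lemma popen_map_comp (A B C : kalg k) (g : khom B C) (h : khom A B) (p : popen_pt A) :
  popen_map (kcomp g h) p = popen_map g (popen_map h p).
Proof. by apply: popen_eq; apply: kmap_comp. Qed.

Definition popen : kfunctor k := KFunctor popen_map_id popen_map_comp.

Definition popen_incl : knat popen X := @KNat k popen X (fun A p => sval p) (fun _ _ _ _ => erefl).

(** If [u] is the universal point of [V], the part of [V] on which [f] is invertible is represented
    by [R] localized at [f(u)], and [e] is a term for [f(u)]. *)
Lemma popen_represented (V : forall A, X A -> Prop) (R : kalg k) :
  subfunctor V -> represented_by V R -> finitely_presented R ->
  exists2 R', represented_by (X := popen) (fun A p => V A (sval p)) R' & finitely_presented R'.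
Proof.
move=> subV [u Vu uR] [n [a [m [r [sa uni]]]]].
have [e fe] := presentation_generates sa uni (f R u : R).
pose r' := loc_rel r e; pose R' := pres_alg r'.
have sg : solution r' (pgen r') by apply: pgen_solution.
have [sr eg] := (loc_solution r e (pgen r' : 'I_n.+1 -> R')).1 sg.
have [i [iE _]] := uni R' _ sr.
have fu : f R' (kmap i u) = peval (fun j => pgen r' (lift ord0 j) : R') e.
  rewrite knatE fe; apply: (etrans (khom_peval i a e)); exact: (peval_ext e iE).
have un : is_unit (f R' (kmap i u) : R') by exists (pgen r' ord0); rewrite fu.
exists R'; last first.
  exists n.+1, (pgen r'), m.+1, r'; split=> // B b sb.
  exists (pres_hom sb); split=> [j|g gE]; first exact: (pres_homE sb (PVar k j)).
  apply: khom_eq; apply: pres_ind => t.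
  rewrite pres_homE -peval_gen khom_peval; apply: peval_ext => j; by rewrite gE.
exists (exist (fun p : X R' => is_unit (f R' p : R')) (kmap i u) un); first exact: subV.
move=> A [p up] Vp; have [h [ph hu]] := uR A p Vp.
pose b (j : 'I_n.+1) : A := match unlift ord0 j with Some j' => h (a j') | None => sval (cid up) end.
have bl j : b (lift ord0 j) = h (a j) by rewrite /b liftK.
have b0 : b ord0 = sval (cid up) by rewrite /b unlift_none.
have sb : solution r' b.
  apply/loc_solution; split=> [j|].
    rewrite (@peval_ext _ _ _ _ (fun l => h (a l))) -?khom_peval; last exact: bl.
    by rewrite (sa j) rmorph0.
  rewrite (@peval_ext _ _ _ _ (fun l => h (a l))) -?khom_peval; last exact: bl.
  rewrite -fe b0; case: cid => z /= pz; rewrite -pz ph.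
  by congr (_ * _); rewrite knatE.
have hi (g : khom R' A) : (forall j, g (pgen r' (lift ord0 j)) = h (a j)) -> kcomp g i = h.
  move=> gE; have sh : solution r (fun j => h (a j)) by move=> j; rewrite -khom_peval sa rmorph0.
  have [h' [_ hu']] := uni A _ sh; rewrite -(hu' h) //.
  by symmetry; apply: hu' => j; rewrite -[LHS]/(g (i (a j))) iE gE.
exists (pres_hom sb); split=> [|g pg].
  apply: popen_eq; rewrite /= -kmap_comp hi ?ph // => j.
  by rewrite -bl; apply: (pres_homE sb (PVar k _)).
have gi : kcomp g i = h.
  by symmetry; apply: hu; rewrite kmap_comp; exact: (congr1 sval pg).
have gE j : g (pgen r' (lift ord0 j)) = h (a j) by rewrite -gi /= iE.
apply: khom_eq; apply: pres_ind => t.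
rewrite pres_homE -peval_gen khom_peval; apply: peval_ext => j.
case: (unliftP ord0 j) => [j' ->|->]; first by rewrite bl gE.
have e1 : (f A p : A) * b ord0 = 1 by rewrite b0; case: cid.
have e2 : (f A p : A) * g (pgen r' ord0) = 1.
  have -> : (f A p : A) = g (f R' (kmap i u)).
    rewrite ph -gi /= kmap_comp; exact: (knatE f g (kmap i u)).
  by rewrite -rmorphM fu eg rmorph1.
by rewrite -[LHS]mul1r -e2 mulrAC e1 mul1r.
Qed.

Lemma square_zero_unit (A B : kalg k) (h : khom A B) (y : A) :
  square_zero_ext h -> is_unit (h y) -> is_unit y.
Proof.
move=> [surj sq] [z hz]; have [a az] := surj z.
pose e := y * a - 1; have e0 : h e = 0 by rewrite rmorphB rmorphM az hz rmorph1 subrr.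
(* Here [y a = 1 + e] with [e] in the kernel, and [1 - e] inverts [1 + e] because [e^2 = 0]. *)
exists (a * (1 - e)); have ee := sq e e e0 e0.
have -> : y * (a * (1 - e)) = 1 - e * e by rewrite /e; ring.
by rewrite ee subr0.
Qed.

Definition rad (A : kalg k) (g y : A) : Prop := exists (N : nat) (w : A), g * w = y ^+ N.

Lemma rad_add (A : kalg k) (g y z : A) : rad g y -> rad g z -> rad g (y + z).
Proof.
move=> [N [w gw]] [K [v gv]]; exists (N + K)%N; rewrite exprDn.
suff [w' ->] : exists w', \sum_(i < (N + K).+1) y ^+ (N + K - i) * z ^+ i *+ 'C(N + K, i) = g * w'.
  by exists w'.
elim/big_ind: _ => [|a b [a' ->] [b' ->]|i _]; first by exists 0; rewrite mulr0.
  by exists (a' + b'); rewrite mulrDr.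
have [Ki|iK] := leqP K i.
  exists (v * z ^+ (i - K) * y ^+ (N + K - i) *+ 'C(N + K, i)).
  have -> : z ^+ i = g * v * z ^+ (i - K) by rewrite gv -exprD subnKC.
  by rewrite mulrnAr; congr (_ *+ _); ring.
have Ni : (N <= N + K - i)%N by rewrite -addnBA ?leq_addr // ltnW.
exists (w * y ^+ (N + K - i - N) * z ^+ i *+ 'C(N + K, i)).
have -> : y ^+ (N + K - i) = g * w * y ^+ (N + K - i - N) by rewrite gw -exprD subnKC.
by rewrite mulrnAr; congr (_ *+ _); ring.
Qed.

Lemma rad_mul (A : kalg k) (g c y : A) : rad g y -> rad g (c * y).
Proof. by move=> [N [w gw]]; exists N, (c ^+ N * w); rewrite exprMn -gw; ring. Qed.

(** The points glue in [X]; it remains to invert the value of [f] at the result. It becomes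
    invertible where [a_i] is, so every [a_i] lies in the radical of the ideal it generates, and
    therefore so does 1. *)
Lemma popen_sheaf : zariski_sheaf X -> zariski_sheaf popen.
Proof.
move=> sh A n a c ac B l loc D r s rs locD x cmp.
have [|y [yl yu]] := sh A n a c ac B l loc D r s rs locD (fun i => sval (x i)).
  by move=> i j; exact: (congr1 sval (cmp i j)).
have ry i : rad (f A y : A) (a i).
  have [[b ab] frac ker] := loc i; have [z hz] := svalP (x i).
  have [w [N wN]] := frac z.
  have e0 : l i ((f A y : A) * w - a i ^+ N) = 0.
    rewrite rmorphB rmorphM rmorphXn -wN mulrA.
    have -> : l i (f A y : A) = f (B i) (sval (x i)) by rewrite -yl knatE.
    by rewrite hz mul1r subrr.
  have [K e] := ker _ e0; exists (N + K)%N, (w * a i ^+ K).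
  by move/eqP: e; rewrite mulrBl subr_eq0 exprD => /eqP <-; rewrite mulrA.
have [N [w fw]] : rad (f A y : A) 1.
  rewrite -ac; elim/big_ind: _ => [|p q|i _]; first by exists 1%N, 0; rewrite mulr0 expr1.
    exact: rad_add.
  exact: rad_mul.
have un : is_unit (f A y : A) by exists w; rewrite fw expr1n.
exists (exist (fun p : X A => is_unit (f A p : A)) y un); split=> [i|[y' un'] y'l].
  by apply: popen_eq; apply: yl.
by apply: popen_eq; apply: yu => i; have := congr1 sval (y'l i).
Qed.

Lemma popen_smooth : is_smooth_scheme X -> is_smooth_scheme popen.
Proof.
move=> [sh [J [V [Vo Vr Vc]]] lift_]; split; first exact: popen_sheaf.
  exists J, (fun j A p => V j A (sval p)); split.
  - move=> j; have [subV openV] := Vo j; split=> [A B h p|A p]; first exact: subV.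
    exact: (openV A (sval p)).
  - move=> j; have [R rR fR] := Vr j; exact: (popen_represented (proj1 (Vo j)) rR fR).
  - by move=> K Kf p; apply: Vc.
move=> A B h sq p; have [y hy] := lift_ A B h sq (sval p).
have un : is_unit (f A y : A).
  apply: (square_zero_unit sq); have := svalP p.
  by rewrite -hy knatE.
exists (exist (fun p : X A => is_unit (f A p : A)) y un); exact: popen_eq.
Qed.

End PrincipalOpen.

Section BasicCover.
Context (k : comPzRingType) (U : Sm k).

Definition popen_sm (x : fn U) : Sm k := SmoothScheme (popen_smooth x (sm_smooth U)).
Definition popen_hom (x : fn U) : ihom (popen_sm x) U := popen_incl x.

Lemma popen_etale (x : fn U) : etale (popen_hom x).
Proof.
move=> A B h sq v p vp.
have un : is_unit (x A p : A).
  by apply: (square_zero_unit sq); have := svalP v; rewrite -[sval v]/(popen_hom x B v) vp knatE.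
exists (exist (fun p : U A => is_unit (x A p : A)) p un); split.
  by split=> //; apply: popen_eq.
by move=> w [_ wp]; apply: popen_eq.
Qed.

Lemma unimodular_cover (x y a b : fn U) : (a * x + b * y)%fn = ofun1 U ->
  nisnevich_cover (V := fun c : bool => if c then popen_sm x else popen_sm y)
    (fun c => match c return ihom (if c then popen_sm x else popen_sm y) U with
       true => popen_hom x | false => popen_hom y end).
Proof.
move=> e; split=> [[]|K [K1 Kinv] p]; [exact: popen_etale|exact: popen_etale|].
have eK : (a K p : K) * x K p + b K p * y K p = 1.
  exact: (congr1 (fun g : fn U => g K p) e).
have [x0|x0] := pselect ((x K p : K) = 0); last first.
  by exists true, (exist (fun p : U K => is_unit (x K p : K)) p (Kinv _ x0)).
have y0 : (y K p : K) <> 0.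
  by move=> y0; apply: K1; rewrite -eK x0 y0 !mulr0 addr0.
by exists false, (exist (fun p : U K => is_unit (y K p : K)) p (Kinv _ y0)).
Qed.

End BasicCover.

(** * Homotopies of pairs of functions *)

Lemma quot_factor (C : icat) (R : spsh C) (B Y : pspace C) (p : smap R B) (kp : spred R)
    (r : smap R Y) (kr : spred R) (f : pmap B Y) :
  quot p kp -> quot r kr -> (forall U n x, f U n (p U n x) = r U n x) ->
  quot f (fun U n b => exists2 x, p U n x = b & kr U n x).
Proof.
move=> qp qr fp; split=> [U n y|U n b|U n b b'].
- by have [x <-] := quot_surj qr y; exists (p U n x).
- split=> [[x <- kx]|fb]; first by rewrite fp; apply/(quot_ker qr).
  have [x xb] := quot_surj qp b; exists x => //.
  by apply/(quot_ker qr); rewrite -fp xb.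
have [x <-] := quot_surj qp b; have [x' <-] := quot_surj qp b'.
by rewrite !fp => /(quot_inj qr) [->|kx]; [left|right; exists x].
Qed.

Lemma quot_comp (C : icat) (R : spsh C) (B Y : pspace C) (p : smap R B) (kp : spred R)
    (q : smap B Y) (kq : spred B) :
  quot p kp -> quot q kq -> (forall U n, q U n (bpt B U n) = bpt Y U n) ->
  quot (smap_comp q p) (fun U n x => kq U n (p U n x)).
Proof.
move=> qp qq q0; split=> [U n y|U n x|U n x x' /= e].
- by have [b <-] := quot_surj qq y; have [x <-] := quot_surj qp b; exists x.
- exact: (quot_ker qq).
case: (quot_inj qq e) => [/(quot_inj qp) [->|kx]|kx]; [by left|right|by right].
by apply/(quot_ker qq); rewrite (proj1 (quot_ker qp x) kx) q0.
Qed.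

Lemma inv_uniq (R : comPzRingType) (x a b : R) : x * a = 1 -> x * b = 1 -> a = b.
Proof. by move=> xa xb; rewrite -[a]mul1r -xb mulrAC xa mul1r. Qed.

Section FunctionUnits.
Context (k : comPzRingType).
Implicit Type U : Sm k.

Definition fun_unit U (x : fn U) : Prop := exists z, (x * z)%fn = 1%fn.
Definition unimodular U (x y : fn U) : Prop := exists a b, (a * x + b * y)%fn = 1%fn.

Lemma fun_unit1 U : fun_unit (1%fn : fn U).
Proof. by exists 1%fn; fn_ring. Qed.

Lemma fun_unitM U (x y : fn U) : fun_unit x -> fun_unit y -> fun_unit (x * y)%fn.
Proof.
move=> [a xa] [b yb]; exists (a * b)%fn.
transitivity ((x * a) * (y * b))%fn; first by fn_ring.
by rewrite xa yb; fn_ring.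
Qed.

Lemma fun_unitN U (x : fn U) : fun_unit x -> fun_unit (- x)%fn.
Proof. by move=> [a xa]; exists (- a)%fn; rewrite -xa; fn_ring. Qed.

Lemma knat_comp_mul (U V : kfunctor k) (h : knat V U) (x y : knat U (A1 k)) :
  knat_comp (x * y)%fn h = (knat_comp x h * knat_comp y h)%fn.
Proof. exact: knat_eq. Qed.

Lemma knat_comp_add (U V : kfunctor k) (h : knat V U) (x y : knat U (A1 k)) :
  knat_comp (x + y)%fn h = (knat_comp x h + knat_comp y h)%fn.
Proof. exact: knat_eq. Qed.

Lemma knat_comp_one (U V : kfunctor k) (h : knat V U) : knat_comp (ofun1 U) h = ofun1 V.
Proof. exact: knat_eq. Qed.

Lemma fun_unit_comp (U V : Sm k) (h : ihom V U) (x : fn U) : fun_unit x -> fun_unit (U := V) (knat_comp x h).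
Proof. by move=> [z xz]; exists (knat_comp z h); rewrite -knat_comp_mul xz knat_comp_one. Qed.

Lemma unimodular_comp (U V : Sm k) (h : ihom V U) (x y : fn U) :
  unimodular x y -> unimodular (U := V) (knat_comp x h) (knat_comp y h).
Proof.
move=> [a [b e]]; exists (knat_comp a h), (knat_comp b h).
by rewrite -!knat_comp_mul -knat_comp_add e knat_comp_one.
Qed.

Lemma unimodular_unitl U (x y : fn U) : fun_unit x -> unimodular x y.
Proof. by move=> [z xz]; exists z, 0%fn; rewrite -xz; fn_ring. Qed.

Lemma unimodular_unitr U (x y : fn U) : fun_unit y -> unimodular x y.
Proof. by move=> [z yz]; exists 0%fn, z; rewrite -yz; fn_ring. Qed.

Lemma unimodular_e12 U (c x y : fn U) : unimodular x y -> unimodular (x + c * y)%fn y.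
Proof. by move=> [a [b e]]; exists a, (b - a * c)%fn; rewrite -e; fn_ring. Qed.

Lemma unimodular_e21 U (c x y : fn U) : unimodular x y -> unimodular x (y + c * x)%fn.
Proof. by move=> [a [b e]]; exists (a - b * c)%fn, b; rewrite -e; fn_ring. Qed.

Lemma unimodular_scale U (w x y : fn U) : fun_unit w -> unimodular x y -> unimodular x (w * y)%fn.
Proof.
move=> [z wz] [a [b e]]; exists a, (b * z)%fn; rewrite -e.
transitivity (a * x + b * (w * z) * y)%fn; first by fn_ring.
by rewrite wz; fn_ring.
Qed.

Definition fn_natural (W : spsh (Sm k)) (x : forall U n, W U n -> fn U) : Prop :=
  forall (U V : Sm k) m n (f : ihom V U) (s : mono n m) w,
    x V n (sres f s w) = knat_comp (x U m w) f.

Notation X := (S11 k).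

Lemma gm_val_subproof (U : kfunctor k) (g : knat U (Gm k)) A B (f : khom A B) (p : U A) :
  (sval (g B (kmap f p))).1 = f (sval (g A p)).1.
Proof. by rewrite knatE. Qed.
Definition gm_val U n (g : X U n) : fn U :=
  @KNat k U (A1 k) (fun A p => (sval (g A p)).1) (gm_val_subproof g).

Lemma gm_inv_subproof (U : kfunctor k) (g : knat U (Gm k)) A B (f : khom A B) (p : U A) :
  (sval (g B (kmap f p))).2 = f (sval (g A p)).2.
Proof. by rewrite knatE. Qed.
Definition gm_inv U n (g : X U n) : fn U :=
  @KNat k U (A1 k) (fun A p => (sval (g A p)).2) (gm_inv_subproof g).

Lemma gm_mulV U n (g : X U n) : (gm_val g * gm_inv g)%fn = 1%fn.
Proof. by apply: knat_eq => A p; apply: (svalP (g A p)). Qed.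

Lemma gm_unit U n (g : X U n) : fun_unit (gm_val g).
Proof. by exists (gm_inv g); apply: gm_mulV. Qed.

Lemma gm_natural : fn_natural (W := X) (fun U n g => gm_val g).
Proof. by move=> *; apply: knat_eq. Qed.

Lemma gm_inv_natural : fn_natural (W := X) (fun U n g => gm_inv g).
Proof. by move=> *; apply: knat_eq. Qed.

Lemma gm_ext U n (g h : X U n) : gm_val g = gm_val h -> g = h.
Proof.
move=> e; apply: knat_eq => A p; apply: Gm_pt_eq.
have := congr1 (fun f : fn U => f A p) e; rewrite /= => {}e.
have := svalP (g A p); have := svalP (h A p).
case: (sval (g A p)) (sval (h A p)) e => [a b] [c d] /= -> cd cb.
by congr pair; apply: inv_uniq cb cd.
Qed.

Lemma gm_make_subproof U (x y : fn U) (e : (x * y)%fn = 1%fn) A (p : U A) :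
  (x A p : A, y A p : A).1 * (x A p : A, y A p : A).2 = 1.
Proof. exact: (congr1 (fun f : fn U => f A p) e). Qed.

Lemma gm_make_nat U (x y : fn U) (e : (x * y)%fn = 1%fn) A B (f : khom A B) (p : U A) :
  exist (fun z : B * B => z.1 * z.2 = 1) _ (gm_make_subproof e (kmap f p)) =
  Gm_map f (exist (fun z : A * A => z.1 * z.2 = 1) _ (gm_make_subproof e p)).
Proof. by apply: Gm_pt_eq; rewrite /= !knatE. Qed.

Definition gm_make U n (x y : fn U) (e : (x * y)%fn = 1%fn) : X U n :=
  @KNat k U (Gm k) (fun A p => exist (fun z : A * A => z.1 * z.2 = 1) _ (gm_make_subproof e p))
    (gm_make_nat e).

Lemma gm_makeE U n (x y : fn U) (e : (x * y)%fn = 1%fn) : gm_val (gm_make n e) = x.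
Proof. exact: knat_eq. Qed.

Lemma gm_val_bpt U n : gm_val (bpt X U n) = 1%fn.
Proof. exact: knat_eq. Qed.

Lemma gm_val_eq1 U n (g : X U n) : gm_val g = 1%fn -> g = bpt X U n.
Proof. by move=> e; apply: gm_ext; rewrite e gm_val_bpt. Qed.

Lemma gm_val_power m U n (g : X U n) :
  gm_val (power_map k (m + 1) U n g) = (gm_val g * gm_val (power_map k m U n g))%fn.
Proof.
apply: knat_eq => A p; have := svalP (g A p); case: m => [m|[|m]].
- have -> : Posz m + 1 = Posz m.+1 by rewrite -PoszD addn1.
  by move=> _; apply: exprS.
- by have -> : Negz 0 + 1 = Posz 0 by []; rewrite /= => ->; rewrite expr0.
have -> : Negz m.+1 + 1 = Negz m by rewrite !NegzE -[m.+2]addn1 PoszD opprD addrNK.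
by rewrite /= => ab; rewrite (exprS _ m.+1) mulrA ab mul1r.
Qed.

End FunctionUnits.

(** * The quotients A^1/(A^1 - 0) and A^2/(A^2 - 0) *)

Section AffineQuotients.
Context (k : comPzRingType).
Notation X := (S11 k).

Definition line : pspace (Sm k) :=
  @PSpace (Sm k) (A1p k) (fun U n => ofun1 U) (fun U V m n f s => knat_comp_one f).

Lemma fun_unit_bpt U n : fun_unit (bpt line U n).
Proof. exact: fun_unit1. Qed.
Lemma fun_unit_res (U V : Sm k) m n (f : ihom V U) (s : mono n m) (x : line U m) :
  fun_unit (x : fn U) -> fun_unit (sres f s x : fn V).
Proof. exact: fun_unit_comp. Qed.

(** [A^1/(A^1 - 0)] *)
Definition T1 : pspace (Sm k) := collapse fun_unit_bpt fun_unit_res.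
Definition t1 : smap line T1 := collapse_map fun_unit_bpt fun_unit_res.

Lemma t1_quot : quot t1 (fun U n x => fun_unit x).
Proof. exact: collapse_quot. Qed.

Lemma t1_bpt U n (x : fn U) : fun_unit x -> t1 U n x = bpt T1 U n.
Proof. exact: (proj1 (quot_ker t1_quot _)). Qed.

Definition plane : pspace (Sm k) := pprod line line.

Lemma unimodular_bpt U n : unimodular (bpt plane U n).1 (bpt plane U n).2.
Proof. exact/unimodular_unitl/fun_unit1. Qed.
Lemma unimodular_res (U V : Sm k) m n (f : ihom V U) (s : mono n m) (x : plane U m) :
  unimodular x.1 x.2 -> unimodular (sres f s x).1 (sres f s x).2.
Proof. exact: unimodular_comp. Qed.

(** [A^2/(A^2 - 0)], up to Nisnevich sheafification *)
Definition T2 : pspace (Sm k) := @collapse _ plane (fun U n x => unimodular x.1 x.2) unimodular_bpt unimodular_res.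
Definition t2 : smap plane T2 := @collapse_map _ plane (fun U n x => unimodular x.1 x.2) unimodular_bpt unimodular_res.

Lemma t2_quot : quot t2 (fun U n x => unimodular x.1 x.2).
Proof. exact: collapse_quot. Qed.

Lemma t2_bpt U n (x y : fn U) : unimodular x y -> t2 U n (x, y) = bpt T2 U n.
Proof. exact: (proj1 (quot_ker t2_quot (x, y))). Qed.

Section Families.
Context (W : spsh (Sm k)) (x y : forall U n, W U n -> fn U).
Hypotheses (xn : fn_natural x) (yn : fn_natural y).

Definition t1_map : smap W T1 := @SMap _ W T1 (fun U n w => t1 U n (x w))
  (fun U V m n f s w => etrans (congr1 (t1 V n) (xn f s w)) (smapE t1 f s (x w))).

Definition t2_map : smap W T2 := @SMap _ W T2 (fun U n w => t2 U n (x w, y w))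
  (fun U V m n f s w => etrans (congr2 (fun a b => t2 V n (a, b)) (xn f s w) (yn f s w))
     (smapE t2 f s (x w, y w))).

End Families.

Lemma t2_homotopy (R : spsh (Sm k)) (Y : pspace (Sm k)) (p : smap R Y) (ker : spred R)
    (x y : forall U n, sprod R (A1p k) U n -> fn U) (f g : pmap Y T2) :
  fn_natural x -> fn_natural y -> quot p ker ->
  (forall U n r t, ker U n r -> unimodular (x U n (r, t)) (y U n (r, t))) ->
  (forall U n r, f U n (p U n r) = t2 U n (x U n (r, 0%fn), y U n (r, 0%fn))) ->
  (forall U n r, g U n (p U n r) = t2 U n (x U n (r, 1%fn), y U n (r, 1%fn))) ->
  sg f = sg g.
Proof.
move=> xn yn q kr f0 g1.
apply: (@sg_homotopy k (a1_interval k) R Y p ker T2 (t2_map xn yn) f g q).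
- by move=> U n r t kr'; apply: t2_bpt; apply: kr.
- by move=> U n r; rewrite f0.
- by move=> U n r; rewrite g1.
Qed.

Definition smash_t2_0 : smap (sprod line line) T2 :=
  t2_map (W := sprod line line) (x := fun U n w => w.1) (y := fun U n w => w.2)
    (fun U V m n f s w => erefl) (fun U V m n f s w => erefl).

Lemma smash_t2_subproof U n (r : sprod line line U n) :
  fun_unit r.1 \/ fun_unit r.2 -> smash_t2_0 U n r = bpt T2 U n.
Proof. by case=> u; apply: t2_bpt; [apply: unimodular_unitl|apply: unimodular_unitr]. Qed.

Definition smash_t2 : pmap (smash T1 T1) T2 := qmap (smash_quot t1_quot t1_quot) smash_t2_subproof.

Lemma smash_t2E U n (x y : fn U) : smash_t2 U n (smash_pair (t1 U n x) (t1 U n y)) = t2 U n (x, y).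
Proof. exact: (qmapE (smash_quot t1_quot t1_quot) smash_t2_subproof (x, y)). Qed.

(** On the members of the covering of [U] by the loci where [x] and [y] are invertible,
    [(x, y)] is already trivial in the smash product. *)
Lemma smash_t2_iso : sh_iso (sg smash_t2).
Proof.
apply: sh_map_iso.
have q := quot_factor (f := smash_t2) (smash_quot t1_quot t1_quot) t2_quot
  (fun U n x => match x with (a, b) => smash_t2E n a b end).
apply: (quot_stable q); apply: (dense_contracts q) => U n b [[x y] <- [a [b' e]]].
exists bool, (fun c : bool => if c then popen_sm x else popen_sm y).
exists (fun c => match c return ihom (if c then popen_sm x else popen_sm y) U with
       true => popen_hom x | false => popen_hom y end).
split; first exact: (unimodular_cover e).
have u (z : fn U) : fun_unit (U := popen_sm z) (knat_comp z (popen_hom z)).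
  have rn A B (f : khom A B) (p : popen_sm z A) :
      sval (cid (svalP (kmap f p))) = f (sval (cid (svalP p))).
    have e1 : z B (sval (kmap f p)) * sval (cid (svalP (kmap f p))) = 1 by case: cid.
    have e2 : z A (sval p) * sval (cid (svalP p)) = 1 by case: (cid (svalP p)).
    have e3 : z B (sval (kmap f p)) = f (z A (sval p)) by rewrite -[RHS](knatE z f).
    by apply: (inv_uniq e1); rewrite e3 -rmorphM e2 rmorph1.
  exists (@KNat k (popen_sm z) (A1 k) (fun A p => sval (cid (svalP p))) rn).
  by apply: knat_eq => A p /=; case: cid.
case; rewrite /is_bpt -smapE; apply: smash_pair_bpt; [left|right]; apply: t1_bpt; exact: u.
Qed.

Section Sigma.
Context (I : interval k) (tau : smap I (A1p k)).
Hypothesis tau0 : forall U n, tau U n (i0 I U n) = ofun0 U.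
Hypothesis tau1 : forall U n, tau U n (i1 I U n) = ofun1 U.

(** The map [tau] is later the identity of [A^1] or the projection of [A^1 * Delta^1], so that one
    construction serves both circles. *)
Definition sigma0 U n (w : sprod X I U n) : fn U :=
  (1 - tau U n w.2 + tau U n w.2 * gm_val w.1)%fn.

Lemma sigma0_natural : fn_natural sigma0.
Proof. by move=> U V m n f s w; rewrite /sigma0 /= smapE (gm_natural f s w.1); apply: knat_eq. Qed.

Let sq := smash_quot (quot_id X) (circle_quot I).

Lemma sigma_subproof U n (r : sprod X I U n) :
  is_bpt r.1 \/ circle_ends r.2 -> t1_map sigma0_natural U n r = bpt T1 U n.
Proof.
case: r => u t /=; case=> [->|[->|->]]; apply: t1_bpt; rewrite /sigma0 /=.
- by rewrite gm_val_bpt (_ : (_ + _)%fn = 1%fn); [apply: fun_unit1|fn_ring].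
- by rewrite tau0 (_ : (_ + _)%fn = 1%fn); [apply: fun_unit1|fn_ring].
- by rewrite tau1 (_ : (_ + _)%fn = gm_val u); [apply: gm_unit|fn_ring].
Qed.

Definition sigma : pmap (smash X (circle I)) T1 := qmap sq sigma_subproof.

Lemma sigmaE U n (u : X U n) (t : I U n) :
  sigma U n (smash_pair u (circle_cl I U n t)) = t1 U n (1 - tau U n t + tau U n t * gm_val u)%fn.
Proof. exact: (qmapE sq sigma_subproof (u, t)). Qed.

(** [T1] is the cofibre of [A^1 - 0] in the line, and [1 - t + t x] contracts the line to 1. *)
Lemma sigma_iso : sh_iso (sg sigma).
Proof.
pose j : pmap X line := @PMap _ X line (@SMap _ X line (fun U n g => gm_val g)
  (fun U V m n f s g => gm_natural f s g)) (fun U n => gm_val_bpt U n).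
have cn : fn_natural (W := sprod line I) (fun U n w => (1 - tau U n w.2 + tau U n w.2 * w.1)%fn).
  by move=> U V m n f s w; rewrite /= smapE; apply: knat_eq.
pose c : smap (sprod line I) line := @SMap _ (sprod line I) line _ cn.
apply: sh_map_iso; apply: (contractible_cofibre (j := j) (q := t1) (c := c)).
- by move=> U n g h; apply: gm_ext.
- case: t1_quot => surj ker inj; split=> // [U n x|U n x x' /inj [->|[z xz]]]; [|by left|].
    rewrite -ker; split=> [[g <-]|[z xz]]; first exact: gm_unit.
    by exists (gm_make n xz); apply: gm_makeE.
  by right; exists (gm_make n xz); apply: gm_makeE.
- by move=> U n b /=; rewrite tau0; fn_ring.
- by move=> U n b /=; rewrite tau1; fn_ring.
- by move=> U n t /=; fn_ring.
by move=> U n a t; rewrite sigmaE.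
Qed.

End Sigma.
End AffineQuotients.
Arguments t1 {k}.
Arguments t2 {k}.
Arguments smash_t2 {k}.

(** * Deforming the pair (u, 1 - t + t u) *)

Section Deformation.
Context (k : comPzRingType).
Notation X := (S11 k).
Notation T2 := (T2 k).
Implicit Type U : Sm k.

(** A family of pairs [(g, f)] of functions of a unit [u] and of two parameters [t] and [l],
    such that [f] is invertible modulo [g] and [g] is [1 - t + t u] up to homotopy. *)
Record family := Family {
  fam_f : forall U, fn U -> fn U -> fn U -> fn U;
  fam_g : forall U, fn U -> fn U -> fn U -> fn U;
  fam_f_nat : forall U V (h : ihom V U) u t l,
    fam_f (U := V) (knat_comp u h) (knat_comp t h) (knat_comp l h) = knat_comp (fam_f u t l) h;
  fam_g_nat : forall U V (h : ihom V U) u t l,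
    fam_g (U := V) (knat_comp u h) (knat_comp t h) (knat_comp l h) = knat_comp (fam_g u t l) h;
  fam_unimodular : forall U (u t l : fn U), fun_unit u -> unimodular (fam_g u t l) (fam_f u t l);
  fam_g1 : forall U (t l : fn U), fam_g 1%fn t l = 1%fn;
  fam_gt0 : forall U (u l : fn U), fam_g u 0%fn l = 1%fn;
  fam_gt1 : forall U (u l : fn U), fam_g u 1%fn l = u }.

(** If [a p + b q = 1] then [(1 + a p d) (1 + b q d) - a b p q d^2 = 1 + d = u]. *)
Section Build.
Context (a b p q c : forall U, fn U -> fn U -> fn U).
Let natural (z : forall U, fn U -> fn U -> fn U) := forall U V (h : ihom V U) t l,
  z V (knat_comp t h) (knat_comp l h) = knat_comp (z U t l) h.
Hypotheses (an : natural a) (bn : natural b) (pn : natural p) (cn : natural c).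
Hypothesis ab1 : forall U t l, (@b U t l * @q U t l)%fn = (1 - @a U t l * @p U t l)%fn.
Hypothesis ab_t0 : forall U l, (@a U 0%fn l * @p U 0%fn l)%fn = 0%fn.
Hypothesis ab_t1 : forall U l, (@a U 1%fn l * @p U 1%fn l)%fn = 1%fn.

Let g U (u t l : fn U) : fn U := (1 + @a U t l * @p U t l * (u - 1))%fn.
Let f U (u t l : fn U) : fn U := (@a U t l * @b U t l * (u - 1) + @c U t l * g u t l)%fn.

Definition build_family : family.
Proof.
apply: (@Family f g).
- by move=> U V h u t l; rewrite /f /g an bn pn cn; apply: knat_eq.
- by move=> U V h u t l; rewrite /g an pn; apply: knat_eq.
- move=> U u t l [v uv]; have := ab1 t l.
  rewrite /f; have : g u t l = (1 + @a U t l * @p U t l * (u - 1))%fn by [].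
  move: (g u t l) (@a U t l) (@b U t l) (@p U t l) (@q U t l) (@c U t l) => G a' b' p' q' c' GE E.
  exists (v * (G + (1 - a' * p' - a' * p') * (u - 1)) + c' * p' * q' * (u - 1) * v)%fn.
  exists (- (p' * q' * (u - 1) * v))%fn.
  transitivity ((G * (G + (1 - a' * p' - a' * p') * (u - 1)) - a' * p' * (b' * q') * (u - 1) * (u - 1)) * v)%fn.
    by fn_ring.
  by transitivity (u * v)%fn; last exact: uv; rewrite E GE; fn_ring.
- by move=> U t l; rewrite /g; fn_ring.
- by move=> U u l; rewrite /g ab_t0; fn_ring.
- by move=> U u l; rewrite /g ab_t1; fn_ring.
Defined.

End Build.

(** From [(f, g) = (u, 1 - t + t u)] to [(t (1 - t) (u - 1), 1 + t^2 (u - 1))]: the weight [a p]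
    passes from [t] to [t^2], while the multiple of [g] contained in [f] fades out. At the start [f]
    is [(1 - t) (u - 1) + g]. *)
Definition family2 : family.
Proof.
by apply: (@build_family (fun U t l => 1 - l * (1 - t))%fn (fun U t l => 1 - t)%fn
  (fun U t l => t) (fun U t l => 1 + l * t)%fn (fun U t l => 1 - l)%fn);
  [move=> *; apply: knat_eq|move=> *; apply: knat_eq|move=> *; apply: knat_eq|
   move=> *; apply: knat_eq|fn_ring|fn_ring|fn_ring].
Defined.

(** Here [f = t (1 - t) (u - 1)] does not move. The weight [a p] passes from [t^2] to [t (2 - t)],
    which is [1 - (1 - t)^2]. *)
Definition family3 : family.
Proof.
by apply: (@build_family (fun U t l => t) (fun U t l => 1 - t)%fn
  (fun U t l => t + (l + l) * (1 - t))%fn (fun U t l => 1 + t - (l + l) * t)%fn (fun U t l => 0)%fn);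
  [move=> *; apply: knat_eq|move=> *; apply: knat_eq|move=> *; apply: knat_eq|
   move=> *; apply: knat_eq|fn_ring|fn_ring|fn_ring].
Defined.

(** The return to [g = 1 - t + t u], now with [a b = t] instead of [1 - t]: modulo [g] the function
    [f] becomes [t (u - 1)], and subtracting [g] leaves the constant -1. *)
Definition family4 : family.
Proof.
by apply: (@build_family (fun U t l => t) (fun U t l => 1 - (1 - l) * t)%fn
  (fun U t l => 1 + (1 - l) * (1 - t))%fn (fun U t l => 1 - t)%fn (fun U t l => - l)%fn);
  [move=> *; apply: knat_eq|move=> *; apply: knat_eq|move=> *; apply: knat_eq|
   move=> *; apply: knat_eq|fn_ring|fn_ring|fn_ring].
Defined.

Section Deform.
Context (R : spsh (Sm k)) (Y : pspace (Sm k)) (p : smap R Y) (ker : spred R) (q : quot p ker).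
Context (uc : smap R X) (tc : smap R (A1p k)).
Context (x y : forall U n, R U n -> fn U -> fn U -> fn U).
Hypothesis x_nat : forall U V m n (h : ihom V U) (s : mono n m) r f g,
  @x V n (sres h s r) (knat_comp f h) (knat_comp g h) = knat_comp (@x U m r f g) h.
Hypothesis y_nat : forall U V m n (h : ihom V U) (s : mono n m) r f g,
  @y V n (sres h s r) (knat_comp f h) (knat_comp g h) = knat_comp (@y U m r f g) h.
Hypothesis xy_ker : forall U n r f g, @ker U n r -> unimodular g f ->
  (uc U n r = bpt X U n -> g = 1%fn) -> (tc U n r = ofun0 U -> g = 1%fn) ->
  (tc U n r = ofun1 U -> g = gm_val (uc U n r)) -> unimodular (@x U n r f g) (@y U n r f g).

Lemma family_step (F : family) : exists f0 f1 : pmap Y T2,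
  [/\ sg f0 = sg f1,
      forall U n r, let z (w : forall U, fn U -> fn U -> fn U -> fn U) :=
        w U (gm_val (uc U n r)) (tc U n r) 0%fn in
        f0 U n (p U n r) = t2 U n (@x U n r (z (fam_f F)) (z (fam_g F)), @y U n r (z (fam_f F)) (z (fam_g F)))
    & forall U n r, let z (w : forall U, fn U -> fn U -> fn U -> fn U) :=
        w U (gm_val (uc U n r)) (tc U n r) 1%fn in
        f1 U n (p U n r) = t2 U n (@x U n r (z (fam_f F)) (z (fam_g F)), @y U n r (z (fam_f F)) (z (fam_g F)))].
Proof.
pose z (w : forall U, fn U -> fn U -> fn U -> fn U) U n (r : sprod R (A1p k) U n) : fn U :=
  w U (gm_val (uc U n r.1)) (tc U n r.1) r.2.
pose xx U n (r : sprod R (A1p k) U n) := @x U n r.1 (z (fam_f F) U n r) (z (fam_g F) U n r).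
pose yy U n (r : sprod R (A1p k) U n) := @y U n r.1 (z (fam_f F) U n r) (z (fam_g F) U n r).
have zf U V m n (h : ihom V U) (s : mono n m) r :
    z (fam_f F) V n (sres h s r) = knat_comp (z (fam_f F) U m r) h.
  by rewrite /z -fam_f_nat /= !smapE -(gm_natural h s).
have zg U V m n (h : ihom V U) (s : mono n m) r :
    z (fam_g F) V n (sres h s r) = knat_comp (z (fam_g F) U m r) h.
  by rewrite /z -fam_g_nat /= !smapE -(gm_natural h s).
have xn : fn_natural (W := sprod R (A1p k)) xx.
  by move=> U V m n h s r; rewrite /xx zf zg x_nat.
have yn : fn_natural (W := sprod R (A1p k)) yy.
  by move=> U V m n h s r; rewrite /yy zf zg y_nat.
have kr U n r t : @ker U n r -> unimodular (xx U n (r, t)) (yy U n (r, t)).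
  move=> kr; apply: xy_ker => //; rewrite /z /=.
  - by apply: fam_unimodular; apply: gm_unit.
  - by move=> ->; rewrite gm_val_bpt fam_g1.
  - by move=> ->; rewrite fam_gt0.
  - by move=> ->; rewrite fam_gt1.
have en (c : forall U, fn U) : (forall U V (h : ihom V U), knat_comp (c U) h = c V) ->
    exists e : pmap Y T2, forall U n r, e U n (p U n r) = t2 U n (xx U n (r, c U), yy U n (r, c U)).
  move=> cn.
  have xcn : fn_natural (W := R) (fun U n r => xx U n (r, c U)).
    by move=> U V m n h s r; rewrite -(xn U V m n h s (r, c U)) /= /sprod_res /= cn.
  have ycn : fn_natural (W := R) (fun U n r => yy U n (r, c U)).
    by move=> U V m n h s r; rewrite -(yn U V m n h s (r, c U)) /= /sprod_res /= cn.
  by apply: (quot_lift q (phi := t2_map xcn ycn)) => U n r kr'; apply: t2_bpt; apply: kr.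
have [|f0 f0E] := en (fun U => ofun0 U); first by move=> *; apply: knat_eq.
have [|f1 f1E] := en (fun U => ofun1 U); first by move=> *; apply: knat_eq.
exists f0, f1; split=> //; exact: (t2_homotopy xn yn q kr f0E f1E).
Qed.

(** In every pair [(x, y)] built from [f] and [g] which stays unimodular on the kernel, [f = u] may
    be replaced by [f = -1]: each of the three families starts where the previous one ends. *)
Lemma deform (f0 f1 : pmap Y T2) :
  (forall U n r, let g := (1 - tc U n r + tc U n r * gm_val (uc U n r))%fn in
     f0 U n (p U n r) = t2 U n (@x U n r (gm_val (uc U n r)) g, @y U n r (gm_val (uc U n r)) g)) ->
  (forall U n r, let g := (1 - tc U n r + tc U n r * gm_val (uc U n r))%fn in
     f1 U n (p U n r) = t2 U n (@x U n r (- ofun1 U)%fn g, @y U n r (- ofun1 U)%fn g)) ->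
  sg f0 = sg f1.
Proof.
move=> f0E f1E.
have [a0 [a1 [ea a0E a1E]]] := family_step family2.
have [b0 [b1 [eb b0E b1E]]] := family_step family3.
have [c0 [c1 [ec c0E c1E]]] := family_step family4.
have cg U n r (a b c d : fn U) : a = c -> b = d ->
    t2 U n (@x U n r a b, @y U n r a b) = t2 U n (@x U n r c d, @y U n r c d) by move=> -> ->.
have -> : f0 = a0.
  by apply: (quot_peq q) => U n r; rewrite f0E a0E /=; apply: cg; fn_ring.
have e1 : a1 = b0.
  by apply: (quot_peq q) => U n r; rewrite a1E b0E /=; apply: cg; fn_ring.
have e2 : b1 = c0.
  by apply: (quot_peq q) => U n r; rewrite b1E c0E /=; apply: cg; fn_ring.
have -> : f1 = c1.
  by apply: (quot_peq q) => U n r; rewrite f1E c1E /=; apply: cg; fn_ring.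
by rewrite ea e1 eb e2 ec.
Qed.

End Deform.
End Deformation.

Section PlaneHomotopies.
Context (k : comPzRingType).
Notation X := (S11 k).
Notation T1 := (T1 k).
Notation T2 := (T2 k).
Notation I := (a1_interval k).
Notation K := (circle I).
Implicit Type U : Sm k.

Lemma unimodularC U (x y : fn U) : unimodular x y -> unimodular y x.
Proof. by move=> [a [b e]]; exists b, a; rewrite -e; fn_ring. Qed.

Section Elementary.
Context (R : spsh (Sm k)) (Y : pspace (Sm k)) (p : smap R Y) (ker : spred R) (q : quot p ker).
Context (x y : forall U n, R U n -> fn U) (xn : fn_natural x) (yn : fn_natural y).

(** A path from the identity to [diag (w, 1/w)] in [SL_2]. *)
Lemma t2_scale (w w' : forall U n, R U n -> fn U) (f : pmap Y T2) :
  fn_natural w -> fn_natural w' -> (forall U n r, (w U n r * w' U n r)%fn = 1%fn) ->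
  (forall U n r, @ker U n r -> unimodular (x r) (y r)) ->
  (forall U n r, f U n (p U n r) = t2 U n (w U n r * x r, y r)%fn) ->
  exists2 f0 : pmap Y T2, (forall U n r, f0 U n (p U n r) = t2 U n (x r, w U n r * y r)%fn) & sg f0 = sg f.
Proof.
move=> wn w'n ww kr fE.
have kr' U n r : @ker U n r -> unimodular (x r) (w U n r * y r)%fn.
  by move/kr; apply: unimodular_scale; exists (w' U n r).
have zn : fn_natural (fun U n r => w U n r * @y U n r)%fn.
  by move=> U V m n h s r; rewrite wn yn; apply: knat_eq.
have [|f0 f0E] := quot_lift q (phi := t2_map xn zn).
  by move=> U n r /kr' /t2_bpt.
exists f0 => //.
(* Four elementary operations with parameter [r.2], applied to [(x, w y)]. At 0 they do nothing; at
   1 their product is [diag (w, 1/w)] and the result is [(w x, y)]. *)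
pose y1 U n (r : sprod R (A1p k) U n) := (w U n r.1 * y r.1 - r.2 * w U n r.1 * x r.1)%fn.
pose x1 U n (r : sprod R (A1p k) U n) := (x r.1 + r.2 * (w' U n r.1 - 1) * y1 U n r)%fn.
pose y2 U n (r : sprod R (A1p k) U n) := (y1 U n r + r.2 * x1 U n r)%fn.
pose x2 U n (r : sprod R (A1p k) U n) := (x1 U n r + r.2 * (w U n r.1 - 1) * y2 U n r)%fn.
have x2n : fn_natural (W := sprod R (A1p k)) x2.
  by move=> U V m n h s r; rewrite /x2 /y2 /x1 /y1 /= !(wn, w'n, xn, yn); apply: knat_eq.
have y2n : fn_natural (W := sprod R (A1p k)) y2.
  by move=> U V m n h s r; rewrite /x2 /y2 /x1 /y1 /= !(wn, w'n, xn, yn); apply: knat_eq.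
apply: (t2_homotopy x2n y2n q).
- move=> U n r t /kr' um; rewrite /x2 /y2 /x1.
  apply: unimodular_e12; apply: unimodular_e21; apply: unimodular_e12.
  rewrite /y1 /= (_ : (_ - _)%fn = (w U n r * y r + (- (t * w U n r)) * x r)%fn); last by fn_ring.
  exact: unimodular_e21.
- by move=> U n r; rewrite f0E; congr (t2 U n (_, _)); rewrite /x2 /y2 /x1 /y1 /=; fn_ring.
move=> U n r; rewrite fE; have := ww U n r; rewrite /x2 /y2 /x1 /y1 /=.
move: (w U n r) (w' U n r) (x r) (y r) => a b c d ab.
symmetry; congr (t2 U n (_, _)).
  by transitivity (a * c + (a * b - 1) * (a * (d - c)))%fn; [fn_ring|rewrite ab; fn_ring].
by transitivity ((a * b) * d + (1 - a * b) * c)%fn; [fn_ring|rewrite ab; fn_ring].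
Qed.

(** Likewise, with a path to the rotation by a right angle. *)
Lemma t2_swap (f g : pmap Y T2) :
  (forall U n r, @ker U n r -> unimodular (x r) (y r)) ->
  (forall U n r, f U n (p U n r) = t2 U n (y r, x r)) ->
  (forall U n r, g U n (p U n r) = t2 U n (- x r, y r)%fn) ->
  sg f = sg g.
Proof.
move=> kr fE gE.
(* Three shears of [(y, x)]: trivial at 0, while at 1 they give successively [y - x], [y] and
   [- x]. *)
pose y1 U n (r : sprod R (A1p k) U n) := (y r.1 + (- r.2) * x r.1)%fn.
pose x1 U n (r : sprod R (A1p k) U n) := (x r.1 + r.2 * y1 U n r)%fn.
pose y2 U n (r : sprod R (A1p k) U n) := (y1 U n r + (- r.2) * x1 U n r)%fn.
have y2n : fn_natural (W := sprod R (A1p k)) y2.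
  by move=> U V m n h s r; rewrite /y2 /x1 /y1 /= !(xn, yn); apply: knat_eq.
have x1n : fn_natural (W := sprod R (A1p k)) x1.
  by move=> U V m n h s r; rewrite /y2 /x1 /y1 /= !(xn, yn); apply: knat_eq.
apply: (t2_homotopy y2n x1n q).
- move=> U n r t /kr um; apply: unimodular_e12; apply: unimodular_e21; apply: unimodular_e12.
  exact: unimodularC.
- by move=> U n r; rewrite fE; congr (t2 U n (_, _)); rewrite /y2 /x1 /y1 /=; fn_ring.
by move=> U n r; rewrite gE; congr (t2 U n (_, _)); rewrite /y2 /x1 /y1 /=; fn_ring.
Qed.

End Elementary.
End PlaneHomotopies.

(** * The multiplicative group *)

Section Invertibility.
Context (k : comPzRingType) (M : smash_structure k) (N : negative_spheres M).
Notation X := (S11 k).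
Notation S1 := (S1 (Sm k)).
Notation S0 := (S0 (Sm k)).
Notation T1 := (T1 k).
Notation T := (Tsph k).
(* The inclusion of [S^0] in [A^1] is not injective over the empty scheme; the second factor
   of [J] is there to compare the simplicial circle with a circle in which [A^1] contracts. *)
Notation J := (prod_interval (a1_interval k) (d1_interval k)).
Notation K := (circle (a1_interval k)).
Notation inv Y := (invertible M (susp T Y)).

Lemma sg_inverse_iso (Y Z : pspace (Sm k)) (f : pmap Y Z) (g : pmap Z Y) :
  pmap_comp g f = pmap_id Y -> pmap_comp f g = pmap_id Z -> sh_iso (sg f).
Proof. by move=> gf fg; exists (sg g); split; rewrite -sg_comp ?gf ?fg sg_id. Qed.

Lemma sg_mid_iso (A B D E : pspace (Sm k)) : sh_iso (sg (smash_mid A B D E)).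
Proof. exact: sg_inverse_iso (smash_midK A B D E) (smash_midK A D B E). Qed.

Lemma inv_sg (Y Z : pspace (Sm k)) (f : pmap Y Z) : sh_iso (sg f) -> inv Y -> inv Z.
Proof. by move=> i; apply: invertible_iso; exists (sg f). Qed.

Lemma inv_sg_sym (Y Z : pspace (Sm k)) (f : pmap Y Z) : sh_iso (sg f) -> inv Z -> inv Y.
Proof. by move=> i; apply: invertible_iso; apply: isomorphic_sym; exists (sg f). Qed.

Lemma inv_S1 : inv S1.
Proof. by apply: (@invertible_inverse _ _ (Sn10 N)); exists (inv10 N); apply: inv10_iso. Qed.

Lemma inv_S11 : inv X.
Proof. by apply: (@invertible_inverse _ _ (Sn11 N)); exists (inv11 N); apply: inv11_iso. Qed.

Definition J_fst : smap J (A1p k) := sfst _ _.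

Definition sigmaJ : pmap (smash X (circle J)) T1 := @sigma k J J_fst (fun U n => erefl) (fun U n => erefl).
Definition sigmaK : pmap (smash X K) T1 :=
  @sigma k (a1_interval k) (smap_id (A1p k)) (fun U n => erefl) (fun U n => erefl).

Definition S1_cl : smap (simplex1 (Sm k)) S1 := collapse_map (@in_ends_bpt (Sm k)) (@in_ends_res (Sm k)).

Lemma S1_quot : quot S1_cl (fun U n t => t = v0 n \/ t = v1 n).
Proof.
case: (collapse_quot (@in_ends_bpt (Sm k)) (@in_ends_res (Sm k))) => surj ker inj.
have e U n (t : mono n 1) : @in_ends (Sm k) U n t <-> t = v0 n \/ t = v1 n.
  split=> [[i ti]|[->|->]]; [|by exists ord0|by exists ord_max].
  by case: (ord2_cases i) => e; [left|right]; apply: mono_eq => l; rewrite ti e.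
split=> [//|U n t|U n t t' /inj [->|h]]; [by rewrite -e|by left|by right; apply/(e U)].
Qed.

Lemma S1_ends U n t : t = v0 n \/ t = v1 n -> S1_cl U n t = bpt S1 U n.
Proof. exact: (proj1 (quot_ker S1_quot t)). Qed.

Definition theta0 : smap (sprod S0 J) S1 :=
  @SMap _ (sprod S0 J) S1 (fun U n w => if w.1 then S1_cl U n w.2.2 else bpt S1 U n)
    (fun U V m n f s w => match w.1 as b return
       (if b then S1_cl V n (sres f s w.2.2) else bpt S1 V n) =
       sres f s (if b then S1_cl U m w.2.2 else bpt S1 U m)
     with true => smapE S1_cl f s w.2.2
     | false => esym (sres_bpt S1 f s) end).

Let tq := smash_quot (quot_id S0) (circle_quot J).

Lemma theta_subproof U n (r : sprod S0 J U n) :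
  is_bpt r.1 \/ circle_ends r.2 -> theta0 U n r = bpt S1 U n.
Proof.
case: r => b [t s] /= [->//|e]; case: b => //; apply: S1_ends.
by case: e => -[_ ->]; [left|right].
Qed.

Definition theta : pmap (smash S0 (circle J)) S1 := qmap tq theta_subproof.

(** This is [contractible_cofibre] for [S^0] in [Delta^1], which the second coordinate of [J]
    contracts by minima. Combined with [sigmaJ] it relates [T1] to [X] and the simplicial circle. *)
Lemma theta_iso : sh_iso (sg theta).
Proof.
pose B := simplex1 (Sm k).
have jn (U V : Sm k) m n (f : ihom V U) (s : mono n m) (b : S0 U m) :
    (if sres f s b then v1 n else v0 n) = @sres _ B U V m n f s (if b then v1 m else v0 m).
  by case: b; apply: mono_eq.
pose j : pmap S0 B := @PMap _ S0 B (@SMap _ S0 B (fun U n b => if b then v1 n else v0 n) jn) (fun U n => erefl).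
pose c : smap (sprod B J) B := @SMap _ (sprod B J) B (fun U n w => smin w.1 w.2.2)
  (fun U V m n f s w => imeet_res (i := d1_interval k) f s w.1 w.2.2).
have je U n (t : B U n) : t = v0 n \/ t = v1 n <-> exists b, j U n b = t.
  by split=> [[->|->]|[b <-]]; [exists false|exists true|case: b; [right|left]].
apply: sh_map_iso; apply: (contractible_cofibre (j := j) (c := c) (q := S1_cl)).
- by move=> U n [] [] //= e; [case: (v0_neq_v1 (esym e))|case: (v0_neq_v1 e)].
- case: S1_quot => surj ker inj; split=> // [U n t|U n t t' /inj [->|e]]; [by rewrite -je|by left|].
  by right; apply/je.
- by move=> U n b; apply: (imeetx0 (i := d1_interval k) (U := U) b).
- by move=> U n b; apply: (imeetx1 (i := d1_interval k) (U := U) b).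
- by move=> U n t; apply: (imeet0x (i := d1_interval k) (U := U) t.2).
move=> U n b t; rewrite (qmapE tq theta_subproof (b, t)).
case: b => /=; first by congr (S1_cl U n _); exact: esym (imeet1x (i := d1_interval k) (U := U) t.2).
by symmetry; apply: S1_ends; left; apply: (imeet0x (i := d1_interval k) (U := U) t.2).
Qed.

Lemma lunit_iso (Y : pspace (Sm k)) : sh_iso (sg (lunit Y)).
Proof. exact: sg_inverse_iso (lpairK Y) (lunitK Y). Qed.

Lemma inv_circleJ : inv (circle J).
Proof. exact: inv_sg (lunit_iso _) (inv_sg_sym theta_iso inv_S1). Qed.

Lemma inv_T1 : inv T1.
Proof.
apply: (@inv_sg _ _ sigmaJ); first exact: sigma_iso.
by apply: invertible_smash; [exact: inv_S11|exact: inv_circleJ].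
Qed.

(** The circle made from [A^1] is not compared with the simplicial one: it is invertible as a smash
    factor of [X /\ K], which is [T1] by [sigmaK]. *)
Lemma inv_K : inv K.
Proof.
by apply: (@invertible_smash_factor _ M X); apply: (inv_sg_sym (f := sigmaK) _ inv_T1); apply: sigma_iso.
Qed.

End Invertibility.

(** * The diagonal of A^1 - 0 *)

Section DiagonalGm.
Context (k : comPzRingType) (M : smash_structure k) (N : negative_spheres M).
Notation X := (S11 k).
Notation T1 := (T1 k).
Notation T2 := (T2 k).
Notation I := (a1_interval k).
Notation K := (circle I).
Implicit Type U : Sm k.

Lemma sigmaKE U n (u : X U n) (t : fn U) :
  sigmaK k U n (smash_pair u (circle_cl I U n t)) = t1 U n (1 - t + t * gm_val u)%fn.
Proof. exact: sigmaE. Qed.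

Lemma sigmaK_iso : sh_iso (sg (sigmaK k)).
Proof. exact: sigma_iso. Qed.

Lemma neg_t1_subproof U n (x : line k U n) :
  fun_unit (x : fn U) -> t1 U n (- (x : fn U))%fn = bpt T1 U n.
Proof. by move=> u; apply: t1_bpt; apply: fun_unitN. Qed.

Lemma neg_natural : fn_natural (W := line k) (fun U n x => - x)%fn.
Proof. by move=> U V m n f s x; apply: knat_eq. Qed.

Definition neg_t1 : pmap T1 T1 := qmap (t1_quot k) (phi := t1_map neg_natural) neg_t1_subproof.

Lemma neg_t1E U n (x : fn U) : neg_t1 U n (t1 U n x) = t1 U n (- x)%fn.
Proof. exact: (qmapE (phi := t1_map neg_natural) (t1_quot k) neg_t1_subproof x). Qed.

Lemma twist_T1 : sg (smash_tw T1 T1) = sg (smash_pmap neg_t1 (pmap_id T1)).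
Proof.
apply: (sh_mono (smash_t2_iso k)); rewrite -!sg_comp.
apply: (t2_swap (smash_quot (t1_quot k) (t1_quot k)) (x := fun U n w => w.1) (y := fun U n w => w.2)) => //.
- by move=> U n [x y] /= [u|u]; [apply: unimodular_unitl|apply: unimodular_unitr].
- by move=> U n [x y]; rewrite /= smash_twE smash_t2E.
- by move=> U n [x y]; rewrite /= smash_pmapE /= neg_t1E smash_t2E.
Qed.

(** It sends [(a, b, s, t)] to [(1 - s + s a, 1 - t + t b)]. Through it, maps into [X /\ X] become
    pairs of functions once they are smashed with [K /\ K]. *)
Definition plane_out : pmap (smash (smash X X) (smash K K)) T2 :=
  pmap_comp (pmap_comp smash_t2 (smash_pmap (sigmaK k) (sigmaK k))) (smash_mid X X K K).

Lemma plane_out_iso : sh_iso (sg plane_out).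
Proof.
rewrite sg_comp; apply: sh_iso_comp (sg_mid_iso _ _ _ _).
rewrite sg_comp; apply: sh_iso_comp (smash_t2_iso k) _.
exact: (sg_smash_iso M sigmaK_iso sigmaK_iso).
Qed.

Section Squares.
Context (f : pmap X (smash X X)).

Definition plane_map : pmap (smash X (smash K K)) T2 :=
  pmap_comp plane_out (smash_pmap f (pmap_id (smash K K))).

Lemma plane_mapE U n (u a b : X U n) (s t : fn U) : f U n u = smash_pair a b ->
  plane_map U n (smash_pair u (smash_pair (circle_cl I U n s) (circle_cl I U n t))) =
  t2 U n (1 - s + s * gm_val a, 1 - t + t * gm_val b)%fn.
Proof. by move=> e; rewrite /= smash_pmapE e smash_midE smash_pmapE !sigmaKE smash_t2E. Qed.

End Squares.

Definition rho_left : pmap X (smash X X) := pmap_comp (smash_pmap (rho_map k) (pmap_id X)) (lpair X).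
Definition rho_right : pmap X (smash X X) := pmap_comp (smash_pmap (pmap_id X) (rho_map k)) (rpair X).

Lemma gm_val_m1 U n : gm_val (n := n) (Gm_constm1 U) = (- ofun1 U)%fn.
Proof. exact: knat_eq. Qed.

Lemma plane_map_diagonal : sg (plane_map (diagonal X)) = sg (plane_map rho_left).
Proof.
have q := smash_quot (quot_id X) (smash_quot (circle_quot I) (circle_quot I)).
pose W := sprod X (sprod I I).
pose uc : smap W X := sfst _ _.
pose tc : smap W (A1p k) := @SMap _ W (A1p k) (fun U n w => w.2.2) (fun _ _ _ _ _ _ _ => erefl).
(* The pair is [(f, g)] at [s = 1]; its first entry is 1 at [s = 0], and its second entry is 1 at
   [t = 0] and [u] at [t = 1], so it is unimodular on the boundary of the square. For [f = -1] the
   first entry is the line from 1 to -1 of [rho_left]. *)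
apply: (deform q (uc := uc) (tc := tc)
  (x := fun U n w f g => (1 - w.2.1 + w.2.1 * f)%fn)
  (y := fun U n w f g => ((1 - w.2.1) * (1 - w.2.2 + w.2.2 * gm_val w.1) + w.2.1 * g)%fn)).
- by move=> U V m n h s w f g; apply: knat_eq.
- by move=> U V m n h s w f g; apply: knat_eq.
- move=> U n [u [s t]] f g /= kr um g1 gt0 gt1.
  case: kr => [e|[|]].
  + apply: unimodular_unitr; rewrite (g1 e) (e : u = _) gm_val_bpt (_ : (_ + _)%fn = 1%fn); [exact: fun_unit1|fn_ring].
  + case=> ->; first by apply: unimodular_unitl; rewrite (_ : (_ + _)%fn = 1%fn); [exact: fun_unit1|fn_ring].
    rewrite (_ : (_ + _ * f)%fn = f); last by fn_ring.
    by rewrite (_ : (_ + _ * g)%fn = g); [apply: unimodularC|fn_ring].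
  + case=> e; apply: unimodular_unitr; rewrite e.
      by rewrite gt0 // (_ : (_ + _ * _)%fn = 1%fn); [exact: fun_unit1|fn_ring].
    by rewrite gt1 // (_ : (_ + s * _)%fn = gm_val u); [exact: gm_unit|fn_ring].
- move=> U n [u [s t]]; apply: etrans (plane_mapE (f := diagonal X) s t (a := u) (b := u) erefl) _.
  by congr (t2 U n (_, _)) => /=; fn_ring.
move=> U n [u [s t]].
apply: etrans (plane_mapE (f := rho_left) (u := u) s t (a := Gm_constm1 U) (b := u) _) _.
  by rewrite /= smash_twE smash_pmapE.
by rewrite gm_val_m1; congr (t2 U n (_, _)) => /=; fn_ring.
Qed.

Lemma diagonal_rho_left : sg (diagonal X) = sg rho_left.
Proof.
have iK := inv_K N; have iKK : invertible M (susp (Tsph k) (smash K K)) by apply: invertible_smash.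
apply: (sg_cancel iKK).
apply: (sh_mono plane_out_iso).
have e f : sg plane_out \c sg (smash_pmap f (pmap_id (smash K K))) = sg (plane_map f) by rewrite /plane_map sg_comp.
exact (etrans (e (diagonal X)) (etrans plane_map_diagonal (esym (e rho_left)))).
Qed.

(** The diagonal is invariant under the twist, which exchanges [rho_left] and [rho_right]. *)
Lemma diagonal_rho_right : sg (diagonal X) = sg rho_right.
Proof.
have -> : diagonal X = pmap_comp (smash_tw X X) (diagonal X).
  by apply: pmap_eq => U n x; rewrite /= smash_twE.
rewrite sg_comp diagonal_rho_left -sg_comp; congr sg.
by apply: pmap_eq => U n x; rewrite /= smash_twE !smash_pmapE smash_twE.
Qed.

End DiagonalGm.

(** * Lines, triangles and power maps *)

Section Powers.
Context (k : comPzRingType) (M : smash_structure k) (N : negative_spheres M).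
Notation X := (S11 k).
Notation T1 := (T1 k).
Notation T2 := (T2 k).
Notation I := (a1_interval k).
Notation K := (circle I).
Implicit Type U : Sm k.

Definition pw (m : int) U n (u : X U n) : fn U := gm_val (power_map k m U n u).
Definition pw' (m : int) U n (u : X U n) : fn U := gm_inv (power_map k m U n u).

Lemma pw_natural m : fn_natural (W := X) (fun U n u => pw m u).
Proof. by move=> U V p n h s u; rewrite /pw smapE (gm_natural h s). Qed.

Lemma pw'_natural m : fn_natural (W := X) (fun U n u => pw' m u).
Proof. by move=> U V p n h s u; rewrite /pw' smapE (gm_inv_natural h s). Qed.

Lemma pw_bpt m U n : pw m (bpt X U n) = 1%fn.
Proof. by rewrite /pw pmap_bpt gm_val_bpt. Qed.

Lemma pw_unit m U n (u : X U n) : fun_unit (pw m u).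
Proof. exact: gm_unit. Qed.

Lemma pw_succ m U n (u : X U n) : pw (m + 1) u = (gm_val u * pw m u)%fn.
Proof. exact: gm_val_power. Qed.

Let qXK := smash_quot (quot_id X) (circle_quot I).

Definition line_path U n (w : sprod X I U n) : fn U := (1 - (w.2 : fn U) + (w.2 : fn U) * gm_val w.1)%fn.

Lemma line_path_natural : fn_natural (W := sprod X I) line_path.
Proof. by move=> U V m n h s w; apply: knat_eq. Qed.

Lemma line_path_unit U n (w : sprod X I U n) : is_bpt w.1 \/ circle_ends w.2 -> fun_unit (line_path w).
Proof.
case: w => u t; rewrite /line_path /=; case=> [->|[->|->]] /=.
- by rewrite (_ : (_ + _)%fn = 1%fn); [exact: fun_unit1|fn_ring].
- by rewrite (_ : (_ + _)%fn = 1%fn); [exact: fun_unit1|fn_ring].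
- by rewrite (_ : (_ + _)%fn = gm_val u); [exact: gm_unit|fn_ring].
Qed.

Lemma psi_natural m : fn_natural (W := sprod X I) (fun U n w => pw m w.1 * line_path w)%fn.
Proof.
by move=> U V p n h s w; rewrite line_path_natural [pw _ _]pw_natural; apply: knat_eq.
Qed.

Lemma psi_subproof m U n (w : sprod X I U n) :
  is_bpt w.1 \/ circle_ends w.2 -> t1_map (psi_natural m) U n w = bpt T1 U n.
Proof.
by move=> kw; apply: t1_bpt; apply: fun_unitM; [exact: pw_unit|exact: line_path_unit].
Qed.

(** The loop of lines through [u^m] and [u^(m+1)]. *)
Definition psi m : pmap (smash X K) T1 := qmap qXK (psi_subproof m).

Lemma psiE m U n (u : X U n) (t : fn U) :
  psi m U n (smash_pair u (circle_cl I U n t)) = t1 U n (pw m u * (1 - t + t * gm_val u))%fn.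
Proof. exact: (qmapE qXK (psi_subproof m) (u, t)). Qed.

Lemma psi0 : psi 0 = sigmaK k.
Proof.
apply: (quot_peq qXK) => U n [u t]; rewrite [LHS]psiE [RHS]sigmaKE; congr (t1 U n _).
by apply: knat_eq => B x /=; rewrite mul1r.
Qed.

(** Smash with [T1], with coordinate [z], and write [L = 1 - t + t u]. By [t2_scale] the units
    change sides: [(u^(m+1) L, z)] becomes [(L, u^(m+1) z)] and [(- u^m L, z)] becomes
    [(L, - u^m z)]. These are the pairs [(g, f u^m z)] for [g = L] with [f = u] and [f = -1], which
    [deform] identifies. *)
Lemma psi_succ m : sg (psi (m + 1)) = sg (pmap_comp (neg_t1 k) (psi m)).
Proof.
pose lam (f : pmap (smash X K) T1) := pmap_comp smash_t2 (smash_pmap f (pmap_id T1)).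
have lamE (f : pmap (smash X K) T1) U n (u : X U n) (t y : fn U) z : f U n (smash_pair u (circle_cl I U n t)) = t1 U n z ->
    lam f U n (smash_pair (smash_pair u (circle_cl I U n t)) (t1 U n y)) = t2 U n (z, y).
  by move=> e; rewrite /= smash_pmapE e smash_t2E.
have q := smash_quot qXK (t1_quot k).
pose R := sprod (sprod X I) (line k).
pose x U n (r : R U n) := line_path r.1.
pose y U n (r : R U n) : fn U := r.2.
have xn : fn_natural x by move=> U V p n h s r; apply: line_path_natural.
have yn : fn_natural y by [].
have kr U n (r : R U n) : (is_bpt r.1.1 \/ circle_ends r.1.2) \/ fun_unit (r.2 : fn U) ->
    unimodular (x U n r) (y U n r).
  by case=> [/line_path_unit|] e; [apply: unimodular_unitl|apply: unimodular_unitr].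
have [|||||f0 f0E e0] := t2_scale q xn yn (f := lam (psi (m + 1)))
    (w := fun U n r => pw (m + 1) r.1.1) (w' := fun U n r => pw' (m + 1) r.1.1).
- by move=> U V p n h s r; apply: pw_natural.
- by move=> U V p n h s r; apply: pw'_natural.
- by move=> U n r; apply: gm_mulV.
- exact: kr.
- by move=> U n [[u t] z]; apply: lamE; rewrite psiE.
have [|||||f1 f1E e1] := t2_scale q xn yn (f := lam (pmap_comp (neg_t1 k) (psi m)))
    (w := fun U n r => (- pw m r.1.1)%fn) (w' := fun U n r => (- pw' m r.1.1)%fn).
- by move=> U V p n h s r; rewrite [pw _ _]pw_natural; apply: knat_eq.
- by move=> U V p n h s r; rewrite [pw' _ _]pw'_natural; apply: knat_eq.
- by move=> U n r; transitivity (pw m r.1.1 * pw' m r.1.1)%fn; [fn_ring|exact: gm_mulV].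
- exact: kr.
- move=> U n [[u t] z]; apply: lamE; rewrite /= psiE neg_t1E; congr (t1 U n _); rewrite /x /line_path /=; fn_ring.
suff e : sg f0 = sg f1.
  apply: (sg_cancel (inv_T1 N)); apply: (sh_mono (smash_t2_iso k)).
  have le (f : pmap (smash X K) T1) : sg smash_t2 \c sg (smash_pmap f (pmap_id T1)) = sg (lam f) by rewrite /lam sg_comp.
  exact (etrans (le _) (etrans (esym e0) (etrans e (etrans e1 (esym (le _)))))).
pose uc : smap R X := smap_comp (sfst _ _) (sfst _ _).
pose tc : smap R (A1p k) := @SMap _ R (A1p k) (fun U n w => w.1.2) (fun _ _ _ _ _ _ _ => erefl).
apply: (deform q (uc := uc) (tc := tc) (x := fun U n r f g => g)
  (y := fun U n r f g => (f * (pw m r.1.1 * y U n r))%fn)).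
- by [].
- by move=> U V p n h s r f g; rewrite [pw _ _]pw_natural; apply: knat_eq.
- move=> U n [[u t] z] f g /= kz um g1 gt0 gt1.
  have wz : (fun_unit (z : fn U) -> unimodular g (f * (pw m u * (z : fn U)))%fn).
    move=> zu; rewrite (_ : (f * _)%fn = ((pw m u * (z : fn U)) * f)%fn); last by fn_ring.
    by apply: unimodular_scale um; apply: fun_unitM => //; apply: pw_unit.
  case: kz => [|//]; case=> [e|[e|e]]; apply: unimodular_unitl.
  + by rewrite (g1 e); apply: fun_unit1.
  + by rewrite (gt0 e); apply: fun_unit1.
  + by rewrite (gt1 e); apply: gm_unit.
- by move=> U n [[u t] z]; rewrite f0E; congr (t2 U n (_, _)) => /=; rewrite pw_succ /y /=; fn_ring.
- by move=> U n [[u t] z]; rewrite f1E; congr (t2 U n (_, _)) => /=; rewrite /y /=; fn_ring.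
Qed.

End Powers.

Section PowerSum.
Context (k : comPzRingType) (A : additive_structure k).
Notation X := (S11 k).
Notation T1 := (T1 k).
Notation I := (a1_interval k).
Notation K := (circle I).
Notation V2 := (V2 k).
Implicit Type U : Sm k.

Lemma origin_res (U V : Sm k) m n (f : ihom V U) (s : mono n m) :
  @sres _ (sprod (A1p k) (A1p k)) U V m n f s (ofun0 U, ofun0 U) = (ofun0 V, ofun0 V).
Proof. by congr pair; apply: knat_eq. Qed.

Definition plane0 : pspace (Sm k) :=
  @PSpace (Sm k) (sprod (A1p k) (A1p k)) (fun U n => (ofun0 U, ofun0 U)) origin_res.

Definition axis (c : bool) U (t : fn U) : fn U * fn U := if c then (t, 0%fn) else (0%fn, t).
Definition coordinate (c : bool) U (z : fn U * fn U) : fn U := if c then z.1 else z.2.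

Lemma axis_natural (c : bool) (U V : Sm k) m n (f : ihom V U) (s : mono n m) (t : fn U) :
  axis c (@sres _ (A1p k) U V m n f s t) = @sres _ plane0 U V m n f s (axis c t).
Proof. by case: c; congr pair; apply: knat_eq. Qed.

Lemma vertex_natural (U V : Sm k) m n (f : ihom V U) (s : mono n m) (v : V2 U m) :
  (if sres f s v is Some c then axis c (ofun1 V) else bpt plane0 V n) =
  @sres _ plane0 U V m n f s (if v is Some c then axis c (ofun1 U) else bpt plane0 U m).
Proof.
case: v => [c|] /=; last exact: esym (origin_res f s).
transitivity (axis c (@sres _ (A1p k) U V m n f s (ofun1 U))); last exact: axis_natural.
by congr (axis c _); exact: esym (knat_comp_one f).
Qed.

Definition vertex : pmap V2 plane0 :=
  @PMap _ V2 plane0 (@SMap _ V2 plane0 (fun U n v => if v is Some c then axis c (ofun1 U) else bpt plane0 U n)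
    vertex_natural) (fun U n => erefl).

Definition vertices : pmap (smash X V2) (smash X plane0) := smash_pmap (pmap_id X) vertex.

(** Where 0 = 1 the three points coincide, but there [A^1 - 0] has a single point, so both smash
    products are trivial. This is why [X] is smashed in before the points are collapsed. *)
Lemma vertices_inj U n : injective (vertices U n).
Proof.
have empty (u : X U n) : ofun0 U = ofun1 U -> u = bpt X U n.
  move=> e; apply: gm_val_eq1; transitivity (1 * gm_val u)%fn; first by fn_ring.
  rewrite -e; transitivity (0 : fn U)%fn => //; fn_ring.
have vi v v' : vertex U n v = vertex U n v' -> v = v' \/ ofun0 U = ofun1 U.
  case: v v' => [[]|] [[]|] /= e; try (by left); right;
    have e1 := congr1 fst e; have e2 := congr1 snd e; simpl in *; congruence.
have qB := smash_quot (quot_id X) (quot_id plane0).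
elim/smash_ind=> u v; elim/smash_ind=> u' v'; rewrite /vertices !smash_pmapE /= => e.
have v0 (w : X U n) z : vertex U n z = bpt plane0 U n -> smash_pair w z = bpt (smash X V2) U n.
  move=> z0; apply: smash_pair_bpt; have := vi z None z0.
  by case=> [h|h]; [right; rewrite h|left; apply: empty].
have triv (w : X U n) z : is_bpt w \/ is_bpt (vertex U n z) -> smash_pair w z = bpt (smash X V2) U n.
  by case=> [h|]; [apply: smash_pair_bpt; left|apply: v0].
case: (quot_inj qB (r := (u, vertex U n v)) (r' := (u', vertex U n v')) e) => [[<- /vi]|t].
  by case=> [->//|/(empty u) ->]; rewrite !smash_pair_bpt //; left.
rewrite (triv _ _ t); symmetry; apply: triv.
apply/(quot_ker qB (u', vertex U n v')); rewrite -[LHS]/(smash_pair u' (vertex U n v')) -e.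
exact/(quot_ker qB (u, vertex U n v)).
Qed.

Definition is_vertex : spred (smash X plane0) := fun U n b => exists a, vertices U n a = b.
Lemma is_vertex_bpt U n : is_vertex (bpt (smash X plane0) U n).
Proof. by exists (bpt _ U n); apply: pmap_bpt. Qed.
Lemma is_vertex_res (U V : Sm k) m n (f : ihom V U) (s : mono n m) b :
  @is_vertex U m b -> @is_vertex V n (sres f s b).
Proof. by move=> [a <-]; exists (sres f s a); rewrite smapE. Qed.

(** [X /\ (A^2 / three points)]; the edges of the triangle are loops in it. *)
Definition triangle : pspace (Sm k) := collapse is_vertex_bpt is_vertex_res.
Definition triangle_cl : smap (smash X plane0) triangle := collapse_map is_vertex_bpt is_vertex_res.

Let qT : quot triangle_cl is_vertex := collapse_quot is_vertex_bpt is_vertex_res.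
Let qB := smash_quot (quot_id X) (quot_id plane0).
Let qK := smash_quot (quot_id X) (circle_quot I).
Let q := quot_comp qB qT (fun U n => erefl).

Definition triangle_pt U n (u : X U n) (z : fn U * fn U) : triangle U n :=
  triangle_cl U n (@smash_pair _ X plane0 U n u z).

Definition on_vertex U (z : fn U * fn U) : Prop :=
  [\/ z = axis true 0%fn, z = axis true 1%fn | z = axis false 1%fn].

Lemma vertex_ker U n (u : X U n) (z : fn U * fn U) :
  is_vertex (@smash_pair _ X plane0 U n u z) <-> u = bpt X U n \/ on_vertex z.
Proof.
split=> [[]|[->|]].
- elim/smash_ind=> u' v; rewrite /vertices smash_pmapE => e.
  have vv : on_vertex (vertex U n v).
    by case: v e => [[]|] _; [apply: Or32|apply: Or33|apply: Or31].
  case: (quot_inj qB (r := (u, z)) (r' := (u', vertex U n v)) (esym e)) => [[_ ->]|[|/= ->]]; first by right.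
    by left.
  by right; apply: Or31.
- by rewrite smash_pair_bpt; [exact: is_vertex_bpt|left].
- have h v : is_vertex (@smash_pair _ X plane0 U n u (vertex U n v)).
    by exists (smash_pair u v); rewrite /vertices smash_pmapE.
  by case=> ->; [exact: (h None)|exact: (h (Some true))|exact: (h (Some false))].
Qed.

Lemma triangle_pt_bpt U n (u : X U n) z : u = bpt X U n \/ on_vertex z -> triangle_pt u z = bpt triangle U n.
Proof. by move=> h; apply/(quot_ker qT); apply/vertex_ker. Qed.

Section Edge.
Context (z : forall U, fn U -> fn U * fn U).
Hypothesis z_nat : forall (U V : Sm k) m n (f : ihom V U) (s : mono n m) t,
  z (@sres _ (A1p k) U V m n f s t) = @sres _ plane0 U V m n f s (z t).
Hypothesis z0 : forall U, on_vertex (z (ofun0 U)).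
Hypothesis z1 : forall U, on_vertex (z (ofun1 U)).

Lemma edge_natural (U V : Sm k) m n (f : ihom V U) (s : mono n m) (w : sprod X I U m) :
  triangle_pt (sres f s w).1 (z (sres f s w).2) = sres f s (triangle_pt w.1 (z w.2)).
Proof.
rewrite /triangle_pt -smapE; congr (triangle_cl V n _).
by rewrite [RHS](@smash_pairE _ X plane0 U V m n f s w.1 (z w.2)) -z_nat.
Qed.

Lemma edge_subproof U n (w : sprod X I U n) : is_bpt w.1 \/ circle_ends w.2 ->
  SMap edge_natural U n w = bpt triangle U n.
Proof.
case=> h; apply: triangle_pt_bpt; first by left.
by right; case: h => ->; [apply: z0|apply: z1].
Qed.

Definition edge : pmap (smash X K) triangle := qmap qK edge_subproof.

Lemma edgeE U n (u : X U n) (t : fn U) : edge U n (smash_pair u (circle_cl I U n t)) = triangle_pt u (z t).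
Proof. exact: (qmapE qK edge_subproof (u, t)). Qed.

End Edge.

Lemma axis0 c U : on_vertex (axis c (ofun0 U)).
Proof. by case: c; apply: Or31. Qed.
Lemma axis1 c U : on_vertex (axis c (ofun1 U)).
Proof. by case: c; [apply: Or32|apply: Or33]. Qed.
Definition edge_axis c := edge (axis_natural c) (axis0 c) (axis1 c).

Definition hyp U (t : fn U) : fn U * fn U := ((1 - t)%fn, t).
Lemma hyp_natural (U V : Sm k) m n (f : ihom V U) (s : mono n m) (t : fn U) :
  hyp (@sres _ (A1p k) U V m n f s t) = @sres _ plane0 U V m n f s (hyp t).
Proof. by congr pair; apply: knat_eq. Qed.
Lemma hyp0 U : on_vertex (hyp (ofun0 U)).
Proof. by apply: Or32; congr pair; fn_ring. Qed.
Lemma hyp1 U : on_vertex (hyp (ofun1 U)).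
Proof. by apply: Or33; congr pair; fn_ring. Qed.
Definition edge_hyp := edge hyp_natural hyp0 hyp1.

Section Projection.
Context (c : bool).
Lemma coordinate_natural (U V : Sm k) m n (f : ihom V U) (s : mono n m) (r : sprod X plane0 U m) :
  smash_pair (sres f s r).1 (circle_cl I V n (coordinate c (sres f s r).2)) =
  sres f s (smash_pair r.1 (circle_cl I U m (coordinate c r.2)) : smash X K U m).
Proof.
rewrite [RHS]smash_pairE; congr smash_pair.
by rewrite -[RHS]smapE; congr (circle_cl I V n _); case: c.
Qed.

Lemma projection_subproof U n (r : sprod X plane0 U n) :
  is_vertex (smash_map0 (smap_id X) (smap_id plane0) U n r) ->
  SMap coordinate_natural U n r = bpt (smash X K) U n.
Proof.
case: r => u z /vertex_ker [e|h]; apply: smash_pair_bpt; [by left|right].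
apply/(quot_ker (circle_quot I)); rewrite /circle_ends /=.
by move: h; rewrite /= => -[] ->; case: c; [left|left|right|left|left|right].
Qed.

Definition projection : pmap triangle (smash X K) := qmap q projection_subproof.

Lemma projectionE U n (u : X U n) (z : fn U * fn U) :
  projection U n (triangle_pt u z) = smash_pair u (circle_cl I U n (coordinate c z)).
Proof. exact: (qmapE q projection_subproof (u, z)). Qed.
End Projection.

Lemma projection_edge c : pmap_comp (projection c) (edge_axis c) = pmap_id _.
Proof.
apply: (quot_peq qK) => U n [u t]; rewrite -[RHS]/(smash_pair u (circle_cl I U n t)).
rewrite -[LHS]/(projection c U n (edge_axis c U n (smash_pair u (circle_cl I U n t)))).
by rewrite edgeE projectionE; congr (smash_pair _ (circle_cl I U n _)); case: c.
Qed.

Lemma projection_edge' c : pmap_comp (projection (~~ c)) (edge_axis c) = pmap_const _ _.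
Proof.
apply: (quot_peq qK) => U n [u t]; rewrite -[RHS]/(bpt (smash X K) U n).
rewrite -[LHS]/(projection (~~ c) U n (edge_axis c U n (smash_pair u (circle_cl I U n t)))).
rewrite edgeE projectionE; apply: smash_pair_bpt; right.
by apply/(quot_ker (circle_quot I)); left; case: c.
Qed.

(** Scaling contracts the plane to the origin, so [triangle] is the suspension of [X /\ V2]. That is
    a wedge of two copies of [X /\ K], whose inclusions become the edges on the axes. *)
Lemma edge_axes_jointly_epi (u : SH (susp (Tsph k) triangle) (susp (Tsph k) triangle)) :
  (forall c, u \c sg (edge_axis c) = sg (edge_axis c)) -> u = sh_id _.
Proof.
move=> ue.
pose sc (z : smap (sprod (sprod X plane0) I) (smash X plane0)) := forall U n x a t,
  z U n ((x, a), t) = @smash_pair _ X plane0 U n x ((t : fn U) * a.1, (t : fn U) * a.2)%fn.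
have [c0 c0E] : exists z, sc z.
  have zn (U V : Sm k) m n (f : ihom V U) (s : mono n m) (w : sprod (sprod X plane0) I U m) :
      @smash_pair _ X plane0 V n (sres f s w.1.1)
        ((sres f s w.2 : fn V) * (sres f s w.1.2).1, (sres f s w.2 : fn V) * (sres f s w.1.2).2)%fn =
      sres f s (@smash_pair _ X plane0 U m w.1.1 ((w.2 : fn U) * w.1.2.1, (w.2 : fn U) * w.1.2.2)%fn).
    rewrite [RHS]smash_pairE; congr smash_pair; congr pair; exact: knat_eq.
  by exists (SMap zn).
have [|c [cE cb]] := quot_lift2 qB (phi := c0).
  move=> U n [x a] t /= [e|e]; rewrite c0E; apply: smash_pair_bpt; [by left|right].
  by rewrite (e : a = _) /=; congr pair; fn_ring.
have cP U n x (a : fn U * fn U) t :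
    c U n (@smash_pair _ X plane0 U n x a, t) = @smash_pair _ X plane0 U n x ((t : fn U) * a.1, (t : fn U) * a.2)%fn.
  by rewrite -c0E -cE.
have c_0 U n b : c U n (b, i0 I U n) = bpt (smash X plane0) U n.
  by elim/smash_ind: b => x a; rewrite cP; apply: smash_pair_bpt; right; congr pair; fn_ring.
have c_1 U n b : c U n (b, i1 I U n) = b.
  elim/smash_ind: b => x a; rewrite cP; congr smash_pair.
  by case: a => a b; congr pair; fn_ring.
pose W := smash X V2.
have qW := smash_quot (quot_id W) (circle_quot I).
pose th0 : smap (sprod W I) triangle := @SMap _ (sprod W I) triangle
  (fun U n w => triangle_cl U n (c U n (vertices U n w.1, w.2)))
  (fun U V m n f s w => etrans (congr1 (fun b => triangle_cl V n (c V n (b, _))) (smapE vertices f s w.1))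
    (smapE (smap_comp triangle_cl c) f s (vertices U m w.1, w.2))).
have [|th thE] := quot_lift qW (phi := th0).
  move=> U n [x t] /= [->|[->|->]].
  - by rewrite pmap_bpt cb.
  - by rewrite c_0.
  - by rewrite c_1; apply/(quot_ker qT); exists x.
have thE' U n x (t : fn U) : th U n (smash_pair x (circle_cl I U n t)) = triangle_cl U n (c U n (vertices U n x, t)).
  exact: (thE U n (x, t)).
have thi : sh_iso (sg th).
  exact: sh_map_iso (contractible_cofibre vertices_inj qT c_0 c_1 cb thE').
have iw := wedge_smashL K (wedge_smashR X (V2_wedge k)).
have thi_c b : pmap_comp th (smash_pmap (smash_pmap (pmap_id X) (V2_in k b)) (pmap_id K)) =
    pmap_comp (edge_axis b) (smash_pmap (runit X) (pmap_id K)).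
  apply: (quot_peq (smash_quot (smash_quot (quot_id X) (quot_id (S0 (Sm k)))) (circle_quot I))) => U n [[x e] t].
  rewrite -[LHS]/(th U n (smash_pmap (smash_pmap (pmap_id X) (V2_in k b)) (pmap_id K) U n
    (smash_pair (@smash_pair _ X (S0 (Sm k)) U n x e) (circle_cl I U n t)))).
  rewrite -[RHS]/(edge_axis b U n (smash_pmap (runit X) (pmap_id K) U n
    (smash_pair (@smash_pair _ X (S0 (Sm k)) U n x e) (circle_cl I U n t)))).
  rewrite !smash_pmapE thE' runitE /vertices smash_pmapE cP.
  case: e => /=.
    rewrite edgeE /triangle_pt; congr (triangle_cl U n (smash_pair _ _)).
    by case: b; congr pair; fn_ring.
  rewrite smash_pair_bpt; last by right; congr pair; fn_ring.
  by rewrite [smash_pair (bpt X U n) _]smash_pair_bpt ?pmap_bpt //; left.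
apply: (sh_epi thi); rewrite sh_comp1m; apply: (wedge_space_epi iw).
- by rewrite -sh_compA -sg_comp (thi_c true) sg_comp sh_compA ue.
- by rewrite -sh_compA -sg_comp (thi_c false) sg_comp sh_compA ue.
Qed.

(** The coordinate projections split the edges on the axes, so the identity of [triangle] is the sum
    of two idempotents; it is evaluated on the third edge. *)
Lemma triangle_sum (Y : pspace (Sm k)) (f : pmap triangle Y) :
  sg (pmap_comp f edge_hyp) =
  sh_add A (sg (pmap_comp (pmap_comp f (edge_axis true)) (pmap_comp (projection true) edge_hyp)))
    (sg (pmap_comp (pmap_comp f (edge_axis false)) (pmap_comp (projection false) edge_hyp))).
Proof.
have idE : sh_add A (sg (edge_axis true) \c sg (projection true)) (sg (edge_axis false) \c sg (projection false)) = sh_id _.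
  apply: edge_axes_jointly_epi => c; rewrite sh_addr -!sh_compA -!(sg_comp (projection _)).
  case: c; rewrite ?(projection_edge true) ?(projection_edge false).
    by rewrite (projection_edge' true) sg_const sh_nullR (sh_null_zero A) sh_addr0 sg_id sh_compm1.
  by rewrite (projection_edge' false) sg_const sh_nullR (sh_null_zero A) sh_add0 sg_id sh_compm1.
rewrite (sg_comp f edge_hyp) 2!(sg_comp (pmap_comp f _)) 2!(sg_comp f) 2!(sg_comp (projection _)).
by rewrite -[sg f in LHS]sh_compm1 -idE sh_addl sh_addr !sh_compA.
Qed.

Section Slope.
Context (m : int).
Definition slope_fn U n (r : sprod X plane0 U n) : fn U :=
  (pw m r.1 + r.2.1 * (1 - pw m r.1) + r.2.2 * (pw (m + 1) r.1 - pw m r.1))%fn.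

Lemma slope_natural : fn_natural (W := sprod X plane0) slope_fn.
Proof.
by move=> U V p n h s r; rewrite /slope_fn ![pw _ (sres h s r).1]pw_natural; apply: knat_eq.
Qed.

Lemma slope_subproof U n (r : sprod X plane0 U n) :
  is_vertex (smash_map0 (smap_id X) (smap_id plane0) U n r) ->
  t1_map slope_natural U n r = bpt T1 U n.
Proof.
case: r => u z /vertex_ker h; apply: t1_bpt; rewrite /slope_fn /=.
case: h => [/= ->|].
  by rewrite !pw_bpt (_ : (_ + _)%fn = 1%fn); [exact: fun_unit1|fn_ring].
rewrite /= => -[] -> /=.
- by rewrite (_ : (_ + _)%fn = pw m u); [exact: pw_unit|fn_ring].
- by rewrite (_ : (_ + _)%fn = 1%fn); [exact: fun_unit1|fn_ring].
- by rewrite (_ : (_ + _)%fn = pw (m + 1) u); [exact: pw_unit|fn_ring].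
Qed.

(** The affine function with the values [u^m], [1], [u^(m+1)] at the three points. *)
Definition slope : pmap triangle T1 := qmap q slope_subproof.

Lemma slopeE U n (u : X U n) (z : fn U * fn U) : slope U n (triangle_pt u z) = t1 U n (slope_fn (u, z)).
Proof. exact: (qmapE q slope_subproof (u, z)). Qed.
End Slope.

Definition power_loop m : pmap (smash X K) T1 :=
  pmap_comp (sigmaK k) (smash_pmap (power_map k m) (pmap_id K)).

Lemma power_loopE m U n (u : X U n) (t : fn U) :
  power_loop m U n (smash_pair u (circle_cl I U n t)) = t1 U n (1 - t + t * pw m u)%fn.
Proof. by rewrite /= smash_pmapE sigmaKE. Qed.

(** On the third edge [slope m] runs from 1 to [u^(m+1)]. The projections of that edge to the axes
    run from 1 to [u^m], the first axis being traversed backwards, and from [u^m] to [u^(m+1)];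
    these are [power_loop m] and [psi m]. *)
Lemma power_sum m :
  sg (power_loop (m + 1)) = sh_add A (sg (power_loop m)) (sg (psi k m)).
Proof.
have -> : power_loop (m + 1) = pmap_comp (slope m) edge_hyp.
  apply: (quot_peq qK) => U n [u t].
  apply: etrans (power_loopE _ _ _) (esym (etrans (congr1 (slope m U n) (edgeE hyp_natural hyp0 hyp1 u t)) _)).
  by rewrite slopeE /slope_fn /hyp /=; congr (t1 U n _); fn_ring.
rewrite triangle_sum; congr (sh_add A (sg _) (sg _)); apply: (quot_peq qK) => U n [u t].
- rewrite -[LHS]/(slope m U n (edge_axis true U n (projection true U n (edge_hyp U n
    (smash_pair u (circle_cl I U n t)))))).
  rewrite edgeE projectionE edgeE slopeE; apply: etrans (esym (power_loopE _ _ _)).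
  by rewrite /slope_fn /hyp /=; congr (t1 U n _); fn_ring.
- rewrite -[LHS]/(slope m U n (edge_axis false U n (projection false U n (edge_hyp U n
    (smash_pair u (circle_cl I U n t)))))).
  rewrite edgeE projectionE edgeE slopeE; apply: etrans (esym (psiE _ _ _)).
  by rewrite /slope_fn /hyp /= pw_succ; congr (t1 U n _); fn_ring.
Qed.

End PowerSum.

(** * The simplicial circle *)

Section SimplicialCircle.
Context (k : comPzRingType) (A : additive_structure k).
Notation S1 := (S1 (Sm k)).
Notation D1 := (simplex1 (Sm k)).
Notation cl := (S1_cl k).

Definition sle n (s t : mono n 1) : Prop := forall i, (s i <= t i)%N.

(** A simplex of [Delta^1] is determined by the place where it jumps from 0 to 1. The two cases are
    the two triangles of the square. *)
Lemma sle_total n (s t : mono n 1) : sle s t \/ sle t s.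
Proof.
have [st|nst] := pselect (sle s t); [by left|right=> j].
have [i /negP si] : exists i, ~ (s i <= t i)%N by apply/not_existsP => h; apply: nst => i; apply: contrapT; apply: h.
move: si; rewrite -ltnNge => si.
have [ij|/ltnW ji] := leqP i j.
  have := monoP s ij; move: si; case: (ord2_cases (s i)) => ->; case: (ord2_cases (t i)) => ->;
  by case: (ord2_cases (s j)) => -> //; case: (ord2_cases (t j)) => ->.
have := monoP t ji; move: si; case: (ord2_cases (s i)) => ->; case: (ord2_cases (t i)) => -> //;
by case: (ord2_cases (t j)) => ->.
Qed.

Lemma smaxC n (s t : mono n 1) : smax s t = smax t s.
Proof. by apply: mono_eq => i; rewrite /= /mmax; case: (ord2_cases (s i)) => ->; case: (ord2_cases (t i)) => ->. Qed.

Lemma sminC n (s t : mono n 1) : smin s t = smin t s.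
Proof. by apply: mono_eq => i; rewrite /= /push; case: (ord2_cases (s i)) => ->; case: (ord2_cases (t i)) => ->. Qed.

Lemma smin0l n (t : mono n 1) : smin (v0 n) t = v0 n.
Proof. exact: mono_eq. Qed.
Lemma smin1l n (t : mono n 1) : smin (v1 n) t = t.
Proof. exact: mono_eq. Qed.
Lemma smin0r n (t : mono n 1) : smin t (v0 n) = v0 n.
Proof. by rewrite sminC smin0l. Qed.
Lemma smax0l n (t : mono n 1) : smax (v0 n) t = t.
Proof. exact: mono_eq. Qed.
Lemma smax1l n (t : mono n 1) : smax (v1 n) t = v1 n.
Proof. exact: mono_eq. Qed.
Lemma smax0r n (t : mono n 1) : smax t (v0 n) = t.
Proof. by rewrite smaxC smax0l. Qed.
Lemma smax1r n (t : mono n 1) : smax t (v1 n) = v1 n.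
Proof. by rewrite smaxC smax1l. Qed.

Lemma smin_l n (s t : mono n 1) : sle s t -> smin s t = s.
Proof.
move=> st; apply: mono_eq => i; have := st i; rewrite /= /push.
by case: (ord2_cases (s i)) => ->; case: (ord2_cases (t i)) => ->.
Qed.

Lemma smax_r n (s t : mono n 1) : sle s t -> smax s t = t.
Proof.
move=> st; apply: mono_eq => i; have := st i; rewrite /= /mmax.
by case: (ord2_cases (s i)) => ->; case: (ord2_cases (t i)) => ->.
Qed.

Lemma sle_max n (s t : mono n 1) : sle s (smax s t).
Proof. by move=> i; rewrite /= /mmax; case: (ord2_cases (s i)) => ->. Qed.

Lemma smin_le n (s t : mono n 1) : sle (smin s t) t.
Proof. by move=> i; rewrite /= /push; case: (ord2_cases (s i)) => ->; case: (ord2_cases (t i)) => ->. Qed.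

Lemma sle_anti n (s t : mono n 1) : sle s t -> sle t s -> s = t.
Proof. by move=> st ts; apply: mono_eq => i; apply: val_inj; apply/eqP; rewrite eqn_leq st ts. Qed.

Lemma sle_trans n (s t u : mono n 1) : sle s t -> sle t u -> sle s u.
Proof. by move=> st tu i; apply: leq_trans (st i) (tu i). Qed.

Lemma smax_res (U V : Sm k) m n (f : ihom V U) (u : mono n m) (s t : mono m 1) :
  smax (@sres _ D1 U V m n f u s) (@sres _ D1 U V m n f u t) = @sres _ D1 U V m n f u (smax s t).
Proof. exact: (ijoin_res (i := d1_interval k) f u s t). Qed.

Lemma smin_res (U V : Sm k) m n (f : ihom V U) (u : mono n m) (s t : mono m 1) :
  smin (@sres _ D1 U V m n f u s) (@sres _ D1 U V m n f u t) = @sres _ D1 U V m n f u (smin s t).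
Proof. exact: (imeet_res (i := d1_interval k) f u s t). Qed.

Lemma diagonal_S1 : sg (diagonal S1) = sh_null _ _.
Proof.
rewrite -sg_const.
pose H : smap (sprod D1 (d1_interval k)) (smash S1 S1) := @SMap _ (sprod D1 (d1_interval k)) (smash S1 S1)
  (fun U n w => smash_pair (cl U n w.1) (cl U n (smax w.1 w.2)))
  (fun U V m n f s w => etrans (congr2 (fun a b => smash_pair a b) (smapE cl f s w.1)
     (etrans (congr1 (cl V n) (smax_res f s w.1 w.2)) (smapE cl f s (smax w.1 w.2))))
   (esym (smash_pairE f s _ _))).
apply: (@sg_homotopy k (d1_interval k) D1 S1 cl _ _ H _ _ (S1_quot k)).
- by move=> U n s t e; apply: smash_pair_bpt; left; apply: S1_ends.
- by move=> U n s; congr (smash_pair _ (cl U n _)); exact: (smax0r s).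
- move=> U n s; apply: smash_pair_bpt; right; apply: S1_ends; right.
  exact: (smax1r s).
Qed.

(** [S^1 /\ S^1] with the diagonal collapsed is a wedge of two triangles. *)
Definition square : pspace (Sm k) := pprod D1 D1.
Definition in_ends2 : spred square := fun U n w =>
  (w.1 = v0 n \/ w.1 = v1 n) \/ (w.2 = v0 n \/ w.2 = v1 n).

Lemma in_ends2_stable : stable in_ends2.
Proof.
move=> U V m n f s [x y]; rewrite /in_ends2 /= => -[[|]|[|]] ->;
  [left; left|left; right|right; left|right; right]; exact: mono_eq.
Qed.

Definition on_diagonal : spred square := fun U n w => in_ends2 w \/ w.1 = w.2.
Lemma on_diagonal_bpt U n : on_diagonal (bpt square U n).
Proof. by right. Qed.
Lemma on_diagonal_res (U V : Sm k) m n (f : ihom V U) (s : mono n m) x :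
  @on_diagonal U m x -> @on_diagonal V n (sres f s x).
Proof. by case=> [h|h]; [left; apply: in_ends2_stable|right; rewrite /= h]. Qed.
Definition two_triangles := collapse on_diagonal_bpt on_diagonal_res.
Definition two_cl : smap square two_triangles := collapse_map on_diagonal_bpt on_diagonal_res.

(** The closed lower triangle and the boundary of the square; collapsing them leaves the upper
    triangle modulo its boundary. *)
Definition below : spred square := fun U n w => in_ends2 w \/ sle w.2 w.1.
Lemma below_bpt U n : below (bpt square U n).
Proof. by right. Qed.
Lemma below_res (U V : Sm k) m n (f : ihom V U) (s : mono n m) x :
  @below U m x -> @below V n (sres f s x).
Proof. by case=> [h|h]; [left; apply: in_ends2_stable|right=> i; apply: h]. Qed.
Definition one_triangle := collapse below_bpt below_res.
Definition one_cl : smap square one_triangle := collapse_map below_bpt below_res.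

Let q2 : quot two_cl on_diagonal := collapse_quot on_diagonal_bpt on_diagonal_res.
Let q1 : quot one_cl below := collapse_quot below_bpt below_res.
Let qS := smash_quot (S1_quot k) (S1_quot k).

Lemma one_bpt U n (w : square U n) : below w -> one_cl U n w = bpt one_triangle U n.
Proof. exact: (proj1 (quot_ker q1 w)). Qed.
Lemma two_bpt U n (w : square U n) : on_diagonal w -> two_cl U n w = bpt two_triangles U n.
Proof. exact: (proj1 (quot_ker q2 w)). Qed.

Lemma swap_natural (Y : pspace (Sm k)) (g : smap square Y) (U V : Sm k) m n (f : ihom V U) (s : mono n m) (w : square U m) :
  g V n ((sres f s w).2, (sres f s w).1) = sres f s (g U m (w.2, w.1)).
Proof. exact: (smapE g f s (w.2, w.1)). Qed.
Definition swapped (Y : pspace (Sm k)) (g : smap square Y) : smap square Y := SMap (swap_natural g).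

Lemma two_out_subproof (c : bool) U n (w : square U n) : on_diagonal w ->
  (if c then one_cl else swapped one_cl) U n w = bpt one_triangle U n.
Proof.
case: w => s t /= h; have b : below (s, t : mono n 1) /\ below (t, s : mono n 1).
  by case: h => [h|/= ->]; [split; left; [exact: h|case: h; [right|left]]|split; right].
by case: c; apply: one_bpt; case: b.
Qed.
Definition two_out c : pmap two_triangles one_triangle := qmap q2 (two_out_subproof c).

Lemma two_outE c U n (s t : mono n 1) :
  two_out c U n (two_cl U n (s, t)) = one_cl U n (if c then (s, t) else (t, s)).
Proof. by apply: etrans (qmapE q2 (two_out_subproof c) (s, t)) _; case: c. Qed.

Lemma min_natural (Y : pspace (Sm k)) (g : smap square Y) (U V : Sm k) m n (f : ihom V U) (s : mono n m) (w : square U m) :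
  g V n (smin (sres f s w).1 (sres f s w).2, (sres f s w).2) = sres f s (g U m (smin w.1 w.2, w.2)).
Proof. by rewrite -(smapE g f s (smin w.1 w.2, w.2)) -[LHS]/(g V n (smin (sres f s w.1) (sres f s w.2), _)) smin_res. Qed.
(** Precomposition with the retraction [(min s t, t)] of the square onto its upper triangle, which
    sends the lower triangle to the diagonal. *)
Definition min_map (Y : pspace (Sm k)) (g : smap square Y) : smap square Y := SMap (min_natural g).

Lemma two_in_subproof (c : bool) U n (w : square U n) : below w ->
  min_map (if c then two_cl else swapped two_cl) U n w = bpt two_triangles U n.
Proof.
case: w => s t /= h.
suff [b b'] : @on_diagonal U n (smin s t, t) /\ @on_diagonal U n (t, smin s t).
  by case: c; [exact: (two_bpt b)|exact: (two_bpt b')].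
case: h => [|/= h].
  rewrite /on_diagonal /in_ends2 /=; case=> [[->|->]|h].
  - by rewrite (smin0l t); split; left; [left; left|right; left].
  - by rewrite (smin1l t); split; right.
  - by split; left; [right|left].
by rewrite sminC smin_l //; split; right.
Qed.
Definition two_in c : pmap one_triangle two_triangles := qmap q1 (two_in_subproof c).

Lemma two_inE c U n (s t : mono n 1) :
  two_in c U n (one_cl U n (s, t)) = two_cl U n (if c then (smin s t, t) else (t, smin s t)).
Proof. by apply: etrans (qmapE q1 (two_in_subproof c) (s, t)) _; case: c. Qed.

Lemma one_min U n (s t : mono n 1) : one_cl U n (smin s t, t) = one_cl U n (s, t).
Proof.
case: (sle_total s t) => h; first by rewrite smin_l.
by rewrite sminC smin_l // !one_bpt //; right.
Qed.

Lemma triangles_wedge : is_wedge (two_in true) (two_in false) (two_out true) (two_out false).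
Proof.
split=> U n y.
- by have [[s t] <-] := quot_surj q1 y; rewrite two_inE two_outE one_min.
- by have [[s t] <-] := quot_surj q1 y; rewrite two_inE two_outE one_min.
- have [[s t] <-] := quot_surj q1 y; rewrite two_inE two_outE one_bpt //; right; exact: smin_le.
- have [[s t] <-] := quot_surj q1 y; rewrite two_inE two_outE one_bpt //; right; exact: smin_le.
have [[s t] <-] := quot_surj q2 y; rewrite !two_outE !two_inE.
by case: (sle_total s t) => h; [left|right]; rewrite smin_l.
Qed.

Lemma pinch_subproof U n (w : sprod D1 D1 U n) :
  (w.1 = v0 n \/ w.1 = v1 n) \/ (w.2 = v0 n \/ w.2 = v1 n) -> two_cl U n w = bpt two_triangles U n.
Proof. by move=> h; apply: two_bpt; left. Qed.
Definition pinch : pmap (smash S1 S1) two_triangles := qmap qS (phi := two_cl) pinch_subproof.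

Lemma pinchE U n (s t : mono n 1) : pinch U n (smash_pair (cl U n s) (cl U n t)) = two_cl U n (s, t).
Proof. exact: (qmapE qS (phi := two_cl) pinch_subproof (s, t)). Qed.

Definition half := pmap_comp (two_out true) pinch.

Lemma halfE U n (s t : mono n 1) : half U n (smash_pair (cl U n s) (cl U n t)) = one_cl U n (s, t).
Proof. by rewrite /= pinchE two_outE. Qed.

Lemma half_swap : pmap_comp half (smash_tw S1 S1) = pmap_comp (two_out false) pinch.
Proof.
apply: (quot_peq qS) => U n [s t].
rewrite -[LHS]/(half U n (smash_tw S1 S1 U n (smash_pair (cl U n s) (cl U n t)))).
rewrite -[RHS]/(two_out false U n (pinch U n (smash_pair (cl U n s) (cl U n t)))).
by rewrite smash_twE halfE pinchE two_outE.
Qed.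

(** The collapsed lower triangle is contractible in [S^1 /\ S^1]: raising the first coordinate by a
    maximum stays below the diagonal and ends at 1, which is the base point of the circle. *)
Lemma half_iso : sh_iso (sg half).
Proof.
have q := quot_factor qS q1 (fun U n (w : sprod D1 D1 U n) =>
  match w with (s, t) => halfE U s t end).
pose rep U n (b : smash S1 S1 U n) : sprod D1 D1 U n := sval (cid (quot_surj qS b)).
have repK U n b : smash_map0 cl cl U n (rep U n b) = b by rewrite /rep; case: cid.
pose d0 U n (w : sprod D1 D1 U n) (t : mono n 1) : smash S1 S1 U n :=
  if pselect (sle w.2 w.1) then smash_pair (cl U n (smax w.1 t)) (cl U n w.2) else bpt _ U n.
have d0T U n s x t : sle x s -> d0 U n (s, x) t = smash_pair (cl U n (smax s t)) (cl U n x).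
  by rewrite /d0 /=; case: (pselect _).
have d0b U n w t : in_ends2 w -> d0 U n w t = bpt (smash S1 S1) U n.
  case: w => s x h; rewrite /d0 /=; case: (pselect _) => //= xs.
  apply: smash_pair_bpt; case: h => /= [[e|e]|h]; [right|left|right]; apply: S1_ends => //.
    left; move: xs; rewrite e => xs; apply: (sle_anti xs) => i; exact: leq0n.
  by right; rewrite e; exact: (smax1l t).
pose d U n (y : cyl (smash S1 S1) U n) : smash S1 S1 U n := d0 U n (rep U n y.1) y.2.
have dE U n s x t : d U n (smash_pair (cl U n s) (cl U n x), t) = d0 U n (s, x) t.
  rewrite /d /=; case: (quot_inj qS (r' := (s, x)) (repK U n (smash_pair (cl U n s) (cl U n x)))) => [->//|h].
  rewrite (d0b _ _ _ _ h) d0b //.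
  apply/(quot_ker qS (s, x)); apply: etrans (esym (repK U n (smash_pair (cl U n s) (cl U n x)))) _.
  exact/(quot_ker qS).
apply: sh_map_iso; apply: (quot_stable q).
have kC U n (b : smash S1 S1 U n) : (exists2 w, smash_map0 cl cl U n w = b & below w) ->
    b = bpt _ U n \/ exists s x, sle x s /\ b = smash_pair (cl U n s) (cl U n x).
  move=> [[s x] <- [h|h]]; last by right; exists s, x.
  by left; apply/(quot_ker qS).
have ptE U n : bpt (smash S1 S1) U n = smash_pair (cl U n (v0 n)) (cl U n (v0 n)).
  by symmetry; apply: smash_pair_bpt; left; apply: S1_ends; left.
have db U n t : d U n (bpt (smash S1 S1) U n, t) = bpt (smash S1 S1) U n.
  by rewrite ptE dE d0b //; left; left.
apply: (homotopy_contracts (d := d)).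
- move=> U V m n f s [b t] kb.
  rewrite -[LHS]/(d V n (sres f s b, mono_comp t s)).
  case: (kC _ _ _ kb) => [e|[x [y [yx e]]]]; rewrite [b]e; first by rewrite sres_bpt !db sres_bpt.
  rewrite smash_pairE -!smapE !dE !d0T //; last by move=> i; apply: yx.
  by rewrite smash_pairE -!smapE; congr (smash_pair (cl V n _) _); exact: smax_res.
- move=> U n b kb; case: (kC _ _ _ kb) => [->|[x [y [yx ->]]]]; first exact: db.
  by rewrite dE d0T //; congr (smash_pair (cl U n _) _); exact: (smax0r x).
- move=> U n b kb; case: (kC _ _ _ kb) => [->|[x [y [yx ->]]]]; first exact: db.
  rewrite dE d0T //; apply: smash_pair_bpt; left; apply: S1_ends; right.
  exact: (smax1r x).
- exact: db.
move=> U n b t kb; case: (kC _ _ _ kb) => [->|[x [y [yx ->]]]]; first by rewrite db; exists (v0 n, v0 n); [exact: esym (ptE U n)|left; left; left].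
rewrite dE d0T //; exists (smax x t, y) => //; right; exact: sle_trans yx (sle_max x t).
Qed.

Lemma fold_natural (U V : Sm k) m n (f : ihom V U) (s : mono n m) (w : square U m) :
  one_cl V n (smin (sres f s w).1 (sres f s w).2, smax (sres f s w).1 (sres f s w).2) =
  sres f s (one_cl U m (smin w.1 w.2, smax w.1 w.2)).
Proof.
rewrite -(smapE one_cl f s (smin w.1 w.2, smax w.1 w.2)); congr (one_cl V n (_, _)).
  exact: smin_res.
exact: smax_res.
Qed.

Lemma fold_subproof U n (w : square U n) : on_diagonal w -> SMap fold_natural U n w = bpt one_triangle U n.
Proof.
case: w => s t h /=; apply: one_bpt.
case: h => [h|/= ->]; last by right; rewrite smax_r // smin_l.
left; rewrite /in_ends2 /=; case: h => /= -[->|->].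
- by left; left; exact: (smin0l t).
- by right; right; exact: (smax1l t).
- by left; left; exact: (smin0r s).
- by right; right; exact: (smax1r s).
Qed.
Definition fold : pmap two_triangles one_triangle := qmap q2 fold_subproof.

Lemma foldE U n (s t : mono n 1) : fold U n (two_cl U n (s, t)) = one_cl U n (smin s t, smax s t).
Proof. exact: (qmapE q2 fold_subproof (s, t)). Qed.

Lemma fold_in c : pmap_comp fold (two_in c) = pmap_id one_triangle.
Proof.
apply: (quot_peq q1) => U n [s t]; rewrite -[LHS]/(fold U n (two_in c U n (one_cl U n (s, t)))).
have le : sle (smin s t) t := @smin_le n s t.
have e : one_cl U n (smin (smin s t) t, smax (smin s t) t) = one_cl U n (s, t).
  by rewrite (smin_l le) (smax_r le) one_min.
by rewrite two_inE; case: c; rewrite foldE // sminC smaxC.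
Qed.

(** After the fold [(min, max)], the larger coordinate can be raised to 1 on the whole square. *)
Lemma fold_pinch : sg (pmap_comp fold pinch) = sh_null _ _.
Proof.
rewrite -sg_const.
pose H : smap (sprod (sprod D1 D1) (d1_interval k)) one_triangle :=
  @SMap _ (sprod (sprod D1 D1) (d1_interval k)) one_triangle
  (fun U n w => one_cl U n (smin w.1.1 w.1.2, smax (smax w.1.1 w.1.2) w.2))
  (fun U V m n f s w => etrans (congr2 (fun a b => one_cl V n (a, b)) (smin_res f s w.1.1 w.1.2)
     (etrans (congr1 (fun a => smax a _) (smax_res f s w.1.1 w.1.2)) (smax_res f s (smax w.1.1 w.1.2) w.2)))
   (smapE one_cl f s (smin w.1.1 w.1.2, smax (smax w.1.1 w.1.2) w.2))).
apply: (@sg_homotopy k (d1_interval k) _ _ _ _ _ H _ _ qS).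
- move=> U n [s t] x h; apply: one_bpt; left; rewrite /in_ends2 /=; case: h => /= -[->|->].
  + by left; left; exact: (smin0l t).
  + right; right; rewrite (smax1l t).
    exact: (smax1l x).
  + by left; left; exact: (smin0r s).
  + right; right; rewrite (smax1r s).
    exact: (smax1l x).
- move=> U n [s t]; apply: etrans (esym (etrans (congr1 (fold U n) (pinchE U s t)) (foldE U s t))).
  by congr (one_cl U n (_, _)); exact: (smax0r (smax s t)).
move=> U n [s t]; apply: one_bpt; left; right; right.
exact: (smax1r (smax s t)).
Qed.

(** As [two_triangles] is a wedge, [fold] after [pinch] is the sum of the two collapses, namely
    [half] and [half] after the twist. That composite is null, and [half] can be cancelled. *)
Lemma twist_S1 : sh_add A (sh_id (susp (Tsph k) (smash S1 S1))) (sg (smash_tw S1 S1)) = sh_zero A _ _.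
Proof.
apply: (sh_mono half_iso); rewrite sh_addl sh_compm1 sh_zeroR -sg_comp half_swap.
have e : sg (pmap_comp fold pinch) = sg fold \c (sg pinch) by rewrite sg_comp.
rewrite -(sh_null_zero A) -fold_pinch e -[sg fold in RHS]sh_compm1 -(wedge_biproduct triangles_wedge A).
rewrite sh_addl !sh_compA -2!(sg_comp fold) !fold_in sg_id !sh_comp1m sh_addr -!sg_comp.
by [].
Qed.

End SimplicialCircle.

(** * The ring of scalars *)

Section Multiples.
Context (k : comPzRingType) (A : additive_structure k).
Implicit Types X Y Z : mspec k.

(** A step in the form of an equivalence serves both directions; going down corresponds to
    cancelling a summand or an invertible factor. *)
Lemma int_step_ind (P : int -> Prop) : P 0 -> (forall n, P n <-> P (n + 1)) -> forall n, P n.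
Proof.
move=> P0 PS; elim/int_ind=> [//|n|n h]; first by move/PS; rewrite -PoszD addn1.
by apply/PS; rewrite -addn1 PoszD opprD addrNK.
Qed.

Lemma sh_oppD X Y (f g : SH X Y) : sh_opp A (sh_add A f g) = sh_add A (sh_opp A f) (sh_opp A g).
Proof.
apply: (@sh_addI _ A _ _ (sh_add A f g)); rewrite sh_addC sh_addN sh_addC.
rewrite [sh_add A f g]sh_addC -sh_addA (sh_addA A _ g) sh_addN sh_add0 sh_addN //.
Qed.

Lemma sh_mulzS X Y (n : int) (f : SH X Y) :
  sh_mulz A (n + 1) f = sh_add A (sh_mulz A n f) f.
Proof.
case: n => [n|[|n]].
- by rewrite -PoszD addn1 /= sh_addC.
- by rewrite (_ : Negz 0 + 1 = 0) //= sh_addr0 sh_addN.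
rewrite (_ : Negz n.+1 + 1 = Negz n); last by rewrite !NegzE -[n.+2]addn1 PoszD opprD addrNK.
rewrite [in RHS]/= -/(sh_muln A n.+1 f) [RHS]sh_addC sh_oppD sh_addA (sh_addC A f) sh_addN.
by rewrite sh_add0.
Qed.

Lemma sh_comp_opp X Y Z (g : SH Y Z) (f : SH X Y) : sh_comp (sh_opp A g) f = sh_opp A (sh_comp g f).
Proof.
apply: (@sh_addI _ A _ _ (sh_comp g f)); rewrite -sh_addr !(sh_addC A _ (sh_opp A _)) !sh_addN.
exact: sh_zeroL.
Qed.

Lemma sh_comp_mulz X Y Z (n : int) (g : SH Y Z) (f : SH X Y) :
  sh_comp (sh_mulz A n g) f = sh_mulz A n (sh_comp g f).
Proof.
move: n; apply: int_step_ind => [|n]; first exact: sh_zeroL.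
rewrite !sh_mulzS sh_addr; split=> [->//|].
by rewrite ![sh_add A _ (sh_comp g f)]sh_addC => /sh_addI.
Qed.

End Multiples.

Section Scalars.
Context (k : comPzRingType) (M : smash_structure k) (N : negative_spheres M) (A : additive_structure k).
Notation X := (S11 k).
Notation T1 := (T1 k).
Notation I := (sphere_spectrum k).
Notation T := (Tsph k).
Notation K := (circle (a1_interval k)).
Hypothesis unit_eq : sm_unitl M I = sm_unitr M I.
Notation inv Y := (invertible M (susp T Y)).
Implicit Types Y Z : pspace (Sm k).

(** For invertible [Y] this scalar exists and is unique; it is transported along isomorphisms given
    by maps of spaces and is multiplicative for smash products, so that it can be computed in
    several ways. *)
Definition twist_scalar Y (s : SH I I) : Prop := sg (smash_tw Y Y) = scal M s (susp T (smash Y Y)).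

Lemma tw_smash_pmap Y Z (f : pmap Y Z) :
  pmap_comp (smash_tw Z Z) (smash_pmap f f) = pmap_comp (smash_pmap f f) (smash_tw Y Y).
Proof. by apply: pmap_eq => U n; apply: smash_ind => x y; rewrite /= smash_pmapE !smash_twE smash_pmapE. Qed.

Lemma twist_scalar_push Y Z (f : pmap Y Z) s : sh_iso (sg f) -> twist_scalar Y s -> twist_scalar Z s.
Proof.
move=> fi e; apply: (sh_epi (sg_smash_iso M fi fi)).
by rewrite -sg_comp tw_smash_pmap sg_comp e scal_nat.
Qed.

Lemma twist_scalar_pull Y Z (f : pmap Y Z) s : sh_iso (sg f) -> twist_scalar Z s -> twist_scalar Y s.
Proof.
move=> fi e; apply: (sh_mono (sg_smash_iso M fi fi)).
by rewrite -sg_comp -tw_smash_pmap sg_comp e scal_nat.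
Qed.

Lemma sg_smash_scal Y Z (f : pmap Y Y) (g : pmap Z Z) s t :
  sg f = scal M s (susp T Y) -> sg g = scal M t (susp T Z) ->
  sg (smash_pmap f g) = scal M (s \c t) (susp T (smash Y Z)).
Proof.
move=> fs gt; have -> : smash_pmap f g = pmap_comp (smash_pmap f (pmap_id Z)) (smash_pmap (pmap_id Y) g).
  by rewrite -smash_pmap_comp; congr smash_pmap; apply: pmap_eq.
by rewrite sg_comp (sg_smash_scalL (M := M) _ fs) (sg_smash_scalR _ gt) scal_comp.
Qed.

Lemma twist_scalar_smash Y Z s t : twist_scalar Y s -> twist_scalar Z t -> twist_scalar (smash Y Z) (s \c t).
Proof.
move=> ys zt; have e : smash_tw (smash Y Z) (smash Y Z) =
    pmap_comp (pmap_comp (smash_mid Y Y Z Z) (smash_pmap (smash_tw Y Y) (smash_tw Z Z))) (smash_mid Y Z Y Z).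
  apply: pmap_eq => U n; apply: smash_ind => a b.
  elim/smash_ind: a => x y; elim/smash_ind: b => z w.
  by rewrite /= smash_twE smash_midE smash_pmapE !smash_twE smash_midE.
rewrite /twist_scalar e sg_comp sg_comp (sg_smash_scal ys zt) scal_nat -sh_compA -sg_comp smash_midK.
by rewrite sg_id sh_compm1.
Qed.

Lemma twist_scalar_ex Y : inv Y -> exists s, twist_scalar Y s.
Proof. by move=> iY; apply: (scal_surj unit_eq); apply: invertible_smash. Qed.

Lemma twist_scalar_inj Y s t : inv Y -> twist_scalar Y s -> twist_scalar Y t -> s = t.
Proof. by move=> iY es et; apply: (scal_inj (invertible_smash iY iY)); rewrite -es -et. Qed.

Lemma twist_scalar_S1 : twist_scalar (S1 (Sm k)) (sh_opp A (sh_id I)).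
Proof.
rewrite /twist_scalar scal_opp scal_id; apply: (@sh_addI _ A _ _ (sh_id _)).
by rewrite (twist_S1 A) sh_addC sh_addN.
Qed.

Lemma power_map0 : power_map k 0 = pmap_const X X.
Proof. by apply: pmap_eq => U n x; apply: knat_eq => B y; apply: Gm_pt_eq. Qed.

Lemma neg_t1K : pmap_comp (neg_t1 k) (neg_t1 k) = pmap_id T1.
Proof.
apply: (quot_peq (t1_quot k)) => U n x; rewrite -[LHS]/(neg_t1 k U n (neg_t1 k U n (t1 U n x))).
by rewrite !neg_t1E; congr (t1 U n _); fn_ring.
Qed.

Lemma power_scalar : exists2 e : SH I I, twist_scalar X e &
  forall m : int, sg (power_map k m) = scal M
    (if (2 %| m)%Z then sh_mulz A (m %/ 2)%Z (sh_sub A (sh_id I) e)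
     else sh_add A (sh_id I) (sh_mulz A ((m - 1) %/ 2)%Z (sh_sub A (sh_id I) e))) (susp T X).
Proof.
have iX := inv_S11 N; have iT := inv_T1 N.
have [e eX] := twist_scalar_ex iX; exists e => //.
have [n nE] := scal_surj unit_eq (sg (neg_t1 k)) iT.
(* Two values of the twist scalar of [T1]: it is [n] because the twist is [(-1) /\ 1], and [- e]
   because [T1] is [X /\ circle J], where [circle J] has the twist scalar -1 of the simplicial
   circle. *)
have en : n = sh_opp A e.
  have eT : twist_scalar T1 n by rewrite /twist_scalar twist_T1; apply: sg_smash_scalL.
  have eJ := twist_scalar_push (lunit_iso _) (twist_scalar_pull (theta_iso k) twist_scalar_S1).
  have si : sh_iso (sg (sigmaJ k)) by apply: sigma_iso.
  rewrite (twist_scalar_inj iT eT (twist_scalar_push si (twist_scalar_smash eX eJ))).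
  apply: (@sh_addI _ A _ _ e); rewrite -[in X in sh_add A X _](sh_compm1 e) -sh_addl.
  by rewrite !(sh_addC A _ (sh_opp A _)) !sh_addN sh_zeroR.
have nn : n \c n = sh_id I.
  by apply: (scal_inj iT); rewrite -scal_comp -nE -sg_comp neg_t1K sg_id scal_id.
have pX m := scal_surj unit_eq (sg (power_map k m)) iX.
pose p m := sval (cid (pX m)).
have pE m : sg (power_map k m) = scal M (p m) (susp T X) by rewrite /p; case: cid.
have sK := sigmaK_iso k.
(* Both directions of the induction multiply by [n], which is its own inverse. *)
have qX m : exists s, sg (psi k m) = scal M s (susp T T1) \c sg (sigmaK k).
  move: m; apply: int_step_ind => [|m].
    by exists (sh_id I); rewrite psi0 scal_id sh_comp1m.
  rewrite (psi_succ N) sg_comp nE; split=> [[s ->]|[s]].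
    by exists (n \c s); rewrite sh_compA scal_comp.
  move/(congr1 (fun f => scal M n _ \c f)); rewrite !sh_compA !scal_comp nn scal_id sh_comp1m => ->.
  by exists (n \c s).
pose c m := sval (cid (qX m)).
have qE m : sg (psi k m) = scal M (c m) (susp T T1) \c sg (sigmaK k) by rewrite /c; case: cid.
have cS m : c (m + 1) = n \c c m.
  apply: (scal_inj iT); apply: (sh_epi sK); rewrite -qE (psi_succ N) sg_comp nE qE.
  by rewrite sh_compA scal_comp.
have c0 : c 0 = sh_id I.
  by apply: (scal_inj iT); apply: (sh_epi sK); rewrite -qE psi0 scal_id sh_comp1m.
have pS m : p (m + 1) = sh_add A (p m) (c m).
  apply: (scal_inj iT); apply: (sh_epi sK); rewrite scal_add sh_addr -qE.
  have pl l : scal M (p l) (susp T T1) \c sg (sigmaK k) = sg (power_loop k l).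
    by rewrite /power_loop sg_comp (sg_smash_scalL (M := M) _ (pE l)) scal_nat.
  rewrite (pl (m + 1)) (pl m); exact: (power_sum A m).
have p0 : p 0 = sh_zero A I I.
  by apply: (scal_inj iX); rewrite -pE power_map0 sg_const scal_zero (sh_null_zero A).
have c2 j : c (j * 2) = sh_id I.
  move: j; apply: int_step_ind => [|j]; first by rewrite mul0r.
  rewrite mulrDl mul1r -[2]/(1 + 1) addrA !cS sh_compA nn sh_comp1m; by [].
(* Two consecutive steps add [c (2 j) + c (2 j + 1) = 1 + n = 1 - e]. *)
have p2 j : p (j * 2) = sh_mulz A j (sh_sub A (sh_id I) e).
  move: j; apply: int_step_ind => [|j]; first by rewrite mul0r.
  rewrite sh_mulzS mulrDl mul1r -[X in _ + X]/(1 + 1) addrA !pS cS c2 sh_compm1 -sh_addA.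
  rewrite (_ : sh_add A (sh_id I) n = sh_sub A (sh_id I) e); last by rewrite en.
  by split=> [->//|]; rewrite !(sh_addC A _ (sh_sub A _ _)) => /sh_addI.
move=> m; rewrite pE; apply: (congr1 (fun s => scal M s _)); case: ifP => [/divzK <-|h].
  by rewrite mulzK // p2.
have [j ->] : exists j, m = j * 2 + 1.
  exists (m %/ 2)%Z; rewrite {1}(divz_eq m 2); congr (_ + _).
  have := modz_ge0 m (isT : 2 != 0 :> int); have := ltz_pmod m (isT : 0 < 2 :> int).
  have : (m %% 2)%Z <> 0 by move/dvdz_mod0P; rewrite h.
  by case: (m %% 2)%Z => [[|[|?]]|].
by rewrite addrK mulzK // pS c2 p2 sh_addC.
Qed.

End Scalars.

(** * Canonical isomorphisms *)

Section Canonical.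
Context (k : comPzRingType) (M : smash_structure k) (N : negative_spheres M) (F : canonical_isos N).
Notation "f \s g" := (smf M f g) (at level 40, left associativity).
Notation idw w := (sh_id (wspec N w)).

Lemma unit_coherence : sm_unitl M (sphere_spectrum k) = sm_unitr M (sphere_spectrum k).
Proof. by rewrite -(phi_unitl F W00) -(phi_unitr F W00). Qed.

Lemma bideg_iter g n : bideg (iter n (Wsm g) W00) = ((bideg g).1 *+ n, (bideg g).2 *+ n).
Proof. by elim: n => //= n ->; rewrite !mulrS. Qed.

Lemma bideg_wpow10 n : bideg (wpow W10 Wn10 n) = (n, 0).
Proof. by case: n => n; rewrite bideg_iter /= mul0rn ?mulNrn natz // NegzE. Qed.

Lemma bideg_wpow11 n : bideg (wpow W11 Wn11 n) = (n, n).
Proof. by case: n => n; rewrite bideg_iter /= ?mulNrn natz // NegzE. Qed.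

Lemma bideg_wsphere p q : bideg (wsphere p q) = (p, q).
Proof. by rewrite /= bideg_wpow10 bideg_wpow11 /= add0r subrK. Qed.

Lemma phi_inverse v w : bideg v = bideg w -> F w v \c F v w = idw v.
Proof. by move=> e; rewrite phi_comp // phi_id. Qed.

(** Maps between spheres are compared up to canonical isomorphisms of their sources and
    targets; this makes the smash product strictly associative and unital. *)
Record sphere_map := SphereMap { src : sword; tgt : sword; wmor : SH (wspec N src) (wspec N tgt) }.

Definition canon (f g : sphere_map) : Prop :=
  [/\ bideg (src f) = bideg (src g), bideg (tgt f) = bideg (tgt g)
    & wmor g = F (tgt f) (tgt g) \c (wmor f) \c (F (src g) (src f))].

Lemma canon_refl f : canon f f.
Proof. by split=> //; rewrite !phi_id sh_comp1m sh_compm1. Qed.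

Lemma canon_sym f g : canon f g -> canon g f.
Proof.
case: f g => v w f [v' w' g] [/= ev ew ->]; split=> //=.
by rewrite !sh_compA phi_inverse // sh_comp1m -sh_compA phi_inverse // sh_compm1.
Qed.

Lemma canon_trans f g h : canon f g -> canon g h -> canon f h.
Proof.
case: f g h => v w f [v' w' g] [v'' w'' h] [/= ev ew ->] [/= ev' ew' ->]; split=> //=.
- by rewrite ev.
- by rewrite ew.
by rewrite !sh_compA phi_comp // -!sh_compA phi_comp.
Qed.

Lemma canon_eq v w (f g : SH (wspec N v) (wspec N w)) : canon (SphereMap f) (SphereMap g) -> f = g.
Proof. by case=> _ _ /=; rewrite !phi_id sh_comp1m sh_compm1. Qed.

Definition wsm (f g : sphere_map) : sphere_map :=
  @SphereMap (Wsm (src f) (src g)) (Wsm (tgt f) (tgt g)) (wmor f \s wmor g).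
Definition wid (w : sword) : sphere_map := @SphereMap w w (idw w).

Lemma canon_sm f f' g g' : canon f f' -> canon g g' -> canon (wsm f g) (wsm f' g').
Proof.
case: f f' g g' => v w f [v' w' f'] [x y g] [x' y' g'] [/= ev ew ->] [/= ex ey ->].
split=> /=; rewrite ?ev ?ew ?ex ?ey //.
by rewrite !phi_sm // -!smf_comp.
Qed.

Lemma canon_assoc f g h : canon (wsm (wsm f g) h) (wsm f (wsm g h)).
Proof.
case: f g h => v w f [v' w' g] [v'' w'' h]; split=> /=; rewrite ?addrA //.
rewrite phi_assoc sm_assoc_nat -(phi_assoc F v v' v'') -sh_compA.
rewrite (phi_inverse (v := Wsm v (Wsm v' v'')) (w := Wsm (Wsm v v') v'')); last by rewrite /= !addrA.
by rewrite sh_compm1.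
Qed.

Lemma canon_unitl f : canon (wsm (wid W00) f) f.
Proof.
case: f => v w f; split=> /=; rewrite ?add0r -?surjective_pairing //.
rewrite phi_unitl sm_unitl_nat -(phi_unitl F v) -sh_compA.
rewrite (phi_inverse (v := v) (w := Wsm W00 v)); last by rewrite /= !add0r -surjective_pairing.
by rewrite sh_compm1.
Qed.

Lemma canon_unitr f : canon (wsm f (wid W00)) f.
Proof.
case: f => v w f; split=> /=; rewrite ?addr0 -?surjective_pairing //.
rewrite phi_unitr sm_unitr_nat -(phi_unitr F v) -sh_compA.
rewrite (phi_inverse (v := v) (w := Wsm v W00)); last by rewrite /= !addr0 -surjective_pairing.
by rewrite sh_compm1.
Qed.

Lemma canon_id v w : bideg v = bideg w -> canon (wid v) (wid w).
Proof. by move=> e; split=> //=; rewrite sh_compm1 phi_inverse. Qed.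

Lemma wsm_id v w : wsm (wid v) (wid w) = wid (Wsm v w).
Proof. by rewrite /wsm /wid /= smf_id. Qed.

(** In the strict language, representing an element means smashing on the left with the sphere
    inverse to the target. *)
Lemma canon_represents v w p q (f : SH (wspec N v) (wspec N w)) :
  (p, q) = ((bideg v).1 - (bideg w).1, (bideg v).2 - (bideg w).2) ->
  canon (wsm (wid (wsphere (- (bideg w).1) (- (bideg w).2))) (SphereMap f))
    (@SphereMap (wsphere p q) W00 (represents F p q f)).
Proof.
case=> -> ->; split; rewrite /= -/(wsphere _ _) ?bideg_wpow10 ?bideg_wpow11 /=.
- by rewrite !add0r !subrK ![- _ + _]addrC.
- by rewrite !add0r !subrK !addNr.
by rewrite /represents sh_compA.
Qed.

Lemma canon_mul a b c d p q (f : pi_ N a b) (g : pi_ N c d) : (p, q) = (a + c, b + d) ->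
  canon (wsm (@SphereMap (wsphere a b) W00 f) (@SphereMap (wsphere c d) W00 g))
    (@SphereMap (wsphere p q) W00 (pi_mul F p q f g)).
Proof.
case=> -> ->; split; rewrite /= ?bideg_wpow10 ?bideg_wpow11 //=.
  by rewrite !add0r !subrK.
by rewrite /pi_mul sh_compA -(phi_unitl F).
Qed.

End Canonical.

(** * Diagonals of spheres *)

Section DiagonalOfSpheres.
Context (k : comPzRingType) (M : smash_structure k) (N : negative_spheres M) (F : canonical_isos N).
Notation "f \s g" := (smf M f g) (at level 40, left associativity).
Notation S0 := (S0 (Sm k)).
Notation X := (S11 k).
Notation W := (SphereMap (N := N)).
Notation wid w := (wid N w).
Notation "f ~~ g" := (canon F f g) (at level 70).

Fixpoint tate_word (w : sword) : Prop :=
  match w with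
  | W00 | W11 => True
  | Wsm v w => tate_word v /\ tate_word w
  | _ => False
  end.

Fixpoint rho_space (w : sword) : pmap S0 (wspace k w) :=
  match w return pmap S0 (wspace k w) with
  | W11 => rho_map k
  | W10 => pmap_const S0 (S1 (Sm k))
  | Wsm v w => pmap_comp (smash_pmap (rho_space v) (rho_space w)) (rpair S0)
  | _ => pmap_id S0
  end.

Lemma wcomp_iso w : tate_word w -> sh_iso (wcomp N w).
Proof.
elim: w => //= [_|_|v IHv w IHw [tv tw]]; [exact: sh_iso_id|exact: sh_iso_id|].
by apply: sh_iso_comp (susp_smash_iso M _ _) _; apply: smf_iso; [apply: IHv|apply: IHw].
Qed.

Lemma diagonal_smash (Y Z : pspace (Sm k)) :
  diagonal (smash Y Z) = pmap_comp (smash_mid Y Y Z Z) (smash_pmap (diagonal Y) (diagonal Z)).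
Proof.
by apply: pmap_eq => U n; apply: smash_ind => y z; rewrite /= smash_pmapE smash_midE.
Qed.

Lemma diagonal_rho_space w : tate_word w ->
  sg (diagonal (wspace k w)) = sg (pmap_comp (smash_pmap (pmap_id (wspace k w)) (rho_space w)) (rpair (wspace k w))).
Proof.
elim: w => // [_|_|v IHv w IHw [/IHv ev /IHw ew]].
- congr sg; apply: pmap_eq => U n [] /=; rewrite smash_pmapE //.
  by rewrite smash_pair_bpt; [symmetry; apply: smash_pair_bpt|]; left.
- exact: (diagonal_rho_right N).
rewrite -[LHS]/(sg (diagonal (smash (wspace k v) (wspace k w)))) diagonal_smash sg_comp.
rewrite (sg_smash_congr M ev ew) -sg_comp; congr sg.
apply: pmap_eq => U n; apply: smash_ind => y z.
by rewrite /= !smash_pmapE /= !smash_pmapE smash_midE.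
Qed.

Definition rho_word w : SH (wspec N W00) (wspec N w) := sh_inv (wcomp N w) \c sg (rho_space w).

Lemma wdiag_rho w : tate_word w -> wsm (wid w) (W (rho_word w)) ~~ W (wdiag N w).
Proof.
move=> tw; split=> /=; rewrite ?addr0 -?surjective_pairing //.
have ci := wcomp_iso tw; have cci : sh_iso (wcomp N w \s wcomp N w) by apply: smf_iso.
have cs := susp_smash_iso M (wspace k w) (wspace k w).
have ji := sh_iso_comp cs cci.
have uE : sh_inv (sm_unitr M (susp (Tsph k) (wspace k w))) \c wcomp N w =
    (wcomp N w \s sh_id (sphere_spectrum k)) \c F w (Wsm w W00).
  apply: (sh_mono (sm_unitr_iso M _)); rewrite !sh_compA (sh_mulmV (sm_unitr_iso M _)) sh_comp1m.
  rewrite (sm_unitr_nat M (wcomp N w)) -(phi_unitr F w) -sh_compA (phi_inverse F (v := w) (w := Wsm w W00)).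
    by rewrite sh_compm1.
  by rewrite /= !addr0 -surjective_pairing.
rewrite phi_id sh_comp1m /wdiag -[sh_map _]/(sg (diagonal (wspace k w))).
apply: (sh_mono ji); rewrite [LHS]sh_compA.
rewrite [wcomp N (Wsm w w)]/= (sh_mulmV ji) sh_comp1m.
rewrite diagonal_rho_space // sg_comp (sg_rpair M) sh_compA susp_smash_nat.
rewrite -sh_compA -sh_compA uE -[RHS]sh_compA; congr sh_comp.
by rewrite !sh_compA -!smf_comp sg_id sh_comp1m sh_compm1 sh_compm1 /rho_word sh_compA (sh_mulmV ci) sh_comp1m.
Qed.

Lemma rho_word_sm v w : tate_word v -> tate_word w ->
  W (rho_word (Wsm v w)) ~~ wsm (W (rho_word v)) (W (rho_word w)).
Proof.
move=> tv tw; split=> //=; rewrite phi_id sh_comp1m phi_unitr.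
have ci := wcomp_iso tv; have di := wcomp_iso tw.
have cci : sh_iso (wcomp N v \s wcomp N w) by apply: smf_iso.
have cs := susp_smash_iso M (wspace k v) (wspace k w).
apply: (sh_mono (sh_iso_comp cs cci)); rewrite /rho_word /= !sh_compA (sh_mulmV (sh_iso_comp cs cci)) sh_comp1m.
rewrite sg_comp (sg_rpair M) -!sh_compA (sh_mulVm (sm_unitr_iso M _)) sh_compm1 susp_smash_nat.
by rewrite -smf_comp !sh_compA (sh_mulmV ci) (sh_mulmV di) !sh_comp1m.
Qed.

Lemma rho_word00 : rho_word W00 = sh_id _.
Proof. by rewrite /rho_word /= sh_inv_id sh_comp1m; apply: sg_id. Qed.

Lemma rho_word11 : rho_word W11 = sg (rho_map k).
Proof. by rewrite /rho_word /= sh_inv_id sh_comp1m. Qed.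

Notation rho := (W (rho_word W11)).
Definition central (w : sword) : Prop := wsm rho (wid w) ~~ wsm (wid w) rho.

(** Both sides are the diagonal of [S^{1,1}], one by [diagonal_rho_left] and the other by
    [wdiag_rho]. *)
Lemma central11 : central W11.
Proof.
apply: (canon_trans (g := W (wdiag N W11))); last first.
  by apply: canon_sym; apply: (wdiag_rho (w := W11)).
split=> //=; rewrite phi_id sh_comp1m /wdiag /= smf_id sh_compm1 sh_compm1.
have cs := susp_smash_iso M X X.
apply: (sh_mono cs); rewrite sh_compA (sh_mulmV cs) sh_comp1m -[sh_map _]/(sg (diagonal X)).
rewrite (diagonal_rho_left N) sg_comp (sg_lpair M) sh_compA susp_smash_nat -sh_compA; congr sh_comp.
rewrite rho_word11 sg_id; congr sh_comp.
apply: (sh_mono (sm_unitl_iso M _)); rewrite (sh_mulmV (sm_unitl_iso M _)).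
by rewrite -(phi_unitl F W11) (phi_inverse F (v := W11) (w := Wsm W00 W11)).
Qed.

Lemma central00 : central W00.
Proof. exact: canon_trans (canon_unitr F _) (canon_sym (canon_unitl F _)). Qed.

Lemma central_sm v w : central v -> central w -> central (Wsm v w).
Proof.
move=> cv cw; rewrite /central -!wsm_id.
apply: canon_trans (canon_sym (canon_assoc F rho (wid v) (wid w))) _.
apply: canon_trans (canon_sm cv (canon_refl F (wid w))) _.
apply: canon_trans (canon_assoc F (wid v) rho (wid w)) _.
apply: canon_trans (canon_sm (canon_refl F (wid v)) cw) _.
exact: canon_sym (canon_assoc F (wid v) (wid w) rho).
Qed.

(** The inverse of an object which commutes with [rho] commutes with [rho]. *)
Lemma centraln11 : central Wn11.
Proof.
pose x := wid W11; pose y := wid Wn11; pose o := wid W00.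
have xy : o ~~ wsm x y by rewrite wsm_id; apply: canon_id.
have yx : wsm y x ~~ o by rewrite wsm_id; apply: canon_id.
have r f : f ~~ f := canon_refl F f.
apply: canon_sym; apply: canon_trans (canon_sym (canon_unitr F (wsm y rho))) _.
apply: canon_trans (canon_sm (r _) xy) _.
apply: canon_trans (canon_assoc F _ _ _) _.
apply: canon_trans (canon_sm (r y) (canon_sym (canon_assoc F rho x y))) _.
apply: canon_trans (canon_sm (r y) (canon_sm central11 (r y))) _.
apply: canon_trans (canon_sm (r y) (canon_assoc F x rho y)) _.
apply: canon_trans (canon_sym (canon_assoc F y x (wsm rho y))) _.
apply: canon_trans (canon_sm yx (r _)) _.
exact: canon_unitl.
Qed.

Notation pos n := (iter n (Wsm W11) W00).
Notation neg n := (iter n (Wsm Wn11) W00).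

Lemma tate_pos n : tate_word (pos n).
Proof. by elim: n. Qed.

Lemma central_neg n : central (neg n).
Proof. by elim: n => [|n IH]; [apply: central00|apply: central_sm centraln11 IH]. Qed.

Lemma rho_pow n : wsm (wid (neg n)) (W (rho_word (pos n))) ~~
  @SphereMap _ _ N (wsphere (- n%:Z) (- n%:Z)) W00 (pi_rho_pow F n).
Proof.
have r f : f ~~ f := canon_refl F f.
elim: n => [|n IH].
  apply: canon_trans (canon_unitl F _) _; rewrite rho_word00; split=> //=.
  by rewrite phi_id sh_comp1m sh_comp1m.
have m := @canon_mul _ _ _ F (-1) (-1) (- n%:Z) (- n%:Z) (- n.+1%:Z) (- n.+1%:Z) (pi_rho F) (pi_rho_pow F n).
apply: canon_trans _ (m _); last by rewrite -addn1 PoszD opprD addrC.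
have e : wsm (wid Wn11) rho ~~ @SphereMap _ _ N (wsphere (-1) (-1)) W00 (pi_rho F).
  rewrite rho_word11; apply: canon_trans (@canon_represents _ _ _ F W00 W11 (-1) (-1) (sg (rho_map k)) _); last by [].
  by apply: canon_sm (r _); apply: canon_id; rewrite bideg_wsphere.
apply: canon_trans (canon_sm e IH).
have [tn t11] : tate_word (pos n) /\ tate_word W11 by split; first exact: tate_pos.
apply: canon_trans (canon_sm (r _) (rho_word_sm t11 tn)) _; rewrite /= -wsm_id.
apply: canon_trans (canon_assoc F _ _ _) _; apply: canon_trans _ (canon_sym (canon_assoc F _ _ _)).
apply: canon_sm (r _) _; apply: canon_trans (canon_sym (canon_assoc F _ _ _)) _.
apply: canon_trans _ (canon_assoc F _ _ _); apply: canon_sm _ (r _).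
by apply: canon_sym; apply: central_neg.
Qed.

(** The diagonal is [1 /\ rho^n] with target [S^{2n,2n}], so it is smashed with [S^{-2n,-2n}]. The
    identity of [S^{n,n}] is absorbed, which leaves [S^{-n,-n} /\ rho^n] as in [rho_pow]. *)
Lemma represents_diagonal n :
  represents F (- n%:Z) (- n%:Z) (wdiag N (wsphere n n)) = pi_rho_pow F n.
Proof.
have r f : f ~~ f := canon_refl F f.
apply: (canon_eq (F := F)).
apply: canon_trans (rho_pow n).
apply: canon_trans (canon_sym (canon_represents F _ _)) _.
  have b2 v : bideg (Wsm v v) = ((bideg v).1 + (bideg v).1, (bideg v).2 + (bideg v).2) by [].
  by rewrite b2 bideg_wsphere /= !opprD !addrA subrr !add0r.
have -> : wsphere n n = Wsm W00 (pos n) by rewrite /wsphere subrr.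
have tn : tate_word (Wsm W00 (pos n)) by split=> //; apply: tate_pos.
apply: canon_trans (canon_sm (r _) (canon_sym (wdiag_rho tn))) _.
apply: canon_trans (canon_sym (canon_assoc F _ _ _)) _; rewrite wsm_id; apply: canon_sm.
  apply: canon_id; have bs v w : bideg (Wsm v w) = ((bideg v).1 + (bideg w).1, (bideg v).2 + (bideg w).2) by [].
  have bp : bideg (pos n) = (n%:Z, n%:Z) by apply: (bideg_wpow11 n).
  have bn : bideg (neg n) = (- n%:Z, - n%:Z) by rewrite bideg_iter /= !mulNrn natz.
  by rewrite bs bideg_wsphere !bs bp bn /= !add0r opprD addrNK.
apply: canon_trans (rho_word_sm (v := W00) I (tate_pos n)) _.
by rewrite rho_word00; apply: canon_unitl.
Qed.

Lemma diagonal_null p q : (q < p)%N -> wdiag N (wsphere p q) = sh_null _ _.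
Proof.
(* Since [p - q] is positive, a factor [S^{1,0}] splits off, and its null diagonal makes the whole
   diagonal null. *)
move=> qp; have [m ->] : exists m, wsphere p q = Wsm (Wsm W10 (iter m (Wsm W10) W00)) (wpow W11 Wn11 q).
  by exists (p - q).-1; rewrite /wsphere (subzn (ltnW qp)) -[(p - q)%N]prednK ?subn_gt0.
move: (wpow _ _ _) (iter _ _ _) => w v.
have sg_null (Y Y' Z Z' : pspace (Sm k)) (f : pmap Y Y') (g : pmap Z Z') :
    sg f = sh_null _ _ -> sg (smash_pmap f g) = sh_null _ _.
  move=> f0; rewrite (sg_smash_congr M (f' := pmap_const Y Y') (g' := g)) ?sg_const //.
  rewrite -sg_const; congr sg; apply: pmap_eq => U n; apply: smash_ind => y z; rewrite smash_pmapE.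
  by apply: smash_pair_bpt; left.
rewrite /wdiag -[sh_map _]/(sg (diagonal _)) [wspace k (Wsm _ _)]/= diagonal_smash sg_comp.
rewrite sg_null ?sh_nullR ?sh_nullL ?sh_nullR //.
by rewrite diagonal_smash sg_comp sg_null ?sh_nullR // diagonal_S1.
Qed.

End DiagonalOfSpheres.

(** A scalar passes through smash products and canonical isomorphisms, so its class does not depend
    on the sphere on which it acts. Thus the twist of [S^{1,1} /\ S^{1,1}] and the power maps of
    [S^{1,1}] are compared as scalars. *)
Lemma represents_scal (k : comPzRingType) (M : smash_structure k) (N : negative_spheres M)
    (F : canonical_isos N) (w : sword) (s : SH (sphere_spectrum k) (sphere_spectrum k)) :
  represents F 0 0 (scal M s (wspec N w)) = s \c pi_one F 0 0.
Proof.
rewrite /represents (scal_smR M s _ (wspec N w)); set w' := wsphere (- _) _.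
have nat := scal_nat M s (F (Wsm w' w) W00); rewrite (scal_unit (unit_coherence F)) in nat.
have b : bideg (Wsm w' w) = (0, 0).
  have bs v u : bideg (Wsm v u) = ((bideg v).1 + (bideg u).1, (bideg v).2 + (bideg u).2) by [].
  by rewrite bs bideg_wsphere /= !addNr.
rewrite sh_compA [X in X \c _]nat -sh_compA; congr sh_comp.
by apply: (@phi_comp _ _ _ F (wsphere 0 0) (Wsm w' w) W00); rewrite ?b ?bideg_wsphere.
Qed.

Theorem theorem1p6 (k : comPzRingType) (M : smash_structure k)
    (N : negative_spheres M) (F : canonical_isos N) (A : additive_structure k) :
  (forall n : nat,
     represents F (- n%:Z) (- n%:Z) (wdiag N (wsphere n n)) = pi_rho_pow F n) /\
  (forall p q : nat, (q < p)%N ->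
     wdiag N (wsphere p q) =
     sh_null (wspec N (wsphere p q))
       (wspec N (Wsm (wsphere p q) (wsphere p q)))) /\
  (forall n : int,
     pi_power F n =
     if (2 %| n)%Z
     then sh_mulz A (n %/ 2)%Z (sh_sub A (pi_one F 0 0) (pi_epsilon F))
     else sh_add A (pi_one F 0 0)
            (sh_mulz A ((n - 1) %/ 2)%Z
               (sh_sub A (pi_one F 0 0) (pi_epsilon F)))).
Proof.
split; first exact: represents_diagonal.
split; first exact: diagonal_null.
have [e eE pE] := power_scalar N A (unit_coherence F).
have epsE : pi_epsilon F = e \c pi_one F 0 0.
  rewrite /pi_epsilon -(represents_scal F (Wsm W11 W11) e); congr represents.
  rewrite [LHS](twist_sg M (S11 k)) eE scal_nat -sh_compA (sh_mulVm (susp_smash_iso M _ _)).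
  exact: sh_compm1.
move=> n; rewrite /pi_power -[sh_map _]/(sg (power_map k n)) pE.
rewrite (represents_scal F W11) epsE.
have subE : sh_sub A (pi_one F 0 0) (e \c pi_one F 0 0) = sh_sub A (sh_id _) e \c pi_one F 0 0.
  by rewrite /sh_sub sh_addr sh_comp1m sh_comp_opp.
rewrite subE; case: ifP => _; first exact: sh_comp_mulz.
by rewrite [LHS]sh_addr sh_comp1m sh_comp_mulz.
Qed.
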